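(* Let $(M,\varphi_i,\xi_i,\eta_i,g)$, $i=1,2,3$, be a $3$-$\delta$-cosymplectic manifold with $\delta\neq0$. Then the structure is hypernormal (i.e. $N_{\varphi_1}=N_{\varphi_2}=N_{\varphi_3}=0$), and the Levi-Civita connection $\nabla^g$ satisfies $$(\nabla^g_X\varphi_i)Y=\delta\{\eta_j(X)\eta_j(Y)+\eta_k(X)\eta_k(Y)\}\xi_i-\delta\,\eta_i(Y)\{\eta_j(X)\xi_j+\eta_k(X)\xi_k\},$$ $$\nabla^g_X\xi_i=\delta\{\eta_k(X)\xi_j-\eta_j(X)\xi_k\}$$ for all vector fields $X,Y$ and every even permutation $(i,j,k)$ of $(1,2,3)$. Furthermore, each $\xi_i$ is a Killing vector field and $M$ is locally isometric to the Riemannian product of a hyper-Kähler manifold and the $3$-dimensional sphere of constant curvature $\delta^2$.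
   Context: An almost contact metric structure $(\varphi,\xi,\eta,g)$ consists of a $(1,1)$-tensor field $\varphi$, a vector field $\xi$, a $1$-form $\eta$ and a Riemannian metric $g$ with $\varphi^2=-I+\eta\otimes\xi$, $\eta(\xi)=1$, $g(\varphi X,\varphi Y)=g(X,Y)-\eta(X)\eta(Y)$. Its fundamental form is $\Phi(X,Y)=g(X,\varphi Y)$, and $N_\varphi(X,Y)=[\varphi X,\varphi Y]+\varphi^2[X,Y]-\varphi[\varphi X,Y]-\varphi[X,\varphi Y]+d\eta(X,Y)\xi$. An almost $3$-contact metric manifold $(M,\varphi_i,\xi_i,\eta_i,g)$, $i=1,2,3$, is a manifold of dimension $4n+3$ with three almost contact metric structures with the same $g$ such that, for every even permutation $(i,j,k)$ of $(1,2,3)$, $\varphi_k=\varphi_i\varphi_j-\eta_j\otimes\xi_i=-\varphi_j\varphi_i+\eta_i\otimes\xi_j$, $\xi_k=\varphi_i\xi_j=-\varphi_j\xi_i$, $\eta_k=\eta_i\circ\varphi_j=-\eta_j\circ\varphi_i$. It is $3$-$\delta$-cosymplectic, $\delta\in\mathbb R$, if $d\eta_i=-2\delta\,\eta_j\wedge\eta_k$ and $d\Phi_i=0$ for every even permutation $(i,j,k)$ of $(1,2,3)$. Conventions: $d\eta(X,Y)=X(\eta(Y))-Y(\eta(X))-\eta([X,Y])$ and $(\eta\wedge\zeta)(X,Y)=\eta(X)\zeta(Y)-\eta(Y)\zeta(X)$. *)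

(* Defs.v *)
From HB Require Import structures.
From mathcomp Require Import all_boot all_order all_algebra all_fingroup.
From mathcomp Require Import all_classical all_reals all_analysis.
From mathcomp Require Import ring lra.

Set Implicit Arguments.
Unset Strict Implicit.
Unset Printing Implicit Defensive.

Import Order.TTheory GRing.Theory Num.Theory.
Import numFieldNormedType.Exports.

Local Open Scope classical_set_scope.
Local Open Scope ring_scope.

(* [f] is of class C^k on the set [A], which is meant to be open: partial
   derivatives up to order k exist and are continuous. *)
Fixpoint Ck (R : realType) m k (A : set 'rV[R]_m) (f : 'rV[R]_m -> R) : Prop :=
  (forall x, A x -> {for x, continuous f}) /\
  if k is k'.+1 then
    forall i, (forall x, A x -> derivable f x 'e_i) /\
              Ck k' A (fun x => 'D_'e_i f x)
  else True.

Definition smooth_on (R : realType) m (A : set 'rV[R]_m) (f : 'rV[R]_m -> R) :=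
  forall k, Ck k A f.

Definition smooth_map_on (R : realType) m n (A : set 'rV[R]_m)
    (f : 'rV[R]_m -> 'rV[R]_n) :=
  forall j, smooth_on A (fun x => f x 0 j).

Section ck_theory.
Variables (R : realType).
Implicit Types (m n k : nat).

Lemma Ck_continuous m k (A : set 'rV[R]_m) f : Ck k A f ->
  forall x, A x -> {for x, continuous f}.
Proof. by case: k => [|k] []. Qed.

Lemma near_open m (A : set 'rV[R]_m) (f g : 'rV[R]_m -> R) x : open A ->
  A x -> (forall y, A y -> f y = g y) -> \forall y \near x, f y = g y.
Proof.
move=> oA Ax fg; have nA : nbhs x A by apply: open_nbhs_nbhs.
by apply: filterS nA => y /fg.
Qed.

Lemma Ck_ext m k (A : set 'rV[R]_m) f g : open A ->
  (forall x, A x -> f x = g x) -> Ck k A f -> Ck k A g.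
Proof.
move=> oA; elim: k f g => [|k IH] f g fg /= [cf df]; split => //.
1,2: move=> x Ax; rewrite /prop_for /continuous_at -(fg _ Ax);
     apply: cvg_trans (cf _ Ax);
     by apply: (@near_eq_cvg _ _ (nbhs x)); exact: near_open oA Ax fg.
move=> i; have [d1 d2] := df i; split.
  by move=> x Ax; apply: near_eq_derivable (d1 _ Ax); exact: near_open oA Ax fg.
by apply: IH d2 => x Ax; apply: near_eq_derive; exact: near_open oA Ax fg.
Qed.

Lemma Ck_eq m k (A : set 'rV[R]_m) f g : f =1 g -> Ck k A f -> Ck k A g.
Proof. by move=> /funext ->. Qed.

Lemma Ck_sub m k (A B : set 'rV[R]_m) f : B `<=` A -> Ck k A f -> Ck k B f.
Proof.
move=> BA; elim: k f => [|k IH] f [cf df]; split => //; try by move=> x /BA /cf.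
by move=> i; have [d1 d2] := df i; split; [move=> x /BA /d1|exact: IH].
Qed.

Lemma CkW m k (A : set 'rV[R]_m) f : Ck k.+1 A f -> Ck k A f.
Proof.
elim: k f => [|k IH] f [cf df]; split => //.
by move=> i; have [d1 d2] := df i; split => //; exact: IH.
Qed.

Lemma Ck_cst m k (A : set 'rV[R]_m) (c : R) : Ck k A (fun=> c).
Proof.
elim: k c => [|k IH] c; split => //; try by move=> x _; exact: cst_continuous.
move=> i; split=> [x _|]; first exact: derivable_cst.
by apply: Ck_eq (IH 0) => x; rewrite -[RHS]/('D_'e_i (cst c) x) derive_cst.
Qed.

Lemma growth_lin_comp m n (L : {linear 'rV[R]_m -> 'rV[R]_n})
    (f : 'rV[R]_n -> R) (x v : 'rV[R]_m) :
  (fun h : R => h^-1 *: (((f \o L) \o shift x) (h *: v) - (f \o L) x)) =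
  (fun h : R => h^-1 *: ((f \o shift (L x)) (h *: L v) - f (L x))).
Proof. by apply/funext => h /=; rewrite (linearP L). Qed.

Lemma derivable_lin_comp m n (L : {linear 'rV[R]_m -> 'rV[R]_n})
    (f : 'rV[R]_n -> R) (x v : 'rV[R]_m) :
  derivable f (L x) (L v) -> derivable (f \o L) x v.
Proof. by rewrite /derivable growth_lin_comp. Qed.

Lemma derive_lin_comp m n (L : {linear 'rV[R]_m -> 'rV[R]_n})
    (f : 'rV[R]_n -> R) (x v : 'rV[R]_m) :
  'D_v (f \o L) x = 'D_(L v) f (L x).
Proof. by rewrite /derive growth_lin_comp. Qed.

Lemma Ck_lin_comp m n k (L : {linear 'rV[R]_m -> 'rV[R]_n})
    (A : set 'rV[R]_n) (f : 'rV[R]_n -> R) :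
  continuous L ->
  (forall i, L 'e_i = 0 \/ exists j, L 'e_i = 'e_j) ->
  Ck k A f -> Ck k (L @^-1` A) (f \o L).
Proof.
move=> cL Li; elim: k f => [|k IH] f [cf df]; split => //.
1,2: by move=> x Ax; apply: continuous_comp; [exact: cL|exact: cf].
move=> i; split.
  move=> x Ax; apply: derivable_lin_comp; case: (Li i) => [->|[j ->]].
    exact: derivable0.
  by have [d1 _] := df j; exact: d1.
apply: (@Ck_eq _ _ _ ((fun y => 'D_(L 'e_i) f y) \o L)).
  by move=> x; rewrite derive_lin_comp.
apply: IH; case: (Li i) => [->|[j ->]]; last by have [] := df j.
by apply: Ck_eq (Ck_cst _ _ 0) => y; rewrite derive0.
Qed.

Lemma Ck_coord m k (A : set 'rV[R]_m) j : Ck k A (fun x => x 0 j).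
Proof.
have cj : continuous (fun x : 'rV[R]_m => x 0 j) by exact: coord_continuous.
have der (x v : 'rV[R]_m) : is_derive x v (fun x : 'rV[R]_m => x 0 j) (v 0 j).
  have df : differentiable (fun x : 'rV[R]_m => x 0 j) x by exact: differentiable_coord.
  have lf : linear (fun x : 'rV[R]_m => x 0 j : R^o).
    by move=> a u w; rewrite !mxE.
  pose aux := GRing.isLinear.Build R 'rV[R]_m R^o _ (fun x : 'rV[R]_m => x 0 j) lf.
  pose F : {linear 'rV[R]_m -> R^o} := HB.pack (fun x : 'rV[R]_m => x 0 j) aux.
  split; first exact: diff_derivable.
  rewrite deriveE //.
  by have -> := @diff_lin R 'rV[R]_m R^o F x cj.
case: k => [|k]; split => //; try by move=> x _; exact: cj.
move=> i; split=> [x _|].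
  by have [] := der x 'e_i.
by apply: Ck_eq (Ck_cst _ _ (('e_i : 'rV[R]_m) 0 j)) => x; have [] := der x 'e_i.
Qed.

Lemma CkD m k (A : set 'rV[R]_m) f g : open A -> Ck k A f -> Ck k A g ->
  Ck k A (fun x => f x + g x).
Proof.
move=> oA; elim: k f g => [|k IH] f g [cf df] [cg dg]; split => //.
1,2: by move=> x Ax; exact: continuousD (cf _ Ax) (cg _ Ax).
move=> i; have [f1 f2] := df i; have [g1 g2] := dg i; split.
  by move=> x Ax; apply: derivableD; [exact: f1|exact: g1].
apply: Ck_ext (IH _ _ f2 g2) => // x Ax.
by rewrite -[RHS]/('D_'e_i (f + g) x) (deriveD (f1 _ Ax) (g1 _ Ax)).
Qed.

Lemma CkM m k (A : set 'rV[R]_m) f g : open A -> Ck k A f -> Ck k A g ->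
  Ck k A (fun x => f x * g x).
Proof.
move=> oA; elim: k f g => [|k IH] f g hf hg; move: (hf) (hg) => [cf df] [cg dg]; split => //.
1,2: by move=> x Ax; exact: continuousM (cf _ Ax) (cg _ Ax).
move=> i; have [f1 f2] := df i; have [g1 g2] := dg i; split.
  by move=> x Ax; apply: derivableM; [exact: f1|exact: g1].
apply: Ck_ext (CkD oA (IH _ _ (CkW hf) g2) (IH _ _ (CkW hg) f2)) => // x Ax.
by rewrite -[RHS]/('D_'e_i (f * g) x) (deriveM (f1 _ Ax) (g1 _ Ax)).
Qed.

Lemma CkV m k (A : set 'rV[R]_m) f : open A -> (forall x, A x -> f x != 0) ->
  Ck k A f -> Ck k A (fun x => (f x)^-1).
Proof.
move=> oA f0; elim: k => [|k IH] hf; move: (hf) => [cf df]; split => //.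
1,2: by move=> x Ax; exact: continuousV (f0 _ Ax) (cf _ Ax).
move=> i; have [f1 f2] := df i; split.
  by move=> x Ax; apply: derivableV; [exact: f0|exact: f1].
have hV := IH (CkW hf).
apply: Ck_ext (CkM oA (CkM oA (CkM oA (Ck_cst _ _ (-1)) hV) hV) f2) => // x Ax.
rewrite -[RHS]/('D_'e_i (fun y => (f y)^-1) x).
rewrite (deriveV (f0 _ Ax) (f1 _ Ax)).
rewrite /GRing.scale /= mulN1r mulNr; congr (- _ * _).
by rewrite expr2 invfM.
Qed.

Lemma Ck_sum m k (A : set 'rV[R]_m) n (F : 'I_n -> 'rV[R]_m -> R) :
  open A -> (forall i, Ck k A (F i)) -> Ck k A (fun x => \sum_i F i x).
Proof.
move=> oA; elim: n F => [|n IH] F hF.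
  by apply: Ck_eq (Ck_cst _ _ 0) => x; rewrite big_ord0.
apply: Ck_eq (CkD oA (IH (fun i => F (widen_ord (leqnSn n) i)) _) (hF ord_max)) => //.
by move=> x; rewrite big_ord_recr.
Qed.

End ck_theory.

Record chart (R : realType) (T : topologicalType) m := Chart {
  chart_dom : set T;
  chart_map : T -> 'rV[R]_m;
  chart_cod : set 'rV[R]_m;
  chart_inv : 'rV[R]_m -> T;
  chart_dom_open : open chart_dom;
  chart_cod_open : open chart_cod;
  chart_mapP : forall p, chart_dom p -> chart_cod (chart_map p);
  chart_invP : forall x, chart_cod x -> chart_dom (chart_inv x);
  chart_mapK : forall p, chart_dom p -> chart_inv (chart_map p) = p;
  chart_invK : forall x, chart_cod x -> chart_map (chart_inv x) = x;
  chart_map_continuous : forall p, chart_dom p -> {for p, continuous chart_map};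
  chart_inv_continuous : forall x, chart_cod x -> {for x, continuous chart_inv}
}.

(* The atlas is indexed by the points of the manifold: [chart_at p] is a chart
   around [p].  It provides the coordinates in which tangent vectors at [p] are
   written. *)
Record manifold (R : realType) m := Manifold {
  carrier :> topologicalType;
  chart_at : carrier -> chart R carrier m;
  chart_at_dom : forall p, chart_dom (chart_at p) p;
  chart_at_compat : forall p q,
    smooth_map_on
      (chart_cod (chart_at p) `&`
       chart_inv (chart_at p) @^-1` chart_dom (chart_at q))
      (chart_map (chart_at q) \o chart_inv (chart_at p));
  manifold_hausdorff : hausdorff_space carrier;
  manifold_second_countable : @second_countable carrier
}.

Section topology_facts.
Variable (R : realType).

Lemma countable_im (T U : Type) (f : T -> U) (A : set T) :
  countable A -> countable (f @` A).
Proof. by move=> cA; apply: card_le_trans (card_image_le f A) cA. Qed.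

Lemma continuous_rowP (T : topologicalType) m (f : T -> 'rV[R]_m) x :
  (forall j, {for x, continuous (fun y => f y 0 j)}) -> {for x, continuous f}.
Proof.
move=> cf U [P nP sPU].
have : \forall y \near x, forall j, P 0 j (f y 0 j).
  by apply: filter_forall => j; apply: (cf j); exact: nP.
by apply: filterS => y Py; apply: sPU => i j; rewrite ord1.
Qed.

Lemma hausdorff_prod (T U : topologicalType) :
  hausdorff_space T -> hausdorff_space U -> hausdorff_space (T * U)%type.
Proof.
move=> hT hU [p1 p2] [q1 q2] pq; congr pair.
- apply: hT => A B nA nB.
  have [|| [x y] [[/= Ax _] [/= Bx _]]] := pq (A `*` setT) (B `*` setT).
  + by exists (A, setT) => //=; split => //; exact: filterT.
  + by exists (B, setT) => //=; split => //; exact: filterT.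
  + by exists x.
- apply: hU => A B nA nB.
  have [|| [x y] [[/= _ Ax] [/= _ Bx]]] := pq (setT `*` A) (setT `*` B).
  + by exists (setT, A) => //=; split => //; exact: filterT.
  + by exists (setT, B) => //=; split => //; exact: filterT.
  + by exists y.
Qed.

Lemma open_setX (T U : topologicalType) (A : set T) (B : set U) :
  open A -> open B -> open (A `*` B).
Proof.
move=> oA oB; rewrite openE => -[p q] [/= Ap Bq].
by exists (A, B) => //=; split; exact: open_nbhs_nbhs.
Qed.

Lemma second_countable_prod (T U : topologicalType) :
  @second_countable T -> @second_countable U -> @second_countable (T * U)%type.
Proof.
move=> [B cB [oB bB]] [C cC [oC bC]].
exists [set (X.1 `*` X.2) | X in B `*` C].
  by apply: countable_im; exact: countableX.
split=> [_ [[X Y] [/= /oB oX /oC oY] <-]|]; first exact: open_setX.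
move=> [p q] W [[X Y] [/= nX nY] sW].
have [X' [BX' X'p] sX] := bB p X nX; have [Y' [CY' Y'q] sY] := bC q Y nY.
exists (X' `*` Y'); first by split => //; exists (X', Y').
by move=> [a b] [/= /sX Xa /sY Yb]; exact: sW.
Qed.

Lemma second_countable_rV m : @second_countable 'rV[R]_m.
Proof.
pose f (c : 'rV[rat]_m * nat) : set 'rV[R]_m :=
  (ball (map_mx ratr c.1 : 'rV[R]_m) c.2.+1%:R^-1)°.
exists (range f); first by apply: countable_im; exact: countableP.
split=> [_ [c _ <-]|x U nU]; first exact: open_interior.
have /nbhs_ballP[e /= e0 sU] := nU.
have [n] : exists n, n.+1%:R^-1 < e / 2.
  have [N] := @ltr_add_invr R 0 (e / 2) (divr_gt0 e0 (ltr0Sn R 1)).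
  by rewrite add0r => ?; exists N.
move=> ne; have n0 : 0 < n.+1%:R^-1 :> R by [].
have [q qx] : exists q : 'rV[rat]_m, forall j, `|x 0 j - ratr (q 0 j)| < n.+1%:R^-1 / 2.
  have h j : exists y : rat, `|x 0 j - ratr y| < n.+1%:R^-1 / 2 :> R.
    have [||z [bz [y _ yz]]] := @dense_rat R (ball (x 0 j) (n.+1%:R^-1 / 2)).
    + by exists (x 0 j); apply: ballxx; rewrite divr_gt0.
    + exact: ball_open.
    + by exists y; rewrite yz.
  exists (\row_j xchoose (h j)) => j; rewrite mxE.
  exact: (xchooseP (h j)).
exists (f (q, n)).
  split; first by exists (q, n).
  rewrite /f /= /interior; apply/nbhs_ballP; exists (n.+1%:R^-1 / 2) => /=.
    by rewrite divr_gt0.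
  move=> y [_ xy]; split => // i j; rewrite ord1 mxE /ball /=.
  have := xy 0 j; have := qx j; rewrite /ball /= => h1 h2.
  rewrite -(subrK (x 0 j) (ratr _)) -addrA (le_lt_trans (ler_normD _ _)) //.
  by rewrite (splitr n.+1%:R^-1) ltrD // distrC.
move=> y /interior_subset [_ by_]; apply: sU; split => // i j; rewrite ord1 /ball /=.
have := by_ 0 j; have := qx j; rewrite mxE /ball /= => h1 h2.
rewrite -(subrK (ratr (q 0 j)) (x 0 j)) -addrA (le_lt_trans (ler_normD _ _)) //.
rewrite (splitr e) ltrD //; last exact: lt_trans h2 ne.
apply: lt_trans h1 _; apply: le_lt_trans ne.
by rewrite [leRHS]splitr lerDl ltW // divr_gt0.
Qed.

Lemma nbhs_set_type (T : topologicalType) (A : set T) (p : A) (U : set A) :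
  nbhs p U -> exists W : set T, [/\ open W, W (set_val p) & set_val @^-1` W `<=` U].
Proof. by move=> [_ [[W oW <-] Wp sU]]; exists W. Qed.

Lemma open_set_type (T : topologicalType) (A : set T) (W : set T) :
  open W -> open (set_val @^-1` W : set A).
Proof. by move=> oW; exists W. Qed.

Lemma continuous_set_type (S T : topologicalType) (A : set T) (f : S -> A) x :
  {for x, continuous (set_val \o f)} -> {for x, continuous f}.
Proof.
move=> cf U /nbhs_set_type [W [oW Wf sU]].
have nW : nbhs (set_val (f x)) W by apply: open_nbhs_nbhs; split.
have h : nbhs x [set y | W (set_val (f y))] := cf W nW.
suff : nbhs x (f @^-1` U) by [].
by apply: filterS h => y /=; exact: sU.
Qed.

Lemma second_countable_set_type (T : topologicalType) (A : set T) :
  @second_countable T -> @second_countable A.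
Proof.
move=> [B cB [oB bB]]; exists [set (set_val @^-1` X : set A) | X in B].
  exact: countable_im.
split=> [_ [X /oB oX <-]|p U]; first exact: open_set_type.
move=> /nbhs_set_type [W [oW Wp sU]].
have [X [BX Xp] sX] := bB (set_val p) W (open_nbhs_nbhs (conj oW Wp)).
exists (set_val @^-1` X); first by split => //; exists X.
by move=> q /sX /sU.
Qed.

Lemma hausdorff_set_type (T : topologicalType) (A : set T) :
  hausdorff_space T -> hausdorff_space A.
Proof.
move=> hT p q pq; apply: val_inj; apply: hT => X Y nX nY.
have cv : continuous (set_val : A -> T) by exact: initial_continuous.
have [z [/= Xz Yz]] := pq (set_val @^-1` X) (set_val @^-1` Y) (cv p _ nX) (cv q _ nY).
by exists (set_val z).
Qed.

End topology_facts.

Section product.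
Variables (R : realType) (m1 m2 : nat).

Section product_chart.
Variables (T1 T2 : topologicalType).
Variables (c1 : chart R T1 m1) (c2 : chart R T2 m2).

Let dom : set (T1 * T2) := chart_dom c1 `*` chart_dom c2.
Let cod : set 'rV[R]_(m1 + m2) :=
  lsubmx @^-1` chart_cod c1 `&` rsubmx @^-1` chart_cod c2.
Let map (p : T1 * T2) := row_mx (chart_map c1 p.1) (chart_map c2 p.2).
Let inv (x : 'rV[R]_(m1 + m2)) : T1 * T2 :=
  (chart_inv c1 (lsubmx x), chart_inv c2 (rsubmx x)).

Let dom_open : open dom.
Proof. by apply: open_setX; exact: chart_dom_open. Qed.

Let cod_open : open cod.
Proof.
apply: openI.
- have /continuousP := @continuous_lsubmx R 1 m1 m2; apply; exact: chart_cod_open.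
- have /continuousP := @continuous_rsubmx R 1 m1 m2; apply; exact: chart_cod_open.
Qed.

Let mapP p : dom p -> cod (map p).
Proof.
by move=> [d1 d2]; split; rewrite /= /map (row_mxKl, row_mxKr); apply: chart_mapP.
Qed.

Let invP x : cod x -> dom (inv x).
Proof. by move=> [d1 d2]; split; apply: chart_invP. Qed.

Let mapK p : dom p -> inv (map p) = p.
Proof.
case: p => p q [/= d1 d2].
by rewrite /inv /map /= row_mxKl row_mxKr !chart_mapK.
Qed.

Let invK x : cod x -> map (inv x) = x.
Proof. by move=> [d1 d2]; rewrite /map /inv /= !chart_invK // hsubmxK. Qed.

Let map_continuous p : dom p -> {for p, continuous map}.
Proof.
move=> [d1 d2]; apply: continuous_rowP => j.
case: (split_ordP j) => i ->.
- have h : {for p, continuous (fun q : T1 * T2 => chart_map c1 q.1 0 i)}.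
    apply: (@continuous_comp _ _ _ (fun q : T1 * T2 => chart_map c1 q.1) (fun x : 'rV[R]_m1 => x 0 i)).
      apply: (@continuous_comp _ _ _ fst); first exact: cvg_fst.
      exact: chart_map_continuous.
    exact: coord_continuous.
  have E : (fun q => map q 0 (lshift m2 i)) = (fun q => chart_map c1 q.1 0 i).
    by apply/funext => q; rewrite /map row_mxEl.
  by rewrite E.
- have h : {for p, continuous (fun q : T1 * T2 => chart_map c2 q.2 0 i)}.
    apply: (@continuous_comp _ _ _ (fun q : T1 * T2 => chart_map c2 q.2) (fun x : 'rV[R]_m2 => x 0 i)).
      apply: (@continuous_comp _ _ _ snd); first exact: cvg_snd.
      exact: chart_map_continuous.
    exact: coord_continuous.
  have E : (fun q => map q 0 (rshift m1 i)) = (fun q => chart_map c2 q.2 0 i).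
    by apply/funext => q; rewrite /map row_mxEr.
  by rewrite E.
Qed.

Let inv_continuous x : cod x -> {for x, continuous inv}.
Proof.
move=> [d1 d2].
have h1 : {for x, continuous (chart_inv c1 \o lsubmx)}.
  apply: continuous_comp; first exact: continuous_lsubmx.
  exact: chart_inv_continuous.
have h2 : {for x, continuous (chart_inv c2 \o rsubmx)}.
  apply: continuous_comp; first exact: continuous_rsubmx.
  exact: chart_inv_continuous.
exact: (cvg_pair h1 h2).
Qed.

Definition prod_chart : chart R (T1 * T2)%type (m1 + m2) :=
  Chart dom_open cod_open mapP invP mapK invK map_continuous inv_continuous.

End product_chart.

Lemma lsubmx_delta i : lsubmx ('e_i : 'rV[R]_(m1 + m2)) = 0 \/
  exists j, lsubmx ('e_i : 'rV[R]_(m1 + m2)) = 'e_j.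
Proof.
case: (split_ordP i) => j ->; [right; exists j|left]; apply/rowP => k; rewrite !mxE //=.
by rewrite (eq_sym _ (rshift _ _)) eq_rlshift.
Qed.

Lemma rsubmx_delta i : rsubmx ('e_i : 'rV[R]_(m1 + m2)) = 0 \/
  exists j, rsubmx ('e_i : 'rV[R]_(m1 + m2)) = 'e_j.
Proof.
case: (split_ordP i) => j ->; [left|right; exists j]; apply/rowP => k; rewrite !mxE //=.
  by rewrite eq_rlshift.
by rewrite eq_rshift.
Qed.

Variables (M1 : manifold R m1) (M2 : manifold R m2).

Let chart_at12 (p : M1 * M2) := prod_chart (chart_at p.1) (chart_at p.2).

Let chart_at12_dom p : chart_dom (chart_at12 p) p.
Proof. by split; exact: chart_at_dom. Qed.

Let chart_at12_compat p q :
  smooth_map_on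
    (chart_cod (chart_at12 p) `&`
     chart_inv (chart_at12 p) @^-1` chart_dom (chart_at12 q))
    (chart_map (chart_at12 q) \o chart_inv (chart_at12 p)).
Proof.
move=> j k; case: (split_ordP j) => i ->.
- have h := @chart_at_compat _ _ M1 p.1 q.1 i k.
  have {}h := Ck_lin_comp (@continuous_lsubmx R 1 m1 m2) lsubmx_delta h.
  apply: Ck_eq (Ck_sub _ h) => [x /=|x [[? ?] [? ?]]]; last by split.
  by rewrite row_mxEl.
- have h := @chart_at_compat _ _ M2 p.2 q.2 i k.
  have {}h := Ck_lin_comp (@continuous_rsubmx R 1 m1 m2) rsubmx_delta h.
  apply: Ck_eq (Ck_sub _ h) => [x /=|x [[? ?] [? ?]]]; last by split.
  by rewrite row_mxEr.
Qed.

Definition prod_manifold : manifold R (m1 + m2) :=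
  @Manifold R (m1 + m2) (M1 * M2)%type chart_at12 chart_at12_dom chart_at12_compat
    (hausdorff_prod (@manifold_hausdorff _ _ M1) (@manifold_hausdorff _ _ M2))
    (second_countable_prod (@manifold_second_countable _ _ M1)
                           (@manifold_second_countable _ _ M2)).

End product.

Definition sqnorm (R : realType) m (x : 'rV[R]_m) : R := \sum_i x 0 i ^+ 2.

Definition sphere_set (R : realType) m (r : R) : set 'rV[R]_(m + 1) :=
  [set x | sqnorm x = r ^+ 2].
Arguments sphere_set {R} m r.

Section sphere.
Variables (R : realType) (m : nat) (r : R) (r0 : 0 < r).

Lemma sqnorm_ge0 k (x : 'rV[R]_k) : 0 <= sqnorm x.
Proof. by apply: sumr_ge0 => i _; exact: sqr_ge0. Qed.

Lemma sqnormZ k a (x : 'rV[R]_k) : sqnorm (a *: x) = a ^+ 2 * sqnorm x.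
Proof. by rewrite mulr_sumr; apply: eq_bigr => i _; rewrite mxE exprMn. Qed.

Lemma sqnorm_row k (x : 'rV[R]_k) (y : 'rV[R]_1) :
  sqnorm (row_mx x y) = sqnorm x + y 0 0 ^+ 2.
Proof.
rewrite /sqnorm big_split_ord /= big_ord1 row_mxEr; congr (_ + _).
by apply: eq_bigr => i _; rewrite row_mxEl.
Qed.

Lemma Ck_sqnorm n k (A : set 'rV[R]_n) : open A -> Ck k A (@sqnorm R n).
Proof.
move=> oA; apply: Ck_sum => // i.
by apply: Ck_eq (CkM oA (Ck_coord k A i) (Ck_coord k A i)) => x; rewrite expr2.
Qed.

Let height (x : 'rV[R]_(m + 1)) : R := x 0 (rshift m 0).
Let den (u : 'rV[R]_m) : R := sqnorm u + r ^+ 2.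

Lemma sqnorm_split (x : 'rV[R]_(m + 1)) :
  sqnorm x = sqnorm (lsubmx x) + height x ^+ 2.
Proof. by rewrite -{1}(hsubmxK x) sqnorm_row /height !mxE. Qed.

Let den_gt0 u : 0 < den u.
Proof. by rewrite /den ltr_wpDl ?sqnorm_ge0 // exprn_gt0. Qed.

(* Stereographic projection from the pole (0, (-1) ^+ b * r). *)
Definition stereo (b : bool) (p : sphere_set m r) : 'rV[R]_m :=
  (r / (r - (-1) ^+ b * height (set_val p))) *: lsubmx (set_val p).

Definition stereo_inv_row (b : bool) (u : 'rV[R]_m) : 'rV[R]_(m + 1) :=
  row_mx ((2 * r ^+ 2 / (sqnorm u + r ^+ 2)) *: u)
    (const_mx ((-1) ^+ b * r * ((sqnorm u - r ^+ 2) / (sqnorm u + r ^+ 2)))).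

Lemma stereo_inv_subproof b u : sphere_set m r (stereo_inv_row b u).
Proof.
rewrite /sphere_set /= sqnorm_row sqnormZ mxE !exprMn sqrr_sign.
have := den_gt0 u; rewrite /den => /lt0r_neq0 d0.
by field.
Qed.

Definition stereo_inv (b : bool) (u : 'rV[R]_m) : sphere_set m r :=
  SigSub (mem_set (stereo_inv_subproof b u)).

Definition stereo_dom (b : bool) : set (sphere_set m r) :=
  [set p | r - (-1) ^+ b * height (set_val p) != 0].

Let sphereP (p : sphere_set m r) :
  sqnorm (lsubmx (set_val p)) + height (set_val p) ^+ 2 = r ^+ 2.
Proof. by rewrite -sqnorm_split; have /set_mem := valP p. Qed.

Let val_inv b u : set_val (stereo_inv b u) = stereo_inv_row b u.
Proof. by []. Qed.

Let height_inv b u :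
  height (stereo_inv_row b u) =
    (-1) ^+ b * r * ((sqnorm u - r ^+ 2) / (sqnorm u + r ^+ 2)).
Proof. by rewrite /height row_mxEr mxE. Qed.

Let height_continuous : continuous (fun p : sphere_set m r => height (set_val p)).
Proof.
move=> p; apply: (@continuous_comp _ _ _ set_val height).
  exact: initial_continuous.
exact: coord_continuous.
Qed.

Let den_continuous (b : bool) :
  continuous (fun p : sphere_set m r => r - (-1) ^+ b * height (set_val p)).
Proof.
move=> p.
have c1 a : {for p, continuous (fun=> a : R)} by exact: cst_continuous.
exact: (continuousB (c1 r) (continuousM (c1 ((-1) ^+ b)) (@height_continuous p))).
Qed.

Let dom_open b : open (stereo_dom b).
Proof.
have /continuousP := @den_continuous b.
by move/(_ [set x | x != 0]); apply; exact: open_neq.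
Qed.

Let mapP b p : stereo_dom b p -> [set: 'rV[R]_m] (stereo b p).
Proof. by []. Qed.

Let den_inv (b : bool) u : r - (-1) ^+ b * height (stereo_inv_row b u) =
  2 * r ^+ 3 / (sqnorm u + r ^+ 2).
Proof.
rewrite height_inv !mulrA -expr2 sqrr_sign mul1r.
have := den_gt0 u; rewrite /den => d0.
by field; exact: lt0r_neq0.
Qed.

Let invP b u : [set: 'rV[R]_m] u -> stereo_dom b (stereo_inv b u).
Proof.
move=> _; rewrite /stereo_dom /= den_inv.
by rewrite lt0r_neq0 // divr_gt0 ?den_gt0 // mulr_gt0 // exprn_gt0.
Qed.

Let invK b u : [set: 'rV[R]_m] u -> stereo b (stereo_inv b u) = u.
Proof.
move=> _; rewrite /stereo val_inv den_inv row_mxKl scalerA.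
rewrite -[RHS]scale1r; congr (_ *: _).
have := den_gt0 u; rewrite /den => d0.
by field; rewrite (lt0r_neq0 r0) (lt0r_neq0 d0).
Qed.

Let mapK b p : stereo_dom b p -> stereo_inv b (stereo b p) = p.
Proof.
move=> dp; apply: val_inj => /=; rewrite -[RHS](hsubmxK (set_val p)).
have := sphereP p; move: dp; rewrite /stereo_dom /stereo_inv_row /stereo /=.
set t := height _; set y := lsubmx _ => dp yt.
have ht : rsubmx (set_val p) = const_mx t.
  by apply/rowP => i; rewrite ord1 !mxE /t /height.
have e1 : ((-1) ^+ b : R) ^+ 2 = 1 by rewrite sqrr_sign.
rewrite ht sqnormZ scalerA.
have ye : sqnorm y = r ^+ 2 - t ^+ 2 by rewrite -yt addrK.
set s : R := (-1) ^+ b in dp e1 *.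
have ys : sqnorm y = (r - s * t) * (r + s * t).
  by rewrite ye -subr_sqr exprMn e1 mul1r.
have dE : (r / (r - s * t)) ^+ 2 * sqnorm y + r ^+ 2 = 2 * r ^+ 3 / (r - s * t).
  by rewrite ys; field.
have nE : (r / (r - s * t)) ^+ 2 * sqnorm y - r ^+ 2 = 2 * r ^+ 2 * (s * t) / (r - s * t).
  by rewrite ys; field.
rewrite dE nE; congr row_mx.
  rewrite -[RHS]scale1r; congr (_ *: _).
  by field; rewrite dp lt0r_neq0.
congr const_mx.
have s0 : s != 0 by rewrite /s signr_eq0.
rewrite -[RHS]mul1r -e1.
by field; rewrite dp s0 lt0r_neq0.
Qed.

Let map_continuous b p : stereo_dom b p -> {for p, continuous (stereo b)}.
Proof.
move=> dp; apply: continuous_rowP => j.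
have E : (fun q => stereo b q 0 j) =
    (fun q => (r / (r - (-1) ^+ b * height (set_val q))) * set_val q 0 (lshift 1 j)).
  by apply/funext => q; rewrite /stereo !mxE.
have c1 : {for p, continuous (fun=> r : R)} by exact: cst_continuous.
have c2 : {for p, continuous (fun q : sphere_set m r => set_val q 0 (lshift 1 j))}.
  apply: (@continuous_comp _ _ _ set_val (fun x : 'rV[R]_(m + 1) => x 0 (lshift 1 j))).
    exact: initial_continuous.
  exact: coord_continuous.
rewrite E.
have c3 : {for p, continuous (fun q : sphere_set m r =>
    (r - (-1) ^+ b * height (set_val q))^-1)}.
  by apply: continuousV; [exact: dp|exact: den_continuous].
exact: (continuousM (continuousM c1 c3) c2).
Qed.

Let Ck_inv_row b k j : Ck k setT (fun u => stereo_inv_row b u 0 j).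
Proof.
have oT := @openT 'rV[R]_m.
have Cq : Ck k setT (@sqnorm R m) by exact: Ck_sqnorm.
have Cd : Ck k setT (fun u : 'rV[R]_m => (sqnorm u + r ^+ 2)^-1).
  apply: CkV => // [u _|]; first exact: lt0r_neq0 (den_gt0 u).
  by apply: CkD => //; exact: Ck_cst.
case: (split_ordP j) => i ->.
- apply: Ck_eq (CkM oT (CkM oT (Ck_cst _ _ (2 * r ^+ 2)) Cd) (Ck_coord k setT i)).
  by move=> u; rewrite row_mxEl mxE.
- apply: Ck_eq (CkM oT (Ck_cst _ _ ((-1) ^+ b * r))
    (CkM oT (CkD oT Cq (Ck_cst _ _ (- r ^+ 2))) Cd)).
  by move=> u; rewrite row_mxEr mxE.
Qed.

Let inv_continuous b u : [set: 'rV[R]_m] u -> {for u, continuous (stereo_inv b)}.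
Proof.
move=> _; apply: continuous_set_type; apply: continuous_rowP => j.
exact: (Ck_continuous (Ck_inv_row b 0 j)).
Qed.

Definition stereo_chart (b : bool) : chart R (sphere_set m r) m :=
  Chart (dom_open b) openT (@mapP b) (@invP b) (@mapK b) (@invK b)
    (@map_continuous b) (@inv_continuous b).

Let chart_at_sphere (p : sphere_set m r) := stereo_chart (0 < height (set_val p)).

Let chart_at_sphere_dom p : chart_dom (chart_at_sphere p) p.
Proof.
rewrite /= /stereo_dom /=; case: ltP => h; rewrite lt0r_neq0 //.
  by rewrite expr1 mulN1r opprK addr_gt0.
by rewrite expr0 mul1r subr_gt0 (le_lt_trans h).
Qed.

Let chart_at_sphere_compat p q :
  smooth_map_on
    (chart_cod (chart_at_sphere p) `&`
     chart_inv (chart_at_sphere p) @^-1` chart_dom (chart_at_sphere q))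
    (chart_map (chart_at_sphere q) \o chart_inv (chart_at_sphere p)).
Proof.
rewrite /=; move: (0 < _) (0 < _) => c b j k.
set A := _ `&` _.
have oA : open A.
  apply: openI; first exact: openT.
  have /continuousP h : continuous (stereo_inv b) by move=> u; exact: inv_continuous.
  exact: (h _ (dom_open c)).
have Cinv i : Ck k A (fun u => stereo_inv_row b u 0 i).
  by apply: Ck_sub (Ck_inv_row b k i).
have Cd : Ck k A (fun u => (r - (-1) ^+ c * height (stereo_inv_row b u))^-1).
  apply: CkV => // [u [_ //]|].
  apply: Ck_eq (CkD oA (Ck_cst _ _ r) (CkM oA (Ck_cst _ _ (- (-1) ^+ c)) (Cinv (rshift m 0)))).
  by move=> u; rewrite mulNr.
apply: Ck_eq (CkM oA (CkM oA (Ck_cst _ _ r) Cd) (Cinv (lshift 1 j))) => u.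
by rewrite /= /stereo val_inv [RHS]mxE [X in _ = _ * X]mxE.
Qed.

(* The round sphere of radius [r] in R^(m+1). *)
Definition sphere : manifold R m :=
  @Manifold R m (sphere_set m r) chart_at_sphere chart_at_sphere_dom
    chart_at_sphere_compat
    (@hausdorff_set_type 'rV[R]_(m + 1) (sphere_set m r) (@norm_hausdorff _ _))
    (@second_countable_set_type 'rV[R]_(m + 1) (sphere_set m r)
       (@second_countable_rV R (m + 1))).

End sphere.

Section tensors.
Variables (R : realType) (m : nat) (M : manifold R m).

(* The tangent space at [p] is R^m, a vector being given by its components in
   the chart [chart_at p]. *)
Definition vfield := M -> 'rV[R]_m.
Definition oneform := M -> {scalar 'rV[R]_m}.
Definition endofield := M -> {linear 'rV[R]_m -> 'rV[R]_m}.
Definition bilinfield := M -> 'rV[R]_m -> 'rV[R]_m -> R.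

Definition coords (p : M) : M -> 'rV[R]_m := chart_map (chart_at p).
Definition param (p : M) : 'rV[R]_m -> M := chart_inv (chart_at p).
Definition coords_cod (p : M) : set 'rV[R]_m := chart_cod (chart_at p).

(* Components in the chart at [p] of the tangent vector [v] at [q]. *)
Definition rep (p q : M) (v : 'rV[R]_m) : 'rV[R]_m :=
  'D_v (coords p \o param q) (coords q q).

(* The tangent vector at [q] whose components in the chart at [p] are [v];
   for v = 'e_i, the i-th coordinate vector field of the chart at [p]. *)
Definition coord_field (p : M) (v : 'rV[R]_m) : vfield := fun q =>
  'D_v (coords q \o param p) (coords p q).

Definition local_rep (X : vfield) (p : M) (x : 'rV[R]_m) : 'rV[R]_m :=
  rep p (param p x) (X (param p x)).

Definition smooth_fun (f : M -> R) :=
  forall p, smooth_on (coords_cod p) (f \o param p).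

Definition smooth_vfield (X : vfield) :=
  forall p, smooth_map_on (coords_cod p) (local_rep X p).

Definition smooth_oneform (eta : oneform) := forall p i,
  smooth_on (coords_cod p)
    ((fun q => eta q (coord_field p 'e_i q)) \o param p).

Definition smooth_endofield (phi : endofield) := forall p i,
  smooth_map_on (coords_cod p)
    (local_rep (fun q => phi q (coord_field p 'e_i q)) p).

Definition smooth_bilinfield (g : bilinfield) := forall p i j,
  smooth_on (coords_cod p)
    ((fun q => g q (coord_field p 'e_i q) (coord_field p 'e_j q)) \o param p).

Definition dirder (X : vfield) (f : M -> R) : M -> R := fun p =>
  'D_(X p) (f \o param p) (coords p p).

(* In the components of the chart at [p], [X, Y] = DY(X) - DX(Y). *)
Definition lie (X Y : vfield) : vfield := fun p =>
  'D_(X p) (local_rep Y p) (coords p p) - 'D_(Y p) (local_rep X p) (coords p p).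

Definition appv (phi : endofield) (X : vfield) : vfield := fun p => phi p (X p).

Definition wedge1 (eta zeta : oneform) (p : M) (v w : 'rV[R]_m) : R :=
  eta p v * zeta p w - eta p w * zeta p v.

Definition d1 (eta : oneform) (X Y : vfield) : M -> R := fun p =>
  dirder X (fun q => eta q (Y q)) p - dirder Y (fun q => eta q (X q)) p
  - eta p (lie X Y p).

Definition d2 (Phi : bilinfield) (X Y Z : vfield) : M -> R := fun p =>
  dirder X (fun q => Phi q (Y q) (Z q)) p
  + dirder Y (fun q => Phi q (Z q) (X q)) p
  + dirder Z (fun q => Phi q (X q) (Y q)) p
  - Phi p (lie X Y p) (Z p) - Phi p (lie Y Z p) (X p) - Phi p (lie Z X p) (Y p).

Record riemannian_metric (g : bilinfield) : Prop := {
  metric_smooth : smooth_bilinfield g;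
  metric_linear : forall p w, scalar (fun v => g p v w);
  metric_sym : forall p v w, g p v w = g p w v;
  metric_pos : forall p v, v != 0 -> 0 < g p v v
}.

Record affine_connection (nabla : vfield -> vfield -> vfield) : Prop := {
  nabla_smooth : forall X Y, smooth_vfield X -> smooth_vfield Y ->
    smooth_vfield (nabla X Y);
  nabla_addl : forall X X' Y,
    smooth_vfield X -> smooth_vfield X' -> smooth_vfield Y -> forall p,
    nabla (fun q => X q + X' q) Y p = nabla X Y p + nabla X' Y p;
  nabla_scalel : forall f X Y,
    smooth_fun f -> smooth_vfield X -> smooth_vfield Y -> forall p,
    nabla (fun q => f q *: X q) Y p = f p *: nabla X Y p;
  nabla_addr : forall X Y Y',
    smooth_vfield X -> smooth_vfield Y -> smooth_vfield Y' -> forall p,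
    nabla X (fun q => Y q + Y' q) p = nabla X Y p + nabla X Y' p;
  nabla_leibniz : forall f X Y,
    smooth_fun f -> smooth_vfield X -> smooth_vfield Y -> forall p,
    nabla X (fun q => f q *: Y q) p = dirder X f p *: Y p + f p *: nabla X Y p
}.

Record levi_civita (g : bilinfield) (nabla : vfield -> vfield -> vfield) : Prop := {
  lc_connection : affine_connection nabla;
  lc_torsion_free : forall X Y, smooth_vfield X -> smooth_vfield Y -> forall p,
    nabla X Y p - nabla Y X p = lie X Y p;
  lc_metric : forall X Y Z,
    smooth_vfield X -> smooth_vfield Y -> smooth_vfield Z -> forall p,
    dirder X (fun q => g q (Y q) (Z q)) p =
      g p (nabla X Y p) (Z p) + g p (Y p) (nabla X Z p)
}.

Definition nabla_endo (nabla : vfield -> vfield -> vfield) (X : vfield)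
    (phi : endofield) (Y : vfield) : vfield := fun p =>
  nabla X (appv phi Y) p - phi p (nabla X Y p).

Definition killing (g : bilinfield) (V : vfield) :=
  forall X Y, smooth_vfield X -> smooth_vfield Y -> forall p,
  dirder V (fun q => g q (X q) (Y q)) p =
    g p (lie V X p) (Y p) + g p (X p) (lie V Y p).

(* [i], [j], [k] are the images of 1, 2, 3 under an even permutation. *)
Definition even_triple (i j k : 'I_3) :=
  exists2 s : 'S_3, ~~ odd_perm s & [/\ s 0 = i, s 1 = j & s 2 = k].

Record almost_contact_metric (phi : endofield) (xi : vfield) (eta : oneform)
    (g : bilinfield) : Prop := {
  acm_phi_smooth : smooth_endofield phi;
  acm_xi_smooth : smooth_vfield xi;
  acm_eta_smooth : smooth_oneform eta;
  acm_metric : riemannian_metric g;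
  acm_phi2 : forall p v, phi p (phi p v) = - v + eta p v *: xi p;
  acm_eta_xi : forall p, eta p (xi p) = 1;
  acm_compat : forall p v w,
    g p (phi p v) (phi p w) = g p v w - eta p v * eta p w
}.

Definition fundamental_form (phi : endofield) (g : bilinfield) : bilinfield :=
  fun p v w => g p v (phi p w).

Definition nijenhuis (phi : endofield) (xi : vfield) (eta : oneform)
    (X Y : vfield) : vfield := fun p =>
  lie (appv phi X) (appv phi Y) p + phi p (phi p (lie X Y p))
  - phi p (lie (appv phi X) Y p) - phi p (lie X (appv phi Y) p)
  + d1 eta X Y p *: xi p.

Definition hypernormal (phi : 'I_3 -> endofield) (xi : 'I_3 -> vfield)
    (eta : 'I_3 -> oneform) :=
  forall i X Y, smooth_vfield X -> smooth_vfield Y -> forall p,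
  nijenhuis (phi i) (xi i) (eta i) X Y p = 0.

Record almost_3_contact_metric (phi : 'I_3 -> endofield) (xi : 'I_3 -> vfield)
    (eta : 'I_3 -> oneform) (g : bilinfield) : Prop := {
  a3cm_acm : forall i, almost_contact_metric (phi i) (xi i) (eta i) g;
  a3cm_phi : forall i j k, even_triple i j k -> forall p v,
    phi k p v = phi i p (phi j p v) - eta j p v *: xi i p /\
    phi k p v = - phi j p (phi i p v) + eta i p v *: xi j p;
  a3cm_xi : forall i j k, even_triple i j k -> forall p,
    xi k p = phi i p (xi j p) /\ xi k p = - phi j p (xi i p);
  a3cm_eta : forall i j k, even_triple i j k -> forall p v,
    eta k p v = eta i p (phi j p v) /\ eta k p v = - eta j p (phi i p v)
}.

Record three_delta_cosymplectic (delta : R) (phi : 'I_3 -> endofield)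
    (xi : 'I_3 -> vfield) (eta : 'I_3 -> oneform) (g : bilinfield) : Prop := {
  tdc_a3cm : almost_3_contact_metric phi xi eta g;
  tdc_deta : forall i j k, even_triple i j k ->
    forall X Y, smooth_vfield X -> smooth_vfield Y -> forall p,
    d1 (eta i) X Y p = - 2 * delta * wedge1 (eta j) (eta k) p (X p) (Y p);
  tdc_dPhi : forall i X Y Z,
    smooth_vfield X -> smooth_vfield Y -> smooth_vfield Z -> forall p,
    d2 (fundamental_form (phi i) g) X Y Z p = 0
}.

(* The dimension, a multiple of 4, is imposed where this is used. *)
Record hyperkahler (J : 'I_3 -> endofield) (g : bilinfield) : Prop := {
  hk_metric : riemannian_metric g;
  hk_smooth : forall i, smooth_endofield (J i);
  hk_sqr : forall i p v, J i p (J i p v) = - v;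
  hk_mul : forall i j k, even_triple i j k ->
    forall p v, J i p (J j p v) = J k p v;
  hk_isometry : forall i p v w, g p (J i p v) (J i p w) = g p v w;
  hk_parallel : forall nabla, levi_civita g nabla ->
    forall i X Y, smooth_vfield X -> smooth_vfield Y -> forall p,
    nabla_endo nabla X (J i) Y p = 0
}.

End tensors.

Section maps.
Variables (R : realType) (m n : nat) (M : manifold R m) (N : manifold R n).

Definition smooth_between (U : set M) (F : M -> N) :=
  (forall p, U p -> {for p, continuous F}) /\
  forall p q, smooth_map_on
    [set x | [/\ coords_cod p x, U (param p x) &
                 chart_dom (chart_at q) (F (param p x))]]
    (coords q \o F \o param p).

Definition differential (F : M -> N) (p : M) (v : 'rV[R]_m) : 'rV[R]_n :=
  'D_v (coords (F p) \o F \o param p) (coords p p).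

End maps.

(* Every point of M has an open neighbourhood isometric to an open subset of N. *)
Definition locally_isometric (R : realType) m (M N : manifold R m)
    (g : bilinfield M) (h : bilinfield N) :=
  forall p : M, exists (U : set M) (V : set N) (F : M -> N) (G : N -> M),
    [/\ open U, U p & open V] /\
    [/\ (forall q, U q -> V (F q) /\ G (F q) = q),
        (forall q, V q -> U (G q) /\ F (G q) = q),
        smooth_between U F,
        smooth_between V G &
        forall q, U q -> forall v w,
          h (F q) (differential F q v) (differential F q w) = g q v w].

Definition prod_metric (R : realType) m1 m2 (M1 : manifold R m1)
    (M2 : manifold R m2) (g1 : bilinfield M1) (g2 : bilinfield M2) :
    bilinfield (prod_manifold M1 M2) := fun p v w =>
  g1 p.1 (lsubmx v) (lsubmx w) + g2 p.2 (rsubmx v) (rsubmx w).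

(* Metric induced by the Euclidean metric of R^(m+1); for m >= 2 the sphere of
   radius r has constant curvature r^-2. *)
Definition sphere_metric (R : realType) m (r : R) (r0 : 0 < r) :
    bilinfield (sphere m r0) := fun p v w =>
  let emb u := 'D_u (set_val \o param p) (coords p p) in
  \sum_i emb v 0 i * emb w 0 i.
Arguments sphere_metric {R} m {r} r0.

Lemma radius_gt0 (R : realType) (delta : R) : delta != 0 -> 0 < `|delta|^-1.
Proof. by move=> d0; rewrite invr_gt0 normr_gt0. Qed.

(* Main.v *)
(* Subtract from the components of nabla phi_i and nabla xi_i the values announced by the
   theorem.  On TM + R, where the phi_i become anticommuting complex structures, the
   differences obey all the identities of the derivatives of an almost hyperhermitian
   structure with closed Kaehler forms, and vanish by Hitchin's lemma.  Hypernormality, the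
   Killing property and [xi_i, xi_j] = 2 delta xi_k follow.

   The Reeb fields thus span an involutive distribution, which combinations of them with
   commuting flows integrate.  The structure equations of the eta_i say that
   delta (eta_1 i + eta_2 j + eta_3 k) is a flat connection on the trivial bundle of
   quaternions; a parallel section is a map to the sphere, and together with the space of
   leaves it gives coordinates (z, w).  The forms Phi_i + eta_j ^ eta_k are closed and
   annihilated by the leaves, hence depend on z only; they determine a metric and three complex
   structures in z, parallel by Hitchin's lemma again.  A countable disjoint union of such
   z-domains is the hyperkaehler factor. *)

(* Differentiating the algebraic identities between phi_i, xi_i, eta_i and g gives affine equations
   for the covariant derivatives, and the announced values solve the same equations; hence the
   differences satisfy homogeneous ones. The products phi_i phi_j fail to be quaternionic by terms
   eta tensor xi, which the extra summand R absorbs exactly. Covariant derivatives are expressed by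
   Koszul's formula for g(nabla_X Y, Z), so that no connection has to be constructed; a given
   Levi-Civita connection is compared with it at the end.

   The quaternionic section pulls the metric of the unit sphere back to delta^2 times the sum of the
   squares of the eta_a, whence the radius 1/|delta|. It starts at the south pole, so that a single
   stereographic chart serves a whole piece.

   The leaf spaces exist only locally, yet one manifold N must serve all points of M. Since the
   isometry is local, the pieces of N need not fit together and a disjoint union suffices; second
   countability of M keeps their number countable. *)
From HB Require Import structures.
Require Import Defs.
From mathcomp Require Import all_boot all_order all_algebra all_fingroup.
From mathcomp Require Import all_classical all_reals all_analysis.
From mathcomp Require Import ring lra.

Set Implicit Arguments.
Unset Strict Implicit.
Unset Printing Implicit Defensive.

Import Order.TTheory GRing.Theory Num.Theory.
Import numFieldNormedType.Exports.

Local Open Scope classical_set_scope.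
Local Open Scope ring_scope.

(** * Differential calculus in R^m *)

Section calculus.
Variable R : realType.
Implicit Types (m n k : nat) (U V W : normedModType R).

Lemma line_is_derive V W (f : V -> W) (u v : V) (t : R) :
  derivable f (u + t *: v) v ->
  is_derive t 1 (fun s : R => f (u + s *: v)) ('D_v f (u + t *: v)).
Proof.
move=> df.
have E : (fun h : R => h^-1 *: (((fun s : R => f (u + s *: v)) \o shift t) (h *: 1) -
                          f (u + t *: v))) =
         (fun h : R => h^-1 *: ((f \o shift (u + t *: v)) (h *: v) - f (u + t *: v))).
  apply/funext => h /=; congr (_ *: (f _ - _)).
  by rewrite [h *: 1]mulr1 scalerDl addrCA.
by split; rewrite /derivable /derive E.
Qed.

Lemma is_derive_line V W (f : V -> W) (x v : V) d :
  is_derive (0 : R) 1 (fun s : R => f (x + s *: v)) d -> is_derive x v f d.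
Proof.
have E : (fun h : R => h^-1 *: (((fun s : R => f (x + s *: v)) \o shift 0) (h *: 1) -
                          f (x + 0 *: v))) =
         (fun h : R => h^-1 *: ((f \o shift x) (h *: v) - f x)).
  apply/funext => h /=; rewrite scale0r !addr0; congr (_ *: (f _ - _)).
  by rewrite [h *: 1]mulr1 addrC.
by case=> a b; split; move: a b; rewrite /derivable /derive E.
Qed.

Lemma mvt_line V (f : V -> R) (u v : V) :
  (forall t : R, 0 <= t <= 1 -> derivable f (u + t *: v) v) ->
  exists2 t : R, 0 <= t <= 1 & f (u + v) - f u = 'D_v f (u + t *: v).
Proof.
move=> df.
have d (t : R) : t \in `[0, 1] -> is_derive t 1 (fun s : R => f (u + s *: v)) ('D_v f (u + t *: v)).
  by rewrite in_itv /= => /df /line_is_derive.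
have d' (t : R) : t \in `]0, 1[ -> is_derive t 1 (fun s : R => f (u + s *: v)) ('D_v f (u + t *: v)).
  by move=> t01; apply: d; exact: subset_itv_oo_cc.
have cf : {within `[0, 1], continuous (fun s : R => f (u + s *: v))}.
  apply: derivable_within_continuous => x x01.
  by have [] := d x x01.
have [c] := MVT_segment (@ler01 R) d' cf.
rewrite in_itv /= => c01; rewrite scale1r scale0r addr0 subr0 mulr1 => ->.
by exists c.
Qed.

Lemma derive_rowE V n (F : V -> 'rV[R]_n) x v j : derivable F x v ->
  ('D_v F x) 0 j = 'D_v (fun y => F y 0 j) x.
Proof. by move=> dF; rewrite derive_mx // mxE. Qed.

Lemma derivable_rowP V n (F : V -> 'rV[R]_n) x v :
  derivable F x v <-> forall j, derivable (fun y => F y 0 j) x v.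
Proof.
rewrite derivable_mxP; split=> [h j|h i j]; first exact: h.
by rewrite ord1; exact: h.
Qed.

(** Restricting F to the line through x turns its derivability along v into differentiability of a
    map of one variable, to which the usual chain rule applies; hence the inner map needs no more
    than a directional derivative. *)
Lemma is_derive_comp U V W (f : V -> W) (F : U -> V) x v :
  differentiable f (F x) -> derivable F x v ->
  is_derive x v (f \o F) ('D_('D_v F x) f (F x)).
Proof.
move=> df dF.
have dF1 : derivable F (x + 0 *: v) v by rewrite scale0r addr0.
have g1 := line_is_derive dF1.
set g := fun s : R => F (x + s *: v) in g1.
have dg : differentiable g (0 : R) by apply/derivable1_diffP; exact: ex_derive.
have gx : g 0 = F x by rewrite /g scale0r addr0.
have dfg : differentiable f (g 0) by rewrite gx.
have d2 : is_derive (0 : R) 1 (f \o g) ('d f (F x) ('D_v F x)).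
  have h := differentiable_comp dg dfg.
  split; first exact: diff_derivable.
  rewrite deriveE // diff_comp //= gx; congr ('d f _ _).
  by rewrite -deriveE // (@derive_val _ _ _ _ _ _ _ g1) scale0r addr0.
rewrite -(deriveE _ df) in d2.
exact: is_derive_line d2.
Qed.

Lemma derive_basis m W (f : 'rV[R]_m -> W) x v : differentiable f x ->
  'D_v f x = \sum_i v 0 i *: 'D_'e_i f x.
Proof.
move=> df; rewrite deriveE // {1}(row_sum_delta v) linear_sum.
by apply: eq_bigr => i _; rewrite linearZ /= deriveE.
Qed.

Lemma deriveZv V W (f : V -> W) x v (a : R) : differentiable f x ->
  'D_(a *: v) f x = a *: 'D_v f x.
Proof. by move=> df; rewrite !deriveE // linearZ. Qed.

Lemma deriveDv V W (f : V -> W) x u v : differentiable f x ->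
  'D_(u + v) f x = 'D_u f x + 'D_v f x.
Proof. by move=> df; rewrite !deriveE // linearD. Qed.

Lemma deriveNv V W (f : V -> W) x v : differentiable f x ->
  'D_(- v) f x = - 'D_v f x.
Proof. by move=> df; rewrite !deriveE // linearN. Qed.

(** Reparametrising the line gives homogeneity in the direction from derivability alone.
    [C1_estimate] needs this before differentiability is available. *)
Lemma is_deriveZv V W (f : V -> W) x v (a : R) : derivable f x v ->
  is_derive x (a *: v) f (a *: 'D_v f x).
Proof.
move=> df; have df0 : derivable f (x + 0 *: v) v by rewrite scale0r addr0.
have := line_is_derive df0; set g := fun s : R => f (x + s *: v) => -[dg gE].
have da : is_derive (0 : R) 1 (fun h : R => a * h) a.
  apply: (@is_derive_eq _ _ _ (cst a * id) 0 1 _ _ (is_deriveM _ _)).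
  by rewrite scaler0 addr0 /GRing.scale /= mulr1.
have dga : differentiable g ((fun h : R => a * h) 0).
  by rewrite mulr0; apply/derivable1_diffP.
have h := is_derive_comp dga (@ex_derive _ _ _ _ _ _ _ da).
apply: is_derive_line; move: h; rewrite (@derive_val _ _ _ _ _ _ _ da).
have -> : g \o (fun h => a * h) = fun s : R => f (x + s *: (a *: v)).
  by apply/funext => s /=; rewrite /g scalerA mulrC.
rewrite -[X in 'D_X g _]mulr1 -/(a *: (1 : R)) deriveZv //.
by rewrite mulr0 gE scale0r addr0.
Qed.

Lemma normr_row m (x : 'rV[R]_m) i : `|x 0 i| <= `|x|.
Proof.
rewrite [leRHS]/Num.Def.normr /= mx_normrE.
exact: (@le_bigmax _ _ _ _ _ (0, i)).
Qed.

Lemma normr_row_le m (x : 'rV[R]_m) e : 0 <= e -> (forall i, `|x 0 i| <= e) -> `|x| <= e.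
Proof.
move=> e0 xe; rewrite [leLHS]/Num.Def.normr /= mx_normrE.
by apply: bigmax_le => // -[i j] _; rewrite ord1.
Qed.

(* Telescoping along the coordinate axes, one mean value theorem for each. *)
Lemma C1_estimate m (A : set 'rV[R]_m) f x (e : R) : open A -> Ck 1 A f -> A x -> 0 < e ->
  exists2 d, 0 < d & forall h, `|h| < d ->
    `|f (x + h) - f x - \sum_i h 0 i * 'D_'e_i f x| <= m%:R * e * `|h|.
Proof.
move=> oA [cf df] Ax e0.
have : \forall y \near x, A y /\ forall i, `|'D_'e_i f y - 'D_'e_i f x| <= e.
  near=> y; split; first by near: y; exact: open_nbhs_nbhs.
  near: y; apply: filter_forall => i.
  have [_ Di] := df i; have := Ck_continuous (k := 0) Di Ax.
  move=> /cvgrPdist_le /(_ e e0); apply: filterS => y.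
  by rewrite distrC.
move=> /nbhs_ballP [d /= d0 dP]; exists d => // h hd.
have step (u : 'rV[R]_m) (s : R) i : ball x d u -> ball x d (u + s *: 'e_i) ->
    `|f (u + s *: 'e_i) - f u - s * 'D_'e_i f x| <= e * `|s|.
  move=> bu bus.
  have conv (t : R) : 0 <= t <= 1 -> ball x d (u + t *: (s *: 'e_i)).
    move=> /andP[t0 t1].
    have -> : u + t *: (s *: 'e_i) = (1 - t) *: u + t *: (u + s *: 'e_i).
      by rewrite scalerDr addrA -scalerDl subrK scale1r.
    move: bu bus; rewrite -!ball_normE /ball_ /= => bu bus.
    have -> : x - ((1 - t) *: u + t *: (u + s *: 'e_i)) =
       (1 - t) *: (x - u) + t *: (x - (u + s *: 'e_i)).
      by rewrite !scalerBr addrACA -scalerDl subrK scale1r opprD.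
    apply: le_lt_trans (ler_normD _ _) _.
    rewrite !normrZ (ger0_norm t0) ger0_norm ?subr_ge0 //.
    have [->|tn0] := eqVneq t 0; first by rewrite subr0 mul1r mul0r addr0.
    have tp : 0 < t by rewrite lt_def tn0.
    rewrite -[ltRHS](_ : (1 - t) * d + t * d = d); last by rewrite -mulrDl subrK mul1r.
    apply: ler_ltD; first by rewrite ler_wpM2l ?subr_ge0 // ltW.
    by rewrite ltr_pM2l.
  have dl y (a : R) : ball x d y -> is_derive y (a *: 'e_i) f (a * 'D_'e_i f y).
    by move=> /dP [Ay _]; have [/(_ _ Ay) dfi _] := df i; exact: is_deriveZv.
  have [t t01|t t01 ->] := @mvt_line _ f u (s *: 'e_i).
    by have [] := dl _ s (conv t t01).
  have bt := conv t t01; rewrite (@derive_val _ _ _ _ _ _ _ (dl _ s bt)).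
  rewrite -mulrBr normrM mulrC ler_wpM2r //.
  by have [_] := dP _ bt.
pose trunc j : 'rV[R]_m := \row_i if (i < j)%N then h 0 i else 0.
have bt j : ball x d (x + trunc j).
  rewrite -ball_normE /ball_ /= opprD addNKr normrN; apply: le_lt_trans hd.
  by apply: normr_row_le => // i; rewrite mxE; case: ifP => _; rewrite ?normr_row ?normr0.
have S j : (j <= m)%N -> `|f (x + trunc j) - f x - \sum_(i < m | (i < j)%N) h 0 i * 'D_'e_i f x|
    <= j%:R * e * `|h|.
  elim: j => [_|j IH jm].
    rewrite big_pred0 // subr0 !mul0r (_ : trunc 0 = 0) ?addr0 ?subrr ?normr0 //.
    by apply/rowP => i; rewrite !mxE.
  have tS : trunc j.+1 = trunc j + h 0 (Ordinal jm) *: 'e_(Ordinal jm).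
    apply/rowP => i; rewrite !mxE eqxx ltnS leq_eqVlt /=.
    have [ij|ij] := eqVneq i (Ordinal jm).
      by rewrite ij /= eqxx ltnn mulr1 add0r.
    rewrite (_ : (i == j :> nat) = false) /= ?mulr0 ?addr0 //.
    by apply/negbTE; apply: contraNneq ij => ij; apply/eqP/val_inj.
  have bj := bt j.+1; rewrite tS addrA in bj.
  have := step _ _ _ (bt j) bj; rewrite -[x + trunc j + _]addrA -tS => st.
  rewrite (bigD1 (Ordinal jm)) //= (eq_bigl (fun i : 'I_m => (i < j)%N)); last first.
    move=> i; rewrite ltnS leq_eqVlt; have [->|ij] := eqVneq i (Ordinal jm).
      by rewrite andbF ltnn.
    rewrite andbT (_ : (i == j :> nat) = false) //.
    by apply/negbTE; apply: contraNneq ij => ij; apply/eqP/val_inj.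
  have -> : f (x + trunc j.+1) - f x - (h 0 (Ordinal jm) * 'D_'e_(Ordinal jm) f x +
     \sum_(i < m | (i < j)%N) h 0 i * 'D_'e_i f x) =
     (f (x + trunc j) - f x - \sum_(i < m | (i < j)%N) h 0 i * 'D_'e_i f x) +
     (f (x + trunc j.+1) - f (x + trunc j) - h 0 (Ordinal jm) * 'D_'e_(Ordinal jm) f x) by ring.
  apply: le_trans (ler_normD _ _) _; rewrite -natr1 !mulrDl mul1r.
  apply: lerD; first by apply: IH; exact: ltnW.
  by apply: le_trans st _; rewrite ler_wpM2l ?normr_row // ltW.
have E : \sum_(i < m | (i < m)%N) h 0 i * 'D_'e_i f x = \sum_i h 0 i * 'D_'e_i f x.
  by apply: eq_bigl => i; rewrite ltn_ord.
have := S m (leqnn m); rewrite E.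
by rewrite (_ : trunc m = h) //; apply/rowP => i; rewrite mxE ltn_ord.
Unshelve. all: by end_near.
Qed.

(** The bridge from the partial derivatives of [Ck] to Fréchet differentiability, on which linearity
    in the direction and the chain rule rest from here on. *)
Lemma C1_differentiable m (A : set 'rV[R]_m) f x : open A -> Ck 1 A f -> A x ->
  differentiable f x.
Proof.
move=> oA Cf Ax.
pose L (h : 'rV[R]_m) : R^o := \sum_i h 0 i * 'D_'e_i f x.
have lL : linear L.
  move=> a u v; rewrite /L scaler_sumr -big_split; apply: eq_bigr => i _ /=.
  by rewrite !mxE mulrDl -mulrA.
pose LL : {linear 'rV[R]_m -> R^o} := HB.pack L (GRing.isLinear.Build R 'rV[R]_m R^o _ L lL).
have cL : continuous LL.
  have {}cL : continuous (fun h : 'rV[R]_m => L h : R^o).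
    move=> y; rewrite /L; have -> : (fun h : 'rV[R]_m => \sum_i h 0 i * 'D_'e_i f x : R^o) =
       \sum_i (fun h : 'rV[R]_m => h 0 i * 'D_'e_i f x : R^o).
      by apply/funext => h; rewrite fct_sumE.
    apply: (big_ind (fun g : 'rV[R]_m -> R^o => {for y, continuous g})).
    - exact: cst_continuous.
    - by move=> g1 g2 c1 c2; exact: continuousD.
    - move=> i _; apply: (@continuousM R); first exact: coord_continuous.
      exact: cst_continuous.
  exact: cL.
have key : f \o shift x = cst (f x) + (LL : 'rV[R]_m -> R) +o_ (0 : 'rV[R]_m) id.
  apply/eqaddoP => _/posnumP[e].
  have m1 : 0 < m%:R + 1 :> R by rewrite ltr_wpDl.
  (* The estimate loses a factor m; dividing by m + 1 absorbs it and covers m = 0. *)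
  have [d d0 dP] := C1_estimate oA Cf Ax (divr_gt0 [gt0 of e%:num] m1).
  near=> h.
  rewrite -[X in `|X| <= _]/(f (h + x) - (f x + L h)) (addrC h) opprD addrA.
  apply: le_trans (dP h _) _; last first.
    apply: ler_wpM2r => //; rewrite mulrCA ger_pMr //.
    by rewrite ler_pdivrMr // mul1r lerDl.
  by near: h; apply/nbhs_ballP; exists d => //= z; rewrite -ball_normE /ball_ /= sub0r normrN.
have dE := @diff_unique R _ _ f LL x cL key.
by apply/diff_locallyP; rewrite dE.
Unshelve. all: by end_near.
Qed.
End calculus.

Local Opaque derive.

(** * Calculus of C^k functions and smooth maps *)

Section smooth.
Variable R : realType.
Implicit Types (m n k : nat).

(** [Ck] refers to its set only through the points where continuity and derivability are asked.
    Functions defined by cases can thus be checked piece by piece, in particular those extended by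
    zero. *)
Lemma Ck_union m k (A B : set 'rV[R]_m) f :
  Ck k A f -> Ck k B f -> Ck k (A `|` B) f.
Proof.
elim: k f => [|k IH] f [ca da] [cb db]; split => //; try by move=> x [/ca|/cb].
move=> i; have [a1 a2] := da i; have [b1 b2] := db i.
by split; [move=> x [/a1|/b1]|exact: IH].
Qed.

Lemma Ck_bigcup m k (I : Type) (A : I -> set 'rV[R]_m) f :
  (forall i, Ck k (A i) f) -> Ck k (\bigcup_i A i) f.
Proof.
elim: k f => [|k IH] f h; split => //.
- by move=> x [i _ Ax]; have [c _] := h i; exact: c.
- by move=> x [i _ Ax]; have [c _] := h i; exact: c.
- move=> j; split=> [x [i _ Ax]|]; first by have [_ /(_ j) [d _]] := h i; exact: d.
  by apply: IH => i; have [_ /(_ j) []] := h i.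
Qed.

Lemma smooth_continuous m (A : set 'rV[R]_m) f x : smooth_on A f -> A x ->
  {for x, continuous f}.
Proof. by move=> /(_ 0%N) /Ck_continuous h; exact: h. Qed.

Lemma smooth_differentiable m (A : set 'rV[R]_m) f x : open A ->
  smooth_on A f -> A x -> differentiable f x.
Proof. by move=> oA /(_ 1%N) /(C1_differentiable oA) h; exact: h. Qed.

Lemma differentiable_row m n (F : 'rV[R]_m -> 'rV[R]_n) x :
  (forall j, differentiable (fun y => F y 0 j) x) -> differentiable F x.
Proof.
move=> dF; have -> : F = \sum_j (fun y => F y 0 j *: 'e_j).
  by apply/funext => y; rewrite fct_sumE -row_sum_delta.
by apply: differentiable_sum => j; exact: differentiableZl.
Qed.

Lemma smooth_map_differentiable m n (A : set 'rV[R]_m) (F : 'rV[R]_m -> 'rV[R]_n) x :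
  open A -> smooth_map_on A F -> A x -> differentiable F x.
Proof.
by move=> oA sF Ax; apply: differentiable_row => j; exact: smooth_differentiable (sF j) Ax.
Qed.

Lemma smooth_map_continuous m n (A : set 'rV[R]_m) (F : 'rV[R]_m -> 'rV[R]_n) x :
  smooth_map_on A F -> A x -> {for x, continuous F}.
Proof.
by move=> sF Ax; apply: continuous_rowP => j; exact: smooth_continuous (sF j) Ax.
Qed.

Lemma derive_map_rowE m n (A : set 'rV[R]_m) (F : 'rV[R]_m -> 'rV[R]_n) x v j :
  open A -> smooth_map_on A F -> A x ->
  ('D_v F x) 0 j = 'D_v (fun y => F y 0 j) x.
Proof.
move=> oA sF Ax; apply: derive_rowE; apply: diff_derivable.
exact: smooth_map_differentiable sF Ax.
Qed.

Lemma derive_comp m n (W : normedModType R) (f : 'rV[R]_n -> W)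
    (F : 'rV[R]_m -> 'rV[R]_n) x v :
  differentiable F x -> differentiable f (F x) ->
  'D_v (f \o F) x = 'D_('D_v F x) f (F x).
Proof.
move=> dF df; have h := is_derive_comp df (diff_derivable (v := v) dF).
exact: derive_val.
Qed.

Lemma Ck_derive m k (A : set 'rV[R]_m) f v : open A -> Ck k.+1 A f ->
  Ck k A (fun x => 'D_v f x).
Proof.
move=> oA Cf; have C1f : Ck 1 A f by elim: k Cf => // k IH /CkW.
apply: (@Ck_ext _ _ _ _ (fun x => \sum_i v 0 i * 'D_'e_i f x)) => //.
  by move=> x Ax; rewrite derive_basis //; exact: C1_differentiable C1f Ax.
apply: Ck_sum => // i; apply: CkM => //; first exact: Ck_cst.
by case: Cf => _ /(_ i) [].
Qed.

Lemma Ck_le1 m k (A : set 'rV[R]_m) f : Ck k.+1 A f -> Ck 1 A f.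
Proof. by elim: k => // k IH /CkW. Qed.

Lemma Ck_map_differentiable m n k (A : set 'rV[R]_m) (F : 'rV[R]_m -> 'rV[R]_n) x :
  open A -> (forall j, Ck k.+1 A (fun x => F x 0 j)) -> A x -> differentiable F x.
Proof.
move=> oA CF Ax; apply: differentiable_row => j.
exact: C1_differentiable oA (Ck_le1 (CF j)) Ax.
Qed.

Lemma Ck_comp m n k (A : set 'rV[R]_m) (B : set 'rV[R]_n) f
    (F : 'rV[R]_m -> 'rV[R]_n) :
  open A -> open B -> (forall x, A x -> B (F x)) ->
  (forall j, Ck k A (fun x => F x 0 j)) -> Ck k B f -> Ck k A (f \o F).
Proof.
move=> oA oB AB; elim: k f => [|k IH] f CF Cf.
  split=> // x Ax; apply: continuous_comp.
    by apply: continuous_rowP => j; exact: (Ck_continuous (CF j)).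
  by apply: (Ck_continuous Cf); exact: AB.
have df x : A x -> differentiable f (F x).
  by move=> /AB Bx; exact: C1_differentiable oB (Ck_le1 Cf) Bx.
have dF x : A x -> differentiable F x by exact: (Ck_map_differentiable oA CF).
split=> [x Ax|i].
  by apply: differentiable_continuous; apply: differentiable_comp; [exact: dF|exact: df].
split.
  move=> x Ax; apply: diff_derivable; apply: differentiable_comp; first exact: dF.
  exact: df.
apply: (@Ck_ext _ _ _ _ (fun x => \sum_j 'D_'e_i (fun y => F y 0 j) x * ('D_'e_j f \o F) x)) => //.
  move=> x Ax; rewrite derive_comp; [|exact: dF|exact: df].
  rewrite (derive_basis _ (df _ Ax)); apply: eq_bigr => j _.
  by rewrite derive_rowE //; apply: diff_derivable; exact: dF.
apply: Ck_sum => // j; apply: CkM => //.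
  by have [_ /(_ i) []] := CF j.
by apply: IH => [l|]; [exact: CkW (CF l)|case: Cf => _ /(_ j) []].
Qed.

Lemma smooth_ext m (A : set 'rV[R]_m) f g : open A ->
  (forall x, A x -> f x = g x) -> smooth_on A f -> smooth_on A g.
Proof. by move=> oA fg sf k; exact: Ck_ext fg (sf k). Qed.

Lemma smooth_map_ext m n (A : set 'rV[R]_m) (f g : 'rV[R]_m -> 'rV[R]_n) : open A ->
  (forall x, A x -> f x = g x) -> smooth_map_on A f -> smooth_map_on A g.
Proof. by move=> oA fg sf j; apply: smooth_ext (sf j) => // x /fg ->. Qed.

Lemma smooth_sub m (A B : set 'rV[R]_m) f : B `<=` A -> smooth_on A f -> smooth_on B f.
Proof. by move=> BA sf k; exact: Ck_sub (sf k). Qed.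

Lemma smooth_map_sub m n (A B : set 'rV[R]_m) (f : 'rV[R]_m -> 'rV[R]_n) :
  B `<=` A -> smooth_map_on A f -> smooth_map_on B f.
Proof. by move=> BA sf j; exact: smooth_sub (sf j). Qed.

Lemma smooth_cst m (A : set 'rV[R]_m) (c : R) : smooth_on A (fun=> c).
Proof. by move=> k; exact: Ck_cst. Qed.

Lemma smooth_map_cst m n (A : set 'rV[R]_m) (c : 'rV[R]_n) : smooth_map_on A (fun=> c).
Proof. by move=> j; exact: smooth_cst. Qed.

Lemma smooth_coord m (A : set 'rV[R]_m) j : smooth_on A (fun x => x 0 j).
Proof. by move=> k; exact: Ck_coord. Qed.

Lemma smooth_map_id m (A : set 'rV[R]_m) : smooth_map_on A id.
Proof. by move=> j; exact: smooth_coord. Qed.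

Lemma smoothD m (A : set 'rV[R]_m) f g : open A -> smooth_on A f -> smooth_on A g ->
  smooth_on A (fun x => f x + g x).
Proof. by move=> oA sf sg k; exact: CkD. Qed.

Lemma smoothM m (A : set 'rV[R]_m) f g : open A -> smooth_on A f -> smooth_on A g ->
  smooth_on A (fun x => f x * g x).
Proof. by move=> oA sf sg k; exact: CkM. Qed.

Lemma smoothN m (A : set 'rV[R]_m) f : open A -> smooth_on A f ->
  smooth_on A (fun x => - f x).
Proof.
move=> oA sf; apply: smooth_ext (smoothM oA (smooth_cst _ (-1)) sf) => // x _.
exact: mulN1r.
Qed.

Lemma smoothB m (A : set 'rV[R]_m) f g : open A -> smooth_on A f -> smooth_on A g ->
  smooth_on A (fun x => f x - g x).
Proof. by move=> oA sf sg; apply: smoothD => //; exact: smoothN. Qed.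

Lemma smoothV m (A : set 'rV[R]_m) f : open A -> (forall x, A x -> f x != 0) ->
  smooth_on A f -> smooth_on A (fun x => (f x)^-1).
Proof. by move=> oA f0 sf k; exact: CkV. Qed.

Lemma smooth_sum m (A : set 'rV[R]_m) n (F : 'I_n -> 'rV[R]_m -> R) :
  open A -> (forall i, smooth_on A (F i)) -> smooth_on A (fun x => \sum_i F i x).
Proof. by move=> oA sF k; apply: Ck_sum => // i; exact: sF. Qed.

Lemma smooth_sumT m (A : set 'rV[R]_m) (I : finType) (F : I -> 'rV[R]_m -> R) :
  open A -> (forall i, smooth_on A (F i)) -> smooth_on A (fun x => \sum_i F i x).
Proof.
move=> oA sF; apply: smooth_ext (smooth_sum (F := fun i => F (enum_val i)) oA _) => //.
by move=> x _; rewrite [RHS](reindex _ (onW_bij _ (enum_val_bij I))).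
Qed.

Lemma smooth_prodT m (A : set 'rV[R]_m) (I : finType) (F : I -> 'rV[R]_m -> R) :
  open A -> (forall i, smooth_on A (F i)) -> smooth_on A (fun x => \prod_i F i x).
Proof.
move=> oA sF.
suff h (s : seq I) : smooth_on A (fun x => \prod_(i <- s) F i x) by exact: h.
elim: s => [|i s IH]; first by under eq_fun do rewrite big_nil; exact: smooth_cst.
by under eq_fun do rewrite big_cons; apply: smoothM.
Qed.

Lemma smooth_derive m (A : set 'rV[R]_m) f v : open A -> smooth_on A f ->
  smooth_on A (fun x => 'D_v f x).
Proof. by move=> oA sf k; exact: Ck_derive. Qed.

Lemma smooth_map_derive m n (A : set 'rV[R]_m) (F : 'rV[R]_m -> 'rV[R]_n) v : open A ->
  smooth_map_on A F -> smooth_map_on A (fun x => 'D_v F x).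
Proof.
move=> oA sF j; apply: smooth_ext (smooth_derive v oA (sF j)) => // x Ax.
by rewrite (derive_map_rowE _ _ oA sF Ax).
Qed.

Lemma smooth_comp m n (A : set 'rV[R]_m) (B : set 'rV[R]_n) f
    (F : 'rV[R]_m -> 'rV[R]_n) :
  open A -> open B -> (forall x, A x -> B (F x)) -> smooth_map_on A F ->
  smooth_on B f -> smooth_on A (f \o F).
Proof. by move=> oA oB AB sF sf k; exact: Ck_comp oA oB AB (fun j => sF j k) (sf k). Qed.

Lemma smooth_map_comp m n p (A : set 'rV[R]_m) (B : set 'rV[R]_n)
    (G : 'rV[R]_n -> 'rV[R]_p) (F : 'rV[R]_m -> 'rV[R]_n) :
  open A -> open B -> (forall x, A x -> B (F x)) -> smooth_map_on A F ->
  smooth_map_on B G -> smooth_map_on A (G \o F).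
Proof. by move=> oA oB AB sF sG j; exact: smooth_comp oA oB AB sF (sG j). Qed.

Lemma smooth_mapD m n (A : set 'rV[R]_m) (F G : 'rV[R]_m -> 'rV[R]_n) : open A ->
  smooth_map_on A F -> smooth_map_on A G -> smooth_map_on A (fun x => F x + G x).
Proof.
move=> oA sF sG j; apply: smooth_ext (smoothD oA (sF j) (sG j)) => // x _.
by rewrite mxE.
Qed.

Lemma smooth_mapZ m n (A : set 'rV[R]_m) f (G : 'rV[R]_m -> 'rV[R]_n) : open A ->
  smooth_on A f -> smooth_map_on A G -> smooth_map_on A (fun x => f x *: G x).
Proof.
move=> oA sF sG j; apply: smooth_ext (smoothM oA sF (sG j)) => // x _.
by rewrite mxE.
Qed.

Lemma smooth_map_sum m n (A : set 'rV[R]_m) (I : finType)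
    (F : I -> 'rV[R]_m -> 'rV[R]_n) : open A ->
  (forall i, smooth_map_on A (F i)) -> smooth_map_on A (fun x => \sum_i F i x).
Proof.
move=> oA sF j; apply: smooth_ext (smooth_sumT oA (fun i => sF i j)) => // x _.
by rewrite summxE.
Qed.

Lemma smooth_map_row_mx m n1 n2 (A : set 'rV[R]_m) (F : 'rV[R]_m -> 'rV[R]_n1)
    (G : 'rV[R]_m -> 'rV[R]_n2) :
  smooth_map_on A F -> smooth_map_on A G ->
  smooth_map_on A (fun x => row_mx (F x) (G x)).
Proof.
move=> sF sG j; case: (split_ordP j) => i ->.
  by under eq_fun do rewrite row_mxEl; exact: sF.
by under eq_fun do rewrite row_mxEr; exact: sG.
Qed.

Lemma smooth_map_lsubmx m n1 n2 (A : set 'rV[R]_m) (F : 'rV[R]_m -> 'rV[R]_(n1 + n2)) :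
  smooth_map_on A F -> smooth_map_on A (fun x => lsubmx (F x)).
Proof. by move=> sF j; under eq_fun do rewrite mxE; exact: sF. Qed.

Lemma smooth_map_rsubmx m n1 n2 (A : set 'rV[R]_m) (F : 'rV[R]_m -> 'rV[R]_(n1 + n2)) :
  smooth_map_on A F -> smooth_map_on A (fun x => rsubmx (F x)).
Proof. by move=> sF j; under eq_fun do rewrite mxE; exact: sF. Qed.

Lemma smooth_map_mulmx m n p (A : set 'rV[R]_m) (F : 'rV[R]_m -> 'rV[R]_n)
    (K : 'rV[R]_m -> 'M[R]_(n, p)) : open A ->
  smooth_map_on A F -> (forall i j, smooth_on A (fun x => K x i j)) ->
  smooth_map_on A (fun x => F x *m K x).
Proof.
move=> oA sF sK j; under eq_fun do rewrite mxE.
by apply: smooth_sum => // i; apply: smoothM.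
Qed.

(* The second difference of [f] along [u] and [v] equals, by two applications of
   the mean value theorem, a value of either iterated derivative nearby. *)
Lemma schwarz m (A : set 'rV[R]_m) f x u v : open A -> smooth_on A f -> A x ->
  'D_u (fun y => 'D_v f y) x = 'D_v (fun y => 'D_u f y) x.
Proof.
move=> oA sf Ax.
pose P (u v : 'rV[R]_m) (t e : R) := exists y : 'rV[R]_m,
    `|'D_v (fun y => 'D_u f y) x - 'D_v (fun y => 'D_u f y) y| < e /\
    f (x + t *: u + t *: v) - f (x + t *: u) - (f (x + t *: v) - f x) =
    t ^+ 2 * 'D_v (fun y => 'D_u f y) y.
have close : forall (u v : 'rV[R]_m) (e : R), 0 < e -> \forall t \near (0 : R)^'+, P u v t e.
  move=> {}u {}v e e0.
  have cD := smooth_continuous (smooth_derive v oA (smooth_derive u oA sf)) Ax.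
  have : \forall y \near x, A y /\
     `|'D_v (fun y => 'D_u f y) x - 'D_v (fun y => 'D_u f y) y| < e.
    near=> y; split; first by near: y; exact: open_nbhs_nbhs.
    by near: y; move/cvgrPdist_lt: cD; apply.
  move=> /nbhs_ballP [d /= d0 dP].
  have nuv : 0 < `|u| + `|v| + 1 by rewrite ltr_wpDl // addr_ge0.
  near=> t.
  have t0 : 0 < t by near: t; exact: nbhs_right_gt.
  have td : t * (`|u| + `|v| + 1) < d.
    by rewrite -ltr_pdivlMr //; near: t; apply: nbhs_right_lt; rewrite divr_gt0.
  have bl a b : 0 <= a <= 1 -> 0 <= b <= 1 -> ball x d (x + a *: (t *: u) + b *: (t *: v)).
    move=> /andP[a0 a1] /andP[b0 b1].
    rewrite -ball_normE /ball_ /= -addrA opprD addNKr normrN.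
    apply: le_lt_trans (ler_normD _ _) _; apply: le_lt_trans td.
    rewrite !normrZ (ger0_norm a0) (ger0_norm b0) (gtr0_norm t0) !mulrDr.
    rewrite -[leLHS]addr0 lerD //; last by rewrite mulr1 ltW.
    apply: lerD; rewrite -[leRHS]mul1r; apply: ler_wpM2r => //;
    by rewrite mulr_ge0 // ltW.
  have dfy y : ball x d y -> differentiable f y.
    by move=> /dP [Ay _]; exact: smooth_differentiable sf Ay.
  have dDfy y : ball x d y -> differentiable (fun y => 'D_u f y) y.
    by move=> /dP [Ay _]; exact: smooth_differentiable (smooth_derive u oA sf) Ay.
  pose G y := f (y + t *: v) - f y.
  have i0 : 0 <= (0 : R) <= 1 by rewrite lexx ler01.
  have i1 : 0 <= (1 : R) <= 1 by rewrite lexx ler01.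
  have dG a : 0 <= a <= 1 -> is_derive (x + a *: (t *: u)) (t *: u) G
     (t *: 'D_u f (x + a *: (t *: u) + t *: v) - t *: 'D_u f (x + a *: (t *: u))).
    move=> a01.
    have b1 := bl a 1 a01 i1; have b0 := bl a 0 a01 i0.
    rewrite scale1r in b1; rewrite scale0r addr0 in b0.
    apply: is_deriveB; last first.
      rewrite -deriveZv; last exact: dfy.
      by apply: derivableP; apply: diff_derivable; exact: dfy.
    have dsh : is_derive (x + a *: (t *: u)) (t *: u) (fun y : 'rV[R]_m => y + t *: v) (t *: u).
      apply: (@is_derive_eq _ _ _ _ _ _ _ _ (is_deriveD (is_derive_id _ _) (is_derive_cst (t *: v) _ _))).
      by rewrite addr0.
    have h := @is_derive_comp R _ _ _ f (fun y => y + t *: v) (x + a *: (t *: u)) (t *: u)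
      (dfy _ b1) (@ex_derive _ _ _ _ _ _ _ dsh).
    by rewrite (@derive_val _ _ _ _ _ _ _ dsh) deriveZv in h; last exact: dfy.
  have [a a01|a a01 aE] := @mvt_line R _ G x (t *: u).
    by have [] := dG a a01.
  have [b b01|b b01 bE] := @mvt_line R _ (fun y => 'D_u f y) (x + a *: (t *: u)) (t *: v).
    by apply: diff_derivable; apply: dDfy; exact: bl.
  exists (x + a *: (t *: u) + b *: (t *: v)).
  split; first by have [] := dP _ (bl a b a01 b01).
  rewrite -[LHS]/(G (x + t *: u) - G x) aE (@derive_val _ _ _ _ _ _ _ (dG a a01)).
  rewrite -scalerBr bE deriveZv; last by apply: dDfy; exact: bl.
  by rewrite /GRing.scale /= mulrA expr2.
have fin (p q r s T d d' e : R) : T != 0 -> `|p - r| < e / 2 -> `|q - s| < e / 2 ->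
    d = T * r -> d' = T * s -> d = d' -> `|q - p| <= e.
  move=> T0 pr qs -> -> /(mulfI T0) rs; rewrite -(subrK s q) -addrA.
  apply: le_trans (ler_normD _ _) _; rewrite (splitr e) ltW // ltrD //.
  by rewrite -rs distrC.
apply/eqP; rewrite -subr_eq0 -normr_le0; apply/ler_addgt0Pr => e e0; rewrite add0r.
have e2 : 0 < e / 2 by rewrite divr_gt0.
have c1 := close u v _ e2; have c2 := close v u _ e2.
have [t [[t00 Puv] Pvu]] := filter_ex (filterI (filterI (nbhs_right_gt (0 : R)) c1) c2).
have t0 : t ^+ 2 != 0 by rewrite expf_eq0 /= lt0r_neq0.
have [y [y1 y2]] := Puv; have [z [z1 z2]] := Pvu.
apply: (fin _ _ _ _ _ _ _ _ t0 y1 z1 y2 z2).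
by rewrite (addrAC x); ring.
Unshelve. all: by end_near.
Qed.

Lemma schwarz_map m n (A : set 'rV[R]_m) (F : 'rV[R]_m -> 'rV[R]_n) x u v :
  open A -> smooth_map_on A F -> A x ->
  'D_u (fun y => 'D_v F y) x = 'D_v (fun y => 'D_u F y) x.
Proof.
move=> oA sF Ax; apply/rowP => j.
have E w1 w2 : ('D_w1 (fun y => 'D_w2 F y) x) 0 j =
               'D_w1 (fun y => 'D_w2 (fun z => F z 0 j) y) x.
  rewrite (derive_map_rowE w1 j oA (smooth_map_derive w2 oA sF) Ax).
  apply: near_eq_derive; apply: (near_open oA Ax) => y Ay.
  exact: (derive_map_rowE w2 j oA sF Ay).
exact: (etrans (E u v) (etrans (schwarz u v oA (sF j) Ax) (esym (E v u)))).
Qed.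

End smooth.

(** * Bump functions *)

Section bump.
Variable R : realType.
Implicit Types (m n k : nat) (t : R).

(* x^-n exp(-1/x) for x > 0, extended by 0: a family that is closed under
   differentiation up to linear combinations. *)
Definition flat n (x : R) : R := if 0 < x then x^-1 ^+ n * expR (- x^-1) else 0.

Lemma flat_ge0 n (x : R) : 0 <= flat n x.
Proof.
by rewrite /flat; case: ifP => // x0; rewrite mulr_ge0 ?expR_ge0 // exprn_ge0 // invr_ge0 ltW.
Qed.

Lemma flat_gt0 n (x : R) : 0 < x -> 0 < flat n x.
Proof. by move=> x0; rewrite /flat x0 mulr_gt0 ?expR_gt0 // exprn_gt0 // invr_gt0. Qed.

Lemma flat_eq0 n (x : R) : x <= 0 -> flat n x = 0.
Proof. by rewrite /flat; case: ltP. Qed.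

Lemma expR_ge_pow n (x : R) : 0 <= x -> x ^+ n <= n`!%:R * expR x.
Proof.
case: n => [|n] x0; first by rewrite expr0 fact0 mul1r -expR0 ler_expR.
have f0 : 0 < n.+1`!%:R :> R by rewrite ltr0n fact_gt0.
rewrite mulrC -ler_pdivrMr //; apply: le_trans (expR_ge1Dxn n x0).
by rewrite lerDr.
Qed.

(** From y^(n+1) <= (n+1)! exp y at y = 1/x. The linear bound gives continuity at 0 for the whole
    family. *)
Lemma flat_le n (x : R) : flat n x <= n.+1`!%:R * `|x|.
Proof.
rewrite /flat; case: ltP => x0; last by rewrite mulr_ge0.
have y0 : 0 < x^-1 by rewrite invr_gt0.
rewrite gtr0_norm // -ler_pdivrMr // mulrAC -exprSr expRN ler_pdivrMr ?expR_gt0 //.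
by apply: expR_ge_pow; rewrite ltW.
Qed.

Lemma flat_near0 n (c : R) : 0 < c -> \forall h \near (0 : R), `|flat n h| <= c.
Proof.
move=> c0; pose d : R := c / n.+1`!%:R.
have d0 : 0 < d by rewrite divr_gt0 // ltr0n fact_gt0.
apply/nbhs_ballP; exists d => //= h; rewrite -ball_normE /ball_ /= sub0r normrN => hd.
rewrite ger0_norm ?flat_ge0 //; apply: le_trans (flat_le n h) _.
by rewrite mulrC -ler_pdivlMr ?ltW // ltr0n fact_gt0.
Qed.

(** At 0 the difference quotient of [flat n] is [flat n.+1], which tends to 0, so the family is
    closed under differentiation there as well. *)
Lemma is_derive_flat n (x : R) :
  is_derive x 1 (flat n) (flat n.+2 x - n%:R * flat n.+1 x).
Proof.
have [x0|x0|<-] := ltgtP 0 x.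
- have E : \forall y \near x, y^-1 ^+ n * expR (- y^-1) = flat n y.
    by near=> y; rewrite /flat; have -> : 0 < y by near: y; exact: lt_nbhsr.
  apply: (near_eq_is_derive E).
  have xn0 : x != 0 by rewrite lt0r_neq0.
  have dV : is_derive x 1 (fun y : R => y^-1) (- (x ^- 2)).
    apply: (@is_derive_eq _ _ _ _ _ _ _ _ (@is_deriveV R id x 1 1 xn0 _)).
    by rewrite /GRing.scale /= mulr1.
  have dE : is_derive x 1 (fun y => expR (- y^-1)) (expR (- x^-1) * x ^- 2).
    have dN : is_derive x 1 (fun y : R => - y^-1) (- - x ^- 2) by exact: (is_deriveN dV).
    have h := @is_derive1_comp R expR (fun y : R => - y^-1) x _ _ (is_derive_expR _) dN.
    by move: h; rewrite opprK.
  have dX := is_deriveX n dV.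
  have -> : (fun y : R => y^-1 ^+ n * expR (- y^-1)) =
            (fun y : R => y^-1) ^+ n * (fun y : R => expR (- y^-1)).
    by apply/funext => y; rewrite /= !fctE.
  apply: (@is_derive_eq _ _ _ _ x 1 _ _ (is_deriveM dX dE)).
  rewrite /flat x0 /GRing.scale /= !fctE -!exprVn; set y := x^-1.
  by case: n {E dX} => [|n] /=; rewrite ?expr0 ?exprS; ring.
- have E : \forall y \near x, cst 0 y = flat n y.
    near=> y; rewrite /flat; case: ltP => // y0; suff : y < 0 by rewrite ltNge ltW.
    by near: y; exact: lt_nbhsl.
  apply: (near_eq_is_derive E).
  apply: (@is_derive_eq _ _ _ _ x 1 _ _ (is_derive_cst _ _ _)).
  by rewrite !flat_eq0 ?mulr0 ?subr0 // ltW.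
- rewrite !flat_eq0 // mulr0 subr0.
  have cv : (fun h : R => h^-1 *: ((flat n \o shift 0) (h *: 1) - flat n 0)) @ 0^' --> (0 : R).
    apply/cvgrPdist_le => e e0; near=> h.
    rewrite sub0r normrN /= addr0 [h *: 1]mulr1 (flat_eq0 n (lexx 0)) subr0.
    have -> : h^-1 *: flat n h = flat n.+1 h.
      by rewrite /flat /GRing.scale /=; case: ifP; rewrite ?mulr0 // exprS mulrA.
    by near: h; apply: nbhs_dnbhs; exact: flat_near0.
  split; first by apply/cvg_ex; exists 0.
  exact: cvg_lim cv.
Unshelve. all: by end_near.
Qed.

Lemma smooth_flat m n (A : set 'rV[R]_m) f : open A -> smooth_on A f ->
  smooth_on A (fun x => flat n (f x)).
Proof.
move=> oA sf k; elim: k n => [|k IH] n.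
  split=> // x Ax; apply: (@continuous_comp _ _ _ f (flat n)).
    exact: smooth_continuous sf Ax.
  apply: differentiable_continuous; apply/derivable1_diffP.
  by have [] := is_derive_flat n (f x).
have df x : A x -> differentiable f x by move=> Ax; exact: smooth_differentiable sf Ax.
have dfl x : differentiable (flat n) (f x).
  by apply/derivable1_diffP; have [] := is_derive_flat n (f x).
have h i x (Ax : A x) := is_derive_comp (dfl x) (diff_derivable (v := 'e_i) (df x Ax)).
split=> [x Ax|i]; first exact: (Ck_continuous (IH n) Ax).
split=> [x Ax|]; first by have [] := h i x Ax.
apply: (@Ck_ext _ _ _ _ (fun x => 'D_'e_i f x * (flat n.+2 (f x) + (- n%:R) * flat n.+1 (f x)))) => //.
  move=> x Ax; have [_ ->] := h i x Ax.
  rewrite -[X in 'D_X (flat n) _]mulr1 -/('D_'e_i f x *: (1 : R)) deriveZv //.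
  have [_ ->] := is_derive_flat n (f x).
  by rewrite /GRing.scale /= mulNr.
apply: CkM => //; first exact: (smooth_derive _ oA sf k).
by apply: CkD => //; apply: CkM => //; exact: Ck_cst.
Qed.

Definition step t : R := flat 0 t / (flat 0 t + flat 0 (1 - t)).

Lemma step_den t : 0 < flat 0 t + flat 0 (1 - t).
Proof.
have [t0|t0] := ltP 0 t; first by rewrite ltr_wpDr ?flat_ge0 // flat_gt0.
by rewrite ltr_wpDl ?flat_ge0 // flat_gt0 // subr_gt0 (le_lt_trans t0).
Qed.

Lemma step0 t : t <= 0 -> step t = 0.
Proof. by move=> t0; rewrite /step flat_eq0 // mul0r. Qed.

Lemma step1 t : 1 <= t -> step t = 1.
Proof.
move=> t1; have t0 : 0 < t by rewrite (lt_le_trans ltr01).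
by rewrite /step (@flat_eq0 _ (1 - t)) ?subr_le0 // addr0 divff // lt0r_neq0 // flat_gt0.
Qed.

Lemma step_itv t : 0 <= step t <= 1.
Proof.
rewrite /step divr_ge0 ?flat_ge0 ?(ltW (step_den t)) //=.
by rewrite ler_pdivrMr ?step_den // mul1r lerDl flat_ge0.
Qed.

Lemma smooth_step m (A : set 'rV[R]_m) f : open A -> smooth_on A f ->
  smooth_on A (fun x => step (f x)).
Proof.
move=> oA sf; rewrite /step; apply: smoothM => //; first exact: smooth_flat.
apply: smoothV => // [x _|]; first by rewrite lt0r_neq0 // step_den.
apply: smoothD => //; apply: smooth_flat => //.
by apply: smoothB => //; exact: smooth_cst.
Qed.

Lemma cutoff m (x0 : 'rV[R]_m) (r : R) : 0 < r -> exists chi : 'rV[R]_m -> R,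
  [/\ smooth_on setT chi, forall x, 0 <= chi x <= 1,
      forall x, `|x - x0| <= r -> chi x = 1 &
      forall x, 2 * r <= `|x - x0| -> chi x = 0].
Proof.
move=> r0.
(* The norm is the maximum norm, which is not smooth; hence a product over the coordinates. The
   quotient is at least 1 when the i-th coordinate is within r of the centre and at most 0 beyond
   2r. *)
pose a i (x : 'rV[R]_m) : R := (4 * r ^+ 2 - (x 0 i - x0 0 i) * (x 0 i - x0 0 i)) / (3 * r ^+ 2).
exists (fun x => \prod_i step (a i x)); split.
- apply: smooth_prodT; first exact: openT.
  move=> i; apply: smooth_step; first exact: openT.
  have h : smooth_on setT (fun x : 'rV[R]_m => x 0 i - x0 0 i).
    by apply: smoothB; [exact: openT|exact: smooth_coord|exact: smooth_cst].
  apply: smoothM; [exact: openT| |exact: smooth_cst].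
  apply: smoothB; [exact: openT|exact: smooth_cst|].
  by apply: smoothM; first exact: openT.
- move=> x; apply/andP; split; first by apply: prodr_ge0 => i _; have /andP[] := step_itv (a i x).
  apply: (@le_trans _ _ (\prod_(i < m) 1)); last by rewrite big1.
  by apply: ler_prod => i _; exact: step_itv.
- move=> x xr; apply: big1 => i _; apply: step1; rewrite /a ler_pdivlMr ?mul1r; last first.
    by rewrite mulr_gt0 // exprn_gt0.
  have := le_trans (normr_row (x - x0) i) xr; rewrite !mxE => h.
  have : (x 0 i - x0 0 i) ^+ 2 <= r ^+ 2 by rewrite -[leLHS]real_normK ?num_real // lerXn2r ?nnegrE // ltW.
  by rewrite expr2; lra.
- move=> x xr.
  have [i hi] : exists i, 2 * r <= `|x 0 i - x0 0 i|.
    apply: contrapT => /forallNP h; move: xr; apply/negP; rewrite -ltNge.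
    have r20 : 0 < 2 * r by rewrite mulr_gt0.
    rewrite [ltLHS]/Num.Def.normr /= mx_normrE; apply: bigmax_lt => // -[j i] _ /=.
    by rewrite ord1 !mxE ltNge; apply/negP; exact: h.
  apply/eqP; rewrite prodf_seq_eq0; apply/hasP; exists i; first exact: mem_index_enum.
  rewrite /= step0 // /a pmulr_lle0 ?invr_gt0 ?mulr_gt0 ?exprn_gt0 // subr_le0.
  have : (2 * r) ^+ 2 <= (x 0 i - x0 0 i) ^+ 2.
    by rewrite -[leRHS]real_normK ?num_real // lerXn2r ?nnegrE // mulr_ge0 // ltW.
  by rewrite exprMn expr2; nra.
Qed.

End bump.

(** * Differential inequalities and Picard iteration *)

Section gronwall.
Variable R : realType.
Implicit Types (T a b : R) (F G f g : R -> R).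

Lemma derive_ndecr T F f a b : (forall s : R, `|s| <= T -> is_derive s 1 F (f s)) ->
  (forall s : R, `|s| <= T -> 0 <= f s) -> - T <= a -> a <= b -> b <= T -> F a <= F b.
Proof.
move=> dF f0 Ta ab bT.
have inT (s : R) : s \in `[a, b] -> `|s| <= T.
  rewrite in_itv /= => /andP[as_ sb]; rewrite ler_norml.
  by rewrite (le_trans Ta) // (le_trans sb).
have d' (s : R) : s \in `]a, b[ -> is_derive s 1 F (f s).
  by move=> sab; apply: dF; apply: inT; exact: subset_itv_oo_cc.
have cF : {within `[a, b], continuous F}.
  by apply: derivable_within_continuous => x /inT /dF [].
have [c cab E] := MVT_segment ab d' cF.
rewrite -subr_ge0 E mulr_ge0 ?subr_ge0 //.
by apply: f0; exact: inT.
Qed.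

(** Comparison without integrals: G - F and G + F are nondecreasing on [-T, T]. *)
Lemma derive_cmp T F f G g t : (forall s : R, `|s| <= T -> is_derive s 1 F (f s)) ->
  (forall s : R, `|s| <= T -> is_derive s 1 G (g s)) ->
  (forall s : R, `|s| <= T -> `|f s| <= g s) -> `|t| <= T ->
  `|F t - F 0| <= `|G t - G 0|.
Proof.
move=> dF dG fg tT.
have T0 : 0 <= T := le_trans (normr_ge0 _) tT.
have d1 (s : R) : `|s| <= T -> is_derive s 1 (fun s => G s - F s) (g s - f s).
  by move=> sT; exact: (is_deriveB (dG s sT) (dF s sT)).
have d2 (s : R) : `|s| <= T -> is_derive s 1 (fun s => G s + F s) (g s + f s).
  by move=> sT; exact: (is_deriveD (dG s sT) (dF s sT)).
have n1 (s : R) : `|s| <= T -> 0 <= g s - f s.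
  by move=> /fg; rewrite ler_norml subr_ge0 => /andP[].
have n2 (s : R) : `|s| <= T -> 0 <= g s + f s.
  by move=> /fg; rewrite ler_norml => /andP[h1 h2]; lra.
move: tT; rewrite ler_norml => /andP[Tt tT].
have [t0|t0] := leP 0 t.
- have NT0 : - T <= 0 by rewrite oppr_le0.
  have h1 := derive_ndecr d1 n1 NT0 t0 tT; have h2 := derive_ndecr d2 n2 NT0 t0 tT.
  move: h1 h2 => /= h1 h2.
  by rewrite ler_norml; have := ler_norm (G t - G 0) => hn; apply/andP; split; lra.
- have h1 := derive_ndecr d1 n1 Tt (ltW t0) T0; have h2 := derive_ndecr d2 n2 Tt (ltW t0) T0.
  move: h1 h2 => /= h1 h2.
  rewrite ler_norml -(normrN (G t - G 0)) opprB; have := ler_norm (G 0 - G t) => hn.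
  by apply/andP; split; lra.
Qed.

(** The fundamental theorem of calculus yields antiderivatives on the growing intervals of
    half-length n + 1; normalised at 0 they agree by [derive_cmp]. *)
Lemma antiderivative f : continuous f ->
  exists F : R -> R, F 0 = 0 /\ forall t : R, is_derive t 1 F (f t).
Proof.
move=> cf.
have loc (n : nat) : exists F : R -> R, F 0 = 0 /\
    forall t : R, `|t| < n.+1%:R -> is_derive t 1 F (f t).
  pose F (x : R) := (\int[lebesgue_measure]_(s in `[(- n.+1%:R)%R, x]) f s)%R : R.
  exists (fun x => F x - F 0); split; first by rewrite subrr.
  move=> t; rewrite ltr_norml => /andP[t1 t2].
  have int : lebesgue_measure.-integrable `[(- n.+1%:R)%R, n.+1%:R] (EFin \o f).
    apply: continuous_compact_integrable; first exact: segment_compact.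
    exact: continuous_subspaceT.
  have [dF dE] := continuous_FTC1_closed t2 int t1 (cf t).
  have d1 : is_derive t 1 F (f t).
    by split; [exact: dF|rewrite -derive1E; exact: dE].
  apply: (@is_derive_eq _ _ _ _ _ _ _ _ (is_deriveB d1 (is_derive_cst (F 0) _ _))).
  by rewrite subr0.
have [F FP] := choice loc.
have F0 n : F n 0 = 0 by have [] := FP n.
have uniq_ (n m : nat) t : `|t| < n.+1%:R -> `|t| < m.+1%:R -> F n t = F m t.
  move=> tn tm.
  have dd (s : R) : `|s| <= `|t| -> is_derive s 1 (fun s => F n s - F m s) (f s - f s).
    move=> st; have [_ /(_ s) d1] := FP n; have [_ /(_ s) d2] := FP m.
    by apply: is_deriveB; [apply: d1|apply: d2]; exact: le_lt_trans st _.
  have d0 (s : R) : `|s| <= `|t| -> is_derive s 1 (cst (0 : R)) (0 : R).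
    by move=> _; exact: is_derive_cst.
  have := derive_cmp dd d0 _ (lexx `|t|); rewrite /= !F0 !subr0 normr0 => h.
  apply/eqP; rewrite -subr_eq0 -normr_le0; apply: h => s _.
  by rewrite subrr normr0.
exists (fun t => F (Num.truncn `|t|) t); split; first exact: F0.
(* The index chosen at s jumps at the integers. Near t it is replaced by the fixed N, so large that
   N + 1 exceeds |t| + 1. *)
move=> t; pose N := (Num.truncn `|t|).+1.
have tN : `|t| < N.+1%:R.
  apply: lt_trans (_ : N%:R < _); last by rewrite ltr_nat.
  by have := truncnS_gt `|t|.
have d1 : is_derive t 1 (F N) (f t) by have [_] := FP N; apply.
apply: near_eq_is_derive d1.
near=> s; apply: uniq_; last exact: truncnS_gt.
have : `|t - s| < 1.
  near: s; apply/nbhs_ballP; exists 1 => //= z.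
have := truncnS_gt `|t|; rewrite -/N -[N.+1%:R]natr1.
have := ler_normD (s - t) t; rewrite subrK (distrC s t).
lra.
Unshelve. all: by end_near.
Qed.

Lemma derive_row_cmp n T (F f : R -> 'rV[R]_n) G g t :
  (forall (s : R) j, `|s| <= T -> is_derive s 1 (fun r => F r 0 j) (f s 0 j)) ->
  (forall s : R, `|s| <= T -> is_derive s 1 G (g s)) ->
  (forall s : R, `|s| <= T -> `|f s| <= g s) -> `|t| <= T ->
  `|F t - F 0| <= `|G t - G 0|.
Proof.
move=> dF dG fg tT; apply: normr_row_le => // j; rewrite !mxE.
have d1 (s : R) : `|s| <= T -> is_derive s 1 (fun r => F r 0 j) (f s 0 j) by exact: dF.
have d2 (s : R) : `|s| <= T -> `|f s 0 j| <= g s.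
  by move=> sT; apply: le_trans (fg s sT); exact: normr_row.
exact: (derive_cmp d1 dG d2 tT).
Qed.

Lemma row_le_sqnorm n (x : 'rV[R]_n) : `|x| ^+ 2 <= sqnorm x.
Proof.
have [[i E]|E] : (exists i : 'I_n, `|x| = `|x 0 i|) \/ `|x| = 0.
  have [->|x0] := eqVneq x 0; first by right; rewrite normr0.
  have nx : mx_norm x != 0 by rewrite -[mx_norm x]/(`|x|) normr_eq0.
  have [[i j]] := mx_norm_neq0 nx.
  by rewrite ord1 => E; left; exists j.
- rewrite E real_normK ?num_real // /sqnorm (bigD1 i) //= lerDl.
  by apply: sumr_ge0 => k _; exact: sqr_ge0.
- by rewrite E expr0n /=; exact: sqnorm_ge0.
Qed.

Lemma sqnorm_le_row n (x : 'rV[R]_n) : sqnorm x <= n%:R * `|x| ^+ 2.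
Proof.
apply: (@le_trans _ _ (\sum_(i < n) `|x| ^+ 2)); last first.
  by rewrite sumr_const card_ord mulr_natl.
apply: ler_sum => i _.
by rewrite -(real_normK (num_real (x 0 i))) lerXn2r ?nnegrE // normr_row.
Qed.

(* The squared Euclidean norm s satisfies |s'| <= c (s + e^2), so that
   (s + e^2) exp(-c t) is nonincreasing and (s + e^2) exp(c t) nondecreasing. *)
Lemma gronwall n T (u u' : R -> 'rV[R]_n) (K e : R) t :
  0 <= K -> 0 <= e ->
  (forall (s : R) j, `|s| <= T -> is_derive s 1 (fun r => u r 0 j) (u' s 0 j)) ->
  (forall s : R, `|s| <= T -> `|u' s| <= K * `|u s| + e) -> `|t| <= T ->
  `|u t| ^+ 2 <= (n%:R * `|u 0| ^+ 2 + e ^+ 2) * expR (2 * n%:R * (K + 1) * T).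
Proof.
move=> K0 e0 du ub tT.
have T0 : 0 <= T := le_trans (normr_ge0 _) tT.
pose c : R := 2 * n%:R * (K + 1).
have c0 : 0 <= c by rewrite /c !mulr_ge0 // addr_ge0.
pose s (r : R) := sqnorm (u r) + e ^+ 2.
pose s' (r : R) := \sum_j (u r 0 j * u' r 0 j + u r 0 j * u' r 0 j).
have ds (r : R) : `|r| <= T -> is_derive r 1 s (s' r).
  move=> rT.
  have h : is_derive r 1 (\sum_j (fun r => u r 0 j * u r 0 j)) (s' r).
    apply: is_derive_sum => j.
    exact: (@is_deriveM _ _ _ _ _ _ _ _ (du r j rT) (du r j rT)).
  have -> : s = (\sum_j (fun r => u r 0 j * u r 0 j)) + cst (e ^+ 2).
    apply/funext => q; rewrite /s /= !fctE fct_sumE /sqnorm; congr (_ + _).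
  apply: (@is_derive_eq _ _ _ _ _ _ _ _ (is_deriveD h (is_derive_cst _ _ _))).
  by rewrite addr0.
have s'b (r : R) : `|r| <= T -> `|s' r| <= c * s r.
  move=> rT; have ubr := ub r rT.
  have : `|s' r| <= \sum_(j < n) (2 * (`|u r| * `|u' r|)).
    apply: le_trans (ler_norm_sum _ _ _) _; apply: ler_sum => j _.
    have h : `|u r 0 j * u' r 0 j| <= `|u r| * `|u' r|.
      by rewrite normrM ler_pM // normr_row.
    by apply: le_trans (ler_normD _ _) _; lra.
  rewrite sumr_const card_ord => h; apply: (le_trans h).
  have -> : c * s r = n%:R * (2 * ((K + 1) * s r)) by rewrite /c; ring.
  rewrite -[leLHS]mulr_natl; apply: ler_wpM2l => //; apply: ler_wpM2l => //.
  have h2 := row_le_sqnorm (u r).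
  have h3 : `|u r| * `|u' r| <= `|u r| * (K * `|u r| + e) by rewrite ler_wpM2l.
  have h4 := sqr_ge0 (`|u r| - e).
  apply: (le_trans h3); rewrite /s.
  have : (K + 1) * (`|u r| ^+ 2 + e ^+ 2) <= (K + 1) * (sqnorm (u r) + e ^+ 2).
    by rewrite ler_wpM2l ?addr_ge0 // lerD2r.
  apply: le_trans.
  have h5 : 0 <= K * e ^+ 2 by rewrite mulr_ge0 // sqr_ge0.
  have h6 := sqr_ge0 (`|u r| + e); have h7 := sqr_ge0 `|u r|; have h8 := sqr_ge0 e.
  by nra.
have sE (r : R) : `|u r| ^+ 2 <= s r.
  by apply: le_trans (row_le_sqnorm _) _; rewrite lerDl sqr_ge0.
have s0 : s 0 <= n%:R * `|u 0| ^+ 2 + e ^+ 2 by rewrite lerD2r sqnorm_le_row.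
have dE (a r : R) : is_derive r 1 (fun r : R => expR (a * r)) (a * expR (a * r)).
  have da : is_derive r 1 (fun r : R => a * r) a.
    apply: (@is_derive_eq _ _ _ (cst a * id) r 1 _ _ (is_deriveM _ _)).
    by rewrite scaler0 addr0 /GRing.scale /= mulr1.
  have h := @is_derive1_comp R expR (fun r : R => a * r) r _ _ (is_derive_expR _) da.
  by move: h; rewrite mulrC.
have dsE (a r : R) : `|r| <= T -> is_derive r 1 (fun r => s r * expR (a * r))
    (expR (a * r) * (a * s r + s' r)).
  move=> rT; apply: (@is_derive_eq _ _ _ _ _ _ _ _ (is_deriveM (ds r rT) (dE a r))).
  by rewrite /GRing.scale /=; ring.
suff main : s t <= s 0 * expR (c * T).
  apply: le_trans (sE t) _; apply: (le_trans main).
  by rewrite ler_wpM2r // expR_ge0.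
have s00 : 0 <= s 0 by apply: le_trans (sE 0); exact: sqr_ge0.
move: tT; rewrite ler_norml => /andP[Tt tT].
have [t0|t0] := leP 0 t.
- have h := derive_ndecr (F := fun r => - (s r * expR (- c * r)))
    (fun r rT => is_deriveN (dsE (- c) r rT)) _ (_ : - T <= 0) t0 tT.
  rewrite /= mulr0 expR0 mulr1 lerN2 in h.
  have : s t * expR (- c * t) <= s 0.
    apply: h; last by rewrite oppr_le0.
    move=> r rT; rewrite oppr_ge0 mulr_ge0_le0 ?expR_ge0 //.
    by have := s'b r rT; rewrite ler_norml => /andP[_]; lra.
  rewrite mulNr expRN ler_pdivrMr ?expR_gt0 // => h1.
  by apply: (le_trans h1); rewrite ler_wpM2l // ler_expR ler_wpM2l.
- have h := derive_ndecr (F := fun r => s r * expR (c * r))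
    (fun r rT => dsE c r rT) _ Tt (ltW t0) T0.
  rewrite /= mulr0 expR0 mulr1 in h.
  have : s t * expR (c * t) <= s 0.
    apply: h => r rT; rewrite mulr_ge0 ?expR_ge0 //.
    by have := s'b r rT; rewrite ler_norml => /andP[]; lra.
  rewrite -[c * t]opprK expRN ler_pdivrMr ?expR_gt0 // => h1.
  apply: (le_trans h1); rewrite ler_wpM2l // ler_expR -mulrN ler_wpM2l //.
  by rewrite lerNl.
Qed.

End gronwall.

Section picard.
Variables (R : realType) (N : nat) (g : 'rV[R]_N -> 'rV[R]_N) (L : R).
Hypotheses (L0 : 0 < L) (lip : forall x y, `|g x - g y| <= L * `|x - y|).

Definition integral_curve (x0 : 'rV[R]_N) (c : R -> 'rV[R]_N) :=
  c 0 = x0 /\ forall (t : R) j, is_derive t 1 (fun r => c r 0 j) (g (c t) 0 j).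

Lemma lip_continuous : continuous g.
Proof.
move=> x; apply/(@cvgrPdist_le R _ _ (nbhs x)) => e e0; near=> y.
apply: le_trans (lip x y) _; rewrite mulrC -ler_pdivlMr //.
near: y; apply/nbhs_ballP; exists (e / L) => /=; first by rewrite divr_gt0.
by move=> y; rewrite -ball_normE /ball_ /= => /ltW.
Unshelve. all: by end_near.
Qed.

Lemma derive_continuous_row n (c : R -> 'rV[R]_n) (c' : R -> 'rV[R]_n) (t : R) :
  (forall j, is_derive t 1 (fun r => c r 0 j) (c' t 0 j)) -> {for t, continuous c}.
Proof.
move=> dc; apply: continuous_rowP => j; apply: differentiable_continuous.
by apply/derivable1_diffP; have [] := dc j.
Qed.

(** With d n the tail of the geometric series, every u i - d i lies below every u j + d j, so the
    supremum of the lower bounds is the limit. *)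
Lemma geometric_cauchy (u : nat -> R) (C : R) :
  (forall n, `|u n.+1 - u n| <= C / 2 ^+ n) ->
  exists l, forall n, `|l - u n| <= 2 * C / 2 ^+ n.
Proof.
move=> uC; pose d n : R := 2 * C / 2 ^+ n.
have dS n : d n = C / 2 ^+ n + d n.+1.
  by rewrite /d exprS; field; rewrite expf_neq0.
have C0 : 0 <= C by have := le_trans (normr_ge0 _) (uC 0%N); rewrite expr0 divr1.
have d0 n : 0 <= d n by rewrite /d mulr_ge0 ?mulr_ge0 // invr_ge0 exprn_ge0.
have near_ n k : `|u (n + k)%N - u n| <= d n - d (n + k)%N.
  elim: k => [|k IH]; first by rewrite addn0 !subrr normr0.
  rewrite addnS -(subrK (u (n + k)%N) (u _.+1)) -addrA.
  apply: le_trans (ler_normD _ _) _.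
  by have := uC (n + k)%N; have := dS (n + k)%N; lra.
have ab i j : u i - d i <= u j + d j.
  have [ij|/ltnW ij] := leqP i j.
    have := near_ i (j - i)%N; rewrite subnKC // ler_norml => /andP[h1 h2].
    by have := d0 i; have := d0 j; lra.
  have := near_ j (i - j)%N; rewrite subnKC // ler_norml => /andP[h1 h2].
  by have := d0 i; have := d0 j; lra.
pose A := [set x | exists i, x = u i - d i].
have sA : has_sup A.
  split; first by exists (u 0%N - d 0%N), 0%N.
  by exists (u 0%N + d 0%N) => _ [i ->]; exact: ab.
exists (sup A) => n; rewrite -/(d n) ler_norml; apply/andP; split.
  have : u n - d n <= sup A by apply: ub_le_sup; [exact: sA.2|exists n].
  by lra.
have : sup A <= u n + d n by apply: ge_sup; [exact: sA.1|move=> _ [i ->]; exact: ab].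
by lra.
Qed.

Lemma geometric_le0 (x C : R) : (forall n : nat, x <= C / 2 ^+ n) -> x <= 0.
Proof.
move=> h; rewrite leNgt; apply/negP => x0.
have C0 : 0 < C by have := h 0%N; rewrite expr0 divr1; exact: lt_le_trans.
have := h (Num.truncn (C / x)).+1; apply/negP; rewrite -ltNge ltr_pdivrMr ?exprn_gt0 //.
rewrite mulrC -ltr_pdivrMr //.
have := truncnS_gt (C / x); move=> /lt_le_trans; apply.
by rewrite -natrX ler_nat ltnW // ltn_expl.
Qed.

(** Bielecki's weight, made symmetric in time, and its primitive [W]. For the norm weighted by w the
    Picard operator contracts on the whole line at once, and no local solutions have to be
    continued. *)
Let w (t : R) : R := expR (2 * L * t) + expR (- (2 * L) * t).
Let W (t : R) : R := (expR (2 * L * t) - expR (- (2 * L) * t)) / (2 * L).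

Let dE (a r : R) : is_derive r 1 (fun r : R => expR (a * r)) (a * expR (a * r)).
Proof.
have da : is_derive r 1 (fun r : R => a * r) a.
  apply: (@is_derive_eq _ _ _ (cst a * id) r 1 _ _ (is_deriveM _ _)).
  by rewrite scaler0 addr0 /GRing.scale /= mulr1.
have h := @is_derive1_comp R expR (fun r : R => a * r) r _ _ (is_derive_expR _) da.
by move: h; rewrite mulrC.
Qed.

Let dW (r : R) : is_derive r 1 W (w r).
Proof.
have h := is_deriveB (dE (2 * L) r) (dE (- (2 * L)) r).
have := is_deriveM h (is_derive_cst ((2 * L)^-1) r 1).
have -> : (fun r => expR (2 * L * r)) - (fun r => expR (- (2 * L) * r)) =
          (fun r => expR (2 * L * r) - expR (- (2 * L) * r)) by [].
move=> h2; apply: (@is_derive_eq _ _ _ _ _ _ _ _ h2).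
rewrite scaler0 add0r /GRing.scale /= /w.
by field; rewrite lt0r_neq0.
Qed.

Let w1 t : 1 <= w t.
Proof.
rewrite /w; have [t0|t0] := leP 0 t.
  apply: (@le_trans _ _ (expR (2 * L * t))); last by rewrite lerDl expR_ge0.
  by rewrite -expR0 ler_expR; apply: mulr_ge0 => //; apply: mulr_ge0 => //; exact: ltW.
apply: (@le_trans _ _ (expR (- (2 * L) * t))); last by rewrite lerDr expR_ge0.
rewrite -expR0 ler_expR mulr_le0 // ?ltW // oppr_lt0; exact: mulr_gt0.
Qed.

Let W_le t : `|W t - W 0| <= w t / (2 * L).
Proof.
have l2 : 0 < 2 * L by exact: mulr_gt0.
rewrite /W /w !mulr0 subrr mul0r subr0 normrM normfV (gtr0_norm l2).
rewrite ler_pM2r ?invr_gt0 // ler_norml.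
have := expR_ge0 (2 * L * t); have := expR_ge0 (- (2 * L) * t).
by move=> h1 h2; apply/andP; split; lra.
Qed.

(* If c1 - c2 is at most C w then, w' being of size 2 L w, one step of the
   Picard iteration reduces the bound to C w / 2. *)
Let contract (c1 c2 d1 d2 : R -> 'rV[R]_N) (C : R) :
  d1 0 = d2 0 ->
  (forall (t : R) j, is_derive t 1 (fun r => d1 r 0 j) (g (c1 t) 0 j)) ->
  (forall (t : R) j, is_derive t 1 (fun r => d2 r 0 j) (g (c2 t) 0 j)) ->
  (forall t, `|c1 t - c2 t| <= C * w t) -> 0 <= C ->
  forall t, `|d1 t - d2 t| <= C / 2 * w t.
Proof.
move=> d0 D1 D2 c12 C0 t.
have dF (s : R) j : `|s| <= `|t| ->
   is_derive s 1 (fun r => (d1 r - d2 r) 0 j) ((g (c1 s) - g (c2 s)) 0 j).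
  move=> _; rewrite !mxE.
  have -> : (fun r => (d1 r - d2 r) 0 j) = (fun r => d1 r 0 j) - (fun r => d2 r 0 j).
    by apply/funext => r; rewrite !mxE.
  exact: (is_deriveB (D1 s j) (D2 s j)).
have dG (s : R) : `|s| <= `|t| -> is_derive s 1 (fun r => L * C * W r) (L * C * w s).
  move=> _; apply: (@is_derive_eq _ _ _ (cst (L * C) * W) s 1 _ _ (is_deriveM (is_derive_cst _ _ _) (dW s))).
  by rewrite scaler0 addr0.
have fg (s : R) : `|s| <= `|t| -> `|g (c1 s) - g (c2 s)| <= L * C * w s.
  move=> _; apply: le_trans (lip _ _) _; rewrite -mulrA; apply: ler_wpM2l; [exact: ltW|exact: c12].
have := derive_row_cmp dF dG fg (lexx _); rewrite /= d0 subrr subr0 => h.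
apply: (le_trans h); rewrite -mulrBr normrM (ger0_norm (mulr_ge0 (ltW L0) C0)).
apply: le_trans (ler_wpM2l (mulr_ge0 (ltW L0) C0) (W_le t)) _.
by rewrite le_eqVlt; apply/orP; left; apply/eqP; field; rewrite lt0r_neq0.
Qed.

Lemma picard x0 : exists c, integral_curve x0 c.
Proof.
pose T := {c : R -> 'rV[R]_N | continuous c}.
have next (c : T) : exists d : T, sval d 0 = x0 /\
    forall (t : R) j, is_derive t 1 (fun r => sval d r 0 j) (g (sval c t) 0 j).
  have cg j : continuous (fun t => g (sval c t) 0 j).
    move=> t; apply: (@continuous_comp _ _ _ (fun t => g (sval c t)) (fun v : 'rV[R]_N => v 0 j)).
      apply: continuous_comp; first exact: (svalP c).
      exact: lip_continuous.
    exact: coord_continuous.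
  have [F FP] := choice (fun j => antiderivative (@cg j)).
  pose d (t : R) : 'rV[R]_N := x0 + \row_j F j t.
  have dd (t : R) j : is_derive t 1 (fun r => d r 0 j) (g (sval c t) 0 j).
    have [_ /(_ t) FPj] := FP j.
    have -> : (fun r => d r 0 j) = cst (x0 0 j) + F j by apply/funext => r; rewrite !mxE.
    by apply: (@is_derive_eq _ _ _ _ _ _ _ _ (is_deriveD (is_derive_cst _ _ _) FPj)); rewrite add0r.
  have cd : continuous d.
    by move=> t; exact: (@derive_continuous_row N d (fun t => g (sval c t)) t (dd t)).
  exists (exist _ d cd); split => //=; rewrite /d.
  by apply/rowP => j; rewrite !mxE; have [-> _] := FP j; rewrite addr0.
have [P PP] := choice next.
have c0 : continuous (fun _ : R => x0) by move=> t; exact: cst_continuous.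
pose u n : T := iter n P (exist _ _ c0).
have u0 n : sval (u n) 0 = x0 by case: n => [//|n]; have [] := PP (u n).
have du n (t : R) j : is_derive t 1 (fun r => sval (u n.+1) r 0 j) (g (sval (u n) t) 0 j).
  by have [_] := PP (u n); apply.
pose M : R := `|g x0| / (2 * L).
have l2 : 0 < 2 * L by exact: mulr_gt0.
have M0 : 0 <= M by rewrite /M divr_ge0 // ltW.
have uS n t : `|sval (u n.+1) t - sval (u n) t| <= M / 2 ^+ n * w t.
  elim: n t => [|n IH] t; last first.
    have -> : M / 2 ^+ n.+1 = M / 2 ^+ n / 2 by rewrite exprS; field; rewrite expf_neq0.
    apply: (contract _ (du n.+1) (du n) IH); first by rewrite !u0.
    by rewrite divr_ge0 // exprn_ge0.
  rewrite expr0 divr1.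
  have dG (s : R) : `|s| <= `|t| -> is_derive s 1 (fun r => `|g x0| * W r) (`|g x0| * w s).
    move=> _; apply: (@is_derive_eq _ _ _ (cst `|g x0| * W) s 1 _ _ (is_deriveM (is_derive_cst _ _ _) (dW s))).
    by rewrite scaler0 addr0.
  have fg (s : R) : `|s| <= `|t| -> `|g (sval (u 0%N) s)| <= `|g x0| * w s.
    by move=> _ /=; rewrite ler_peMr.
  have := derive_row_cmp (fun s j _ => du 0%N s j) dG fg (lexx _); rewrite u0 => h.
  apply: (le_trans h); rewrite -mulrBr normrM normr_id.
  apply: le_trans (ler_wpM2l (normr_ge0 _) (W_le t)) _.
  by rewrite /M mulrAC mulrA.
have lim t : exists l : 'rV[R]_N, forall n, `|l - sval (u n) t| <= 2 * (M * w t) / 2 ^+ n.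
  have h j := @geometric_cauchy (fun n => sval (u n) t 0 j) (M * w t).
  have {}h j : exists l, forall n, `|l - sval (u n) t 0 j| <= 2 * (M * w t) / 2 ^+ n.
    apply: h => n; apply: (@le_trans _ _ `|sval (u n.+1) t - sval (u n) t|).
      by have := normr_row (sval (u n.+1) t - sval (u n) t) j; rewrite !mxE.
    by apply: le_trans (uS n t) _; rewrite mulrAC.
  have [l lP] := choice h; exists (\row_j l j) => n; apply: normr_row_le.
    by rewrite divr_ge0 ?exprn_ge0 // mulr_ge0 // mulr_ge0 // (le_trans ler01).
  by move=> j; rewrite !mxE.
have [c cP] := choice lim.
have cc : continuous c.
  move=> t; apply/(@cvgrPdist_le R _ _ (nbhs t)) => e e0.
  have wc : {for t, continuous w}.
    apply: differentiable_continuous; apply/derivable1_diffP.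
    by have [] := is_deriveD (dE (2 * L) t) (dE (- (2 * L)) t).
  have : \forall s \near t, w s <= w t + 1.
    move/(@cvgrPdist_le R _ _ (nbhs t)): wc => /(_ 1 ltr01); apply: filterS => s.
    by rewrite ler_norml => /andP[]; lra.
  move=> wb; pose B : R := 2 * (M * (w t + 1)).
  have B0 : 0 <= B.
    have := w1 t => w1t; apply: mulr_ge0 => //; apply: mulr_ge0 => //; lra.
  have [n nP] : exists n : nat, B / 2 ^+ n <= e / 3.
    apply: contrapT => /forallNP h.
    suff : e / 3 <= 0 by rewrite leNgt divr_gt0.
    by apply: (@geometric_le0 _ B) => n; rewrite leNgt; apply/negP => /ltW; exact: h.
  have bnd s : w s <= w t + 1 -> `|c s - sval (u n) s| <= e / 3.
    move=> ws; apply: le_trans (cP s n) _; apply: le_trans nP.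
    by rewrite ler_pM2r ?invr_gt0 ?exprn_gt0 // ler_pM2l // ler_wpM2l.
  have cu := svalP (u n) t.
  have e3 : 0 < e / 3 by rewrite divr_gt0.
  move/(@cvgrPdist_le R _ _ (nbhs t)): cu => /(_ _ e3) cu.
  near=> s.
  have ws : w s <= w t + 1 by near: s.
  have h1 := bnd s ws; have h2 : `|c t - sval (u n) t| <= e / 3 by apply: bnd; rewrite lerDl.
  have h3 : `|sval (u n) t - sval (u n) s| <= e / 3 by near: s.
  have -> : c t - c s = (c t - sval (u n) t) + (sval (u n) t - sval (u n) s) +
      (sval (u n) s - c s) by rewrite !subrKA.
  apply: le_trans (ler_normD _ _) _.
  have hn := ler_normD (c t - sval (u n) t) (sval (u n) t - sval (u n) s).
  rewrite distrC in h1; apply: le_trans (lerD (le_trans hn (lerD h2 h3)) h1) _.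
  by rewrite le_eqVlt; apply/orP; left; apply/eqP; field.
(* d is the Picard transform of the limit c. Both are geometrically close to the iterates, so they
   coincide and c solves the equation. *)
have [d [d0 dd]] := next (exist _ c cc).
have cd t : c t = sval d t.
  apply/eqP; rewrite -subr_eq0 -normr_le0; apply: (@geometric_le0 _ (2 * M * w t)) => n.
  have h1 := cP t n.+1.
  have Cn : 0 <= 2 * M / 2 ^+ n by rewrite divr_ge0 ?exprn_ge0 // mulr_ge0.
  have h2 : `|sval (u n.+1) t - sval d t| <= 2 * M / 2 ^+ n / 2 * w t.
    apply: (contract _ (du n) dd _ Cn); first by rewrite u0 d0.
    by move=> s /=; rewrite distrC; apply: le_trans (cP s n) _; rewrite le_eqVlt; apply/orP; left; apply/eqP; ring.
  rewrite -(subrK (sval (u n.+1) t) (c t)) -addrA.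
  apply: le_trans (ler_normD _ _) _; apply: le_trans (lerD h1 h2) _.
  rewrite le_eqVlt; apply/orP; left; apply/eqP; rewrite exprS; field.
  by rewrite expf_neq0.
exists c; split; first by rewrite cd d0.
move=> t j; have -> : (fun r => c r 0 j) = (fun r => sval d r 0 j) by apply/funext => r; rewrite cd.
exact: dd.
Unshelve. all: by end_near.
Qed.

Lemma integral_curve_lip x y cx cy T t : integral_curve x cx -> integral_curve y cy ->
  `|t| <= T ->
  `|cx t - cy t| ^+ 2 <= N%:R * `|x - y| ^+ 2 * expR (2 * N%:R * (L + 1) * T).
Proof.
move=> [x0 dx] [y0 dy] tT.
have du (s : R) j : `|s| <= T ->
   is_derive s 1 (fun r => (cx r - cy r) 0 j) ((g (cx s) - g (cy s)) 0 j).
  move=> _; rewrite !mxE.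
  have -> : (fun r => (cx r - cy r) 0 j) = (fun r => cx r 0 j) - (fun r => cy r 0 j).
    by apply/funext => r; rewrite !mxE.
  exact: (is_deriveB (dx s j) (dy s j)).
have ub (s : R) : `|s| <= T -> `|g (cx s) - g (cy s)| <= L * `|cx s - cy s| + 0.
  by move=> _; rewrite addr0.
have := gronwall (ltW L0) (lexx 0) du ub tT.
by rewrite expr0n addr0 x0 y0.
Qed.

Lemma integral_curve_uniq x T (cx cy : R -> 'rV[R]_N) t : cx 0 = x -> cy 0 = x ->
  (forall (s : R) j, `|s| <= T -> is_derive s 1 (fun r => cx r 0 j) (g (cx s) 0 j)) ->
  (forall (s : R) j, `|s| <= T -> is_derive s 1 (fun r => cy r 0 j) (g (cy s) 0 j)) ->
  `|t| <= T -> cx t = cy t.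
Proof.
move=> x0 y0 dx dy tT.
have du (s : R) j : `|s| <= T ->
   is_derive s 1 (fun r => (cx r - cy r) 0 j) ((g (cx s) - g (cy s)) 0 j).
  move=> sT; rewrite !mxE.
  have -> : (fun r => (cx r - cy r) 0 j) = (fun r => cx r 0 j) - (fun r => cy r 0 j).
    by apply/funext => r; rewrite !mxE.
  exact: (is_deriveB (dx s j sT) (dy s j sT)).
have ub (s : R) : `|s| <= T -> `|g (cx s) - g (cy s)| <= L * `|cx s - cy s| + 0.
  by move=> _; rewrite addr0.
have := gronwall (ltW L0) (lexx 0) du ub tT.
rewrite expr0n addr0 x0 y0 subrr normr0 expr0n mulr0 mul0r => h.
apply/eqP; rewrite -subr_eq0 -normr_eq0 -sqrf_eq0 eq_le h.
exact: sqr_ge0.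
Qed.

End picard.

(** * Smooth flows *)

Section flow.
Variable R : realType.
Implicit Types (m n k N : nat).

Lemma closed_ball_compact m (x0 : 'rV[R]_m) (r : R) : 0 < r ->
  compact [set x | `|x - x0| <= r].
Proof.
move=> r0; have -> : [set x | `|x - x0| <= r] = closed_ball x0 r.
  by rewrite closed_ballE //; apply/seteqP; split => x; rewrite /closed_ball_ /= distrC.
apply: bounded_closed_compact; last exact: closed_ball_closed.
exists (`|x0| + r); split; first exact: num_real.
move=> M rM x; rewrite closed_ballE // /closed_ball_ /= => xr.
have := ler_normD (x - x0) x0; rewrite subrK distrC => h.
by apply: (le_trans h); apply: le_trans (ltW rM); rewrite addrC lerD2l.
Qed.

Lemma vanishing_bounded m (f : 'rV[R]_m -> R) (r : R) : continuous f ->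
  (forall x, r <= `|x| -> f x = 0) -> exists2 B, 0 <= B & forall x, `|f x| <= B.
Proof.
move=> cf f0; pose s := Num.max r 1.
have s0 : 0 < s by rewrite lt_max ltr01 orbT.
have cA : compact [set x : 'rV[R]_m | `|x| <= s].
  have -> : [set x : 'rV[R]_m | `|x| <= s] = [set x | `|x - 0| <= s].
    by apply/seteqP; split => x /=; rewrite subr0.
  exact: closed_ball_compact.
have A0 : [set x : 'rV[R]_m | `|x| <= s] !=set0 by exists 0; rewrite /= normr0 ltW.
have cn : {within [set x : 'rV[R]_m | `|x| <= s], continuous (fun x => `|f x|)}.
  apply: continuous_subspaceT => x; apply: (@continuous_comp _ _ _ f (fun y : R => `|y|)).
    exact: cf.
  exact: norm_continuous.
have [c _ cP] := EVT_max_rV A0 cA cn; exists `|f c| => // x.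
have [xs|xs] := leP `|x| s; first by apply: cP; rewrite inE.
by rewrite f0 ?normr0 // ltW // (le_lt_trans _ xs) // le_max lexx.
Qed.

(** Smooth with compact support: the field and its derivatives are then globally bounded, and its
    flow exists for all times. *)
Definition compact_field N (g : 'rV[R]_N -> 'rV[R]_N) :=
  smooth_map_on setT g /\ exists r, forall x, r <= `|x| -> g x = 0.

Lemma derive_vanishing m (f : 'rV[R]_m -> R) (r : R) v :
  (forall x, r <= `|x| -> f x = 0) -> forall x, r + 1 <= `|x| -> 'D_v f x = 0.
Proof.
move=> f0 x xr.
have E : \forall y \near x, f y = cst 0 y.
  apply/nbhs_ballP; exists 1 => //= y; rewrite -ball_normE /ball_ /= => xy.
  apply: f0; have := ler_normD (x - y) y; rewrite subrK; lra.
by rewrite (near_eq_derive _ E) derive_cst.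
Qed.

Lemma compact_field_bounds N (g : 'rV[R]_N -> 'rV[R]_N) : compact_field g ->
  exists2 K, 0 < K & [/\ forall x, `|g x| <= K,
    forall x v, `|'D_v g x| <= K * `|v|, forall x y, `|g x - g y| <= K * `|x - y| &
    forall x v, `|g (x + v) - g x - 'D_v g x| <= K * `|v| ^+ 2].
Proof.
move=> [sg [r gr]].
have oT := @openT 'rV[R]_N.
have dg x : differentiable g x by exact: smooth_map_differentiable oT sg _.
have vj j x : r <= `|x| -> g x 0 j = 0 by move=> /gr ->; rewrite mxE.
have /choice [B0 B0P] : forall j, exists B : R, 0 <= B /\ forall x, `|g x 0 j| <= B.
  move=> j; have [|B b0 bP] := @vanishing_bounded _ (fun x => g x 0 j) r _ (vj j).
    by move=> x; exact: smooth_continuous (sg j) _.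
  by exists B.
have s1 i j : smooth_on setT (fun x => 'D_'e_i (fun y => g y 0 j) x).
  by apply: smooth_derive.
have v1 i j x : r + 1 <= `|x| -> 'D_'e_i (fun y => g y 0 j) x = 0.
  exact: derive_vanishing (vj j) x.
have /choice [B1 B1P] : forall ij : 'I_N * 'I_N, exists B : R, 0 <= B /\
    forall x, `|'D_'e_ij.1 (fun y => g y 0 ij.2) x| <= B.
  move=> [i j].
  have [|B b0 bP] := @vanishing_bounded _ (fun x => 'D_'e_i (fun y => g y 0 j) x) (r + 1) _ (v1 i j).
    by move=> x; exact: smooth_continuous (s1 i j) _.
  by exists B.
have /choice [B2 B2P] : forall q : 'I_N * 'I_N * 'I_N, exists B : R, 0 <= B /\
    forall x, `|'D_'e_q.2 (fun x => 'D_'e_q.1.1 (fun y => g y 0 q.1.2) x) x| <= B.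
  move=> [[i j] l].
  have [|B b0 bP] := @vanishing_bounded _ (fun x => 'D_'e_l (fun x => 'D_'e_i (fun y => g y 0 j) x) x)
    (r + 1 + 1) _ (derive_vanishing 'e_l (v1 i j)).
    by move=> x; exact: smooth_continuous (smooth_derive _ oT (s1 i j)) _.
  by exists B.
pose M : R := \sum_j B0 j + \sum_q B1 q + \sum_q B2 q.
have S0 : 0 <= \sum_j B0 j by apply: sumr_ge0 => j _; have [] := B0P j.
have S1 : 0 <= \sum_q B1 q by apply: sumr_ge0 => j _; have [] := B1P j.
have S2 : 0 <= \sum_q B2 q by apply: sumr_ge0 => j _; have [] := B2P j.
have M0 j : B0 j <= M.
  have : B0 j <= \sum_j B0 j.
    by rewrite (bigD1 j) //= lerDl; apply: sumr_ge0 => i _; have [] := B0P i.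
  by rewrite /M; lra.
have M1 q : B1 q <= M.
  have : B1 q <= \sum_q B1 q.
    by rewrite (bigD1 q) //= lerDl; apply: sumr_ge0 => i _; have [] := B1P i.
  by rewrite /M; lra.
have M2 q : B2 q <= M.
  have : B2 q <= \sum_q B2 q.
    by rewrite (bigD1 q) //= lerDl; apply: sumr_ge0 => i _; have [] := B2P i.
  by rewrite /M; lra.
have M00 : 0 <= M by rewrite /M; lra.
have n0 : 0 <= N%:R :> R by [].
have lin (f : 'rV[R]_N -> R) x v C : differentiable f x ->
    (forall i, `|'D_'e_i f x| <= C) -> `|'D_v f x| <= N%:R * C * `|v|.
  move=> df fC; rewrite derive_basis //.
  apply: le_trans (ler_norm_sum _ _ _) _.
  apply: (@le_trans _ _ (\sum_(i < N) C * `|v|)); last first.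
    by rewrite sumr_const card_ord -[leLHS]mulr_natl mulrA.
  by apply: ler_sum => i _; rewrite normrZ mulrC ler_pM // normr_row.
have lipf (f : 'rV[R]_N -> R) x v C : smooth_on setT f -> 0 <= C ->
    (forall i y, `|'D_'e_i f y| <= C) -> `|f (x + v) - f x| <= N%:R * C * `|v|.
  move=> sf C0 fC; have df y : differentiable f y by exact: smooth_differentiable oT sf _.
  have [t _|t _ ->] := @mvt_line _ _ f x v; first exact: diff_derivable.
  by apply: lin.
have dgj x j : differentiable (fun y => g y 0 j) x by exact: smooth_differentiable oT (sg j) _.
have DE x v j : ('D_v g x) 0 j = 'D_v (fun y => g y 0 j) x.
  exact: derive_map_rowE oT sg _.
(* M bounds the components and their partial derivatives up to order 2. A directional derivative or
   a Lipschitz estimate costs a factor N, the Taylor remainder a factor N^2. *)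
pose K := M + N%:R * M + N%:R * (N%:R * M) + 1.
have NM : 0 <= N%:R * M by rewrite mulr_ge0.
have NNM : 0 <= N%:R * (N%:R * M) by rewrite mulr_ge0.
have K0 : 0 < K by rewrite /K; lra.
have KM : M <= K by rewrite /K; lra.
have KNM : N%:R * M <= K by rewrite /K; lra.
have KNNM : N%:R * (N%:R * M) <= K by rewrite /K; lra.
have Db x v j : `|'D_v (fun y => g y 0 j) x| <= N%:R * M * `|v|.
  by apply: lin => // i; have [_ h] := B1P (i, j); exact: le_trans (h x) (M1 _).
exists K => //; split.
- move=> x; apply: normr_row_le => [|j]; first exact: ltW.
  by have [_ h] := B0P j; apply: le_trans (h x) (le_trans (M0 j) KM).
- move=> x v; apply: normr_row_le => [|j]; first by rewrite mulr_ge0 // ltW.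
  by rewrite DE; apply: le_trans (Db _ _ _) _; rewrite ler_wpM2r.
- move=> x y; apply: normr_row_le => [|j]; first by rewrite mulr_ge0 // ltW.
  rewrite !mxE; have := lipf (fun z => g z 0 j) y (x - y) M (sg j) M00.
  rewrite [y + _]addrC subrK => h; apply: le_trans (h _) _; last by rewrite ler_wpM2r.
  by move=> i z; have [_ q] := B1P (i, j); exact: le_trans (q z) (M1 _).
- move=> x v; apply: normr_row_le => [|j]; first by rewrite mulr_ge0 ?exprn_ge0 // ltW.
  pose f := fun z => g z 0 j.
  have -> : (g (x + v) - g x - 'D_v g x) 0 j = f (x + v) - f x - 'D_v f x.
    by rewrite -DE !mxE.
  have [t _|t /andP[t0 t1]] := @mvt_line _ _ f x v; first by apply: diff_derivable; exact: dgj.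
  move=> fE.
  have -> : f (x + v) - f x - 'D_v f x = 'D_v f (x + t *: v) - 'D_v f x by rewrite -fE.
  rewrite (derive_basis _ (dgj _ j)) (derive_basis v (dgj x j)) -sumrB.
  apply: le_trans (ler_norm_sum _ _ _) _.
  apply: (@le_trans _ _ (\sum_(i < N) N%:R * M * `|v| ^+ 2)); last first.
    by rewrite sumr_const card_ord -[leLHS]mulr_natl mulrA ler_wpM2r // exprn_ge0.
  apply: ler_sum => i _; rewrite -scalerBr normrZ expr2 mulrA mulrC.
  apply: ler_pM => //; last exact: normr_row.
  have h := lipf _ x (t *: v) M (s1 i j) M00.
  apply: le_trans (h _) _.
    by move=> l z; have [_ q] := B2P (i, j, l); exact: le_trans (q z) (M2 _).
  by rewrite ler_wpM2l // normrZ (ger0_norm t0) ler_piMl.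
Qed.

Lemma flow_exists N (g : 'rV[R]_N -> 'rV[R]_N) : compact_field g ->
  exists phi : R -> 'rV[R]_N -> 'rV[R]_N, forall x, integral_curve g x (phi^~ x).
Proof.
move=> cg; have [K K0 [_ _ lip _]] := compact_field_bounds cg.
have [c cP] := choice (picard K0 lip).
by exists (fun t x => c x t).
Qed.

(* The error r = phi_t (x + h v) - phi_t x - h V satisfies
   |r'| <= K |r| + O(h^2), hence r = O(h^2) by Gronwall's inequality. *)
Lemma flow_derive N (g : 'rV[R]_N -> 'rV[R]_N) phi x v (V : R -> 'rV[R]_N) T t :
  compact_field g -> (forall x, integral_curve g x (phi^~ x)) ->
  V 0 = v ->
  (forall (s : R) j, `|s| <= T -> is_derive s 1 (fun r => V r 0 j) (('D_(V s) g (phi s x)) 0 j)) ->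
  `|t| <= T -> is_derive x v (phi t) (V t).
Proof.
move=> cg flow V0 dV tT.
have [K K0 [_ gD lip taylor]] := compact_field_bounds cg.
have oT := @openT 'rV[R]_N.
have dg y : differentiable g y by exact: smooth_map_differentiable oT cg.1 _.
pose E := expR (2 * N%:R * (K + 1) * T).
have E0 : 0 <= E by exact: expR_ge0.
pose C := K * (N%:R * `|v| ^+ 2 * E).
have C0 : 0 <= C by rewrite /C !mulr_ge0 ?exprn_ge0 // ltW.
have est h : `|phi t (h *: v + x) - phi t x - h *: V t| ^+ 2 <= (C * h ^+ 2) ^+ 2 * E.
  pose y := h *: v + x; pose u s := phi s y - phi s x - h *: V s.
  pose u' s := g (phi s y) - g (phi s x) - h *: 'D_(V s) g (phi s x).
  have [y0 dy] := flow y; have [x0 dx] := flow x.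
  have du (s : R) j : `|s| <= T -> is_derive s 1 (fun r => u r 0 j) (u' s 0 j).
    move=> sT.
    have -> : (fun r => u r 0 j) = (fun r => phi r y 0 j) - (fun r => phi r x 0 j)
        - h *: (fun r => V r 0 j).
      by apply/funext => r; rewrite /u !mxE.
    rewrite /u' !mxE.
    exact: (is_deriveB (is_deriveB (dy s j) (dx s j)) (is_deriveZ h (dV s j sT))).
  have yx s : `|s| <= T -> `|phi s y - phi s x| ^+ 2 <= N%:R * (h ^+ 2 * `|v| ^+ 2) * E.
    move=> sT; have := integral_curve_lip K0 lip (flow y) (flow x) sT.
    by rewrite /y addrK normrZ exprMn real_normK ?num_real.
  have ub (s : R) : `|s| <= T -> `|u' s| <= K * `|u s| + C * h ^+ 2.
    move=> sT; pose w := phi s y - phi s x.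
    have -> : u' s = 'D_(u s) g (phi s x) + (g (phi s x + w) - g (phi s x) - 'D_w g (phi s x)).
      rewrite /u' {1}/u deriveDv // -/w deriveNv // deriveZv // /w [phi s x + _]addrC subrK.
      by rewrite [RHS]addrC addrA subrK.
    apply: le_trans (ler_normD _ _) _; apply: lerD; first exact: gD.
    apply: le_trans (taylor _ _) _; rewrite /C -!mulrA ler_pM2l //.
    by apply: le_trans (yx s sT) _; rewrite le_eqVlt; apply/orP; left; apply/eqP; ring.
  have e0 : 0 <= C * h ^+ 2 by rewrite mulr_ge0 // sqr_ge0.
  have := gronwall (ltW K0) e0 du ub tT.
  by rewrite {2}/u y0 x0 V0 /y addrK subrr normr0 expr0n mulr0 add0r.
have cv : (fun h : R => h^-1 *: ((phi t \o shift x) (h *: v) - phi t x)) @ 0^' --> V t.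
  apply/cvgrPdist_le => e e0.
  pose D := C * (E + 1) + 1.
  have D0 : 0 < D by rewrite /D ltr_wpDl // mulr_ge0 // addr_ge0.
  near=> h.
  have h0 : h != 0 by near: h; exact: nbhs_dnbhs_neq.
  have he : `|h| <= e / D by near: h; apply: dnbhs0_le; rewrite divr_gt0.
  have -> : V t - h^-1 *: ((phi t \o shift x) (h *: v) - phi t x) =
      - h^-1 *: (phi t (h *: v + x) - phi t x - h *: V t).
    by rewrite [RHS]scalerBr !scaleNr opprK [X in _ = _ + X]scalerA mulVf // scale1r addrC.
  rewrite normrZ normrN normfV ler_pdivrMl ?normr_gt0 //.
  have h2 : `|phi t (h *: v + x) - phi t x - h *: V t| <= C * h ^+ 2 * (E + 1).
    have A0 : 0 <= C * h ^+ 2 * (E + 1).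
      by apply: mulr_ge0; [apply: mulr_ge0 => //; exact: sqr_ge0|exact: addr_ge0].
    rewrite -ler_sqr ?nnegrE //.
    apply: le_trans (est h) _; rewrite [leRHS]exprMn; apply: ler_wpM2l; first exact: sqr_ge0.
    by rewrite sqrrD expr1n mulr1; have := sqr_ge0 E; lra.
  apply: (le_trans h2); rewrite -(real_normK (num_real h)) expr2.
  move: he; rewrite ler_pdivlMr // => he.
  have : `|h| * (`|h| * D) <= `|h| * e by rewrite ler_wpM2l.
  apply: le_trans; rewrite /D.
  by have := normr_ge0 h; nra.
by split; [apply/cvg_ex; exists (V t)|exact: cvg_lim cv].
Unshelve. all: by end_near.
Qed.

End flow.

Section flow_smooth.
Variable R : realType.
Implicit Types (m n k N : nat).

Lemma normr_lsubmx m n (z : 'rV[R]_(m + n)) : `|lsubmx z| <= `|z|.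
Proof. by apply: normr_row_le => // i; rewrite mxE normr_row. Qed.

Lemma normr_rsubmx m n (z : 'rV[R]_(m + n)) : `|rsubmx z| <= `|z|.
Proof. by apply: normr_row_le => // i; rewrite mxE normr_row. Qed.

Lemma normr_row_mx m n (z : 'rV[R]_(m + n)) r : `|lsubmx z| <= r -> `|rsubmx z| <= r ->
  `|z| <= r.
Proof.
move=> lr rr; apply: normr_row_le => [|j]; first exact: le_trans (normr_ge0 _) lr.
case: (split_ordP j) => i ->.
  by apply: le_trans lr; have := normr_row (lsubmx z) i; rewrite mxE.
by apply: le_trans rr; have := normr_row (rsubmx z) i; rewrite mxE.
Qed.

Lemma le1Dsqr (a b : R) : a ^+ 2 <= b -> a <= 1 + b.
Proof. by move=> ab; have := sqr_ge0 (a - 1); nra. Qed.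

(* The cut-off of the tangent field (x, v) |-> (g x, Dg(x) v) is again compactly
   supported, and by a priori bounds its curves do not meet the cut-off region. *)
Lemma tangent_field N (g : 'rV[R]_N -> 'rV[R]_N) (T rho : R) : compact_field g ->
  0 <= T -> 0 <= rho ->
  exists2 gt : 'rV[R]_(N + N) -> 'rV[R]_(N + N), compact_field gt &
  forall phi zeta x v, (forall x, integral_curve g x (phi^~ x)) ->
    `|x| <= rho -> `|v| <= rho -> integral_curve gt (row_mx x v) zeta ->
    forall s : R, `|s| <= T -> lsubmx (zeta s) = phi s x /\
      forall j, is_derive s 1 (fun r => rsubmx (zeta r) 0 j)
        (('D_(rsubmx (zeta s)) g (phi s x)) 0 j).
Proof.
move=> cg T0 rho0.
have [K K0 [gK gD lip _]] := compact_field_bounds cg.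
have oT m := @openT 'rV[R]_m.
have dg y : differentiable g y by exact: smooth_map_differentiable (oT N) cg.1 _.
pose E := expR (2 * N%:R * (K + 1) * T).
have E0 : 0 < E by exact: expR_gt0.
(* A priori bounds up to time T: the base point moves by at most K T, and Gronwall bounds the square
   of the tangent vector by N rho^2 E. Hence the curve stays where the cut-off equals 1. *)
pose r := 1 + rho + K * T + N%:R * rho ^+ 2 * E.
have KT : 0 <= K * T by rewrite mulr_ge0 // ltW.
have NE : 0 <= N%:R * rho ^+ 2 * E by rewrite !mulr_ge0 ?exprn_ge0 // ltW.
have r0 : 0 < r by rewrite /r; lra.
have [chi [schi chi01 chi1 chi0]] := cutoff (0 : 'rV[R]_(N + N)) r0.
pose h (z : 'rV[R]_(N + N)) : 'rV[R]_(N + N) :=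
  row_mx (g (lsubmx z)) ('D_(rsubmx z) g (lsubmx z)).
have sl : smooth_map_on setT (fun z : 'rV[R]_(N + N) => lsubmx z).
  exact: smooth_map_lsubmx (smooth_map_id _).
have sh : smooth_map_on setT h.
  apply: smooth_map_row_mx; first exact: (smooth_map_comp (oT _) (oT _) _ sl cg.1).
  have -> : (fun z : 'rV[R]_(N + N) => 'D_(rsubmx z) g (lsubmx z)) =
      (fun z => \sum_i rsubmx z 0 i *: 'D_'e_i g (lsubmx z)).
    by apply/funext => z; rewrite derive_basis.
  apply: smooth_map_sum; first exact: oT.
  move=> i; apply: smooth_mapZ; first exact: oT.
    exact: (smooth_map_rsubmx (smooth_map_id _)).
  exact: (smooth_map_comp (oT _) (oT _) _ sl (smooth_map_derive 'e_i (oT N) cg.1)).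
pose gt z := chi z *: h z.
exists gt.
  split; first by apply: smooth_mapZ; first exact: oT.
  by exists (2 * r) => z zr; rewrite /gt chi0 ?scale0r // subr0.
move=> phi zeta x v flow xr vr [z0 dz].
have dl (s : R) j : is_derive s 1 (fun q => lsubmx (zeta q) 0 j)
    ((chi (zeta s) *: g (lsubmx (zeta s))) 0 j).
  have -> : (fun q => lsubmx (zeta q) 0 j) = (fun q => zeta q 0 (lshift N j)).
    by apply/funext => q; rewrite mxE.
  by apply: (@is_derive_eq _ _ _ _ _ _ _ _ (dz s _)); rewrite /gt [LHS]mxE /h row_mxEl [RHS]mxE.
have dr (s : R) j : is_derive s 1 (fun q => rsubmx (zeta q) 0 j)
    ((chi (zeta s) *: 'D_(rsubmx (zeta s)) g (lsubmx (zeta s))) 0 j).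
  have -> : (fun q => rsubmx (zeta q) 0 j) = (fun q => zeta q 0 (rshift N j)).
    by apply/funext => q; rewrite mxE.
  by apply: (@is_derive_eq _ _ _ _ _ _ _ _ (dz s _)); rewrite /gt [LHS]mxE /h row_mxEr [RHS]mxE.
have chin z (w : 'rV[R]_N) : `|chi z *: w| <= `|w|.
  by rewrite normrZ; have /andP[c0 c1] := chi01 z; rewrite ger0_norm // ler_piMl.
have zl0 : lsubmx (zeta 0) = x by rewrite z0 row_mxKl.
have zr0 : rsubmx (zeta 0) = v by rewrite z0 row_mxKr.
have bl s : `|s| <= T -> `|lsubmx (zeta s)| <= r.
  move=> sT.
  have dG (q : R) : `|q| <= T -> is_derive q 1 (fun q => K * q) K.
    move=> _; apply: (@is_derive_eq _ _ _ (cst K * id) q 1 _ _ (is_deriveM _ _)).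
    by rewrite scaler0 addr0 /GRing.scale /= mulr1.
  have fg (q : R) : `|q| <= T -> `|chi (zeta q) *: g (lsubmx (zeta q))| <= K.
    by move=> _; apply: le_trans (chin _ _) (gK _).
  have := derive_row_cmp (fun q j _ => dl q j) dG fg sT.
  rewrite mulr0 subr0 zl0 normrM (gtr0_norm K0) => d1.
  have d2 : K * `|s| <= K * T by rewrite ler_pM2l.
  have := ler_normD (lsubmx (zeta s) - x) x; rewrite subrK => d3.
  by rewrite /r; apply: (le_trans d3); lra.
have br s : `|s| <= T -> `|rsubmx (zeta s)| <= r.
  move=> sT.
  have ub (q : R) : `|q| <= T -> `|chi (zeta q) *: 'D_(rsubmx (zeta q)) g (lsubmx (zeta q))| <=
      K * `|rsubmx (zeta q)| + 0.
    by move=> _; rewrite addr0; apply: le_trans (chin _ _) (gD _ _).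
  have := gronwall (ltW K0) (lexx 0) (fun q j _ => dr q j) ub sT.
  rewrite expr0n addr0 zr0 -/E => /le1Dsqr h1; apply: (le_trans h1).
  have : N%:R * `|v| ^+ 2 * E <= N%:R * rho ^+ 2 * E.
    by rewrite ler_pM2r // ler_wpM2l // lerXn2r ?nnegrE.
  by rewrite /r; lra.
have c1 s : `|s| <= T -> chi (zeta s) = 1.
  by move=> sT; apply: chi1; rewrite subr0; apply: normr_row_mx; [exact: bl|exact: br].
move=> s sT.
have eqphi q : `|q| <= T -> lsubmx (zeta q) = phi q x.
  move=> qT; have [p0 dp] := flow x.
  apply: (integral_curve_uniq K0 lip (x := x) (T := T) (cx := fun q => lsubmx (zeta q)) (cy := phi^~ x)) => //.
  by move=> q' j q'T; have := dl q' j; rewrite c1 // scale1r.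
split; first exact: eqphi.
by move=> j; have := dr s j; rewrite c1 // scale1r eqphi.
Qed.

(** Induction on k for all dimensions together: the derivative of the flow along e_i is a block of
    the flow of [tangent_field] in dimension N + N, to which the induction hypothesis applies. The
    cut-off of that field depends on the size of the initial point, so the argument runs on balls
    exhausting the space. *)
Lemma Ck_flow k N (g : 'rV[R]_N -> 'rV[R]_N) phi (t : R) j :
  compact_field g -> (forall x, integral_curve g x (phi^~ x)) ->
  Ck k setT (fun x => phi t x 0 j).
Proof.
elim: k N g phi j => [|k IH] N g phi j cg flow.
  split => // x _.
  have [K K0 [_ _ lip _]] := compact_field_bounds cg.
  pose C := 1 + N%:R * expR (2 * N%:R * (K + 1) * `|t|).
  have C0 : 0 < C by rewrite /C ltr_pwDl // mulr_ge0 // expR_ge0.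
  apply/(@cvgrPdist_le R _ _ (nbhs x)) => e e0; near=> y.
  have := integral_curve_lip K0 lip (flow x) (flow y) (lexx `|t|).
  have xy : `|x - y| <= e / C.
    near: y; apply/nbhs_ballP; exists (e / C) => /=; first by rewrite divr_gt0.
    by move=> y; rewrite -ball_normE /ball_ /= => /ltW.
  move=> h; have h1 := normr_row (phi t x - phi t y) j; rewrite !mxE in h1.
  apply: (le_trans h1); have en := ltW e0; rewrite -ler_sqr ?nnegrE //; apply: (le_trans h).
  rewrite mulrAC; move: xy; rewrite ler_pdivlMr // => xy.
  have : (`|x - y| * C) ^+ 2 <= e ^+ 2 by rewrite ler_sqr ?nnegrE ?mulr_ge0 // ?ltW.
  apply: le_trans; rewrite exprMn mulrC; apply: ler_wpM2l; first exact: sqr_ge0.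
  rewrite /C sqrrD expr1n mul1r; set D := N%:R * _.
  have D0 : 0 <= D by rewrite mulr_ge0 // expR_ge0.
  by have := sqr_ge0 D; lra.
have cover : \bigcup_(n : nat) [set x : 'rV[R]_N | `|x| < n%:R] = setT.
  apply/seteqP; split => // x _; exists (Num.truncn `|x|).+1 => //=.
  exact: truncnS_gt.
rewrite -cover; apply: Ck_bigcup => n.
set A := [set x : 'rV[R]_N | `|x| < n%:R].
have oA : open A.
  have -> : A = (fun x : 'rV[R]_N => `|x|) @^-1` [set y : R | y < n%:R] by [].
  move: (@norm_continuous R 'rV[R]_N) => /continuousP; apply; exact: open_lt.
have Cphi : Ck k A (fun x => phi t x 0 j) by apply: Ck_sub (IH _ _ _ _ cg flow).
split; first by move=> x Ax; exact: (Ck_continuous Cphi).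
move=> i.
have n0 : 0 <= n.+1%:R :> R by [].
have [gt cgt gtP] := tangent_field cg (normr_ge0 t) n0.
have [zeta zP] := flow_exists cgt.
have ei : `|'e_i : 'rV[R]_N| <= n.+1%:R.
  apply: normr_row_le => // l; rewrite mxE /=.
  by rewrite normr_nat ler_nat (leq_trans (leq_b1 _)).
have D x : A x -> is_derive x 'e_i (phi t) (rsubmx (zeta t (row_mx x 'e_i))).
  move=> Ax; have xn : `|x| <= n.+1%:R.
    by apply: ltW; apply: lt_trans Ax _; rewrite ltr_nat.
  have h := gtP _ _ _ _ flow xn ei (zP (row_mx x 'e_i)).
  apply: (flow_derive (T := `|t|) (V := fun s => rsubmx (zeta s (row_mx x 'e_i))) cg flow) => //.
    by have [-> _] := zP (row_mx x 'e_i); rewrite row_mxKr.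
  by move=> s l sT; have [_] := h s sT; apply.
split.
  by move=> x Ax; have [/derivable_rowP d _] := D x Ax; exact: d.
apply: (@Ck_ext _ _ _ _ ((fun z => zeta t z 0 (rshift N j)) \o (fun x => row_mx x 'e_i))) => //.
  move=> x Ax; have [dx E] := D x Ax.
  by rewrite /= -(derive_rowE j dx) E mxE.
have srow : smooth_map_on A (fun x => row_mx x ('e_i : 'rV[R]_N)).
  by apply: smooth_map_row_mx; [exact: smooth_map_id|exact: smooth_map_cst].
apply: (Ck_comp oA (@openT _)) => //; last exact: IH _ _ _ _ cgt zP.
by move=> l; exact: srow.
Unshelve. all: by end_near.
Qed.

Lemma flow_smooth N (g : 'rV[R]_N -> 'rV[R]_N) phi (t : R) :
  compact_field g -> (forall x, integral_curve g x (phi^~ x)) ->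
  smooth_map_on setT (phi t).
Proof. by move=> cg flow j k; exact: Ck_flow cg flow. Qed.

Lemma flow_variation N (g : 'rV[R]_N -> 'rV[R]_N) phi (T : R) x v :
  compact_field g -> (forall x, integral_curve g x (phi^~ x)) -> 0 <= T ->
  exists2 V : R -> 'rV[R]_N, V 0 = v &
    forall s : R, `|s| <= T -> is_derive x v (phi s) (V s) /\
     forall j, is_derive s 1 (fun r => V r 0 j) (('D_(V s) g (phi s x)) 0 j).
Proof.
move=> cg flow T0; pose rho := `|x| + `|v|.
have rho0 : 0 <= rho by rewrite addr_ge0.
have [gt cgt gtP] := tangent_field cg T0 rho0.
have [zeta zP] := flow_exists cgt.
have xr : `|x| <= rho by rewrite lerDl.
have vr : `|v| <= rho by rewrite lerDr.
have h := gtP _ _ _ _ flow xr vr (zP (row_mx x v)).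
have V0 : rsubmx (zeta 0 (row_mx x v)) = v by have [-> _] := zP (row_mx x v); rewrite row_mxKr.
exists (fun s => rsubmx (zeta s (row_mx x v))) => // s sT.
split; last by have [_] := h s sT.
apply: (flow_derive (T := T) (V := fun s => rsubmx (zeta s (row_mx x v))) cg flow) => //.
by move=> q l qT; have [_] := h q qT; apply.
Qed.

End flow_smooth.

Section local.
Variable R : realType.
Implicit Types (m n k N : nat).

Lemma subrowE m (u v : 'rV[R]_m) j : (u - v) 0 j = u 0 j - v 0 j.
Proof. by rewrite !mxE. Qed.

Lemma open_ball_norm m (x0 : 'rV[R]_m) (r : R) : open [set x | `|x - x0| < r].
Proof.
have -> : [set x | `|x - x0| < r] = ball x0 r.
  by apply/seteqP; split => x; rewrite -ball_normE /ball_ /= distrC.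
exact: ball_open.
Qed.

Lemma near_open_map m (T : Type) (A : set 'rV[R]_m) (f g : 'rV[R]_m -> T) x : open A ->
  A x -> (forall y, A y -> f y = g y) -> \forall y \near x, f y = g y.
Proof.
move=> oA Ax fg; have nA : nbhs x A by apply: open_nbhs_nbhs.
by apply: filterS nA => y /fg.
Qed.

(** A and the complement of the closed ball cover the space, and on the latter the product is zero
    whatever F is there. *)
Lemma smooth_extend m n (A : set 'rV[R]_m) chi (F : 'rV[R]_m -> 'rV[R]_n) x0 (r : R) :
  open A -> [set x | `|x - x0| <= r] `<=` A ->
  smooth_on setT chi -> (forall x, r <= `|x - x0| -> chi x = 0) ->
  smooth_map_on A F -> smooth_map_on setT (fun x => chi x *: F x).
Proof.
move=> oA rA schi chi0 sF j k.
pose B := [set x : 'rV[R]_m | r < `|x - x0|].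
have oB : open B.
  have -> : B = (fun x => `|x - x0|) @^-1` [set y : R | r < y] by [].
  have : continuous (fun x : 'rV[R]_m => `|x - x0|).
    move=> x; have h : {for x, continuous (fun y : 'rV[R]_m => y - x0)}.
      by apply: continuousB; [exact: cvg_id|exact: cst_continuous].
    exact: (cvg_norm h).
  by move=> /continuousP; apply; exact: open_gt.
have -> : setT = A `|` B.
  apply/seteqP; split => // x _; have [h|h] := leP `|x - x0| r; [left|right] => //.
  exact: rA.
apply: Ck_union.
  have h : smooth_map_on A (fun x => chi x *: F x).
    by apply: smooth_mapZ => //; exact: smooth_sub schi.
  exact: h.
apply: Ck_ext (Ck_cst k B 0) => // x /ltW /chi0 ->.
by rewrite scale0r mxE.
Qed.

Lemma ball_in_open m (A : set 'rV[R]_m) x0 : open A -> A x0 ->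
  exists2 r : R, 0 < r & [set x | `|x - x0| <= 2 * r] `<=` A.
Proof.
move=> oA Ax; have : nbhs x0 A by apply: open_nbhs_nbhs.
move=> /nbhs_ballP [d /= d0 dA]; exists (d / 3); first by rewrite divr_gt0.
move=> x /= xd; apply: dA; rewrite -ball_normE /ball_ /= distrC.
by apply: (le_lt_trans xd); lra.
Qed.

Lemma is_derive_const (F : R -> R) (T t : R) :
  (forall s : R, `|s| <= T -> is_derive s 1 F 0) -> `|t| <= T -> F t = F 0.
Proof.
move=> dF tT.
have d0 (s : R) : `|s| <= T -> is_derive s 1 (cst (0 : R)) (0 : R) by move=> _; exact: is_derive_cst.
have h (s : R) : `|s| <= T -> `|0 : R| <= 0 by move=> _; rewrite normr0.
have := derive_cmp dF d0 h tT; rewrite /= subrr normr0 normr_le0 subr_eq0.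
by move/eqP.
Qed.

Lemma is_derive_rowP n (F : R -> 'rV[R]_n) (t : R) v :
  is_derive t 1 F v <-> forall j, is_derive t 1 (fun s => F s 0 j) (v 0 j).
Proof.
split=> [[dF <-] j|h].
  by rewrite derive_rowE //; apply: derivableP; move/derivable_rowP: dF.
have dF : derivable F t 1 by apply/derivable_rowP => j; have [] := h j.
split=> //; apply/rowP => j; rewrite derive_rowE //.
by have [] := h j.
Qed.

Lemma is_derive_coord m (x v : 'rV[R]_m) j :
  is_derive x v (fun y : 'rV[R]_m => y 0 j) (v 0 j).
Proof.
have dx : derivable (id : 'rV[R]_m -> 'rV[R]_m) x v by exact: derivable_id.
split; first by move/derivable_rowP: dx; exact.
by rewrite -(derive_rowE j dx) derive_id.
Qed.

Lemma derive_rsubmx (V : normedModType R) m n (F : V -> 'rV[R]_(m + n)) x v :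
  derivable F x v -> 'D_v (fun z => rsubmx (F z)) x = rsubmx ('D_v F x).
Proof.
move=> dF.
have E j : (fun z => rsubmx (F z) 0 j) = (fun z => F z 0 (rshift m j)).
  by apply/funext => z; rewrite mxE.
have d : derivable (fun z => rsubmx (F z)) x v.
  by apply/derivable_rowP => j; rewrite E; move/derivable_rowP: dF; apply.
by apply/rowP => j; rewrite [RHS]mxE (derive_rowE j d) (derive_rowE _ dF) E.
Qed.

Lemma derive_lsubmx (V : normedModType R) m n (F : V -> 'rV[R]_(m + n)) x v :
  derivable F x v -> 'D_v (fun z => lsubmx (F z)) x = lsubmx ('D_v F x).
Proof.
move=> dF.
have E j : (fun z => lsubmx (F z) 0 j) = (fun z => F z 0 (lshift n j)).
  by apply/funext => z; rewrite mxE.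
have d : derivable (fun z => lsubmx (F z)) x v.
  by apply/derivable_rowP => j; rewrite E; move/derivable_rowP: dF; apply.
by apply/rowP => j; rewrite [RHS]mxE (derive_rowE j d) (derive_rowE _ dF) E.
Qed.

End local.

(** * Commuting flows *)

Section commuting.
Variable R : realType.
Implicit Types (m n k N : nat).

(* E(y, x) is the time-1 flow from x of the field sum_a y_a X_a.  Along that
   flow both the derivative of E in the direction u of y and s |-> s sum_a u_a X_a
   satisfy the variational equation, thanks to the commutation of the X_a. *)
Theorem commuting_flow k N (A : set 'rV[R]_N) (p : 'rV[R]_N)
    (X : 'I_k -> 'rV[R]_N -> 'rV[R]_N) :
  open A -> A p -> (forall a, smooth_map_on A (X a)) ->
  (forall a b x, A x -> 'D_(X a x) (X b) x = 'D_(X b x) (X a) x) ->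
  exists (r : R) (E : 'rV[R]_(k + N) -> 'rV[R]_N), [/\ 0 < r,
    smooth_map_on setT E,
    (forall x, E (row_mx 0 x) = x),
    (forall z, `|z - row_mx 0 p| < r -> A (E z)) &
    forall z u, `|z - row_mx 0 p| < r ->
      'D_(row_mx u 0) E z = \sum_a u 0 a *: X a (E z)].
Proof.
move=> oA Ap sX comm.
have oT m := @openT 'rV[R]_m.
have [rho rho0 rhoA] := ball_in_open oA Ap.
pose z0 : 'rV[R]_(k + N) := row_mx 0 p.
have [chi [schi chi01 chi1 chi0]] := cutoff z0 rho0.
pose B : set 'rV[R]_(k + N) := rsubmx @^-1` A.
have oB : open B by have /continuousP := @continuous_rsubmx R 1 k N; apply.
have rz (z : 'rV[R]_(k + N)) : rsubmx (z - z0) = rsubmx z - p.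
  by rewrite linearB /= row_mxKr.
have lz (z : 'rV[R]_(k + N)) : lsubmx (z - z0) = lsubmx z.
  by rewrite linearB /= row_mxKl subr0.
have rhoB : [set z | `|z - z0| <= 2 * rho] `<=` B.
  move=> z zr; apply: rhoA => /=; apply: le_trans zr.
  by rewrite -rz; exact: normr_rsubmx.
have sr : smooth_map_on B (fun z : 'rV[R]_(k + N) => rsubmx z).
  exact: smooth_map_rsubmx (smooth_map_id _).
have sXr a : smooth_map_on B (fun z : 'rV[R]_(k + N) => X a (rsubmx z)).
  exact: (smooth_map_comp oB oA _ sr (sX a)).
(* The parameters y are carried along as constant coordinates: one field comprises all the
   combinations, and smoothness in y becomes smoothness in the initial point. *)
pose h (z : 'rV[R]_(k + N)) : 'rV[R]_(k + N) :=
  row_mx 0 (\sum_a lsubmx z 0 a *: X a (rsubmx z)).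
have sh : smooth_map_on B h.
  apply: smooth_map_row_mx; first exact: smooth_map_cst.
  apply: smooth_map_sum => // a; apply: smooth_mapZ => //.
  exact: (smooth_map_lsubmx (smooth_map_id _)).
pose f z := chi z *: h z.
have far z : `|z0| + 2 * rho <= `|z| -> 2 * rho <= `|z - z0|.
  by move=> zr; have := ler_normD (z - z0) z0; rewrite subrK; lra.
have cf : compact_field f.
  split; first exact: (smooth_extend oB rhoB schi chi0 sh).
  by exists (`|z0| + 2 * rho) => z /far /chi0; rewrite /f => ->; rewrite scale0r.
have [C C0 CP] : exists2 C : R, 0 <= C & forall a z, `|chi z *: X a (rsubmx z)| <= C.
  have /choice [Ca CaP] : forall aj : 'I_k * 'I_N, exists c : R, 0 <= c /\
      forall z, `|(chi z *: X aj.1 (rsubmx z)) 0 aj.2| <= c.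
    move=> [a j] /=; have s := smooth_extend oB rhoB schi chi0 (sXr a).
    have [||c c0 cP] := @vanishing_bounded _ _ (fun z => (chi z *: X a (rsubmx z)) 0 j) (`|z0| + 2 * rho).
    - by move=> z; exact: smooth_continuous (s j) _.
    - by move=> z /far /chi0 ->; rewrite scale0r mxE.
    - by exists c.
  exists (\sum_aj Ca aj); first by apply: sumr_ge0 => aj _; have [] := CaP aj.
  move=> a z; apply: normr_row_le => [|j]; first by apply: sumr_ge0 => aj _; have [] := CaP aj.
  have [_ q] := CaP (a, j); apply: le_trans (q z) _.
  by rewrite (bigD1 (a, j)) //= lerDl; apply: sumr_ge0 => aj _; have [] := CaP aj.
have [phi flow] := flow_exists cf.
(* C bounds the cut-off fields. A curve starting within r moves by at most r k C in unit time, and 2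
   r + r k C = rho, so it stays where the cut-off is 1. *)
pose r : R := rho / (2 + k%:R * C).
have kC : 0 <= k%:R * C by rewrite mulr_ge0.
have d0 : 0 < 2 + k%:R * C by rewrite ltr_wpDr.
have r0 : 0 < r by rewrite divr_gt0.
have rr : r * 2 + r * (k%:R * C) = rho by rewrite -mulrDr /r divfK // lt0r_neq0.
have rkC : 0 <= r * (k%:R * C) by rewrite mulr_ge0 // ltW.
have lphi z s : lsubmx (phi s z) = lsubmx z.
  have [p0 dp] := flow z; apply/rowP => a; rewrite !mxE.
  transitivity (phi 0 z 0 (lshift N a)); last by rewrite p0.
  apply: (@is_derive_const _ (fun s => phi s z 0 (lshift N a)) `|s| s) => // q _.
  by apply: (@is_derive_eq _ _ _ _ _ _ _ _ (dp q _)); rewrite /f mxE /h row_mxEl mxE mulr0.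
have stay z : `|z - z0| < r -> forall s : R, `|s| <= 1 -> `|phi s z - z0| < rho.
  move=> zr s s1; have [p0 dp] := flow z.
  have zl : `|lsubmx z| < r.
    by apply: le_lt_trans zr; rewrite -lz; exact: normr_lsubmx.
  have dr (q : R) j : `|q| <= 1 -> is_derive q 1 (fun q => rsubmx (phi q z) 0 j)
      ((rsubmx (f (phi q z))) 0 j).
    move=> _; have -> : (fun q => rsubmx (phi q z) 0 j) = (fun q => phi q z 0 (rshift k j)).
      by apply/funext => q'; rewrite mxE.
    by apply: (@is_derive_eq _ _ _ _ _ _ _ _ (dp q _)); rewrite [RHS]mxE.
  have dG (q : R) : `|q| <= 1 -> is_derive q 1 (fun q => r * (k%:R * C) * q) (r * (k%:R * C)).
    move=> _; apply: (@is_derive_eq _ _ _ (cst (r * (k%:R * C)) * id) q 1 _ _ (is_deriveM _ _)).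
    by rewrite scaler0 addr0 /GRing.scale /= mulr1.
  have fg (q : R) : `|q| <= 1 -> `|rsubmx (f (phi q z))| <= r * (k%:R * C).
    move=> _; have -> : rsubmx (f (phi q z)) =
        \sum_a lsubmx z 0 a *: (chi (phi q z) *: X a (rsubmx (phi q z))).
      rewrite /f linearZ /= /h row_mxKr scaler_sumr; apply: eq_bigr => a _.
      by rewrite !scalerA mulrC lphi.
    apply: le_trans (ler_norm_sum _ _ _) _.
    apply: (@le_trans _ _ (\sum_(a < k) r * C)).
      apply: ler_sum => a _; rewrite normrZ ler_pM //.
      by apply: le_trans (normr_row _ _) _; exact: ltW.
    by rewrite sumr_const card_ord -[leLHS]mulr_natl mulrCA.
  have := derive_row_cmp dr dG fg s1; rewrite mulr0 subr0 p0 normrM (ger0_norm rkC) => h1.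
  have h2 : r * (k%:R * C) * `|s| <= r * (k%:R * C) by rewrite ler_piMr.
  have h3 : `|rsubmx z - p| < r.
    by apply: le_lt_trans zr; rewrite -rz; exact: normr_rsubmx.
  apply: (@le_lt_trans _ _ (r + r * (k%:R * C))); last by lra.
  apply: normr_row_mx; first by rewrite lz lphi; have := ltW zl; lra.
  rewrite rz; have := ler_normD (rsubmx (phi s z) - rsubmx z) (rsubmx z - p).
  by rewrite subrKA; lra.
have inB z : `|z - z0| < rho -> B z.
  by move=> zr; apply: rhoB => /=; lra.
have Df (z w : 'rV[R]_(k + N)) : `|z - z0| < rho -> 'D_w f z = row_mx 0
   (\sum_a (lsubmx w 0 a *: X a (rsubmx z) + lsubmx z 0 a *: 'D_(rsubmx w) (X a) (rsubmx z))).
  move=> zr; have Bz := inB z zr.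
  have dX a : differentiable (X a) (rsubmx z) by exact: smooth_map_differentiable oA (sX a) _.
  have drs : is_derive z w (fun z : 'rV[R]_(k + N) => rsubmx z) (rsubmx w).
    split; first by apply/derivable_rowP => j; under eq_fun do rewrite mxE;
      have [] := is_derive_coord z w (rshift k j).
    apply/rowP => j; rewrite derive_rowE; last first.
      apply/derivable_rowP => i; under eq_fun do rewrite mxE.
      by have [] := is_derive_coord z w (rshift k i).
    by under eq_fun do rewrite mxE; have [_ ->] := is_derive_coord z w (rshift k j); rewrite mxE.
  have E : \forall y \near z, h y = f y.
    apply: (near_open_map (@open_ball_norm R _ z0 rho) (zr : [set w | `|w - z0| < rho] z)) => y /= yr.
    by rewrite /f chi1 ?scale1r // ltW.
  rewrite -(near_eq_derive _ E); apply/rowP => j.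
  rewrite (derive_map_rowE w j oB sh Bz); case: (split_ordP j) => i ->.
    rewrite row_mxEl mxE (_ : (fun y => h y 0 (lshift N i)) = cst 0) ?derive_cst //.
    by apply/funext => y; rewrite /h row_mxEl mxE.
  rewrite row_mxEr (_ : (fun y => h y 0 (rshift k i)) =
    \sum_a ((fun y : 'rV[R]_(k + N) => lsubmx y 0 a) * (fun y => X a (rsubmx y) 0 i))); last first.
    apply/funext => y; rewrite /h row_mxEr summxE fct_sumE; apply: eq_bigr => a _.
    by rewrite mxE.
  rewrite summxE.
  have dl a : is_derive z w (fun y : 'rV[R]_(k + N) => lsubmx y 0 a) (lsubmx w 0 a).
    have -> : (fun y : 'rV[R]_(k + N) => lsubmx y 0 a) = (fun y => y 0 (lshift N a)).
      by apply/funext => y; rewrite mxE.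
    by rewrite mxE; exact: is_derive_coord.
  have dXr a : is_derive z w (fun y => X a (rsubmx y) 0 i) (('D_(rsubmx w) (X a) (rsubmx z)) 0 i).
    have h1 := is_derive_comp (dX a) (@ex_derive _ _ _ _ _ _ _ drs).
    rewrite (@derive_val _ _ _ _ _ _ _ drs) in h1.
    have [h2 <-] := h1; rewrite derive_rowE //.
    by apply: derivableP; move/derivable_rowP: h2.
  have dsum := is_derive_sum (fun a => is_deriveM (dl a) (dXr a)).
  rewrite (@derive_val _ _ _ _ _ _ _ dsum); apply: eq_bigr => a _.
  by rewrite /GRing.scale /= [RHS]mxE [X in _ = X + _]mxE [X in _ = _ + X]mxE addrC mulrC.
exists r, (fun z => rsubmx (phi 1 z)).
have one1 : `|1 : R| <= 1 by rewrite normr1.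
split => //.
- exact: smooth_map_rsubmx (flow_smooth _ cf flow).
- move=> x; have [p0 dp] := flow (row_mx 0 x).
  have f0 z : lsubmx z = 0 -> f z = 0.
    move=> z00; rewrite /f /h big1 ?row_mx0 ?scaler0 // => a _.
    by rewrite z00 mxE scale0r.
  suff -> : phi 1 (row_mx 0 x) = row_mx 0 x by rewrite row_mxKr.
  apply/rowP => j; rewrite -[RHS](congr1 (fun v : 'rV[R]_(k + N) => v 0 j) p0).
  apply: (@is_derive_const _ (fun s => phi s (row_mx 0 x) 0 j) 1 1) => // s _.
  by apply: (@is_derive_eq _ _ _ _ _ _ _ _ (dp s _)); rewrite f0 ?mxE // lphi row_mxKl.
- by move=> z zr; exact: inB (stay z zr 1 one1).
move=> z u zr; have st s (s1 : `|s| <= 1) := stay z zr s s1.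
have [V V0 VP] := flow_variation z (row_mx u 0) cf flow (@ler01 R).
have [p0 dp] := flow z.
pose xc s := rsubmx (phi s z).
have fphi s : `|s| <= 1 -> f (phi s z) = row_mx 0 (\sum_a lsubmx z 0 a *: X a (xc s)).
  by move=> s1; rewrite /f chi1 ?scale1r /h ?lphi // ltW // st.
have dxc (s : R) : `|s| <= 1 -> is_derive s 1 xc (\sum_a lsubmx z 0 a *: X a (xc s)).
  move=> s1; apply/is_derive_rowP => j.
  have -> : (fun q => xc q 0 j) = (fun q => phi q z 0 (rshift k j)).
    by apply/funext => q; rewrite mxE.
  by apply: (@is_derive_eq _ _ _ _ _ _ _ _ (dp s _)); rewrite fphi // row_mxEr.
have dX s a : `|s| <= 1 -> differentiable (X a) (xc s).
  by move=> s1; apply: (smooth_map_differentiable oA (sX a)); exact: inB (st s s1).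
pose Y s := \sum_a u 0 a *: X a (xc s).
pose Y' s := \sum_a u 0 a *: 'D_(\sum_b lsubmx z 0 b *: X b (xc s)) (X a) (xc s).
have dY (s : R) j : `|s| <= 1 -> is_derive s 1 (fun q => Y q 0 j) (Y' s 0 j).
  move=> s1; have dXc a : is_derive s 1 (fun q => X a (xc q) 0 j)
      (('D_(\sum_b lsubmx z 0 b *: X b (xc s)) (X a) (xc s)) 0 j).
    have d1 := dxc s s1.
    have h1 := is_derive_comp (dX s a s1) (@ex_derive _ _ _ _ _ _ _ d1).
    rewrite (@derive_val _ _ _ _ _ _ _ d1) in h1.
    by move/is_derive_rowP: h1; apply.
  have -> : (fun q => Y q 0 j) = \sum_a (u 0 a *: (fun q => X a (xc q) 0 j)).
    by apply/funext => q; rewrite /Y summxE fct_sumE; apply: eq_bigr => a _; rewrite mxE.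
  rewrite /Y' summxE; have h1 := is_derive_sum (fun a => is_deriveZ (u 0 a) (dXc a)).
  by apply: (@is_derive_eq _ _ _ _ _ _ _ _ h1); apply: eq_bigr => a _; rewrite mxE.
pose zeta s := row_mx u (s *: Y s).
have dzeta (s : R) j : `|s| <= 1 -> is_derive s 1 (fun q => zeta q 0 j) ('D_(zeta s) f (phi s z) 0 j).
  move=> s1; rewrite (Df _ _ (st s s1)); case: (split_ordP j) => i ->.
    rewrite row_mxEl mxE (_ : (fun q => _) = cst (u 0 i)); first exact: is_derive_cst.
    by apply/funext => q; rewrite row_mxEl.
  rewrite row_mxEr (_ : (fun q => _) = id * (fun q => Y q 0 i)); last first.
    by apply/funext => q; rewrite row_mxEr mxE.
  apply: (@is_derive_eq _ _ _ _ _ _ _ _ (is_deriveM (is_derive_id _ _) (dY s i s1))).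
  rewrite /zeta row_mxKl row_mxKr -/(xc s) big_split /= mxE -/(Y s) /GRing.scale /= mulr1 addrC.
  congr (_ + _); rewrite lphi.
  have -> : \sum_a lsubmx z 0 a *: 'D_(s *: Y s) (X a) (xc s) = s *: Y' s.
    rewrite /Y' [RHS]scaler_sumr.
    have ED v w b : 'D_(\sum_(a < k) v a *: w a) (X b) (xc s) = \sum_a v a *: 'D_(w a) (X b) (xc s).
      rewrite deriveE; last exact: dX.
      by rewrite linear_sum; apply: eq_bigr => a _; rewrite linearZ /= deriveE //; exact: dX.
    rewrite [RHS](eq_bigr (fun a => \sum_b (s * u 0 a * lsubmx z 0 b) *:
       'D_(X b (xc s)) (X a) (xc s))); last first.
      move=> a _; rewrite ED scalerA scaler_sumr; apply: eq_bigr => b _.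
      by rewrite scalerA.
    rewrite exchange_big /=; apply: eq_bigr => b _.
    rewrite deriveZv; last exact: dX.
    rewrite /Y ED !scaler_sumr; apply: eq_bigr => a _.
    rewrite !scalerA comm; last exact: inB (st s s1).
    by congr (_ *: _); ring.
  by rewrite mxE.
have [K K0 [_ fD _ _]] := compact_field_bounds cf.
have dfp y : differentiable f y by exact: smooth_map_differentiable (oT _) cf.1 _.
have V1 : V 1 = zeta 1.
  have du (s : R) j : `|s| <= 1 -> is_derive s 1 (fun q => (V q - zeta q) 0 j)
      (('D_(V s - zeta s) f (phi s z)) 0 j).
    move=> s1; have [_ dV] := VP s s1.
    have -> : (fun q => (V q - zeta q) 0 j) = (fun q => V q 0 j) - (fun q => zeta q 0 j).
      by apply/funext => q; exact: subrowE.
    rewrite deriveDv // deriveNv // subrowE.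
    exact: (is_deriveB (dV j) (dzeta s j s1)).
  have ub (s : R) : `|s| <= 1 -> `|'D_(V s - zeta s) f (phi s z)| <= K * `|V s - zeta s| + 0.
    by move=> _; rewrite addr0.
  have := gronwall (ltW K0) (lexx 0) du ub one1.
  rewrite V0 /zeta scale0r subrr normr0 expr0n mulr0 addr0 mul0r => hV.
  apply/eqP; rewrite -subr_eq0 -normr_eq0 -sqrf_eq0 eq_le hV.
  exact: sqr_ge0.
have [dphi _] := VP 1 one1; have [dph Eph] := dphi.
have D1 : 'D_(row_mx u 0) (fun z => rsubmx (phi 1 z)) z = rsubmx ('D_(row_mx u 0) (phi 1) z).
  exact: derive_rsubmx.
by rewrite D1 Eph V1 /zeta row_mxKr scale1r.
Qed.

End commuting.

(** * The inverse function theorem *)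

Section inverse.
Variable R : realType.
Implicit Types (m n k N : nat).

(* On [U], x = y + Phi x with Phi a 1/2-contraction is solved by iteration. *)
Lemma contraction_solve m (Phi : 'rV[R]_m -> 'rV[R]_m) (x0 y : 'rV[R]_m) (d : R) :
  0 < d ->
  (forall x x', `|x - x0| <= d -> `|x' - x0| <= d -> `|Phi x - Phi x'| <= `|x - x'| / 2) ->
  `|y - (x0 - Phi x0)| < d / 2 ->
  exists2 x, `|x - x0| < d & x - Phi x = y.
Proof.
move=> d0 lip yd.
pose u n := iter n (fun x => y + Phi x) x0.
pose e := `|y - (x0 - Phi x0)|.
have u01 : `|u 1%N - u 0%N| = e.
  by rewrite /u /= /e opprB addrA.
have uD n : `|u n.+1 - u n| <= e / 2 ^+ n /\ `|u n - x0| <= 2 * e * (1 - (2 ^+ n)^-1).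
  elim: n => [|n [IH1 IH2]].
    by rewrite u01 expr0 invr1 mulr1 lexx (subrr (1 : R)) mulr0 /u /= subrr normr0.
  have e0 : 0 <= e by exact: normr_ge0.
  have en k : 2 * e * (1 - (2 ^+ k)^-1) <= d.
    have : 0 <= (2 ^+ k)^-1 :> R by rewrite invr_ge0 exprn_ge0.
    by move: yd; rewrite -/e; nra.
  have h2 : `|u n.+1 - x0| <= 2 * e * (1 - (2 ^+ n.+1)^-1).
    rewrite -(subrK (u n) (u n.+1)) -addrA; apply: le_trans (ler_normD _ _) _.
    apply: le_trans (lerD IH1 IH2) _.
    rewrite exprS invfM; set q := (2 ^+ n)^-1.
    by rewrite le_eqVlt; apply/orP; left; apply/eqP; field.
  split; last exact: h2.
  have -> : u n.+2 - u n.+1 = Phi (u n.+1) - Phi (u n).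
    by rewrite /u !iterS; rewrite opprD addrACA subrr add0r.
  apply: le_trans (lip _ _ _ _) _; first exact: le_trans h2 (en _).
    exact: le_trans IH2 (en _).
  have -> : e / 2 ^+ n.+1 = e / 2 ^+ n / 2 by rewrite exprS invfM; ring.
  by rewrite ler_pM2r ?invr_gt0.
have /choice [l lP] : forall j, exists l : R, forall n, `|l - u n 0 j| <= 2 * e / 2 ^+ n.
  move=> j; apply: (@geometric_cauchy _ (fun n => u n 0 j)) => n.
  have [h _] := uD n; apply: le_trans h.
  by have := normr_row (u n.+1 - u n) j; rewrite !mxE.
pose x : 'rV[R]_m := \row_j l j.
have e0 : 0 <= e by exact: normr_ge0.
have xP n : `|x - u n| <= 2 * e / 2 ^+ n.
  apply: normr_row_le => [|j]; first by rewrite divr_ge0 ?mulr_ge0 // exprn_ge0.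
  by rewrite !mxE.
have xd : `|x - x0| < d.
  by have := xP 0%N; rewrite /= expr0 divr1 => h; apply: (le_lt_trans h); move: yd; rewrite -/e; lra.
exists x => //; apply/eqP; rewrite -subr_eq0 -normr_eq0 eq_le normr_ge0 andbT.
apply: (@geometric_le0 _ _ (3 * e)) => n.
have un : `|u n - x0| <= d.
  have [_ h] := uD n; apply: (le_trans h).
  have : 0 <= (2 ^+ n)^-1 :> R by rewrite invr_ge0 exprn_ge0.
  by move: yd; rewrite -/e; nra.
have -> : x - Phi x - y = (x - u n.+1) + (Phi (u n) - Phi x).
  by rewrite /u iterS -/(u n) opprD [x + (_ - _)]addrA subrKA addrAC.
apply: le_trans (ler_normD _ _) _.
have h1 := xP n.+1; have h2 := lip _ _ un (ltW xd); have h3 := xP n; rewrite distrC in h3.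
have : `|Phi (u n) - Phi x| <= 2 * e / 2 ^+ n / 2.
  by apply: le_trans h2 _; rewrite ler_pM2r ?invr_gt0.
move: h1; rewrite exprS invfM; set q := (2 ^+ n)^-1 => h1 h4.
have q0 : 0 <= e * q by rewrite mulr_ge0 // invr_ge0 exprn_ge0.
apply: le_trans (lerD h1 h4) _.
have -> : 2 * e * (2^-1 * q) + 2 * e * q / 2 = 2 * (e * q) by field.
by rewrite -mulrA ler_wpM2r // ler_nat.
Qed.

Definition jac m n (F : 'rV[R]_m -> 'rV[R]_n) (x : 'rV[R]_m) : 'M[R]_(m, n) :=
  \matrix_(i, j) ('D_'e_i F x) 0 j.

Lemma jacP m n (F : 'rV[R]_m -> 'rV[R]_n) x v : differentiable F x ->
  'D_v F x = v *m jac F x.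
Proof.
move=> dF; rewrite derive_basis //; apply/rowP => j; rewrite summxE mxE.
by apply: eq_bigr => i _; rewrite !mxE.
Qed.

Lemma smooth_jac m n (A : set 'rV[R]_m) (F : 'rV[R]_m -> 'rV[R]_n) i j : open A ->
  smooth_map_on A F -> smooth_on A (fun x => jac F x i j).
Proof.
move=> oA sF; under eq_fun do rewrite mxE.
exact: (smooth_map_derive 'e_i oA sF j).
Qed.

Lemma smooth_det m n (A : set 'rV[R]_m) (K : 'rV[R]_m -> 'M[R]_n) : open A ->
  (forall i j, smooth_on A (fun x => K x i j)) -> smooth_on A (fun x => \det (K x)).
Proof.
move=> oA sK; rewrite /determinant; apply: smooth_sumT => // s.
apply: smoothM => //; first exact: smooth_cst.
by apply: smooth_prodT.
Qed.

(** Cramer's formula: the entries of the inverse are quotients of determinants. *)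
Lemma smooth_invmx m n (A : set 'rV[R]_m) (K : 'rV[R]_m -> 'M[R]_n) i j : open A ->
  (forall i j, smooth_on A (fun x => K x i j)) ->
  (forall x, A x -> K x \in unitmx) ->
  smooth_on A (fun x => invmx (K x) i j).
Proof.
move=> oA sK uK.
apply: (@smooth_ext _ _ _ (fun x => (\det (K x))^-1 * cofactor (K x) j i)) => //.
  by move=> x Ax; rewrite /invmx uK // !mxE.
apply: smoothM => //.
  apply: smoothV => //; last exact: smooth_det.
  by move=> x Ax; have := uK x Ax; rewrite unitmxE unitfE.
rewrite /cofactor; apply: smoothM => //; first exact: smooth_cst.
apply: smooth_det => // k l; under eq_fun do rewrite !mxE.
exact: sK.
Qed.

Lemma injective_unitmx n (K : 'M[R]_n) : (forall v : 'rV_n, v *m K = 0 -> v = 0) ->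
  K \in unitmx.
Proof.
move=> inj; rewrite -row_free_unit -kermx_eq0; apply/eqP/row_matrixP => i.
rewrite row0; apply: inj; apply/sub_kermxP; exact: row_sub.
Qed.

Lemma mulmx_bound m n (K : 'M[R]_(m, n)) :
  exists2 C, 0 <= C & forall w : 'rV[R]_m, `|w *m K| <= C * `|w|.
Proof.
pose C := \sum_i \sum_j `|K i j|.
have C0 : 0 <= C by apply: sumr_ge0 => i _; apply: sumr_ge0 => j _.
exists C => // w; apply: normr_row_le => [|j]; first by rewrite mulr_ge0.
rewrite mxE; apply: le_trans (ler_norm_sum _ _ _) _; rewrite mulr_suml.
apply: ler_sum => i _; rewrite normrM mulrC; apply: ler_pM => //; last exact: normr_row.
by rewrite (bigD1 j) //= lerDl; apply: sumr_ge0.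
Qed.

(** Composing with the inverse of the Jacobian at x0 makes the derivative there the identity, so
    that x - H x is a contraction near x0. The derivative of the inverse G is the inverse Jacobian
    of F taken at G, and this formula lifts the regularity of G from C^k to C^(k+1). *)
Theorem inverse_function m (A : set 'rV[R]_m) (F : 'rV[R]_m -> 'rV[R]_m) x0 :
  open A -> A x0 -> smooth_map_on A F ->
  (forall v, 'D_v F x0 = 0 -> v = 0) ->
  exists (U V : set 'rV[R]_m) (G : 'rV[R]_m -> 'rV[R]_m),
    [/\ open U, U x0, U `<=` A & open V] /\
    [/\ forall x, U x -> V (F x) /\ G (F x) = x,
        forall y, V y -> U (G y) /\ F (G y) = y & smooth_map_on V G].
Proof.
move=> oA Ax sF inj.
have dF x : A x -> differentiable F x by exact: smooth_map_differentiable.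
pose L := jac F x0.
have uL : L \in unitmx by apply: injective_unitmx => v vL; apply: inj; rewrite jacP //; exact: dF.
pose H x := F x *m invmx L.
have sH : smooth_map_on A H.
  by apply: smooth_map_mulmx => // i j; exact: smooth_cst.
pose Phi x := x - H x.
have sPhi : smooth_map_on A Phi.
  apply: (@smooth_map_ext _ _ _ _ (fun x => x + (-1) *: H x)) => //.
    by move=> x _; rewrite scaleN1r.
  apply: smooth_mapD => //; first exact: smooth_map_id.
  by apply: smooth_mapZ => //; exact: smooth_cst.
have dH x : A x -> differentiable H x by exact: smooth_map_differentiable.
have dPhi x : A x -> differentiable Phi x by exact: smooth_map_differentiable.
have DH x v : A x -> 'D_v H x = 'D_v F x *m invmx L.
  move=> Ax'; apply/rowP => j; rewrite (derive_map_rowE v j oA sH Ax').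
  have -> : (fun y => H y 0 j) = \sum_l (invmx L l j *: (fun y => F y 0 l)).
    apply/funext => y; rewrite /H mxE fct_sumE; apply: eq_bigr => l _.
    by rewrite mulrC.
  have dFl l : is_derive x v (fun y => F y 0 l) ('D_v F x 0 l).
    rewrite (derive_map_rowE v l oA sF Ax'); apply: derivableP; apply: diff_derivable.
    exact: smooth_differentiable oA (sF l) Ax'.
  have h := is_derive_sum (fun l => is_deriveZ (invmx L l j) (dFl l)).
  rewrite (@derive_val _ _ _ _ _ _ _ h) mxE; apply: eq_bigr => l _.
  by rewrite /GRing.scale /= mulrC.
have DPhi x v : A x -> 'D_v Phi x = v - 'D_v H x.
  move=> Ax'; have h := is_deriveB (is_derive_id x v) (derivableP (diff_derivable (v := v) (dH _ Ax'))).
  by rewrite -[RHS](@derive_val _ _ _ _ _ _ _ h).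
have DPhi0 v : 'D_v Phi x0 = 0.
  by rewrite DPhi // DH // jacP; [rewrite mulmxK // subrr|exact: dF].
(* If all m partial derivatives of each component are at most c, a directional derivative is at most
   half the length of the direction. *)
pose c : R := (2 * (m%:R + 1))^-1.
have m1 : 0 < m%:R + 1 :> R by rewrite ltr_wpDl.
have c0 : 0 < c by rewrite invr_gt0 mulr_gt0.
have : \forall x \near x0, A x /\ forall ij : 'I_m * 'I_m,
    `|'D_'e_ij.1 (fun y => Phi y 0 ij.2) x| <= c.
  near=> x; split; first by near: x; exact: open_nbhs_nbhs.
  near: x; apply: filter_forall => -[i j] /=.
  have cD := smooth_continuous (smooth_derive 'e_i oA (sPhi j)) Ax.
  have E0 : 'D_'e_i (fun y => Phi y 0 j) x0 = 0.
    by rewrite -(derive_map_rowE 'e_i j oA sPhi Ax) DPhi0 mxE.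
  move/(@cvgrPdist_le R _ _ (nbhs x0)): cD => /(_ _ c0); apply: filterS => x.
  by rewrite E0 sub0r normrN.
move=> /nbhs_ballP [d' /= d'0 dP].
pose d := d' / 2.
have d0 : 0 < d by rewrite divr_gt0.
have dd x : `|x - x0| <= d -> ball x0 d' x.
  move=> xd; rewrite -ball_normE /ball_ /= distrC; apply: (le_lt_trans xd).
  by rewrite /d; lra.
have dA x : `|x - x0| <= d -> A x by move=> /dd /dP [].
have bnd x v j : `|x - x0| <= d -> `|'D_v (fun y => Phi y 0 j) x| <= `|v| / 2.
  move=> xd; have [Ax' h] := dP x (dd x xd).
  rewrite derive_basis; last exact: smooth_differentiable oA (sPhi j) Ax'.
  apply: le_trans (ler_norm_sum _ _ _) _.
  apply: (@le_trans _ _ (\sum_(i < m) `|v| * c)).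
    by apply: ler_sum => i _; rewrite normrZ ler_pM ?normr_row //; exact: (h (i, j)).
  rewrite sumr_const card_ord -[leLHS]mulr_natl mulrCA ler_wpM2l // /c invfM mulrCA.
  by rewrite -[leRHS]mulr1 ler_pM2l ?invr_gt0 // ler_pdivrMr // mul1r lerDl.
have lip x x' : `|x - x0| <= d -> `|x' - x0| <= d -> `|Phi x - Phi x'| <= `|x - x'| / 2.
  move=> xd xd'; apply: normr_row_le => [|j]; first by rewrite divr_ge0.
  have seg t : 0 <= t <= 1 -> `|x' + t *: (x - x') - x0| <= d.
    move=> /andP[t0 t1].
    have -> : x' + t *: (x - x') - x0 = t *: (x - x0) + (1 - t) *: (x' - x0).
      apply/rowP => i; rewrite !mxE; ring.
    apply: le_trans (ler_normD _ _) _; rewrite !normrZ (ger0_norm t0) ger0_norm ?subr_ge0 //.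
    have h1 : t * `|x - x0| <= t * d by rewrite ler_wpM2l.
    have h2 : (1 - t) * `|x' - x0| <= (1 - t) * d by rewrite ler_wpM2l // subr_ge0.
    by apply: le_trans (lerD h1 h2) _; rewrite -mulrDl addrC subrK mul1r.
  have [t t01|t t01] := @mvt_line _ _ (fun y => Phi y 0 j) x' (x - x').
    apply: diff_derivable; apply: smooth_differentiable oA (sPhi j) _.
    by apply: dA; exact: seg.
  rewrite [x' + _]addrC subrK => E.
  have -> : (Phi x - Phi x') 0 j = Phi x 0 j - Phi x' 0 j by rewrite mxE [X in _ + X]mxE.
  by rewrite E; apply: bnd; exact: seg.
have PhiE x : x - Phi x = H x by rewrite /Phi opprB addrCA subrr addr0.
have injH x x' : `|x - x0| <= d -> `|x' - x0| <= d -> `|x - x'| <= 2 * `|H x - H x'|.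
  move=> xd xd'; have h := lip x x' xd xd'.
  have := ler_normD (H x - H x') (Phi x - Phi x').
  have -> : H x - H x' + (Phi x - Phi x') = x - x'.
    by rewrite addrACA -opprD -!PhiE !subrK.
  lra.
pose V : set 'rV[R]_m := (fun y => y *m invmx L) @^-1` [set y | `|y - H x0| < d / 2].
have oV : open V.
  have : continuous (fun y : 'rV[R]_m => y *m invmx L).
    have sm : smooth_map_on setT (fun y : 'rV[R]_m => y *m invmx L).
      apply: smooth_map_mulmx; first exact: openT; first exact: smooth_map_id.
      by move=> i j; exact: smooth_cst.
    by move=> x; exact: smooth_map_continuous sm _.
  by move=> /continuousP; apply; exact: open_ball_norm.
pose U : set 'rV[R]_m := [set x | `|x - x0| < d] `&` (F @^-1` V).
have UA : U `<=` A by move=> x [/ltW /dA].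
have oU : open U.
  rewrite openE => x [xd Vx].
  have cF : {for x, continuous F} by apply: smooth_map_continuous sF _; apply: dA; exact: ltW.
  have nV : nbhs (F x) V by apply: open_nbhs_nbhs.
  have h1 : nbhs x (F @^-1` V) := cF _ nV.
  have h2 : nbhs x [set x | `|x - x0| < d].
    by apply: open_nbhs_nbhs; split => //; exact: open_ball_norm.
  exact: filterI h2 h1.
have UP x : U x -> `|x - x0| <= d by move=> [/ltW].
have FinjU x x' : U x -> U x' -> F x = F x' -> x = x'.
  move=> /UP xd /UP xd' FF; apply/eqP; rewrite -subr_eq0 -normr_le0.
  by have := injH x x' xd xd'; rewrite /H FF subrr normr0 mulr0.
have solve y : exists x, V y -> U x /\ F x = y.
  have [Vy|nV] := pselect (V y); last by exists x0.
  have Vy' := Vy; rewrite /V /= -PhiE in Vy.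
  have [x xd xE] := contraction_solve d0 lip Vy.
  have FE : F x = y.
    rewrite PhiE /H in xE.
    by rewrite -[F x](mulmxKV uL) -[RHS](mulmxKV uL) xE.
  exists x => _; split; last exact: FE.
  by split => //=; rewrite FE.
have [G GP] := choice solve.
exists U, V, G; split; first split => //.
  by split; rewrite /= ?subrr ?normr0 // /V /= -/(H x0) subrr normr0 divr_gt0.
have GFx x : U x -> G (F x) = x.
  move=> Ux; have Vx : V (F x) by case: Ux.
  by have [UG FG] := GP _ Vx; exact: FinjU.
have GlipV y y' : V y -> V y' -> `|G y - G y'| <= 2 * `|(y - y') *m invmx L|.
  move=> Vy Vy'; have [/UP d1 E1] := GP _ Vy; have [/UP d2 E2] := GP _ Vy'.
  by have := injH _ _ d1 d2; rewrite /H E1 E2 -mulmxBl.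
split; [by move=> x Ux; split; [case: Ux|exact: GFx]|by move=> y /GP|].
(* A vector v killed by the Jacobian of F satisfies D Phi v = v, whereas the derivative of Phi at
   least halves lengths on U. *)
have Ginj x : U x -> jac F x \in unitmx.
  move=> Ux; have Ax' := UA _ Ux; apply: injective_unitmx => v vJ.
  have h0 : 'D_v Phi x = v.
    by rewrite DPhi // DH // jacP ?vJ ?mul0mx ?subr0 //; exact: dF.
  have : `|v| <= `|v| / 2.
    apply: normr_row_le => [|j]; first by rewrite divr_ge0.
    by rewrite -{1}h0 (derive_map_rowE v j oA sPhi Ax'); apply: bnd; exact: UP.
  move=> h; apply/eqP; rewrite -normr_le0; lra.
pose J y := invmx (jac F (G y)).
have dG y v : V y -> is_derive y v G (v *m J y).
  move=> Vy; have [Ux FGy] := GP _ Vy; set x := G y in Ux FGy.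
  have Ax' := UA _ Ux; have uJ := Ginj _ Ux.
  have [CL CL0 CLP] := mulmx_bound (invmx L); have [CJ CJ0 CJP] := mulmx_bound (J y).
  have cv : (fun h : R => h^-1 *: ((G \o shift y) (h *: v) - G y)) @ 0^' --> v *m J y.
    apply/cvgrPdist_le => e e0.
    pose D := CJ * (m%:R * (2 * (CL * `|v|))) + 1.
    have D0 : 0 < D by rewrite /D ltr_wpDl // !mulr_ge0.
    have e10 : 0 < e / D by rewrite divr_gt0.
    have /choice [dl dlP] : forall j, exists d, 0 < d /\ forall k : 'rV[R]_m, `|k| < d ->
        `|F (x + k) 0 j - F x 0 j - \sum_i k 0 i * 'D_'e_i (fun z => F z 0 j) x| <= m%:R * (e / D) * `|k|.
      by move=> j; have [d1 d10 dP1] := C1_estimate oA (sF j 1%N) Ax' e10; exists d1.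
    have near_h : \forall h \near (0 : R)^', h != 0 /\ V (h *: v + y) /\
        forall j, 2 * (CL * (`|h| * `|v|)) < dl j.
      near=> h; split; first by near: h; exact: nbhs_dnbhs_neq.
      split.
        near: h; apply: nbhs_dnbhs.
        have cl : {for (0 : R), continuous (fun h : R => h *: v + y)}.
          apply: differentiable_continuous; apply/derivable1_diffP.
          by apply: derivableD => //; apply: diff_derivable; apply: differentiableZl.
        apply: cl; rewrite scale0r add0r; apply: open_nbhs_nbhs; split => //.
      near: h; apply: filter_forall => j; have [dj0 _] := dlP j.
      have b0 : 0 < 2 * (CL * `|v|) + 1 by rewrite ltr_wpDl // !mulr_ge0.
      near=> h; have : `|h| <= dl j / (2 * (2 * (CL * `|v|) + 1)).
        by near: h; apply: dnbhs0_le; rewrite divr_gt0 // mulr_gt0.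
      rewrite ler_pdivlMr ?mulr_gt0 // => hd.
      have : 0 <= CL * (`|h| * `|v|) by rewrite !mulr_ge0.
      have -> : CL * (`|h| * `|v|) = `|h| * (CL * `|v|) by ring.
      have h0 : 0 <= `|h| by [].
      by move=> q; nra.
    apply: filterS near_h => h [h0 [Vh hdl]].
    pose k := G (h *: v + y) - x.
    have [Uk FGk] := GP _ Vh.
    have xk : x + k = G (h *: v + y) by rewrite /k addrC subrK.
    have kb : `|k| <= 2 * (CL * (`|h| * `|v|)).
      apply: le_trans (GlipV _ _ Vh Vy) _; rewrite addrK ler_pM2l //.
      by apply: le_trans (CLP _) _; rewrite normrZ.
    pose rem := F (x + k) - F x - k *m jac F x.
    have remb : `|rem| <= m%:R * (e / D) * `|k|.
      have me : 0 <= m%:R * (e / D) by rewrite mulr_ge0 // ltW.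
      apply: normr_row_le => [|j]; first by rewrite mulr_ge0.
      have [_ q] := dlP j; have := q k (le_lt_trans kb (hdl j)).
      have -> : rem 0 j = F (x + k) 0 j - F x 0 j - (k *m jac F x) 0 j by rewrite /rem !mxE.
      congr (`|_ - _| <= _); rewrite mxE; apply: eq_bigr => i _.
      by congr (_ * _); rewrite [RHS]mxE; exact: (esym (derive_map_rowE 'e_i j oA sF Ax')).
    have -> : v *m J y - h^-1 *: ((G \o shift y) (h *: v) - G y) = h^-1 *: (rem *m J y).
      rewrite /rem xk FGk FGy addrK mulmxBl -mulmxA mulmxV // mulmx1 -scalemxAl [RHS]scalerBr.
      by rewrite scalerA mulVf // scale1r.
    rewrite normrZ normfV ler_pdivrMl ?normr_gt0 //.
    apply: le_trans (CJP _) _.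
    apply: le_trans (ler_wpM2l CJ0 remb) _.
    have q1 : CJ * (m%:R * (e / D) * `|k|) <= CJ * (m%:R * (e / D) * (2 * (CL * (`|h| * `|v|)))).
      by rewrite ler_wpM2l // ler_wpM2l // mulr_ge0 // ltW.
    apply: (le_trans q1).
    have -> : CJ * (m%:R * (e / D) * (2 * (CL * (`|h| * `|v|)))) =
        `|h| * (e * ((CJ * (m%:R * (2 * (CL * `|v|)))) / D)) by ring.
    rewrite ler_wpM2l // ger_pMr // ler_pdivrMr // mul1r /D lerDl //.
  by split; [apply/cvg_ex; exists (v *m J y)|exact: cvg_lim cv].
have sJ i j : smooth_on U (fun x => invmx (jac F x) i j).
  by apply: smooth_invmx => // k l; apply: smooth_jac => //; exact: smooth_map_sub sF.
have contG y j : V y -> {for y, continuous (fun y => G y 0 j)}.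
  move=> Vy; have [CL CL0 CLP] := mulmx_bound (invmx L).
  apply/(@cvgrPdist_le R _ _ (nbhs y)) => e e0; near=> y'.
  have Vy' : V y' by near: y'; exact: open_nbhs_nbhs.
  have yy : `|y - y'| <= e / (2 * CL + 1).
    near: y'; apply/nbhs_ballP; exists (e / (2 * CL + 1)) => /=.
      by rewrite divr_gt0 // ltr_wpDl // mulr_ge0.
    by move=> z; rewrite -ball_normE /ball_ /= => /ltW.
  have h1 := normr_row (G y - G y') j; rewrite [X in `|X|]mxE [X in _ + X]mxE in h1.
  apply: (le_trans h1); apply: le_trans (GlipV _ _ Vy Vy') _.
  have h2 := CLP (y - y').
  move: yy; rewrite ler_pdivlMr; last by rewrite ltr_wpDl // mulr_ge0.
  have : 0 <= `|y - y'| by [].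
  by nra.
move=> j k; elim: k j => [|k IH] j; first by split => // y Vy; exact: contG.
split; first by move=> y Vy; exact: contG.
move=> i; split.
  by move=> y Vy; have [/derivable_rowP dGy _] := dG y 'e_i Vy; exact: dGy.
apply: (@Ck_ext _ _ _ _ ((fun x => invmx (jac F x) i j) \o G)) => //.
  move=> y Vy; have [dGy Ey] := dG y 'e_i Vy.
  by rewrite -(derive_rowE j dGy) Ey -rowE mxE.
apply: Ck_comp oV oU _ IH (sJ i j k).
by move=> y /GP [].
Unshelve. all: by end_near.
Qed.

End inverse.

(** * Calculus on manifolds *)

Section second_derivative.
Variable R : realType.

(** The point enters twice, through the derivative of f and through the direction Y. The first
    contribution is the symmetric one that disappears from brackets. *)
Lemma derive_field_scalar m (A : set 'rV[R]_m) (f : 'rV[R]_m -> R) (Y : 'rV[R]_m -> 'rV[R]_m) x w :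
  open A -> A x -> smooth_on A f -> smooth_map_on A Y ->
  'D_w (fun y => 'D_(Y y) f y) x = 'D_w (fun y => 'D_(Y x) f y) x + 'D_('D_w Y x) f x.
Proof.
move=> oA Ax sf sY.
have df y : A y -> differentiable f y by exact: smooth_differentiable.
have dYi i : is_derive x w (fun y => Y y 0 i) (('D_w Y x) 0 i).
  rewrite (derive_map_rowE w i oA sY Ax); apply: derivableP; apply: diff_derivable.
  exact: smooth_differentiable oA (sY i) Ax.
have dDi i : is_derive x w (fun y => 'D_'e_i f y) ('D_w (fun y => 'D_'e_i f y) x).
  apply: derivableP; apply: diff_derivable.
  exact: smooth_differentiable oA (smooth_derive 'e_i oA sf) Ax.
have E1 : \forall y \near x, 'D_(Y y) f y =
    (\sum_i ((fun y => Y y 0 i) * (fun y => 'D_'e_i f y))) y.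
  apply: (near_open oA Ax) => y Ay; rewrite (derive_basis _ (df y Ay)) fct_sumE.
  by apply: eq_bigr => i _.
have E2 : \forall y \near x, 'D_(Y x) f y =
    (\sum_i (Y x 0 i *: (fun y => 'D_'e_i f y))) y.
  apply: (near_open oA Ax) => y Ay; rewrite (derive_basis _ (df y Ay)) fct_sumE.
  by apply: eq_bigr => i _.
rewrite (near_eq_derive _ E1) (near_eq_derive _ E2).
rewrite (@derive_val _ _ _ _ _ _ _ (is_derive_sum (fun i => is_deriveM (dYi i) (dDi i)))).
rewrite (@derive_val _ _ _ _ _ _ _ (is_derive_sum (fun i => is_deriveZ (Y x 0 i) (dDi i)))).
rewrite (derive_basis _ (df x Ax)) -big_split; apply: eq_bigr => i _ /=.
by congr (_ + _); exact: mulrC.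
Qed.

Lemma smooth_derive_field m (A : set 'rV[R]_m) (f : 'rV[R]_m -> R) (Y : 'rV[R]_m -> 'rV[R]_m) :
  open A -> smooth_on A f -> smooth_map_on A Y -> smooth_on A (fun y => 'D_(Y y) f y).
Proof.
move=> oA sf sY; apply: (@smooth_ext _ _ _ (fun y => \sum_i Y y 0 i * 'D_'e_i f y)) => //.
  by move=> y Ay; rewrite (derive_basis _ (smooth_differentiable oA sf Ay)).
by apply: smooth_sum => // i; apply: smoothM => //; exact: smooth_derive.
Qed.

Lemma smooth_map_derive_field m n (A : set 'rV[R]_m) (F : 'rV[R]_m -> 'rV[R]_n)
    (Y : 'rV[R]_m -> 'rV[R]_m) :
  open A -> smooth_map_on A F -> smooth_map_on A Y ->
  smooth_map_on A (fun y => 'D_(Y y) F y).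
Proof.
move=> oA sF sY j; apply: smooth_ext (smooth_derive_field oA (sF j) sY) => // y Ay.
by rewrite (derive_map_rowE _ j oA sF Ay).
Qed.

Lemma derive_field m n (A : set 'rV[R]_m) (F : 'rV[R]_m -> 'rV[R]_n)
    (Y : 'rV[R]_m -> 'rV[R]_m) x w :
  open A -> A x -> smooth_map_on A F -> smooth_map_on A Y ->
  'D_w (fun y => 'D_(Y y) F y) x = 'D_w (fun y => 'D_(Y x) F y) x + 'D_('D_w Y x) F x.
Proof.
move=> oA Ax sF sY; apply/rowP => j; rewrite [RHS]mxE.
have e1 := derive_map_rowE w j oA (smooth_map_derive_field oA sF sY) Ax.
have e2 := derive_map_rowE w j oA (smooth_map_derive (Y x) oA sF) Ax.
have e3 := derive_map_rowE ('D_w Y x) j oA sF Ax.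
have E1 : \forall y \near x, ('D_(Y y) F y) 0 j = 'D_(Y y) (fun z => F z 0 j) y.
  by apply: (near_open oA Ax) => y Ay; rewrite (derive_map_rowE _ j oA sF Ay).
have E2 : \forall y \near x, ('D_(Y x) F y) 0 j = 'D_(Y x) (fun z => F z 0 j) y.
  by apply: (near_open oA Ax) => y Ay; rewrite (derive_map_rowE _ j oA sF Ay).
have e4 := near_eq_derive w E1; have e5 := near_eq_derive w E2.
have e6 := derive_field_scalar w oA Ax (sF j) sY.
apply: (etrans e1); apply: (etrans e4); apply: (etrans e6).
by congr (_ + _); apply: esym; [exact: etrans e2 e5|exact: e3].
Qed.

End second_derivative.

Section manifold_calculus.
Variables (R : realType) (m : nat) (M : manifold R m).
Implicit Types (p q : M) (X Y : vfield M).

Definition dom p : set M := chart_dom (chart_at p).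
Definition trans p p' : 'rV[R]_m -> 'rV[R]_m := coords p' \o param p.
Definition tdom p p' : set 'rV[R]_m := coords_cod p `&` param p @^-1` dom p'.

Lemma open_dom p : open (dom p). Proof. exact: chart_dom_open. Qed.
Lemma open_cod p : open (coords_cod p). Proof. exact: chart_cod_open. Qed.
Arguments open_dom p : clear implicits.
Arguments open_cod p : clear implicits.
Lemma dom_self p : dom p p. Proof. exact: chart_at_dom. Qed.
Lemma paramP p x : coords_cod p x -> dom p (param p x). Proof. exact: chart_invP. Qed.
Lemma coordsP p q : dom p q -> coords_cod p (coords p q). Proof. exact: chart_mapP. Qed.
Lemma coordsK p q : dom p q -> param p (coords p q) = q. Proof. exact: chart_mapK. Qed.
Lemma paramK p x : coords_cod p x -> coords p (param p x) = x. Proof. exact: chart_invK. Qed.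

Lemma open_param_preimage p (W : set M) : open W -> open (coords_cod p `&` param p @^-1` W).
Proof.
move=> oW; rewrite openE => x [cx Wx].
have cp : {for x, continuous (param p)} by exact: chart_inv_continuous.
have nW : nbhs (param p x) W by apply: open_nbhs_nbhs.
have h1 : nbhs x (param p @^-1` W) := cp _ nW.
have h2 : nbhs x (coords_cod p) by apply: open_nbhs_nbhs; split => //; exact: open_cod.
exact: filterI h2 h1.
Qed.

Lemma open_tdom p p' : open (tdom p p').
Proof. by apply: open_param_preimage; exact: open_dom. Qed.

Arguments open_tdom p p' : clear implicits.

Lemma smooth_trans p p' : smooth_map_on (tdom p p') (trans p p').
Proof. exact: chart_at_compat. Qed.

Arguments smooth_trans p p' : clear implicits.

Lemma tdomP p p' q : dom p q -> dom p' q -> tdom p p' (coords p q).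
Proof. by move=> pq p'q; split; [exact: coordsP|rewrite /= coordsK]. Qed.

Lemma transE p p' q : dom p q -> trans p p' (coords p q) = coords p' q.
Proof. by move=> pq; rewrite /trans /= coordsK. Qed.

Lemma differentiable_trans p p' x : tdom p p' x -> differentiable (trans p p') x.
Proof. by move=> t; exact: (smooth_map_differentiable (open_tdom p p') (smooth_trans p p') t). Qed.

Lemma trans_comp p p' p'' x v : tdom p p' x -> tdom p p'' x ->
  'D_('D_v (trans p p') x) (trans p' p'') (trans p p' x) = 'D_v (trans p p'') x.
Proof.
move=> t1 t2; have d1 := differentiable_trans t1.
have d2 : tdom p' p'' (trans p p' x).
  split; first by apply: coordsP; case: t1.
  by rewrite /= /trans /= coordsK; [case: t2|case: t1].
rewrite -(derive_comp v d1 (differentiable_trans d2)).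
apply: near_eq_derive; apply: (near_open_map (open_tdom p p') t1) => y [cy dy].
by rewrite /= /trans /= coordsK.
Qed.

Lemma derive_idE n (x v : 'rV[R]_n) (A : set 'rV[R]_n) (F : 'rV[R]_n -> 'rV[R]_n) :
  open A -> A x -> (forall y, A y -> F y = y) -> 'D_v F x = v.
Proof.
move=> oA Ax FE; rewrite -[RHS](derive_id x v); apply: near_eq_derive.
exact: (near_open_map oA Ax).
Qed.

Lemma trans_self p x v : coords_cod p x -> 'D_v (trans p p) x = v.
Proof.
move=> cx; apply: (derive_idE _ (open_cod p)) => // y cy.
by rewrite /trans /= paramK.
Qed.

Lemma repE p q v : rep p q v = 'D_v (trans q p) (coords q q). Proof. by []. Qed.
Lemma coord_fieldE p v q : coord_field p v q = 'D_v (trans p q) (coords p q). Proof. by []. Qed.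

Lemma rep_coord_field p p' q v : dom p q -> dom p' q ->
  rep p' q (coord_field p v q) = 'D_v (trans p p') (coords p q).
Proof.
move=> pq p'q; rewrite repE coord_fieldE -(transE q pq).
by apply: trans_comp; apply: tdomP => //; exact: dom_self.
Qed.

Lemma rep_coord_fieldK p q v : dom p q -> rep p q (coord_field p v q) = v.
Proof. by move=> pq; rewrite rep_coord_field // trans_self //; exact: coordsP. Qed.

Lemma coord_field_repK p q v : dom p q -> coord_field p (rep p q v) q = v.
Proof.
move=> pq; rewrite coord_fieldE repE -(transE p (dom_self q)).
rewrite trans_comp; first by rewrite trans_self //; exact: coordsP (dom_self q).
  by apply: tdomP => //; exact: dom_self.
by apply: tdomP; exact: dom_self.
Qed.

Lemma rep_self q v : rep q q v = v.
Proof. by rewrite repE trans_self //; exact: coordsP (dom_self q). Qed.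

Lemma rep_differentiable p q : dom p q -> differentiable (trans q p) (coords q q).
Proof. by move=> pq; apply: differentiable_trans; apply: tdomP => //; exact: dom_self. Qed.

Lemma repD p q u v : dom p q -> rep p q (u + v) = rep p q u + rep p q v.
Proof. by move=> /rep_differentiable d; rewrite !repE deriveDv. Qed.

Lemma repZ p q a v : dom p q -> rep p q (a *: v) = a *: rep p q v.
Proof. by move=> /rep_differentiable d; rewrite !repE deriveZv. Qed.

Lemma rep_sum p q (I : finType) (v : I -> 'rV[R]_m) : dom p q ->
  rep p q (\sum_i v i) = \sum_i rep p q (v i).
Proof.
by move=> /rep_differentiable d; rewrite !repE deriveE // linear_sum; apply: eq_bigr => i _; rewrite repE deriveE.
Qed.

Lemma coord_field_differentiable p q : dom p q -> differentiable (trans p q) (coords p q).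
Proof. by move=> pq; apply: differentiable_trans; apply: tdomP => //; exact: dom_self. Qed.

Lemma coord_field_basis p q v : dom p q ->
  coord_field p v q = \sum_i v 0 i *: coord_field p 'e_i q.
Proof. by move=> /coord_field_differentiable d; rewrite !coord_fieldE derive_basis. Qed.

Lemma coord_fieldD p q u v : dom p q ->
  coord_field p (u + v) q = coord_field p u q + coord_field p v q.
Proof. by move=> /coord_field_differentiable d; rewrite !coord_fieldE deriveDv. Qed.

Lemma coord_fieldZ p q a v : dom p q -> coord_field p (a *: v) q = a *: coord_field p v q.
Proof. by move=> /coord_field_differentiable d; rewrite !coord_fieldE deriveZv. Qed.

Lemma vfieldE X p q : dom p q ->
  X q = coord_field p (local_rep X p (coords p q)) q.
Proof. by move=> pq; rewrite /local_rep coordsK // coord_field_repK. Qed.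

Lemma local_rep_trans X p p' x : tdom p p' x ->
  local_rep X p' (trans p p' x) = 'D_(local_rep X p x) (trans p p') x.
Proof.
move=> [cx dx]; have px := paramP cx.
have E : param p' (trans p p' x) = param p x by exact: coordsK dx.
rewrite [LHS]/local_rep E (vfieldE X px) (paramK cx) (rep_coord_field _ px dx).
by rewrite (paramK cx).
Qed.

(** [dirder] uses the chart at the point itself, which changes from point to point; by the chain
    rule any chart around the point gives the same value. *)
Lemma dirder_chart X f p q : smooth_fun f -> dom p q ->
  dirder X f q = 'D_(rep p q (X q)) (f \o param p) (coords p q).
Proof.
move=> sf pq; rewrite /dirder repE -(transE p (dom_self q)).
have t := tdomP (dom_self q) pq.
have cp : coords_cod p (trans q p (coords q q)) by rewrite (transE p (dom_self q)); exact: coordsP.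
rewrite -derive_comp; [|exact: differentiable_trans|].
  apply: near_eq_derive; apply: (near_open_map (open_tdom q p) t) => y [cy dy].
  by rewrite /= /trans /= coordsK.
exact: smooth_differentiable (open_cod p) (sf p) cp.
Qed.

(** Passing from the chart at q to the chart at p produces second derivatives of the transition map.
    They are symmetric by [schwarz_map] and cancel in the bracket. *)
Lemma lie_chart X Y p q : smooth_vfield X -> smooth_vfield Y -> dom p q ->
  rep p q (lie X Y q) = 'D_(local_rep X p (coords p q)) (local_rep Y p) (coords p q)
     - 'D_(local_rep Y p (coords p q)) (local_rep X p) (coords p q).
Proof.
move=> sX sY pq; have t := tdomP (dom_self q) pq.
have ot := open_tdom q p; have st := smooth_trans q p.
set y := coords q q in t *.
have yp : trans q p y = coords p q by exact: transE (dom_self q).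
have cp : coords_cod p (coords p q) by exact: coordsP.
have dt := differentiable_trans t.
have sub (Z : vfield M) : smooth_vfield Z -> smooth_map_on (tdom q p) (local_rep Z q).
  by move=> sZ; apply: smooth_map_sub (sZ q) => z [].
have Zq (Z : vfield M) : Z q = local_rep Z q y.
  by rewrite /local_rep /y coordsK ?rep_self //; exact: dom_self.
have key (Z W : vfield M) : smooth_vfield Z -> smooth_vfield W ->
   'D_(local_rep Z p (coords p q)) (local_rep W p) (coords p q) =
   'D_(Z q) (fun z => 'D_(W q) (trans q p) z) y + 'D_('D_(Z q) (local_rep W q) y) (trans q p) y.
  move=> sZ sW.
  have -> : local_rep Z p (coords p q) = 'D_(Z q) (trans q p) y.
    by rewrite -yp (local_rep_trans Z t) -(Zq Z).
  have dW : differentiable (local_rep W p) (trans q p y).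
    by rewrite yp; exact: smooth_map_differentiable (open_cod p) (sW p) cp.
  rewrite -yp -(derive_comp _ dt dW).
  rewrite -[RHS](_ : 'D_(Z q) (fun z => 'D_(local_rep W q z) (trans q p) z) y = _); last first.
    by rewrite (derive_field (Z q) ot t st (sub W sW)) -(Zq W).
  apply: near_eq_derive; apply: (near_open_map ot t) => z tz.
  by rewrite /= local_rep_trans.
rewrite (key X Y sX sY) (key Y X sY sX) (schwarz_map (X q) (Y q) ot st t).
by rewrite opprD addrACA subrr add0r -(deriveNv _ dt) -(deriveDv _ _ dt).
Qed.

End manifold_calculus.

Arguments open_dom {R m M} p.
Arguments open_cod {R m M} p.
Arguments open_tdom {R m M} p p'.
Arguments smooth_trans {R m M} p p'.

(** * Functions, vector fields and their brackets *)

Section fields.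
Variables (R : realType) (m : nat) (M : manifold R m).
Implicit Types (p q : M) (X Y Z : vfield M) (f h : M -> R).

Lemma smooth_fun_cst (c : R) : smooth_fun (fun _ : M => c).
Proof. by move=> p; exact: smooth_cst. Qed.

Lemma smooth_funN f : smooth_fun f -> smooth_fun (fun q => - f q).
Proof. by move=> sf p; exact: (smoothN (open_cod p) (sf p)). Qed.

Lemma local_repD X Y p x : coords_cod p x ->
  local_rep (fun q => X q + Y q) p x = local_rep X p x + local_rep Y p x.
Proof. by move=> /paramP px; rewrite /local_rep repD. Qed.

Lemma local_repZ f X p x : coords_cod p x ->
  local_rep (fun q => f q *: X q) p x = f (param p x) *: local_rep X p x.
Proof. by move=> /paramP px; rewrite /local_rep repZ. Qed.

Lemma smooth_vfieldD X Y : smooth_vfield X -> smooth_vfield Y ->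
  smooth_vfield (fun q => X q + Y q).
Proof.
move=> sX sY p; apply: smooth_map_ext (smooth_mapD (open_cod p) (sX p) (sY p)).
  exact: open_cod.
by move=> x cx; rewrite local_repD.
Qed.

Lemma smooth_vfieldZ f X : smooth_fun f -> smooth_vfield X ->
  smooth_vfield (fun q => f q *: X q).
Proof.
move=> sf sX p; apply: smooth_map_ext (smooth_mapZ (open_cod p) (sf p) (sX p)).
  exact: open_cod.
by move=> x cx; rewrite local_repZ.
Qed.

Lemma smooth_vfieldN X : smooth_vfield X -> smooth_vfield (fun q => - X q).
Proof.
move=> sX; have h := smooth_vfieldZ (smooth_fun_cst (-1)) sX.
by under eq_fun do rewrite -scaleN1r.
Qed.

Lemma vfield_basis X p q : dom p q ->
  X q = \sum_i local_rep X p (coords p q) 0 i *: coord_field p 'e_i q.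
Proof. by move=> pq; rewrite {1}(vfieldE X pq) coord_field_basis. Qed.

Lemma smooth_oneform_app (eta : oneform M) X : smooth_oneform eta -> smooth_vfield X ->
  smooth_fun (fun q => eta q (X q)).
Proof.
move=> se sX p.
apply: (@smooth_ext _ _ _ (fun x => \sum_i local_rep X p x 0 i *
   eta (param p x) (coord_field p 'e_i (param p x)))); first exact: open_cod.
  move=> x cx /=; rewrite (vfield_basis X (paramP cx)) linear_sum.
  by apply: eq_bigr => i _; rewrite linearZ /= paramK.
apply: smooth_sum; first exact: open_cod.
by move=> i; apply: (smoothM (open_cod p) (sX p i) (se p i)).
Qed.

Lemma smooth_appv (phi : endofield M) X : smooth_endofield phi -> smooth_vfield X ->
  smooth_vfield (appv phi X).
Proof.
move=> sp sX p.
apply: (@smooth_map_ext _ _ _ _ (fun x => \sum_i local_rep X p x 0 i *: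
   local_rep (fun q => phi q (coord_field p 'e_i q)) p x)); first exact: open_cod.
  move=> x cx; rewrite [RHS]/local_rep /appv (vfield_basis X (paramP cx)) linear_sum rep_sum; last exact: paramP.
  apply: eq_bigr => i _; rewrite linearZ /= repZ; last exact: paramP.
  by rewrite paramK.
apply: smooth_map_sum; first exact: open_cod.
by move=> i; apply: (smooth_mapZ (open_cod p) (sX p i) (sp p i)).
Qed.

Lemma smooth_bilin_app (g : bilinfield M) X Y : smooth_bilinfield g ->
  (forall q w, scalar (fun v => g q v w)) -> (forall q v, scalar (g q v)) ->
  smooth_vfield X -> smooth_vfield Y -> smooth_fun (fun q => g q (X q) (Y q)).
Proof.
move=> sg lg rg sX sY p.
have gl q w : {g' : {scalar 'rV[R]_m} | forall v, g' v = g q v w}.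
  by exists (HB.pack (fun v => g q v w) (GRing.isLinear.Build R 'rV[R]_m R _ (fun v => g q v w) (lg q w)) : {scalar 'rV[R]_m}).
have gr q v : {g' : {scalar 'rV[R]_m} | forall w, g' w = g q v w}.
  by exists (HB.pack (g q v) (GRing.isLinear.Build R 'rV[R]_m R _ (g q v) (rg q v)) : {scalar 'rV[R]_m}).
apply: (@smooth_ext _ _ _ (fun x => \sum_i \sum_j local_rep X p x 0 i * local_rep Y p x 0 j *
   g (param p x) (coord_field p 'e_i (param p x)) (coord_field p 'e_j (param p x)))); first exact: open_cod.
  move=> x cx /=; rewrite (vfield_basis X (paramP cx)).
  have [g1 g1E] := gl (param p x) (Y (param p x)).
  rewrite -g1E linear_sum; apply: eq_bigr => i _; rewrite linearZ /= g1E.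
  have [g2 g2E] := gr (param p x) (coord_field p 'e_i (param p x)).
  rewrite -g2E (vfield_basis Y (paramP cx)) linear_sum paramK // mulr_sumr.
  by apply: eq_bigr => j _; rewrite linearZ /= g2E mulrA.
apply: smooth_sum => [|i]; first exact: open_cod.
apply: smooth_sum => [|j]; first exact: open_cod.
apply: smoothM; first exact: open_cod.
  by apply: smoothM; [exact: open_cod|exact: sX|exact: sY].
exact: sg.
Qed.

Lemma dirder_differentiable f q : smooth_fun f -> differentiable (f \o param q) (coords q q).
Proof.
by move=> sf; exact: smooth_differentiable (open_cod q) (sf q) (coordsP (dom_self q)).
Qed.

Lemma dirderD X f h q : smooth_fun f -> smooth_fun h ->
  dirder X (fun q => f q + h q) q = dirder X f q + dirder X h q.
Proof.
move=> /(@dirder_differentiable _ q) df /(@dirder_differentiable _ q) dh.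
exact: (deriveD (diff_derivable df) (diff_derivable dh)).
Qed.

Lemma dirderM X f h q : smooth_fun f -> smooth_fun h ->
  dirder X (fun q => f q * h q) q = f q * dirder X h q + h q * dirder X f q.
Proof.
move=> /(@dirder_differentiable _ q) df /(@dirder_differentiable _ q) dh.
have := deriveM (diff_derivable (v := X q) df) (diff_derivable (v := X q) dh).
by rewrite /= (coordsK (dom_self q)).
Qed.

Lemma dirder_cst X (c : R) q : dirder X (fun=> c) q = 0.
Proof. exact: (derive_cst c). Qed.

Lemma dirderDl X Y f q : smooth_fun f ->
  dirder (fun q => X q + Y q) f q = dirder X f q + dirder Y f q.
Proof. by move=> /(@dirder_differentiable _ q) df; exact: (deriveDv _ _ df). Qed.

Lemma dirderZl h X f q : smooth_fun f ->
  dirder (fun q => h q *: X q) f q = h q * dirder X f q.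
Proof. by move=> /(@dirder_differentiable _ q) df; exact: (deriveZv _ _ df). Qed.

Lemma lieC X Y q : lie Y X q = - lie X Y q.
Proof. by rewrite /lie opprB. Qed.

Lemma local_rep_self X q : local_rep X q (coords q q) = X q.
Proof. by rewrite /local_rep (coordsK (dom_self q)) rep_self. Qed.

Lemma local_rep_differentiable X q : smooth_vfield X ->
  differentiable (local_rep X q) (coords q q).
Proof.
by move=> sX; exact: smooth_map_differentiable (open_cod q) (sX q) (coordsP (dom_self q)).
Qed.

Lemma derive_scale (V : normedModType R) n (f : V -> R) (F : V -> 'rV[R]_n) x v :
  derivable f x v -> derivable F x v ->
  'D_v (fun y => f y *: F y) x = 'D_v f x *: F x + f x *: 'D_v F x.
Proof.
move=> df dF.
have E j : (fun y => (f y *: F y) 0 j) = f * (fun y => F y 0 j).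
  by apply/funext => y; rewrite mxE.
have dFj j : derivable (fun y => F y 0 j) x v by move/derivable_rowP: dF; apply.
have d : derivable (fun y => f y *: F y) x v.
  by apply/derivable_rowP => j; rewrite E; exact: (derivableM df (dFj j)).
apply/rowP => j; rewrite (derive_rowE j d) E (deriveM df (dFj j)) !mxE (derive_rowE j dF).
by rewrite addrC; congr (_ + _); exact: mulrC.
Qed.

Lemma lieDr X Y Z q : smooth_vfield X -> smooth_vfield Y -> smooth_vfield Z ->
  lie X (fun q => Y q + Z q) q = lie X Y q + lie X Z q.
Proof.
move=> sX sY sZ; rewrite /lie.
have dX := local_rep_differentiable q sX.
have dY := local_rep_differentiable q sY; have dZ := local_rep_differentiable q sZ.
have E : \forall y \near coords q q, local_rep (fun q => Y q + Z q) q y =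
    (local_rep Y q + local_rep Z q) y.
  apply: (near_open_map (open_cod q) (coordsP (dom_self q))) => y cy.
  exact: local_repD.
rewrite (near_eq_derive (X q) E) (deriveDv _ _ dX) (deriveD (diff_derivable dY) (diff_derivable dZ)).
by rewrite opprD addrACA.
Qed.

Lemma lieZr X f Y q : smooth_fun f -> smooth_vfield X -> smooth_vfield Y ->
  lie X (fun q => f q *: Y q) q = dirder X f q *: Y q + f q *: lie X Y q.
Proof.
move=> sf sX sY; rewrite /lie.
have dX := local_rep_differentiable q sX.
have dY := local_rep_differentiable q sY; have df := @dirder_differentiable f q sf.
have E : \forall y \near coords q q, local_rep (fun q => f q *: Y q) q y =
    (f \o param q) y *: local_rep Y q y.
  apply: (near_open_map (open_cod q) (coordsP (dom_self q))) => y cy.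
  exact: local_repZ.
rewrite (near_eq_derive (X q) E) (deriveZv _ _ dX).
rewrite (derive_scale (diff_derivable df) (diff_derivable dY)) local_rep_self /=.
by rewrite (coordsK (dom_self q)) scalerBr addrA.
Qed.

(** Cut off in the chart and extend by zero. The support lies in the image of a closed ball, which
    is compact, hence closed because the manifold is Hausdorff; on its open complement the field
    vanishes. Local data can thus be tested by the global fields over which all the definitions
    quantify. *)
Lemma vfield_germ p q (v : 'rV[R]_m -> 'rV[R]_m) : dom p q ->
  smooth_map_on (coords_cod p) v ->
  exists X, smooth_vfield X /\ \forall x \near coords p q, local_rep X p x = v x.
Proof.
move=> pq sv; set x0 := coords p q.
have cx0 : coords_cod p x0 := coordsP pq.
have [r r0 rcod] := ball_in_open (open_cod p) cx0.
have [chi [schi _ chi1 chi0]] := cutoff x0 r0.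
pose X : vfield M := fun q' => if `[< dom p q' >] then
  chi (coords p q') *: coord_field p (v (coords p q')) q' else 0.
pose K : set M := param p @` [set x | `|x - x0| <= 2 * r].
have cK : closed K.
  apply: compact_closed; first exact: manifold_hausdorff.
  apply: continuous_compact.
    apply: continuous_in_subspaceT => x; rewrite inE => /rcod cx.
    exact: chart_inv_continuous.
  by apply: closed_ball_compact; rewrite mulr_gt0.
have KD : K `<=` dom p by move=> _ [x /rcod cx <-]; exact: paramP.
have XE q' : dom p q' -> X q' = chi (coords p q') *: coord_field p (v (coords p q')) q'.
  by move=> d; rewrite /X; case: asboolP.
have X0 q' : ~ K q' -> X q' = 0.
  move=> nK; rewrite /X; case: asboolP => // d.
  rewrite chi0 ?scale0r //; rewrite leNgt; apply/negP => h; apply: nK.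
  by exists (coords p q'); rewrite ?coordsK //= ltW.
exists X; split.
  move=> p' j k.
  have oA1 := open_tdom p' p.
  have oA2 : open (coords_cod p' `&` param p' @^-1` (~` K)).
    by apply: open_param_preimage; exact: closed_openC.
  have -> : coords_cod p' = tdom p' p `|` (coords_cod p' `&` param p' @^-1` (~` K)).
    apply/seteqP; split => [x cx|x [[]|[]]] //.
    have [d|nd] := pselect (dom p (param p' x)); first by left.
    by right; split => //= /KD.
  apply: Ck_union; last first.
    apply: Ck_ext (Ck_cst k _ 0) => // x [cx nK] /=.
    by rewrite /local_rep X0 // repE derive0 mxE.
  have st := smooth_trans p' p.
  have tt x : tdom p' p x -> coords_cod p (trans p' p x).
    by move=> [cx dx]; exact: coordsP.
  have tt' x : tdom p' p x -> tdom p p' (trans p' p x).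
    move=> [cx dx]; split; first exact: coordsP.
    by rewrite /= /trans /= (coordsK dx); exact: paramP.
  have s1 : smooth_on (tdom p' p) (chi \o trans p' p).
    exact: (smooth_comp oA1 (@openT _) (fun _ _ => I) st schi).
  have s2 : smooth_map_on (tdom p' p) (v \o trans p' p).
    exact: (smooth_map_comp oA1 (open_cod p) tt st sv).
  have s3 i : smooth_map_on (tdom p' p) ((fun y => 'D_'e_i (trans p p') y) \o trans p' p).
    exact: (smooth_map_comp oA1 (open_tdom p p') tt' st
             (smooth_map_derive 'e_i (open_tdom p p') (smooth_trans p p'))).
  have s4 : smooth_map_on (tdom p' p) (fun x => (chi \o trans p' p) x *:
      \sum_i (v \o trans p' p) x 0 i *: ((fun y => 'D_'e_i (trans p p') y) \o trans p' p) x).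
    apply: smooth_mapZ => //; apply: smooth_map_sum => // i.
    by apply: smooth_mapZ => //; exact: (s2 i).
  apply: Ck_ext (s4 j k) => // x tx; have [cx dx] := tx.
  have p'x := paramP cx.
  have dt : differentiable (trans p p') (trans p' p x) by exact: differentiable_trans (tt' x tx).
  rewrite /local_rep (XE _ dx) (repZ _ _ p'x) (rep_coord_field _ dx p'x).
  by rewrite -[coords p (param p' x)]/(trans p' p x) (derive_basis _ dt).
have near_x0 : nbhs x0 [set x | `|x - x0| < r].
  by apply: open_nbhs_nbhs; split; [exact: open_ball_norm|rewrite /= subrr normr0].
apply: filterS near_x0 => x /= xr.
have cx : coords_cod p x by apply: rcod; rewrite /=; apply: ltW; apply: lt_trans xr _; lra.
rewrite /local_rep (XE _ (paramP cx)) (paramK cx) chi1 ?scale1r; last exact: ltW.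
by rewrite -{2}(paramK cx) rep_coord_fieldK ?(paramK cx) //; exact: paramP.
Qed.

End fields.

(** * Hitchin's lemma *)

Section hitchin.
Variables (R : realType) (V : Type) (N J1 J2 J3 : V -> V).
Variables (a1 a2 a3 : V -> V -> V -> R).

(* [a x y z] stands for g(y, (nabla_x J) z), where J is almost Kaehler, and [N] for -1. *)
Lemma almost_kahler (J : V -> V) (a : V -> V -> V -> R) :
  (forall x, J (J x) = N x) ->
  (forall x y z, a x (N y) z = - a x y z) ->
  (forall x y z, a (N x) y z = - a x y z) ->
  (forall x y z, a x y z = - a x z y) ->
  (forall x y z, a x (J y) z = a x y (J z)) ->
  (forall x y z, a x y z + a y z x + a z x y = 0) ->
  forall x y z, a (J x) y z = a x (J y) z.
Proof.
move=> JJ aN aNl skew sym cyc.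
(* Let c2, c3, c4 be the cyclic identities in which J is applied to two of the three arguments. Then
   c3 + c4 - c2, combined with c1, leaves 2 a (J x) (J y) z + 2 a x y z = 0. *)
have key x y z : a (J x) (J y) z = - a x y z.
  have c1 := cyc x y z; have c2 := cyc x (J y) (J z).
  have c3 := cyc (J x) y (J z); have c4 := cyc (J x) (J y) z.
  have e1 : a x (J y) (J z) = - a x y z by rewrite -sym JJ aN.
  have e2 : a y (J z) (J x) = - a y z x by rewrite -sym JJ aN.
  have e3 : a z (J x) (J y) = - a z x y by rewrite -sym JJ aN.
  have e4 : a (J z) (J x) y = a (J z) x (J y) by exact: sym.
  have e5 : a (J y) z (J x) = a (J y) (J z) x by rewrite -sym.
  have e6 : a (J x) y (J z) = a (J x) (J y) z by rewrite -sym.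
  by lra.
move=> x y z; have := key x (J y) z; rewrite JJ aN => h.
by lra.
Qed.

Hypotheses (J11 : forall x, J1 (J1 x) = N x) (J22 : forall x, J2 (J2 x) = N x)
  (J33 : forall x, J3 (J3 x) = N x).
Hypotheses (J12 : forall x, J1 (J2 x) = J3 x) (J21 : forall x, J2 (J1 x) = N (J3 x))
  (J23 : forall x, J2 (J3 x) = J1 x) (J32 : forall x, J3 (J2 x) = N (J1 x))
  (J31 : forall x, J3 (J1 x) = J2 x) (J13 : forall x, J1 (J3 x) = N (J2 x)).
Hypothesis aN : forall x y z, [/\ a1 (N x) y z = - a1 x y z,
  a2 (N x) y z = - a2 x y z & a3 (N x) y z = - a3 x y z].
Hypothesis aNr : forall x y z, [/\ a1 x (N y) z = - a1 x y z,
  a2 x (N y) z = - a2 x y z & a3 x (N y) z = - a3 x y z].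
Hypothesis skew : forall x y z, [/\ a1 x y z = - a1 x z y,
  a2 x y z = - a2 x z y & a3 x y z = - a3 x z y].
Hypothesis sym : forall x y z, [/\ a1 x (J1 y) z = a1 x y (J1 z),
  a2 x (J2 y) z = a2 x y (J2 z) & a3 x (J3 y) z = a3 x y (J3 z)].
Hypothesis cyc : forall x y z, [/\ a1 x y z + a1 y z x + a1 z x y = 0,
  a2 x y z + a2 y z x + a2 z x y = 0 & a3 x y z + a3 y z x + a3 z x y = 0].
(** The Leibniz rule for J3 = J1 J2 and its rotations; [mulB] is the one for J3 = - J2 J1, and [sym]
    comes from differentiating J_i^2 = -1. *)
Hypothesis mulA : forall x y z, [/\ a3 x y z = a1 x y (J2 z) - a2 x (J1 y) z,
  a1 x y z = a2 x y (J3 z) - a3 x (J2 y) z &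
  a2 x y z = a3 x y (J1 z) - a1 x (J3 y) z].
Hypothesis mulB : forall x y z, [/\ a3 x y z = a1 x (J2 y) z - a2 x y (J1 z),
  a1 x y z = a2 x (J3 y) z - a3 x y (J2 z) &
  a2 x y z = a3 x (J1 y) z - a1 x y (J3 z)].

(* The instances of the hypotheses that are used come from a linear programming certificate. *)
Lemma hitchin x y z : a1 x y z = 0.
Proof.
have aN1 u v w : a1 (N u) v w = - a1 u v w by have [] := aN u v w.
have aN2 u v w : a2 (N u) v w = - a2 u v w by have [] := aN u v w.
have aN3 u v w : a3 (N u) v w = - a3 u v w by have [] := aN u v w.
have bN1 u v w : a1 u (N v) w = - a1 u v w by have [] := aNr u v w.
have bN2 u v w : a2 u (N v) w = - a2 u v w by have [] := aNr u v w.
have bN3 u v w : a3 u (N v) w = - a3 u v w by have [] := aNr u v w.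
have sk1 u v w : a1 u v w = - a1 u w v by have [] := skew u v w.
have sk2 u v w : a2 u v w = - a2 u w v by have [] := skew u v w.
have sk3 u v w : a3 u v w = - a3 u w v by have [] := skew u v w.
have cN1 u v w : a1 u v (N w) = - a1 u v w by rewrite sk1 bN1 -sk1.
have cN2 u v w : a2 u v (N w) = - a2 u v w by rewrite sk2 bN2 -sk2.
have cN3 u v w : a3 u v (N w) = - a3 u v w by rewrite sk3 bN3 -sk3.
have s1 u v w : a1 u (J1 v) w = a1 u v (J1 w) by have [] := sym u v w.
have s2 u v w : a2 u (J2 v) w = a2 u v (J2 w) by have [] := sym u v w.
have s3 u v w : a3 u (J3 v) w = a3 u v (J3 w) by have [] := sym u v w.
have k1 : forall u v w, a1 (J1 u) v w = a1 u (J1 v) w.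
  by apply: almost_kahler => // x' y' z'; have [] := cyc x' y' z'.
have k2 : forall u v w, a2 (J2 u) v w = a2 u (J2 v) w.
  by apply: almost_kahler => // x' y' z'; have [] := cyc x' y' z'.
have k3 : forall u v w, a3 (J3 u) v w = a3 u (J3 v) w.
  by apply: almost_kahler => // x' y' z'; have [] := cyc x' y' z'.
have JE := (J11, J22, J33, J12, J21, J23, J32, J31, J13).
have NE := (aN1, aN2, aN3, bN1, bN2, bN3, cN1, cN2, cN3).
have [h0 _ _] := mulB x (J2 y) z.
have h1 := k3 (J3 x) (J2 y) z.
have h2 := k2 (J3 x) (J3 y) (J1 z).
have [_ _ h3] := mulB (J1 x) (J3 y) (J1 z).
have h4 := s1 (J1 x) y z.
have [_ _ h5] := mulA (J1 x) (J2 y) z.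
have h6 := k1 x y (J1 z).
have h7 := k2 (J2 x) (J2 y) (J1 z).
have h8 := s1 x y (J1 z).
have h9 := k2 x (J3 y) (J2 z).
have h10 := s2 x (J1 y) z.
have h11 := k2 (J3 x) (J2 y) z.
have h12 := s2 (J3 x) (J2 y) z.
have h13 := k3 (J2 x) (J2 y) (J1 z).
have [_ h14 _] := mulB (J3 x) (J1 y) (J2 z).
have [_ h15 _] := mulA (J3 x) (J1 y) (J2 z).
have [h16 _ _] := mulA (J1 x) (J3 y) z.
have h17 := k3 (J1 x) y z.
have [_ h18 _] := mulB x y z.
have h19 := k3 (J3 x) y (J2 z).
have [_ _ h20] := mulB (J2 x) y (J1 z).
have [_ h21 _] := mulB (J2 x) y (J2 z).
rewrite ?JE ?NE in h0 h1 h2 h3 h4 h5 h6 h7 h8 h9 h10 h11 h12 h13 h14 h15 h16 h17 h18 h19 h20 h21.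
lra.
Qed.

End hitchin.

(** * The Koszul form *)

Section even_triples.

(** The even permutations of three letters are the rotations: composed with the inverse of the
    rotation having the same value at 0, an even permutation fixes 0, and exchanging the other two
    letters would be odd. *)
Lemma even_tripleP (i j k : 'I_3) : even_triple i j k <-> j = i + 1 /\ k = i + 2.
Proof.
have [r [r0 r1 r2 er]] : exists r : 'S_3, [/\ r 0 = 1, r 1 = 2, r 2 = 0 & ~~ odd_perm r].
  exists (tperm 0%R 1%R * tperm 0%R 2%R)%g; rewrite odd_permM !odd_tperm !permM; split => //.
  - by rewrite tpermL tpermD.
  - by rewrite tpermR tpermL.
  - by rewrite (@tpermD _ 0 1 2) // tpermR.
have ord3 (x : 'I_3) : [\/ x = 0, x = 1 | x = 2].
  by case: x => -[|[|[|//]]] p; [constructor 1|constructor 2|constructor 3]; apply: val_inj.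
have rot (x : 'I_3) : exists s : 'S_3, [/\ ~~ odd_perm s, s 0 = x, s 1 = x + 1 & s 2 = x + 2].
  case: (ord3 x) => ->.
  - by exists 1%g; rewrite odd_perm1 !perm1; split => //; apply: val_inj.
  - by exists r; rewrite r0 r1 r2; split => //; apply: val_inj.
  - exists (r * r)%g; rewrite odd_permM (negbTE er) !permM r0 r1 r2 r0.
    by split => //; apply: val_inj.
split=> [[s es [si sj sk]]|[-> ->]]; last first.
  by have [s [es s0 s1 s2]] := rot i; exists s.
have [t [et t0 t1 t2]] := rot i.
pose u : 'S_3 := (s * t^-1)%g.
have eu : ~~ odd_perm u by rewrite odd_permM odd_permV (negbTE es) (negbTE et).
have u0 : u 0 = 0 by rewrite permM si -t0 permK.
have u1 : u 1 = 1.
  case: (ord3 (u 1)) => // u1.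
    by have := @perm_inj _ u 1 0; rewrite u0 u1 => /(_ erefl).
  have u2 : u 2 = 1.
    case: (ord3 (u 2)) => // u2.
      by have := @perm_inj _ u 2 0; rewrite u0 u2 => /(_ erefl).
    by have := @perm_inj _ u 2 1; rewrite u1 u2 => /(_ erefl).
  have uE : u = tperm 1 2.
    apply/permP => x; case: (ord3 x) => ->; first by rewrite u0 tpermD.
      by rewrite u1 tpermL.
    by rewrite u2 tpermR.
  by move: eu; rewrite uE odd_tperm.
have u2 : u 2 = 2.
  case: (ord3 (u 2)) => // u2.
    by have := @perm_inj _ u 2 0; rewrite u0 u2 => /(_ erefl).
  by have := @perm_inj _ u 2 1; rewrite u1 u2 => /(_ erefl).
split; first by rewrite -sj -t1 -{2}u1 permM permKV.
by rewrite -sk -t2 -{2}u2 permM permKV.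
Qed.

Lemma even_triple_rot (i : 'I_3) : even_triple i (i + 1) (i + 2).
Proof. by apply/even_tripleP. Qed.

End even_triples.

Section metric.
Variables (R : realType) (m : nat) (M : manifold R m) (g : bilinfield M).
Hypothesis hg : riemannian_metric g.
Implicit Types (p q : M) (X Y Z : vfield M) (f : M -> R).

Lemma metricC q v w : g q v w = g q w v. Proof. exact: (Defs.metric_sym hg). Qed.

Lemma metricDl q u v w : g q (u + v) w = g q u w + g q v w.
Proof. by have := metric_linear hg q w 1 u v; rewrite scale1r mul1r. Qed.

Lemma metricZl q a v w : g q (a *: v) w = a * g q v w.
Proof.
have g0 : g q 0 w = 0.
  have := metric_linear hg q w 1 0 0; rewrite scale1r addr0 mul1r => /eqP.
  by rewrite -subr_eq0 opprD addNKr oppr_eq0 => /eqP.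
by have := metric_linear hg q w a v 0; rewrite !addr0 g0 addr0.
Qed.

Lemma metricNl q v w : g q (- v) w = - g q v w.
Proof. by rewrite -scaleN1r metricZl mulN1r. Qed.

Lemma metric0l q w : g q 0 w = 0.
Proof. by rewrite -(scale0r 0) metricZl mul0r. Qed.

Lemma metricDr q u v w : g q w (u + v) = g q w u + g q w v.
Proof. by rewrite metricC metricDl !(metricC q w). Qed.

Lemma metricZr q a v w : g q w (a *: v) = a * g q w v.
Proof. by rewrite metricC metricZl (metricC q w). Qed.

Lemma metricNr q v w : g q w (- v) = - g q w v.
Proof. by rewrite metricC metricNl (metricC q w). Qed.

Lemma metric0r q w : g q w 0 = 0.
Proof. by rewrite metricC metric0l. Qed.

Lemma metric_scalar_r q v : scalar (g q v).
Proof. by move=> a u w; rewrite metricDr metricZr. Qed.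

Lemma metric_nondeg q v : (forall w, g q v w = 0) -> v = 0.
Proof.
move=> h; apply/eqP; apply: contraT => v0.
by have := metric_pos hg q v0; rewrite h ltxx.
Qed.

Lemma smooth_metric X Y : smooth_vfield X -> smooth_vfield Y ->
  smooth_fun (fun q => g q (X q) (Y q)).
Proof.
apply: smooth_bilin_app; [exact: metric_smooth hg|exact: metric_linear hg|exact: metric_scalar_r].
Qed.

Lemma vfield_through p v : exists2 X : vfield M, smooth_vfield X & X p = v.
Proof.
have [X [sX near_]] := vfield_germ (dom_self p) (smooth_map_cst (coords_cod p) v).
exists X => //; have := nbhs_singleton near_.
by rewrite local_rep_self.
Qed.

Lemma metric_eq_fields p u v :
  (forall Z, smooth_vfield Z -> g p u (Z p) = g p v (Z p)) -> u = v.
Proof.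
move=> h; apply/eqP; rewrite -subr_eq0; apply/eqP; apply: (@metric_nondeg p) => w.
have [Z sZ <-] := vfield_through p w.
by rewrite metricDl metricNl h // subrr.
Qed.

End metric.

(* [K X Y Z p] stands for g(nabla_X Y, Z) at p, nabla the Levi-Civita connection,
   [D] for the derivative of functions and [L] for the bracket.  Keeping them
   abstract prevents unification from unfolding derivatives. *)
Record koszul_form (R : realType) (m : nat) (M : manifold R m) (g : bilinfield M)
    (D : vfield M -> (M -> R) -> M -> R) (L : vfield M -> vfield M -> vfield M)
    (K : vfield M -> vfield M -> vfield M -> M -> R) : Prop := {
  K_torsion : forall X Y Z p, K X Y Z p - K Y X Z p = g p (L X Y p) (Z p);
  K_metric : forall X Y Z p, K X Y Z p + K X Z Y p = D X (fun q => g q (Y q) (Z q)) p;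
  K_Dm : forall X Y Y' Z p, smooth_vfield X -> smooth_vfield Y -> smooth_vfield Y' ->
    smooth_vfield Z -> K X (fun q => Y q + Y' q) Z p = K X Y Z p + K X Y' Z p;
  K_Zm : forall X f Y Z p, smooth_fun f -> smooth_vfield X -> smooth_vfield Y ->
    smooth_vfield Z -> K X (fun q => f q *: Y q) Z p =
      D X f p * g p (Y p) (Z p) + f p * K X Y Z p;
  K_Dr : forall X Y Z Z' p, smooth_vfield X -> smooth_vfield Y -> smooth_vfield Z ->
    smooth_vfield Z' -> K X Y (fun q => Z q + Z' q) p = K X Y Z p + K X Y Z' p;
  K_Zr : forall X Y f Z p, smooth_fun f -> smooth_vfield X -> smooth_vfield Y ->
    smooth_vfield Z -> K X Y (fun q => f q *: Z q) p = f p * K X Y Z p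
}.

Record derivation_rules (R : realType) (m : nat) (M : manifold R m)
    (D : vfield M -> (M -> R) -> M -> R) (L : vfield M -> vfield M -> vfield M) : Prop := {
  D_add : forall X f h q, smooth_fun f -> smooth_fun h ->
    D X (fun q => f q + h q) q = D X f q + D X h q;
  D_mul : forall X f h q, smooth_fun f -> smooth_fun h ->
    D X (fun q => f q * h q) q = f q * D X h q + h q * D X f q;
  D_cst : forall X c q, D X (fun=> c) q = 0;
  D_addl : forall X Y f q, smooth_fun f ->
    D (fun q => X q + Y q) f q = D X f q + D Y f q;
  D_scalel : forall h X f q, smooth_fun f -> D (fun q => h q *: X q) f q = h q * D X f q;
  L_anti : forall X Y q, L Y X q = - L X Y q;
  L_add : forall X Y Z q, smooth_vfield X -> smooth_vfield Y -> smooth_vfield Z ->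
    L X (fun q => Y q + Z q) q = L X Y q + L X Z q;
  L_scale : forall X f Y q, smooth_fun f -> smooth_vfield X -> smooth_vfield Y ->
    L X (fun q => f q *: Y q) q = D X f q *: Y q + f q *: L X Y q
}.

Lemma dirder_lie_rules (R : realType) (m : nat) (M : manifold R m) :
  derivation_rules (@dirder R m M) (@lie R m M).
Proof.
split; [exact: dirderD|exact: dirderM|exact: dirder_cst|exact: dirderDl|exact: dirderZl
  |exact: lieC|exact: lieDr|exact: lieZr].
Qed.

Section koszul.
Variables (R : realType) (m : nat) (M : manifold R m) (g : bilinfield M).
Hypothesis hg : riemannian_metric g.
Variables (D : vfield M -> (M -> R) -> M -> R) (L : vfield M -> vfield M -> vfield M).
Hypothesis rules : derivation_rules D L.
Implicit Types (p q : M) (X Y Z : vfield M) (f : M -> R).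

(** Koszul's formula for 2 g(nabla_X Y, Z). Taken as a definition, it makes the covariant identities
    available without any connection. *)
Definition koszul2 X Y Z p : R :=
  D X (fun q => g q (Y q) (Z q)) p + D Y (fun q => g q (X q) (Z q)) p
  - D Z (fun q => g q (X q) (Y q)) p + g p (L X Y p) (Z p)
  - g p (L X Z p) (Y p) - g p (L Y Z p) (X p).

Definition koszul X Y Z p : R := koszul2 X Y Z p / 2.

Lemma metric_swap Y Z : (fun q => g q (Z q) (Y q)) = (fun q => g q (Y q) (Z q)).
Proof. by apply/funext => q; exact: (metricC hg). Qed.

Lemma koszul_torsion X Y Z p :
  koszul X Y Z p - koszul Y X Z p = g p (L X Y p) (Z p).
Proof.
rewrite /koszul /koszul2 (metric_swap X Y) (L_anti rules X Y) (metricNl hg).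
by field.
Qed.

Lemma koszul_metric X Y Z p :
  koszul X Y Z p + koszul X Z Y p = D X (fun q => g q (Y q) (Z q)) p.
Proof.
rewrite /koszul /koszul2 (metric_swap Y Z) (L_anti rules Y Z) (metricNl hg).
by field.
Qed.

Lemma koszulDm X Y Y' Z p : smooth_vfield X -> smooth_vfield Y -> smooth_vfield Y' ->
  smooth_vfield Z ->
  koszul X (fun q => Y q + Y' q) Z p = koszul X Y Z p + koszul X Y' Z p.
Proof.
move=> sX sY sY' sZ; rewrite /koszul /koszul2.
have E1 : (fun q => g q (Y q + Y' q) (Z q)) = (fun q => g q (Y q) (Z q) + g q (Y' q) (Z q)).
  by apply/funext => q; rewrite (metricDl hg).
have E2 : (fun q => g q (X q) (Y q + Y' q)) = (fun q => g q (X q) (Y q) + g q (X q) (Y' q)).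
  by apply/funext => q; rewrite (metricDr hg).
have l1 := L_add rules p sX sY sY'; have l2 := L_add rules p sZ sY sY'.
have l3 : L (fun q => Y q + Y' q) Z p = L Y Z p + L Y' Z p.
  by rewrite (L_anti rules Z) l2 (L_anti rules Z Y) (L_anti rules Z Y') opprD.
have d1 := D_add rules X p (smooth_metric hg sY sZ) (smooth_metric hg sY' sZ).
have d2 := D_add rules Z p (smooth_metric hg sX sY) (smooth_metric hg sX sY').
have d3 := D_addl rules Y Y' p (smooth_metric hg sX sZ).
rewrite E1 E2 d1 d2 d3 l1 l3 (metricDr hg p (Y p) (Y' p) (L X Z p)).
rewrite (metricDl hg p (L X Y p) (L X Y' p) (Z p)) (metricDl hg p (L Y Z p) (L Y' Z p) (X p)).
by field.
Qed.

Lemma koszulZm X f Y Z p : smooth_fun f -> smooth_vfield X -> smooth_vfield Y ->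
  smooth_vfield Z ->
  koszul X (fun q => f q *: Y q) Z p =
    D X f p * g p (Y p) (Z p) + f p * koszul X Y Z p.
Proof.
move=> sf sX sY sZ; rewrite /koszul /koszul2.
have E1 : (fun q => g q (f q *: Y q) (Z q)) = (fun q => f q * g q (Y q) (Z q)).
  by apply/funext => q; rewrite (metricZl hg).
have E2 : (fun q => g q (X q) (f q *: Y q)) = (fun q => f q * g q (X q) (Y q)).
  by apply/funext => q; rewrite (metricZr hg).
have l1 := L_scale rules p sf sX sY; have l2 := L_scale rules p sf sZ sY.
have l3 : L (fun q => f q *: Y q) Z p = - (D Z f p *: Y p) + f p *: L Y Z p.
  by rewrite (L_anti rules Z) l2 (L_anti rules Z Y) opprD scalerN.
have d1 := D_mul rules X p sf (smooth_metric hg sY sZ).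
have d2 := D_mul rules Z p sf (smooth_metric hg sX sY).
have d3 := D_scalel rules f Y p (smooth_metric hg sX sZ).
rewrite E1 E2 d1 d2 d3 l1 l3 (metricZr hg p (f p) (Y p) (L X Z p)).
rewrite (metricDl hg p (D X f p *: Y p) (f p *: L X Y p)).
rewrite (metricDl hg p (- (D Z f p *: Y p)) (f p *: L Y Z p)).
rewrite (metricNl hg p (D Z f p *: Y p)) (metricZl hg p (D X f p)) (metricZl hg p (D Z f p)).
rewrite (metricZl hg p (f p) (L X Y p)) (metricZl hg p (f p) (L Y Z p)) (metricC hg p (Y p) (X p)).
by field.
Qed.

Lemma koszulDr X Y Z Z' p : smooth_vfield X -> smooth_vfield Y -> smooth_vfield Z ->
  smooth_vfield Z' ->
  koszul X Y (fun q => Z q + Z' q) p = koszul X Y Z p + koszul X Y Z' p.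
Proof.
move=> sX sY sZ sZ'.
have h1 := koszul_metric X Y (fun q => Z q + Z' q) p.
have h2 := koszul_metric X Y Z p; have h3 := koszul_metric X Y Z' p.
have E2 : (fun q => g q (Y q) (Z q + Z' q)) = (fun q => g q (Y q) (Z q) + g q (Y q) (Z' q)).
  by apply/funext => q; rewrite (metricDr hg).
rewrite E2 (D_add rules X p (smooth_metric hg sY sZ) (smooth_metric hg sY sZ')) in h1.
rewrite (koszulDm p sX sZ sZ' sY) in h1.
by lra.
Qed.

Lemma koszulZr X Y f Z p : smooth_fun f -> smooth_vfield X -> smooth_vfield Y ->
  smooth_vfield Z ->
  koszul X Y (fun q => f q *: Z q) p = f p * koszul X Y Z p.
Proof.
move=> sf sX sY sZ.
have h1 := koszul_metric X Y (fun q => f q *: Z q) p.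
have h2 := koszul_metric X Y Z p.
have E2 : (fun q => g q (Y q) (f q *: Z q)) = (fun q => f q * g q (Y q) (Z q)).
  by apply/funext => q; rewrite (metricZr hg).
rewrite E2 (D_mul rules X p sf (smooth_metric hg sY sZ)) in h1.
rewrite (koszulZm p sf sX sZ sY) (metricC hg p (Z p)) in h1.
have := congr1 (fun t => f p * t) h2; rewrite mulrDr; lra.
Qed.

Lemma koszul_formP : koszul_form g D L koszul.
Proof.
split; [exact: koszul_torsion|exact: koszul_metric|exact: koszulDm|exact: koszulZm
  |exact: koszulDr|exact: koszulZr].
Qed.

End koszul.

Section koszul_form_theory.
Variables (R : realType) (m : nat) (M : manifold R m) (g : bilinfield M).
Hypothesis hg : riemannian_metric g.
Variables (D : vfield M -> (M -> R) -> M -> R) (L : vfield M -> vfield M -> vfield M).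
Hypothesis rules : derivation_rules D L.
Variable K : vfield M -> vfield M -> vfield M -> M -> R.
Hypothesis hK : koszul_form g D L K.
Implicit Types (p q : M) (X Y Z : vfield M) (f : M -> R).

Lemma K_Nm X Y Z p : smooth_vfield X -> smooth_vfield Y -> smooth_vfield Z ->
  K X (fun q => - Y q) Z p = - K X Y Z p.
Proof.
move=> sX sY sZ; have h := K_Zm hK p (@smooth_fun_cst R m M (-1)) sX sY sZ.
have -> : (fun q => - Y q) = (fun q => -1 *: Y q) by apply/funext => q; rewrite scaleN1r.
by rewrite h (D_cst rules) mul0r add0r mulN1r.
Qed.

Lemma K_0m X Z p : smooth_vfield X -> smooth_vfield Z -> K X (fun q => 0) Z p = 0.
Proof.
move=> sX sZ; have h := K_Zm hK p (@smooth_fun_cst R m M 0) sX sX sZ.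
have -> : (fun q => 0) = (fun q => (0 : R) *: X q) by apply/funext => q; rewrite scale0r.
by rewrite h (D_cst rules) !mul0r addr0.
Qed.

Lemma K_Nr X Y Z p : smooth_vfield X -> smooth_vfield Y -> smooth_vfield Z ->
  K X Y (fun q => - Z q) p = - K X Y Z p.
Proof.
move=> sX sY sZ; have h := K_Zr hK p (@smooth_fun_cst R m M (-1)) sX sY sZ.
have -> : (fun q => - Z q) = (fun q => -1 *: Z q) by apply/funext => q; rewrite scaleN1r.
by rewrite h mulN1r.
Qed.

Lemma K_Nl X Y Z p : smooth_vfield X -> smooth_vfield Y -> smooth_vfield Z ->
  K (fun q => - X q) Y Z p = - K X Y Z p.
Proof.
move=> sX sY sZ.
have h1 := K_torsion hK (fun q => - X q) Y Z p; have h2 := K_torsion hK X Y Z p.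
have h3 := K_Nm p sY sX sZ.
have E : (fun q => - X q) = (fun q => -1 *: X q) by apply/funext => q; rewrite scaleN1r.
have h4 : L (fun q => - X q) Y p = - L X Y p.
  rewrite (L_anti rules Y) E (L_scale rules p (@smooth_fun_cst R m M (-1)) sY sX).
  by rewrite (D_cst rules) scale0r add0r scaleN1r opprK (L_anti rules X).
rewrite h4 (metricNl hg) in h1.
by lra.
Qed.

(** Since the torsion vanishes, the brackets in d Phi are absorbed and d Phi becomes the cyclic sum
    of the covariant derivative of Phi. *)
Lemma d2_K (phi : endofield M) X Y Z p : smooth_endofield phi ->
  (forall q v w, g q (phi q v) w = - g q v (phi q w)) ->
  smooth_vfield X -> smooth_vfield Y -> smooth_vfield Z ->
  let a X Y Z := K X (appv phi Z) Y p + K X Z (appv phi Y) p in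
  D X (fun q => g q (Y q) (phi q (Z q))) p
  + D Y (fun q => g q (Z q) (phi q (X q))) p
  + D Z (fun q => g q (X q) (phi q (Y q))) p
  - g p (L X Y p) (phi p (Z p)) - g p (L Y Z p) (phi p (X p)) - g p (L Z X p) (phi p (Y p)) =
  a X Y Z + a Y Z X + a Z X Y.
Proof.
move=> sphi skew sX sY sZ /=.
have h1 := K_metric hK X Y (appv phi Z) p.
have h2 := K_metric hK Y Z (appv phi X) p.
have h3 := K_metric hK Z X (appv phi Y) p.
have t1 := K_torsion hK X Y (appv phi Z) p.
have t2 := K_torsion hK Y Z (appv phi X) p.
have t3 := K_torsion hK Z X (appv phi Y) p.
rewrite /appv in h1 h2 h3 t1 t2 t3 *.
by lra.
Qed.

Definition has_metric_torsion (nabla : vfield M -> vfield M -> vfield M) :=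
  (forall X Y, smooth_vfield X -> smooth_vfield Y -> forall p,
    nabla X Y p - nabla Y X p = L X Y p) /\
  (forall X Y Z, smooth_vfield X -> smooth_vfield Y -> smooth_vfield Z -> forall p,
    D X (fun q => g q (Y q) (Z q)) p = g p (nabla X Y p) (Z p) + g p (Y p) (nabla X Z p)).

(** Uniqueness of the Levi-Civita connection: the difference of the two sides is symmetric in the
    first two arguments and skew in the last two, hence zero. *)
Lemma K_nabla nabla X Y Z p : has_metric_torsion nabla ->
  smooth_vfield X -> smooth_vfield Y -> smooth_vfield Z ->
  g p (nabla X Y p) (Z p) = K X Y Z p.
Proof.
move=> [tor met] sX sY sZ.
have key (A B : vfield M) C : smooth_vfield A -> smooth_vfield B -> smooth_vfield C ->
    g p (nabla A B p) (C p) - g p (nabla B A p) (C p) = K A B C p - K B A C p.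
  by move=> sA sB sC; rewrite (K_torsion hK) -(tor A B sA sB p) (metricDl hg) (metricNl hg).
have key2 (A B : vfield M) C : smooth_vfield A -> smooth_vfield B -> smooth_vfield C ->
    g p (nabla A B p) (C p) + g p (nabla A C p) (B p) = K A B C p + K A C B p.
  by move=> sA sB sC; rewrite (K_metric hK) (met A B C sA sB sC p) (metricC hg p (B p)).
have := key X Y Z sX sY sZ; have := key Y Z X sY sZ sX; have := key Z X Y sZ sX sY.
have := key2 X Y Z sX sY sZ; have := key2 Y Z X sY sZ sX; have := key2 Z X Y sZ sX sY.
by lra.
Qed.

End koszul_form_theory.

(** * Almost 3-contact metric structures *)

Lemma even_rot (i j k : 'I_3) : even_triple i j k -> even_triple j k i.
Proof.
move=> /even_tripleP [-> ->]; apply/even_tripleP.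
by split; [rewrite -addrA|apply: val_inj; case: i => -[|[|[]]]].
Qed.

Section almost_contact.
Variables (R : realType) (m : nat) (M : manifold R m) (phi : endofield M)
  (xi : vfield M) (eta : oneform M) (g : bilinfield M).
Hypothesis hc : almost_contact_metric phi xi eta g.
Let hg := acm_metric hc.

(** phi^2 xi = 0; applying the formula for phi^2 to phi xi shows that phi xi = c xi, and one more
    application of phi followed by eta gives c^2 = 0. *)
Lemma phi_xi p : phi p (xi p) = 0.
Proof.
have h0 : phi p (phi p (xi p)) = 0.
  by rewrite (acm_phi2 hc) (acm_eta_xi hc) scale1r addNr.
have h1 := acm_phi2 hc p (phi p (xi p)); rewrite h0 linear0 in h1.
have h2 : phi p (xi p) = eta p (phi p (xi p)) *: xi p.
  by apply/esym/eqP; rewrite -subr_eq0 addrC -h1.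
have h3 : eta p (phi p (xi p)) = 0.
  have := congr1 (fun v => eta p (phi p v)) h2.
  rewrite h0 !linear0 linearZ /= linearZ /= => /esym/eqP.
  by rewrite /GRing.scale /= mulf_eq0 orbb => /eqP.
by rewrite h2 h3 scale0r.
Qed.

Lemma eta_phi p v : eta p (phi p v) = 0.
Proof.
have h1 := acm_phi2 hc p (phi p v).
have h2 : phi p (phi p (phi p v)) = - phi p v.
  by rewrite (acm_phi2 hc p v) linearD linearN linearZ /= phi_xi scaler0 addr0.
move: h1; rewrite h2 => /eqP; rewrite -subr_eq0 opprD addNKr oppr_eq0 => /eqP.
move/(congr1 (eta p)); rewrite linear0 linearZ /= (acm_eta_xi hc) => h.
by rewrite -[LHS]mulr1.
Qed.

Lemma metric_xi p v : g p v (xi p) = eta p v.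
Proof.
have := acm_compat hc p v (xi p); rewrite phi_xi (metric0r hg) (acm_eta_xi hc) mulr1.
by move=> /esym/eqP; rewrite subr_eq0 => /eqP.
Qed.

Lemma phi_skew p v w : g p (phi p v) w = - g p v (phi p w).
Proof.
have := acm_compat hc p v (phi p w).
rewrite (acm_phi2 hc) (metricDr hg) (metricNr hg) (metricZr hg) metric_xi !eta_phi.
by rewrite !mulr0 addr0 subr0 => <-; rewrite opprK.
Qed.

End almost_contact.

Section almost_3_contact.
Variables (R : realType) (m : nat) (M : manifold R m) (phi : 'I_3 -> endofield M)
  (xi : 'I_3 -> vfield M) (eta : 'I_3 -> oneform M) (g : bilinfield M).
Hypothesis h3 : almost_3_contact_metric phi xi eta g.
Let hc i := a3cm_acm h3 i.
Let hg := acm_metric (hc 0).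
Variables (i j k : 'I_3).
Hypothesis e : even_triple i j k.

Lemma eta_xi_self p : eta i p (xi i p) = 1. Proof. exact: acm_eta_xi (hc i) p. Qed.

(** eta_i(xi_j) is symmetric in i and j, both values being g(xi_i, xi_j), and skew by the
    expressions of eta_j and xi_j through phi_k. *)
Lemma eta_xi_next p : eta i p (xi j p) = 0.
Proof.
have [_ E1] := a3cm_eta h3 (even_rot (even_rot e)) p (xi i p).
have [E2 _] := a3cm_xi h3 (even_rot (even_rot e)) p.
have E3 : eta i p (xi j p) = eta j p (xi i p).
  by rewrite -(metric_xi (hc i)) -(metric_xi (hc j)) (metricC hg).
rewrite -E2 in E1; lra.
Qed.

Lemma eta_xi_prev p : eta j p (xi i p) = 0.
Proof.
by rewrite -(metric_xi (hc j)) (metricC hg) (metric_xi (hc i)) eta_xi_next.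
Qed.

Lemma phi_mul p v : phi i p (phi j p v) = phi k p v + eta j p v *: xi i p.
Proof. by have [-> _] := a3cm_phi h3 e p v; rewrite subrK. Qed.

Lemma phi_mulC p v : phi j p (phi i p v) = - phi k p v + eta i p v *: xi j p.
Proof. by have [_ ->] := a3cm_phi h3 e p v; rewrite opprD opprK subrK. Qed.

Lemma phi_xi_next p : phi i p (xi j p) = xi k p.
Proof. by have [-> _] := a3cm_xi h3 e p. Qed.

Lemma phi_xi_prev p : phi j p (xi i p) = - xi k p.
Proof. by have [_ ->] := a3cm_xi h3 e p; rewrite opprK. Qed.

Lemma eta_phi_next p v : eta i p (phi j p v) = eta k p v.
Proof. by have [-> _] := a3cm_eta h3 e p v. Qed.

Lemma eta_phi_prev p v : eta j p (phi i p v) = - eta k p v.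
Proof. by have [_ ->] := a3cm_eta h3 e p v; rewrite opprK. Qed.

End almost_3_contact.

Section covariant_derivatives.
Variables (R : realType) (m : nat) (M : manifold R m) (phi : 'I_3 -> endofield M)
  (xi : 'I_3 -> vfield M) (eta : 'I_3 -> oneform M) (g : bilinfield M).
Hypothesis h3 : almost_3_contact_metric phi xi eta g.
Let hc i := a3cm_acm h3 i.
Let hg := acm_metric (hc 0).
Variables (D : vfield M -> (M -> R) -> M -> R) (L : vfield M -> vfield M -> vfield M).
Hypothesis rules : derivation_rules D L.
Variable K : vfield M -> vfield M -> vfield M -> M -> R.
Hypothesis hK : koszul_form g D L K.
Implicit Types (p q : M) (X Y Z W : vfield M) (f : M -> R).

(* [dphi i X Y Z] is g(Y, (nabla_X phi_i) Z) and [dxi i X Y] is g(nabla_X xi_i, Y). *)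
Definition dphi i X Y Z p : R := K X (appv (phi i) Z) Y p + K X Z (appv (phi i) Y) p.
Definition dxi i X Y p : R := K X (xi i) Y p.

Lemma smooth_phi i X : smooth_vfield X -> smooth_vfield (appv (phi i) X).
Proof. exact: smooth_appv (acm_phi_smooth (hc i)). Qed.

Lemma smooth_xi i : smooth_vfield (xi i). Proof. exact: acm_xi_smooth (hc i). Qed.

Lemma smooth_eta i X : smooth_vfield X -> smooth_fun (fun q => eta i q (X q)).
Proof. exact: smooth_oneform_app (acm_eta_smooth (hc i)). Qed.

Lemma K_DZr X Y f Z W p : smooth_fun f -> smooth_vfield X -> smooth_vfield Y ->
  smooth_vfield Z -> smooth_vfield W ->
  K X Y (fun q => Z q + f q *: W q) p = K X Y Z p + f p * K X Y W p.
Proof.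
move=> sf sX sY sZ sW.
by rewrite (K_Dr hK p sX sY sZ (smooth_vfieldZ sf sW)) (K_Zr hK p sf sX sY sW).
Qed.

Lemma K_DZm X Y f Z W p : smooth_fun f -> smooth_vfield X -> smooth_vfield Y ->
  smooth_vfield Z -> smooth_vfield W ->
  K X (fun q => Z q + f q *: W q) Y p =
    K X Z Y p + (D X f p * g p (W p) (Y p) + f p * K X W Y p).
Proof.
move=> sf sX sY sZ sW.
by rewrite (K_Dm hK p sX sZ (smooth_vfieldZ sf sW) sY) (K_Zm hK p sf sX sW sY).
Qed.

Lemma dphi_skew i X Y Z p : smooth_vfield X -> smooth_vfield Y -> smooth_vfield Z ->
  dphi i X Y Z p = - dphi i X Z Y p.
Proof.
move=> sX sY sZ; rewrite /dphi.
have h1 := K_metric hK X (appv (phi i) Z) Y p.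
have h2 := K_metric hK X (appv (phi i) Y) Z p.
have E : (fun q => g q (appv (phi i) Y q) (Z q)) =
    (fun q => -1 * g q (appv (phi i) Z q) (Y q)).
  by apply/funext => q; rewrite /appv (phi_skew (hc i)) (metricC hg) mulN1r.
rewrite E (D_mul rules X p (@smooth_fun_cst R m M (-1)) (smooth_metric hg (smooth_phi i sZ) sY)) in h2.
rewrite (D_cst rules) in h2; lra.
Qed.

Lemma dphi_DZ i X Y f W Z p : smooth_fun f -> smooth_vfield X -> smooth_vfield Y ->
  smooth_vfield W -> smooth_vfield Z ->
  dphi i X (fun q => Y q + f q *: W q) Z p = dphi i X Y Z p + f p * dphi i X W Z p.
Proof.
move=> sf sX sY sW sZ; rewrite /dphi.
have E : appv (phi i) (fun q => Y q + f q *: W q) =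
    (fun q => appv (phi i) Y q + f q *: appv (phi i) W q).
  by apply/funext => q; rewrite /appv linearD linearZ.
have h1 := K_DZr p sf sX (smooth_phi i sZ) sY sW.
have h2 := K_DZr p sf sX sZ (smooth_phi i sY) (smooth_phi i sW).
by rewrite E h1 h2; ring.
Qed.

Lemma dxi_DZ i X Y f W p : smooth_fun f -> smooth_vfield X -> smooth_vfield Y ->
  smooth_vfield W ->
  dxi i X (fun q => Y q + f q *: W q) p = dxi i X Y p + f p * dxi i X W p.
Proof. by move=> sf sX sY sW; exact: (K_DZr p sf sX (smooth_xi i) sY sW). Qed.

Lemma D_eta i X Z p : K X (xi i) Z p + K X Z (xi i) p = D X (fun q => eta i q (Z q)) p.
Proof.
have h := K_metric hK X Z (xi i) p.
have E : (fun q => g q (Z q) (xi i q)) = (fun q => eta i q (Z q)).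
  by apply/funext => q; rewrite (metric_xi (hc i)).
by rewrite E in h; lra.
Qed.

Lemma dxi_self i X p : dxi i X (xi i) p = 0.
Proof.
have h := D_eta i X (xi i) p.
have E : (fun q => eta i q (xi i q)) = (fun=> 1).
  by apply/funext => q; exact: (eta_xi_self h3).
by rewrite E (D_cst rules) in h; rewrite /dxi; lra.
Qed.

(** The covariant derivative of phi^2 = -1 + eta tensor xi, paired with Y. *)
Lemma dphi_sym i X Y Z p : smooth_vfield X -> smooth_vfield Y -> smooth_vfield Z ->
  dphi i X Y (appv (phi i) Z) p - dphi i X (appv (phi i) Y) Z p =
  eta i p (Z p) * dxi i X Y p + eta i p (Y p) * dxi i X Z p.
Proof.
move=> sX sY sZ; rewrite /dphi /dxi.
have E W : appv (phi i) (appv (phi i) W) = (fun q => - W q + eta i q (W q) *: xi i q).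
  by apply/funext => q; exact: (acm_phi2 (hc i)).
have h1 := K_DZm p (smooth_eta i sZ) sX sY (smooth_vfieldN sZ) (smooth_xi i).
have h2 := K_DZr p (smooth_eta i sY) sX sZ (smooth_vfieldN sY) (smooth_xi i).
have h3' := D_eta i X Z p.
rewrite (K_Nm rules hK p sX sZ sY) (metricC hg p (xi i p)) (metric_xi (hc i)) in h1.
rewrite (K_Nr hK p sX sZ sY) in h2.
by rewrite !E h1 h2 -h3'; ring.
Qed.

Lemma dphi_xi i X Y p : smooth_vfield X -> smooth_vfield Y ->
  dphi i X Y (xi i) p = dxi i X (appv (phi i) Y) p.
Proof.
move=> sX sY; rewrite /dphi /dxi.
have E : appv (phi i) (xi i) = (fun=> 0) by apply/funext => q; exact: (phi_xi (hc i)).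
by rewrite E (K_0m rules hK p sX sY) add0r.
Qed.

Section triple.
Variables (i j k : 'I_3).
Hypothesis e : even_triple i j k.

Lemma dxi_antisym X p : dxi i X (xi j) p = - dxi j X (xi i) p.
Proof.
have h := D_eta i X (xi j) p.
have E : (fun q => eta i q (xi j q)) = (fun=> 0).
  by apply/funext => q; exact: (eta_xi_next h3 e).
by rewrite E (D_cst rules) in h; rewrite /dxi; lra.
Qed.

Lemma dphi_xi_next X Y p : smooth_vfield X -> smooth_vfield Y ->
  dphi i X Y (xi j) p = dxi k X Y p + dxi j X (appv (phi i) Y) p.
Proof.
move=> sX sY; rewrite /dphi /dxi.
have -> // : appv (phi i) (xi j) = xi k.
by apply/funext => q; exact: (phi_xi_next h3 e).
Qed.

Lemma dphi_xi_prev X Y p : smooth_vfield X -> smooth_vfield Y ->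
  dphi j X Y (xi i) p = - dxi k X Y p + dxi i X (appv (phi j) Y) p.
Proof.
move=> sX sY; rewrite /dphi /dxi.
have -> : appv (phi j) (xi i) = (fun q => - xi k q).
  by apply/funext => q; exact: (phi_xi_prev h3 e).
by rewrite (K_Nm rules hK p sX (smooth_xi k) sY).
Qed.

(** The covariant derivative of phi_i phi_j = phi_k + eta_j tensor xi_i, paired with Y. *)
Lemma dphi_mul X Y Z p : smooth_vfield X -> smooth_vfield Y -> smooth_vfield Z ->
  dphi i X Y (appv (phi j) Z) p - dphi j X (appv (phi i) Y) Z p =
  dphi k X Y Z p + eta j p (Z p) * dxi i X Y p + eta i p (Y p) * dxi j X Z p.
Proof.
move=> sX sY sZ; rewrite /dphi /dxi.
have E1 : appv (phi i) (appv (phi j) Z) = (fun q => appv (phi k) Z q + eta j q (Z q) *: xi i q).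
  by apply/funext => q; exact: (phi_mul h3 e).
have E2 : appv (phi j) (appv (phi i) Y) =
    (fun q => - appv (phi k) Y q + eta i q (Y q) *: xi j q).
  by apply/funext => q; exact: (phi_mulC h3 e).
have h1 := K_DZm p (smooth_eta j sZ) sX sY (smooth_phi k sZ) (smooth_xi i).
have h2 := K_DZr p (smooth_eta i sY) sX sZ (smooth_vfieldN (smooth_phi k sY)) (smooth_xi j).
have h3' := D_eta j X Z p.
rewrite (metricC hg p (xi i p)) (metric_xi (hc i)) in h1.
rewrite (K_Nr hK p sX sZ (smooth_phi k sY)) in h2.
by rewrite E1 E2 h1 h2 -h3'; ring.
Qed.

End triple.

Lemma dphi_cyc i X Y Z p : smooth_vfield X -> smooth_vfield Y -> smooth_vfield Z ->
  D X (fun q => fundamental_form (phi i) g q (Y q) (Z q)) p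
  + D Y (fun q => fundamental_form (phi i) g q (Z q) (X q)) p
  + D Z (fun q => fundamental_form (phi i) g q (X q) (Y q)) p
  - fundamental_form (phi i) g p (L X Y p) (Z p)
  - fundamental_form (phi i) g p (L Y Z p) (X p)
  - fundamental_form (phi i) g p (L Z X p) (Y p) =
  dphi i X Y Z p + dphi i Y Z X p + dphi i Z X Y p.
Proof.
move=> sX sY sZ.
exact: (d2_K hK p (acm_phi_smooth (hc i)) (phi_skew (hc i)) sX sY sZ).
Qed.

(** As xi is dual to eta and the torsion vanishes, d eta is the skew part of nabla xi. *)
Lemma dxi_deta i X Y p : 
  D X (fun q => eta i q (Y q)) p - D Y (fun q => eta i q (X q)) p - eta i p (L X Y p) =
  dxi i X Y p - dxi i Y X p.
Proof.
have h1 := D_eta i X Y p; have h2 := D_eta i Y X p.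
have h := K_torsion hK X Y (xi i) p; rewrite (metric_xi (hc i)) in h.
by rewrite /dxi; lra.
Qed.

End covariant_derivatives.

(** * Rigidity *)

Section model.
Variables (R : realType) (m : nat) (M : manifold R m) (delta : R) (phi : 'I_3 -> endofield M)
  (xi : 'I_3 -> vfield M) (eta : 'I_3 -> oneform M) (g : bilinfield M).
Hypothesis h3 : almost_3_contact_metric phi xi eta g.
Variables (i j k : 'I_3).
Hypothesis e : even_triple i j k.
Variable p : M.
Implicit Types u v w : 'rV[R]_m.

(* The values of [dxi] and [dphi] announced by the theorem. *)
Definition model_dxi (i : 'I_3) u v : R :=
  delta * (eta (i + 2) p u * eta (i + 1) p v - eta (i + 1) p u * eta (i + 2) p v).

Definition model_dphi (i : 'I_3) u v w : R :=
  delta * ((eta (i + 1) p u * eta (i + 1) p w + eta (i + 2) p u * eta (i + 2) p w)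
             * eta i p v
           - eta i p w * (eta (i + 1) p u * eta (i + 1) p v
                          + eta (i + 2) p u * eta (i + 2) p v)).

Lemma model_dxiE u v :
  model_dxi i u v = delta * (eta k p u * eta j p v - eta j p u * eta k p v).
Proof. by have [-> ->] := (even_tripleP i j k).1 e. Qed.

Lemma model_dphiE u v w :
  model_dphi i u v w =
  delta * ((eta j p u * eta j p w + eta k p u * eta k p w) * eta i p v
           - eta i p w * (eta j p u * eta j p v + eta k p u * eta k p v)).
Proof. by have [-> ->] := (even_tripleP i j k).1 e. Qed.

End model.

Section rigidity.
Variables (R : realType) (m : nat) (M : manifold R m) (delta : R) (phi : 'I_3 -> endofield M)
  (xi : 'I_3 -> vfield M) (eta : 'I_3 -> oneform M) (g : bilinfield M).
Hypothesis h3 : almost_3_contact_metric phi xi eta g.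
Let hc i := a3cm_acm h3 i.
Let hg := acm_metric (hc 0).
Variables (D : vfield M -> (M -> R) -> M -> R) (L : vfield M -> vfield M -> vfield M).
Hypothesis rules : derivation_rules D L.
Variable K : vfield M -> vfield M -> vfield M -> M -> R.
Hypothesis hK : koszul_form g D L K.
Implicit Types (p q : M) (X Y Z W : vfield M) (f : M -> R).

Hypothesis hdeta : forall i j k, even_triple i j k ->
  forall X Y, smooth_vfield X -> smooth_vfield Y -> forall p,
  D X (fun q => eta i q (Y q)) p - D Y (fun q => eta i q (X q)) p - eta i p (L X Y p) =
  - 2 * delta * wedge1 (eta j) (eta k) p (X p) (Y p).
Hypothesis hdphi : forall i X Y Z,
  smooth_vfield X -> smooth_vfield Y -> smooth_vfield Z -> forall p,
  D X (fun q => fundamental_form (phi i) g q (Y q) (Z q)) p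
  + D Y (fun q => fundamental_form (phi i) g q (Z q) (X q)) p
  + D Z (fun q => fundamental_form (phi i) g q (X q) (Y q)) p
  - fundamental_form (phi i) g p (L X Y p) (Z p)
  - fundamental_form (phi i) g p (L Y Z p) (X p)
  - fundamental_form (phi i) g p (L Z X p) (Y p) = 0.

Let a i X Y Z p : R := dphi phi K i X Y Z p - model_dphi delta eta p i (X p) (Y p) (Z p).
Let b i X Y p : R := dxi xi K i X Y p - model_dxi delta eta p i (X p) (Y p).

Let sphi i X : smooth_vfield X -> smooth_vfield (appv (phi i) X).
Proof. exact: smooth_phi h3 i X. Qed.
Let sxi i : smooth_vfield (xi i). Proof. exact: smooth_xi h3 i. Qed.
Let seta i X : smooth_vfield X -> smooth_fun (fun q => eta i q (X q)).
Proof. exact: smooth_eta h3 i X. Qed.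

Let a_skew i X Y Z p : smooth_vfield X -> smooth_vfield Y -> smooth_vfield Z ->
  a i X Y Z p = - a i X Z Y p.
Proof.
move=> sX sY sZ; have h := dphi_skew h3 rules hK i p sX sY sZ.
by rewrite /a h /model_dphi; ring.
Qed.

Let a_DZ i X Y f W Z p : smooth_fun f -> smooth_vfield X -> smooth_vfield Y ->
  smooth_vfield W -> smooth_vfield Z ->
  a i X (fun q => Y q + f q *: W q) Z p = a i X Y Z p + f p * a i X W Z p.
Proof.
move=> sf sX sY sW sZ; have h := dphi_DZ h3 hK i p sf sX sY sW sZ.
rewrite /a h /model_dphi !linearD !linearZ /= /GRing.scale /=; ring.
Qed.

Let a_DZr i X Y f W Z p : smooth_fun f -> smooth_vfield X -> smooth_vfield Y ->
  smooth_vfield W -> smooth_vfield Z ->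
  a i X Z (fun q => Y q + f q *: W q) p = a i X Z Y p + f p * a i X Z W p.
Proof.
move=> sf sX sY sW sZ.
have h1 := a_skew i p sX sZ (smooth_vfieldD sY (smooth_vfieldZ sf sW)).
have h2 := a_skew i p sX sZ sY; have h3' := a_skew i p sX sZ sW.
by rewrite h1 (a_DZ i p sf sX sY sW sZ) h2 h3'; ring.
Qed.

Let b_DZ i X Y f W p : smooth_fun f -> smooth_vfield X -> smooth_vfield Y ->
  smooth_vfield W ->
  b i X (fun q => Y q + f q *: W q) p = b i X Y p + f p * b i X W p.
Proof.
move=> sf sX sY sW; have h := dxi_DZ h3 hK i p sf sX sY sW.
rewrite /b h /model_dxi !linearD !linearZ /= /GRing.scale /=; ring.
Qed.

Let b_self i j k (e : even_triple i j k) X p : b i X (xi i) p = 0.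
Proof.
have e1 := even_rot e; have e2 := even_rot e1.
rewrite /b (dxi_self h3 rules hK i X p) (model_dxiE _ _ e) (eta_xi_prev h3 e).
by rewrite (eta_xi_next h3 e2) !mulr0 subrr mulr0 subr0.
Qed.

Let b_antisym i j k (e : even_triple i j k) X p : b i X (xi j) p = - b j X (xi i) p.
Proof.
have e1 := even_rot e; have e2 := even_rot e1.
rewrite /b (dxi_antisym h3 rules hK e X p) (model_dxiE _ _ e) (model_dxiE _ _ e1).
rewrite !(eta_xi_self h3) (eta_xi_prev h3 e1) (eta_xi_next h3 e2); ring.
Qed.

Let a_sym i j k (e : even_triple i j k) X Y Z p : smooth_vfield X -> smooth_vfield Y -> smooth_vfield Z ->
  a i X Y (appv (phi i) Z) p - a i X (appv (phi i) Y) Z p =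
  eta i p (Z p) * b i X Y p + eta i p (Y p) * b i X Z p.
Proof.
have e1 := even_rot e; have e2 := even_rot e1.
move=> sX sY sZ; have h := dphi_sym h3 rules hK i p sX sY sZ.
rewrite /a /b !(model_dxiE _ _ e) !(model_dphiE _ _ e).
rewrite /appv (eta_phi (hc i)) !(eta_phi_prev h3 e) !(eta_phi_next h3 e2) in h *.
rewrite (eta_phi (hc i)); lra.
Qed.

Let a_xi i j k (e : even_triple i j k) X Y p : smooth_vfield X -> smooth_vfield Y ->
  a i X Y (xi i) p = b i X (appv (phi i) Y) p.
Proof.
have e1 := even_rot e; have e2 := even_rot e1.
move=> sX sY; have h := dphi_xi h3 rules hK i p sX sY.
rewrite /a /b h (model_dxiE _ _ e) (model_dphiE _ _ e).
rewrite /appv (eta_phi_prev h3 e) (eta_phi_next h3 e2).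
rewrite (eta_xi_self h3) (eta_xi_prev h3 e) (eta_xi_next h3 e2); ring.
Qed.

Let a_xi_next i j k (e : even_triple i j k) X Y p : smooth_vfield X -> smooth_vfield Y ->
  a i X Y (xi j) p = b k X Y p + b j X (appv (phi i) Y) p.
Proof.
have e1 := even_rot e; have e2 := even_rot e1.
move=> sX sY; have h := dphi_xi_next h3 K e p sX sY.
rewrite /a /b h (model_dxiE _ _ e2) (model_dxiE _ _ e1) (model_dphiE _ _ e).
rewrite /appv (eta_phi (hc i)) (eta_phi_next h3 e2).
rewrite (eta_xi_self h3) (eta_xi_next h3 e) (eta_xi_prev h3 e1); ring.
Qed.

Let a_xi_prev i j k (e : even_triple i j k) X Y p : smooth_vfield X -> smooth_vfield Y ->
  a j X Y (xi i) p = - b k X Y p + b i X (appv (phi j) Y) p.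
Proof.
have e1 := even_rot e; have e2 := even_rot e1.
move=> sX sY; have h := dphi_xi_prev h3 rules hK e p sX sY.
rewrite /a /b h (model_dxiE _ _ e2) (model_dxiE _ _ e) (model_dphiE _ _ e1).
rewrite /appv (eta_phi (hc j)) (eta_phi_prev h3 e1).
rewrite (eta_xi_self h3) (eta_xi_prev h3 e) (eta_xi_next h3 e2); ring.
Qed.

Let a_mul i j k (e : even_triple i j k) X Y Z p : smooth_vfield X -> smooth_vfield Y -> smooth_vfield Z ->
  a i X Y (appv (phi j) Z) p - a j X (appv (phi i) Y) Z p =
  a k X Y Z p + eta j p (Z p) * b i X Y p + eta i p (Y p) * b j X Z p.
Proof.
have e1 := even_rot e; have e2 := even_rot e1.
move=> sX sY sZ; have h := dphi_mul h3 hK e p sX sY sZ.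
rewrite /a /b !(model_dxiE _ _ e) !(model_dxiE _ _ e1).
rewrite !(model_dphiE _ _ e) !(model_dphiE _ _ e1) !(model_dphiE _ _ e2).
rewrite /appv (eta_phi (hc i)) (eta_phi (hc j)) in h *.
rewrite (eta_phi_next h3 e) (eta_phi_prev h3 e1) (eta_phi_prev h3 e) (eta_phi_next h3 e2).
lra.
Qed.

Let a_cyc i j k (e : even_triple i j k) X Y Z p : smooth_vfield X -> smooth_vfield Y -> smooth_vfield Z ->
  a i X Y Z p + a i Y Z X p + a i Z X Y p = 0.
Proof.
have e1 := even_rot e; have e2 := even_rot e1.
move=> sX sY sZ; have h := dphi_cyc h3 hK i p sX sY sZ.
rewrite (hdphi i sX sY sZ) in h.
rewrite /a !(model_dphiE _ _ e); lra.
Qed.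

Let b_sym i j k (e : even_triple i j k) X Y p : smooth_vfield X -> smooth_vfield Y -> b i X Y p = b i Y X p.
Proof.
have e1 := even_rot e; have e2 := even_rot e1.
move=> sX sY; have h := dxi_deta h3 hK i X Y p; rewrite (hdeta e sX sY) /wedge1 in h.
rewrite /b !(model_dxiE _ _ e); lra.
Qed.

(** Smooth sections of TM + R, packed with their smoothness so as to serve as the type V of
    [hitchin]. *)
Definition field_pair :=
  {x : vfield M * (M -> R) | smooth_vfield x.1 /\ smooth_fun x.2}.

Let pair_eq (x y : field_pair) :
  (forall q, (sval x).1 q = (sval y).1 q) -> (forall q, (sval x).2 q = (sval y).2 q) ->
  x = y.
Proof.
move=> E1 E2; case: x y E1 E2 => [[X f] hx] [[Y h] hy] /= /funext EX /funext Ef.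
by subst; congr exist; exact: Prop_irrelevance.
Qed.

Let pair_neg_subproof (x : field_pair) :
  smooth_vfield (fun q => - (sval x).1 q) /\ smooth_fun (fun q => - (sval x).2 q).
Proof. by case: x => -[X f] [sX sf]; split; [exact: smooth_vfieldN|exact: smooth_funN]. Qed.

Let pair_neg (x : field_pair) : field_pair := exist _ (_, _) (pair_neg_subproof x).

Let pair_J_subproof i (x : field_pair) :
  smooth_vfield (fun q => appv (phi i) (sval x).1 q + (- (sval x).2 q) *: xi i q) /\
  smooth_fun (fun q => eta i q ((sval x).1 q)).
Proof.
case: x => -[X f] [/= sX sf]; split; last exact: seta.
exact: smooth_vfieldD (sphi i sX) (smooth_vfieldZ (smooth_funN sf) (sxi i)).
Qed.

(* On the bundle TM + R the [phi i] become anticommuting almost complex structures. *)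
Let pair_J i (x : field_pair) : field_pair := exist _ (_, _) (pair_J_subproof i x).

(** The expression g(y, (nabla_x J_i) z) on TM + R, with the model values subtracted:
    differentiating J(Z, l) = (phi Z - l xi, eta Z) brings in nabla phi, and in the mixed entries
    nabla xi. *)
Let form i p (x y z : field_pair) : R :=
  a i (sval x).1 (sval y).1 (sval z).1 p
  + (sval y).2 p * b i (sval x).1 (sval z).1 p
  - (sval z).2 p * b i (sval x).1 (sval y).1 p.

Let pair_J_sqr i x : pair_J i (pair_J i x) = pair_neg x.
Proof.
apply: pair_eq => q; case: x => -[X f] [sX sf] /=; rewrite /appv linearD linearZ /=.
  rewrite (phi_xi (hc i)) scaler0 addr0 (acm_phi2 (hc i)).
  by rewrite (scaleNr (eta i q (X q)) (xi i q)) -addrA subrr addr0.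
rewrite (eta_phi (hc i)) (eta_xi_self h3) add0r /GRing.scale /=; ring.
Qed.

Let pair_J_mul i j k (e : even_triple i j k) x : pair_J i (pair_J j x) = pair_J k x.
Proof.
apply: pair_eq => q; case: x => -[X f] [sX sf] /=; rewrite /appv linearD linearZ /=.
  rewrite (phi_xi_next h3 e) (phi_mul h3 e).
  by rewrite !scaleNr addrAC addrK.
by rewrite (eta_phi_next h3 e) (eta_xi_next h3 e) /GRing.scale /= mulr0 addr0.
Qed.

Let pair_J_mulC i j k (e : even_triple i j k) x : pair_J j (pair_J i x) = pair_neg (pair_J k x).
Proof.
apply: pair_eq => q; case: x => -[X f] [sX sf] /=; rewrite /appv linearD linearZ /=.
  rewrite (phi_xi_prev h3 e) (phi_mulC h3 e).
  by rewrite !scaleNr addrAC addrK opprD scalerN !opprK.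
by rewrite (eta_phi_prev h3 e) (eta_xi_prev h3 e) /GRing.scale /= mulr0 addr0.
Qed.

Let form_skew i p x y z : form i p x y z = - form i p x z y.
Proof.
case: x y z => [[X f] [/= sX sf]] [[Y h] [/= sY sh]] [[Z l] [/= sZ sl]]; rewrite /form /=.
by rewrite (a_skew i p sX sY sZ); ring.
Qed.

Let form_sym i j k (e : even_triple i j k) p x y z : form i p x (pair_J i y) z = form i p x y (pair_J i z).
Proof.
case: x y z => [[X f] [/= sX sf]] [[Y h] [/= sY sh]] [[Z l] [/= sZ sl]]; rewrite /form /=.
have h1 := a_DZ i p (smooth_funN sh) sX (sphi i sY) (sxi i) sZ.
have h2 := a_DZr i p (smooth_funN sl) sX (sphi i sZ) (sxi i) sY.
have h4 := b_DZ i p (smooth_funN sh) sX (sphi i sY) (sxi i).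
have h5 := b_DZ i p (smooth_funN sl) sX (sphi i sZ) (sxi i).
rewrite h1 h2 h4 h5 !(b_self e) (a_skew i p sX (sxi i) sZ) !(a_xi e) //.
have := a_sym e p sX sY sZ; lra.
Qed.

Let form_mul i j k (e : even_triple i j k) p x y z :
  form k p x y z = form i p x y (pair_J j z) - form j p x (pair_J i y) z.
Proof.
case: x y z => [[X f] [/= sX sf]] [[Y h] [/= sY sh]] [[Z l] [/= sZ sl]]; rewrite /form /=.
have h1 := a_DZ j p (smooth_funN sh) sX (sphi i sY) (sxi i) sZ.
have h2 := a_DZr i p (smooth_funN sl) sX (sphi j sZ) (sxi j) sY.
have h4 := b_DZ j p (smooth_funN sh) sX (sphi i sY) (sxi i).
have h5 := b_DZ i p (smooth_funN sl) sX (sphi j sZ) (sxi j).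
rewrite h1 h2 h4 h5 (a_skew j p sX (sxi i) sZ) (a_xi_next e p sX sY) (a_xi_prev e p sX sZ).
rewrite (b_antisym e X p).
have := a_mul e p sX sY sZ; lra.
Qed.

Let form_cyc i j k (e : even_triple i j k) p x y z : form i p x y z + form i p y z x + form i p z x y = 0.
Proof.
case: x y z => [[X f] [/= sX sf]] [[Y h] [/= sY sh]] [[Z l] [/= sZ sl]]; rewrite /form /=.
have := a_cyc e p sX sY sZ; rewrite (b_sym e p sY sX) (b_sym e p sZ sX) (b_sym e p sZ sY).
lra.
Qed.

Let form_Nl i p x y z : form i p (pair_neg x) y z = - form i p x y z.
Proof.
case: x y z => [[X f] [/= sX sf]] [[Y h] [/= sY sh]] [[Z l] [/= sZ sl]]; rewrite /form /=.
rewrite /a /b /dphi /dxi (K_Nl hg rules hK p sX (sphi i sZ) sY).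
rewrite (K_Nl hg rules hK p sX sZ (sphi i sY)).
rewrite (K_Nl hg rules hK p sX (sxi i) sY) (K_Nl hg rules hK p sX (sxi i) sZ).
by rewrite /model_dphi /model_dxi !linearN; ring.
Qed.

Let form_Nr i p x y z : form i p x (pair_neg y) z = - form i p x y z.
Proof.
case: x y z => [[X f] [/= sX sf]] [[Y h] [/= sY sh]] [[Z l] [/= sZ sl]]; rewrite /form /=.
have E : (fun q => - Y q) = (fun q => Y q + -2 *: Y q).
  by apply/funext => q; rewrite scaleNr scaler_nat mulr2n opprD addrA subrr sub0r.
have h1 := a_DZ i p (@smooth_fun_cst R m M (-2)) sX sY sY sZ.
have h2 := b_DZ i p (@smooth_fun_cst R m M (-2)) sX sY sY.
by rewrite E h1 h2; ring.
Qed.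

Let form_eq0 i j k (e : even_triple i j k) p x y z : form i p x y z = 0.
Proof.
have e1 := even_rot e; have e2 := even_rot e1.
apply: (@hitchin R field_pair pair_neg (pair_J i) (pair_J j) (pair_J k)
  (form i p) (form j p) (form k p)).
- by move=> u; exact: pair_J_sqr.
- by move=> u; exact: pair_J_sqr.
- by move=> u; exact: pair_J_sqr.
- by move=> u; exact: (pair_J_mul e).
- by move=> u; exact: (pair_J_mulC e).
- by move=> u; exact: (pair_J_mul e1).
- by move=> u; exact: (pair_J_mulC e1).
- by move=> u; exact: (pair_J_mul e2).
- by move=> u; exact: (pair_J_mulC e2).
- by move=> u v w; split; exact: form_Nl.
- by move=> u v w; split; exact: form_Nr.
- by move=> u v w; split; exact: form_skew.
- by move=> u v w; split; [exact: (form_sym e)|exact: (form_sym e1)|exact: (form_sym e2)].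
- by move=> u v w; split; [exact: (form_cyc e)|exact: (form_cyc e1)|exact: (form_cyc e2)].
- by move=> u v w; split; [exact: (form_mul e)|exact: (form_mul e1)|exact: (form_mul e2)].
(* The Leibniz rule for the products in the opposite order follows from the first by skewness in the
   last two arguments. *)
- move=> u v w; split; rewrite form_skew.
  + by rewrite (form_mul e) (form_skew i p u w) (form_skew j p u _ v) opprB opprK addrC.
  + by rewrite (form_mul e1) (form_skew j p u w) (form_skew k p u _ v) opprB opprK addrC.
  + by rewrite (form_mul e2) (form_skew k p u w) (form_skew i p u _ v) opprB opprK addrC.
Qed.

Lemma rigidity i j k (e : even_triple i j k) X Y Z p :
  smooth_vfield X -> smooth_vfield Y -> smooth_vfield Z ->
  dphi phi K i X Y Z p = model_dphi delta eta p i (X p) (Y p) (Z p) /\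
  dxi xi K i X Z p = model_dxi delta eta p i (X p) (Z p).
Proof.
move=> sX sY sZ.
pose pr (W : vfield M) c (sW : smooth_vfield W) : field_pair :=
  exist _ (W, fun=> c) (conj sW (@smooth_fun_cst R m M c)).
(* Zero second components isolate the part from phi; the constant function 1 in the second pair then
   isolates the part from xi. *)
have h0 := form_eq0 e p (pr X 0 sX) (pr Y 0 sY) (pr Z 0 sZ).
have h1 := form_eq0 e p (pr X 0 sX) (pr Y 1 sY) (pr Z 0 sZ).
rewrite /form /a /b /= in h0 h1; split; lra.
Qed.

End rigidity.

Section consequences.
Variables (R : realType) (m : nat) (M : manifold R m) (delta : R) (phi : 'I_3 -> endofield M)
  (xi : 'I_3 -> vfield M) (eta : 'I_3 -> oneform M) (g : bilinfield M).
Hypothesis h3 : almost_3_contact_metric phi xi eta g.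
Let hc i := a3cm_acm h3 i.
Let hg := acm_metric (hc 0).
Variables (D : vfield M -> (M -> R) -> M -> R) (L : vfield M -> vfield M -> vfield M).
Hypothesis rules : derivation_rules D L.
Variable K : vfield M -> vfield M -> vfield M -> M -> R.
Hypothesis hK : koszul_form g D L K.
Implicit Types (p q : M) (X Y Z W : vfield M) (f : M -> R).
Hypothesis dphiE : forall i X Y Z p, smooth_vfield X -> smooth_vfield Y -> smooth_vfield Z ->
  dphi phi K i X Y Z p = model_dphi delta eta p i (X p) (Y p) (Z p).
Hypothesis dxiE : forall i X Z p, smooth_vfield X -> smooth_vfield Z ->
  dxi xi K i X Z p = model_dxi delta eta p i (X p) (Z p).

Lemma nabla_phi_formula nabla (i j k : 'I_3) : even_triple i j k -> has_metric_torsion g D L nabla ->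
  forall X Y, smooth_vfield X -> smooth_vfield Y -> forall p,
  nabla_endo nabla X (phi i) Y p =
    (delta * (eta j p (X p) * eta j p (Y p) + eta k p (X p) * eta k p (Y p))) *: xi i p
    - (delta * eta i p (Y p)) *: (eta j p (X p) *: xi j p + eta k p (X p) *: xi k p).
Proof.
move=> e hn X Y sX sY p; apply: (@metric_eq_fields _ _ _ _ hg p) => Z sZ.
have h := dphiE i p sX sZ sY; rewrite (model_dphiE _ _ e) /dphi in h.
have h1 := K_nabla hg hK p hn sX (smooth_phi h3 i sY) sZ.
have h2 := K_nabla hg hK p hn sX sY (smooth_phi h3 i sZ).
have E : nabla_endo nabla X (phi i) Y p = nabla X (appv (phi i) Y) p - phi i p (nabla X Y p).
  by [].
rewrite E (metricDl hg p (nabla X (appv (phi i) Y) p)) (metricNl hg p (phi i p _)).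
rewrite (phi_skew (hc i)) h1 [X in _ - - X]h2 opprK h.
rewrite (metricDl hg) (metricNl hg) !(metricZl hg) (metricDl hg) !(metricZl hg).
rewrite !(metricC hg _ (xi _ _)) !(metric_xi (hc _)); ring.
Qed.

Lemma nabla_xi_formula nabla (i j k : 'I_3) : even_triple i j k -> has_metric_torsion g D L nabla ->
  forall X, smooth_vfield X -> forall p,
  nabla X (xi i) p = delta *: (eta k p (X p) *: xi j p - eta j p (X p) *: xi k p).
Proof.
move=> e hn X sX p; apply: (@metric_eq_fields _ _ _ _ hg p) => Z sZ.
have h := dxiE i p sX sZ; rewrite (model_dxiE _ _ e) /dxi in h.
rewrite (K_nabla hg hK p hn sX (smooth_xi h3 i) sZ) h.
rewrite (metricZl hg) (metricDl hg) (metricNl hg) !(metricZl hg).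
by rewrite !(metricC hg _ (xi _ _)) !(metric_xi (hc _)).
Qed.

Lemma xi_killing (i : 'I_3) X Y : smooth_vfield X -> smooth_vfield Y -> forall p,
  D (xi i) (fun q => g q (X q) (Y q)) p =
    g p (L (xi i) X p) (Y p) + g p (X p) (L (xi i) Y p).
Proof.
move=> sX sY p.
have h1 := K_metric hK (xi i) X Y p.
have h2 := K_torsion hK (xi i) X Y p; have h4 := K_torsion hK (xi i) Y X p.
have h5 := dxiE i p sX sY; have h6 := dxiE i p sY sX.
rewrite /dxi /model_dxi in h5 h6.
rewrite (metricC hg p (X p)); lra.
Qed.

Lemma lie_xi (i j k : 'I_3) : even_triple i j k -> forall p,
  L (xi i) (xi j) p = (2 * delta) *: xi k p.
Proof.
move=> e p; apply: (@metric_eq_fields _ _ _ _ hg p) => Z sZ.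
have e1 := even_rot e; have e2 := even_rot e1.
have h2 := K_torsion hK (xi i) (xi j) Z p.
have h5 := dxiE j p (smooth_xi h3 i) sZ; have h6 := dxiE i p (smooth_xi h3 j) sZ.
rewrite (model_dxiE _ _ e1) (eta_xi_self h3) (eta_xi_next h3 e2) in h5.
rewrite (model_dxiE _ _ e) (eta_xi_self h3) (eta_xi_prev h3 e1) in h6.
rewrite /dxi in h5 h6.
rewrite (metricZl hg) (metricC hg p (xi k p)) (metric_xi (hc k)); lra.
Qed.

(** Vanishing torsion turns the brackets into covariant derivatives of phi, and their model values
    cancel against t, which stands for d eta_i(X, Y). *)
Lemma nijenhuis_eq0 (i j k : 'I_3) X Y (t : R) p : even_triple i j k ->
  smooth_vfield X -> smooth_vfield Y ->
  t = - 2 * delta * wedge1 (eta j) (eta k) p (X p) (Y p) ->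
  L (appv (phi i) X) (appv (phi i) Y) p + phi i p (phi i p (L X Y p))
  - phi i p (L (appv (phi i) X) Y p) - phi i p (L X (appv (phi i) Y) p)
  + t *: xi i p = 0.
Proof.
move=> e sX sY ->; have e1 := even_rot e; have e2 := even_rot e1.
apply: (@metric_eq_fields _ _ _ _ hg p) => Z sZ.
have sp := smooth_phi h3 i.
rewrite !(metricDl hg) !(metricNl hg) (metricZl hg) !(phi_skew (hc i)) (metric0l hg).
rewrite (metricC hg p (xi i p)) (metric_xi (hc i)).
have t1 := K_torsion hK (appv (phi i) X) (appv (phi i) Y) Z p.
have t2 := K_torsion hK X Y (appv (phi i) (appv (phi i) Z)) p.
have t3 := K_torsion hK (appv (phi i) X) Y (appv (phi i) Z) p.
have t4 := K_torsion hK X (appv (phi i) Y) (appv (phi i) Z) p.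
have d1 := dphiE i p (sp X sX) sZ sY; have d2 := dphiE i p (sp Y sY) sZ sX.
have d3 := dphiE i p sX (sp Z sZ) sY; have d4 := dphiE i p sY (sp Z sZ) sX.
rewrite /dphi !(model_dphiE _ _ e) in d1 d2 d3 d4.
rewrite /wedge1; move: t1 t2 t3 t4 d1 d2 d3 d4; rewrite /appv.
rewrite !(eta_phi (hc i)) !(eta_phi_prev h3 e) !(eta_phi_next h3 e2).
lra.
Qed.

End consequences.

(** * Differential forms in R^m *)

Section forms.
Variable R : realType.
Implicit Types (m n k : nat).

Lemma is_derive_val (V W : normedModType R) (f : V -> W) x v d :
  is_derive x v f d -> 'D_v f x = d.
Proof. by case. Qed.

Lemma scalar_rowE n (T : 'rV[R]_n -> R) v : scalar T -> T v = \sum_i v 0 i * T 'e_i.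
Proof.
move=> lT.
have T0 : T 0 = 0.
  by have /eqP := lT 1 0 0; rewrite scale1r addr0 mul1r -subr_eq0 opprD addNKr oppr_eq0 => /eqP.
have sumE (s : seq 'I_n) : T (\sum_(i <- s) v 0 i *: 'e_i) = \sum_(i <- s) v 0 i * T 'e_i.
  by elim: s => [|i s IH]; rewrite ?big_nil // !big_cons lT IH.
by rewrite {1}(row_sum_delta v) sumE.
Qed.

Lemma is_derive_linear_app m n (T : 'rV[R]_m -> 'rV[R]_n -> R) (Y : 'rV[R]_m -> 'rV[R]_n)
    (x u : 'rV[R]_m) :
  (forall y, scalar (T y)) -> (forall v, derivable (fun y => T y v) x u) ->
  derivable Y x u ->
  is_derive x u (fun y => T y (Y y)) ('D_u (fun y => T y (Y x)) x + T x ('D_u Y x)).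
Proof.
move=> lT dT dY.
have TE y v : T y v = \sum_i v 0 i * T y 'e_i by exact: scalar_rowE.
have dYj j : derivable (fun y => Y y 0 j) x u by move/derivable_rowP: dY; exact.
have E : (fun y => T y (Y y)) = \sum_i (fun y => Y y 0 i * T y 'e_i).
  by apply/funext => y; rewrite fct_sumE TE.
have E' : (fun y => T y (Y x)) = \sum_i (fun y => Y x 0 i * T y 'e_i).
  by apply/funext => y; rewrite fct_sumE TE.
have d1 i : is_derive x u (fun y => Y y 0 i * T y 'e_i)
   (Y x 0 i *: 'D_u (fun y => T y 'e_i) x + T x 'e_i *: 'D_u (fun y => Y y 0 i) x).
  exact: (is_deriveM (derivableP (dYj i)) (derivableP (dT 'e_i))).
have d2 i : is_derive x u (fun y => Y x 0 i * T y 'e_i)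
   (Y x 0 i *: 'D_u (fun y => T y 'e_i) x).
  exact: (is_deriveZ (Y x 0 i) (derivableP (dT 'e_i))).
have s1 := is_derive_sum d1; have s2 := is_derive_sum d2.
rewrite E' (is_derive_val s2) E.
apply: (@is_derive_eq _ _ _ _ _ _ _ _ s1).
rewrite big_split /=; congr (_ + _).
rewrite [RHS]TE; apply: eq_bigr => i _.
by rewrite (derive_rowE i dY) /GRing.scale /= mulrC.
Qed.

Lemma derive_mulmx m n k (F : 'rV[R]_m -> 'rV[R]_n) (K : 'M[R]_(n, k)) x u :
  derivable F x u -> 'D_u (fun y => F y *m K) x = 'D_u F x *m K.
Proof.
move=> dF.
have d j : is_derive x u (fun y => (F y *m K) 0 j) (('D_u F x *m K) 0 j).
  have lT (y : 'rV[R]_m) : scalar (fun w : 'rV[R]_n => (w *m K) 0 j).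
    by move=> a v w; rewrite mulmxDl -scalemxAl !mxE.
  have dT (v : 'rV[R]_n) : derivable (fun y : 'rV[R]_m => (v *m K) 0 j) x u by exact: derivable_cst.
  have h := is_derive_linear_app lT dT dF.
  apply: (@is_derive_eq _ _ _ _ _ _ _ _ h).
  by rewrite (derive_cst ((F x *m K) 0 j)) add0r.
have dK : derivable (fun y => F y *m K) x u.
  by apply/derivable_rowP => j; have [] := d j.
by apply/rowP => j; rewrite (derive_rowE j dK) (is_derive_val (d j)).
Qed.

Definition bilinear_map m n k (W : 'rV[R]_m -> 'rV[R]_n -> 'rV[R]_k -> R) :=
  (forall y v, scalar (W y v)) /\ (forall y w, scalar (fun v => W y v w)).

Lemma is_derive_bilin m n k (W : 'rV[R]_m -> 'rV[R]_n -> 'rV[R]_k -> R)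
    (Y : 'rV[R]_m -> 'rV[R]_n) (Z : 'rV[R]_m -> 'rV[R]_k) (x u : 'rV[R]_m) :
  bilinear_map W -> (forall v w, derivable (fun y => W y v w) x u) ->
  derivable Y x u -> derivable Z x u ->
  is_derive x u (fun y => W y (Y y) (Z y))
    ('D_u (fun y => W y (Y x) (Z x)) x + W x ('D_u Y x) (Z x) + W x (Y x) ('D_u Z x)).
Proof.
move=> [lr ll] dW dY dZ.
have d1 v : is_derive x u (fun y => W y v (Z y))
    ('D_u (fun y => W y v (Z x)) x + W x v ('D_u Z x)).
  exact: (@is_derive_linear_app m k (fun y w => W y v w) Z x u (fun y => lr y v) (dW v) dZ).
have d1' v : derivable (fun y => W y v (Z y)) x u by have [] := d1 v.
have h := @is_derive_linear_app m n (fun y v => W y v (Z y)) Y x u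
  (fun y => ll y (Z y)) d1' dY.
apply: (@is_derive_eq _ _ _ _ _ _ _ _ h).
by rewrite (is_derive_val (d1 (Y x))) addrAC.
Qed.

(* The differential is evaluated on constant fields, whence the absence of brackets. *)
Definition closed_on m (A : set 'rV[R]_m) (W : 'rV[R]_m -> 'rV[R]_m -> 'rV[R]_m -> R) :=
  forall x, A x -> forall u v w,
  'D_u (fun y => W y v w) x + 'D_v (fun y => W y w u) x + 'D_w (fun y => W y u v) x = 0.

(** By the Leibniz rule the derivatives of the fields cancel against the brackets, W being skew.
    This links [closed_on], which tests constant fields, with the invariant formula [d2]. *)
Lemma closed_fields m (A : set 'rV[R]_m) W (X Y Z : 'rV[R]_m -> 'rV[R]_m) x :
  bilinear_map W -> (forall v w, W x v w = - W x w v) ->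
  (forall v w, differentiable (fun y => W y v w) x) ->
  closed_on A W -> A x -> differentiable X x -> differentiable Y x -> differentiable Z x ->
  'D_(X x) (fun y => W y (Y y) (Z y)) x + 'D_(Y x) (fun y => W y (Z y) (X y)) x
  + 'D_(Z x) (fun y => W y (X y) (Y y)) x
  - W x ('D_(X x) Y x - 'D_(Y x) X x) (Z x) - W x ('D_(Y x) Z x - 'D_(Z x) Y x) (X x)
  - W x ('D_(Z x) X x - 'D_(X x) Z x) (Y x) = 0.
Proof.
move=> bW skew dW cW Ax dX dY dZ; have [lr ll] := bW.
have dW' u v w : derivable (fun y => W y v w) x u by exact: diff_derivable.
have d (F : 'rV[R]_m -> 'rV[R]_m) u : differentiable F x -> derivable F x u.
  by move=> dF; exact: diff_derivable.
rewrite (is_derive_val (is_derive_bilin bW (dW' (X x)) (d _ _ dY) (d _ _ dZ))).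
rewrite (is_derive_val (is_derive_bilin bW (dW' (Y x)) (d _ _ dZ) (d _ _ dX))).
rewrite (is_derive_val (is_derive_bilin bW (dW' (Z x)) (d _ _ dX) (d _ _ dY))).
have WB a b c : W x (a - b) c = W x a c - W x b c.
  by have /= := ll x c (-1) b a; rewrite scaleN1r mulN1r => E; rewrite (addrC a) E addrC.
have := cW x Ax (X x) (Y x) (Z x).
move: ('D_(X x) Y x) ('D_(Y x) X x) ('D_(Y x) Z x) ('D_(Z x) Y x) ('D_(Z x) X x)
  ('D_(X x) Z x) => a b c d' e f'.
move: ('D_(X x) _ x) ('D_(Y x) _ x) ('D_(Z x) _ x) => r s t.
rewrite (WB a b) (WB c d') (WB e f').
have s1 := skew (Y x) f'; have s2 := skew (Z x) b; have s3 := skew (X x) d'.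
lra.
Qed.

Definition pullback m n (G : 'rV[R]_m -> 'rV[R]_n) (W : 'rV[R]_n -> 'rV[R]_n -> 'rV[R]_n -> R)
  (y v w : 'rV[R]_m) : R := W (G y) ('D_v G y) ('D_w G y).

(** Naturality of d: the second derivatives of G are symmetric by Schwarz and enter the skew form W,
    so they cancel in the cyclic sum. *)
Lemma closed_pullback m n (B : set 'rV[R]_m) (A : set 'rV[R]_n) G W :
  open B -> open A -> smooth_map_on B G -> (forall y, B y -> A (G y)) ->
  bilinear_map W -> (forall y, A y -> forall v w, W y v w = - W y w v) ->
  (forall v w, smooth_on A (fun y => W y v w)) ->
  closed_on A W -> closed_on B (pullback G W).
Proof.
move=> oB oA sG BA [lr ll] skew sW cW y By u v w.
have bW : bilinear_map (fun z => W (G z)) by split => z; [exact: lr|exact: ll].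
have dG : differentiable G y by exact: smooth_map_differentiable sG By.
have dW a b : differentiable (fun z => W z a b) (G y).
  by exact: smooth_differentiable (sW a b) (BA y By).
have dWG a b c : derivable (fun z => W (G z) a b) y c.
  by apply: diff_derivable; exact: (differentiable_comp dG (dW a b)).
have ddG a c : derivable (fun z => 'D_a G z) y c.
  by apply: diff_derivable; exact: smooth_map_differentiable oB (smooth_map_derive a oB sG) By.
pose P a c := 'D_c (fun z => 'D_a G z) y.
pose S a b c := 'D_('D_c G y) (fun z => W z ('D_a G y) ('D_b G y)) (G y).
have E a b c : 'D_c (fun z => pullback G W z a b) y =
    S a b c + W (G y) (P a c) ('D_b G y) + W (G y) ('D_a G y) (P b c).
  have h := is_derive_bilin bW (fun a b => dWG a b c) (ddG a c) (ddG b c).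
  apply: (etrans (is_derive_val h)); congr (_ + _ + _).
  exact: (derive_comp c dG (dW _ _)).
have PC a c : P a c = P c a by exact: (schwarz_map c a oB sG By).
have c0 : S v w u + S w u v + S u v w = 0.
  exact: (cW _ (BA y By) ('D_u G y) ('D_v G y) ('D_w G y)).
apply: (etrans (congr2 +%R (congr2 +%R (E v w u) (E w u v)) (E u v w))).
move: S P PC c0 {E} => S P PC c0.
move: ('D_u G y) ('D_v G y) ('D_w G y) => a b c.
rewrite (PC v u) (PC w u) (PC w v).
have s1 := skew (G y) (BA y By) (P u v) c; have s2 := skew (G y) (BA y By) (P u w) b.
have s3 := skew (G y) (BA y By) (P v w) a.
lra.
Qed.

End forms.

(** * Foliation charts *)

Section frobenius.
Variables (R : realType) (d k : nat) (A : set 'rV[R]_(d + k)).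
Variables (Xi : 'I_k -> 'rV[R]_(d + k) -> 'rV[R]_(d + k)).
Variables (eta : 'I_k -> 'rV[R]_(d + k) -> 'rV[R]_(d + k) -> R).
Hypotheses (oA : open A) (sXi : forall a, smooth_map_on A (Xi a)).
Hypothesis eta_lin : forall a x, scalar (eta a x).
Hypothesis eta_Xi : forall x, A x -> forall a b, eta a x (Xi b x) = (a == b)%:R.

Definition horizontal (x v : 'rV[R]_(d + k)) := v - \sum_a eta a x v *: Xi a x.

Lemma horizontal_linear x : linear (horizontal x).
Proof.
move=> c u v; rewrite /horizontal scalerBr [RHS]addrACA -opprD; congr (_ - _).
rewrite scaler_sumr -big_split /=; apply: eq_bigr => a _.
by rewrite eta_lin scalerDl scalerA.
Qed.

Lemma horizontalZ x c v : horizontal x (c *: v) = c *: horizontal x v.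
Proof.
have h0 : horizontal x 0 = 0.
  have := horizontal_linear x 1 0 0; rewrite !scale1r addr0 => /eqP.
  by rewrite -subr_eq0 opprD addNKr oppr_eq0 => /eqP.
by have := horizontal_linear x c v 0; rewrite !addr0 h0 addr0.
Qed.

Lemma horizontalB x u v : horizontal x (u - v) = horizontal x u - horizontal x v.
Proof. by rewrite addrC -scaleN1r horizontal_linear scaleN1r addrC. Qed.

Lemma horizontal_sum x n (v : 'I_n -> 'rV[R]_(d + k)) :
  horizontal x (\sum_i v i) = \sum_i horizontal x (v i).
Proof.
have h0 : horizontal x 0 = 0 by rewrite -(scale0r 0) horizontalZ !scale0r.
have sumE (s : seq 'I_n) : horizontal x (\sum_(i <- s) v i) = \sum_(i <- s) horizontal x (v i).
  elim: s => [|i s IH]; first by rewrite !big_nil.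
  by rewrite !big_cons -[v i]scale1r horizontal_linear IH !scale1r.
exact: sumE.
Qed.

Lemma horizontal_Xi x b : A x -> horizontal x (Xi b x) = 0.
Proof.
move=> Ax; rewrite /horizontal (bigD1 b) //= (eta_Xi Ax) eqxx scale1r big1 ?addr0 ?subrr //.
by move=> a /negbTE ab; rewrite (eta_Xi Ax) ab scale0r.
Qed.

Hypothesis involutive : forall a b x, A x ->
  horizontal x ('D_(Xi a x) (Xi b) x - 'D_(Xi b x) (Xi a) x) = 0.
Variable x0 : 'rV[R]_(d + k).
Hypothesis Ax0 : A x0.

(** The covectors eta_i frozen at x0, as a constant linear map. Near x0 the vertical frame is
    renormalised to [Xf], whose image under [Pi] is the constant standard basis. *)
Let Pi : 'M[R]_(d + k, k) := \matrix_(l, i) eta i x0 'e_l.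
Let Xm x : 'M[R]_(k, d + k) := \matrix_(i < k) Xi i x.
Let P x := Xm x *m Pi.
Let C x := invmx (P x).
Let A' : set 'rV[R]_(d + k) := [set x | A x /\ P x \in unitmx].
Let Xf (a : 'I_k) x := row a (C x) *m Xm x.

Let PiE v i : (v *m Pi) 0 i = eta i x0 v.
Proof. by rewrite (scalar_rowE v (eta_lin i x0)) mxE; apply: eq_bigr => l _; rewrite !mxE. Qed.

Let mul_Xm (c : 'rV[R]_k) x : c *m Xm x = \sum_i c 0 i *: Xi i x.
Proof. by rewrite mulmx_sum_row; apply: eq_bigr => i _; rewrite rowK. Qed.

Let sXm i l : smooth_on A (fun x => Xm x i l).
Proof. by under eq_fun do rewrite mxE; exact: sXi. Qed.

Let sP i j : smooth_on A (fun x => P x i j).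
Proof.
under eq_fun do rewrite mxE.
by apply: smooth_sum => // l; apply: smoothM => //; exact: smooth_cst.
Qed.

Let P0 : P x0 = 1%:M.
Proof.
apply/row_matrixP => i; rewrite row_mul rowK row1; apply/rowP => j.
by rewrite PiE (eta_Xi Ax0) mxE eq_sym eqxx.
Qed.

Let oA' : open A'.
Proof.
rewrite openE => x [Ax uP]; have cd := smooth_continuous (smooth_det oA sP) Ax.
have n1 : nbhs x A by apply: open_nbhs_nbhs.
have n2 : nbhs x [set y | \det (P y) != 0].
  apply: (cd [set t | t != 0]); apply: open_nbhs_nbhs; split; first exact: open_neq.
  by rewrite /= -unitfE -unitmxE.
by apply: filterS (filterI n1 n2) => y [Ay dy]; split => //; rewrite unitmxE unitfE.
Qed.

Let sA' : A' `<=` A. Proof. by move=> x []. Qed.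

Let sC i j : smooth_on A' (fun x => C x i j).
Proof.
apply: smooth_invmx => //; last by move=> x [].
by move=> a b; exact: smooth_sub (sP a b).
Qed.

Let sXf a : smooth_map_on A' (Xf a).
Proof.
apply: smooth_map_mulmx => //; last by move=> i j; exact: smooth_sub (sXm i j).
by move=> j; under eq_fun do rewrite mxE; exact: sC.
Qed.

Let Xf_Pi a x : A' x -> Xf a x *m Pi = 'e_a.
Proof. by move=> [_ uP]; rewrite -mulmxA -row_mul mulVmx // row1. Qed.

(** The derivatives of the coefficients of [Xf] multiply vertical vectors and disappear under the
    horizontal projection. *)
Let horizontal_derive a b x : A' x ->
  horizontal x ('D_(Xf a x) (Xf b) x) =
  \sum_j \sum_i (C x b j * C x a i) *: horizontal x ('D_(Xi i x) (Xi j) x).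
Proof.
move=> A'x; have Ax := sA' A'x.
have dC j : derivable (fun y => C y b j) x (Xf a x).
  by apply: diff_derivable; exact: smooth_differentiable oA' (sC b j) A'x.
have dXi j : differentiable (Xi j) x by exact: smooth_map_differentiable (sXi j) Ax.
have E : Xf b = \sum_j (fun y => C y b j *: Xi j y).
  by apply/funext => y; rewrite fct_sumE /Xf mul_Xm; apply: eq_bigr => j _; rewrite mxE.
have dj j : is_derive x (Xf a x) (fun y => C y b j *: Xi j y)
    ('D_(Xf a x) (fun y => C y b j) x *: Xi j x + C x b j *: 'D_(Xf a x) (Xi j) x).
  have dX : derivable (Xi j) x (Xf a x) by exact: diff_derivable.
  split; last exact: derive_scale.
  apply/derivable_rowP => l.
  have dXl : derivable (fun y => Xi j y 0 l) x (Xf a x) by move/derivable_rowP: dX; exact.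
  have -> : (fun y => (C y b j *: Xi j y) 0 l) = (fun y => C y b j) * (fun y => Xi j y 0 l).
    by apply/funext => y; rewrite mxE.
  exact: (derivableM (dC j) dXl).
rewrite [in LHS]E (is_derive_val (is_derive_sum dj)) horizontal_sum; apply: eq_bigr => j _.
rewrite horizontal_linear (horizontal_Xi _ Ax) scaler0 add0r horizontalZ.
have -> : 'D_(Xf a x) (Xi j) x = \sum_i C x a i *: 'D_(Xi i x) (Xi j) x.
  rewrite /Xf mul_Xm (deriveE _ (dXi j)) linear_sum; apply: eq_bigr => i _.
  by rewrite linearZ mxE -(deriveE _ (dXi j)).
rewrite horizontal_sum scaler_sumr; apply: eq_bigr => i _.
by rewrite horizontalZ scalerA.
Qed.

(** The bracket is vertical by involutivity and is killed by [Pi], because [Pi] takes constant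
    values on the frame; but [Pi] is injective on vertical vectors. *)
Let Xf_commute a b x : A' x -> 'D_(Xf a x) (Xf b) x = 'D_(Xf b x) (Xf a) x.
Proof.
move=> A'x; have Ax := sA' A'x; have [_ uP] := A'x.
have dPi c e : 'D_(Xf c x) (Xf e) x *m Pi = 0.
  have dX : derivable (Xf e) x (Xf c x).
    by apply: diff_derivable; exact: smooth_map_differentiable oA' (sXf e) A'x.
  rewrite -(derive_mulmx Pi dX) -(derive_cst ('e_e : 'rV[R]_k) x (Xf c x)).
  by apply: near_eq_derive; apply: (near_open_map oA' A'x) => y; exact: Xf_Pi.
set Y := 'D_(Xf a x) (Xf b) x - 'D_(Xf b x) (Xf a) x.
have YPi : Y *m Pi = 0.
  apply: (etrans (mulmxBl _ _ _)).
  by apply: (etrans (congr2 (fun s t => s - t) (dPi a b) (dPi b a))); rewrite subrr.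
have hY : horizontal x Y = 0.
  apply: (etrans (horizontalB _ _ _)).
  apply: (etrans (congr2 (fun s t => s - t) (horizontal_derive a b A'x) (horizontal_derive b a A'x))).
  rewrite [X in _ - X]exchange_big /= -sumrB big1 // => j _.
  rewrite -sumrB big1 // => i _.
  rewrite (mulrC (C x a i)) -scalerBr -horizontalB.
  by rewrite (involutive i j Ax) scaler0.
have YE : Y = (\row_i eta i x Y) *m Xm x.
  rewrite mul_Xm; move: hY; rewrite /horizontal => /eqP; rewrite subr_eq0 => /eqP YE.
  by rewrite [LHS]YE; apply: eq_bigr => i _; rewrite mxE.
apply/eqP; rewrite -subr_eq0 -/Y YE.
have c0 : (\row_i eta i x Y) *m P x = 0 by rewrite mulmxA -YE.
by rewrite -(mulmxK uP (\row_i eta i x Y)) c0 !mul0mx.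
Qed.

Let horizontal_mul_Xm (c : 'rV[R]_k) x : A x -> horizontal x (c *m Xm x) = 0.
Proof.
move=> Ax; rewrite mul_Xm horizontal_sum big1 // => i _.
by rewrite horizontalZ (horizontal_Xi _ Ax) scaler0.
Qed.

Let horizontal_eq0 x v : horizontal x v = 0 -> v = (\row_i eta i x v) *m Xm x.
Proof.
rewrite mul_Xm /horizontal => /eqP; rewrite subr_eq0 => /eqP vE.
by rewrite [LHS]vE; apply: eq_bigr => i _; rewrite mxE.
Qed.

Let kernel_Pi : exists K : 'M[R]_(d, d + k), row_free K /\ K *m Pi = 0.
Proof.
have rPi : \rank Pi = k.
  apply/eqP; rewrite eqn_leq rank_leq_col -{1}(mxrank1 R k) -P0.
  exact: mxrankM_maxr.
have e : \rank (kermx Pi) = d by rewrite mxrank_ker rPi addnK.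
exists (castmx (e, erefl) (row_base (kermx Pi))); split.
  by rewrite row_free_castmx row_base_free.
apply/eqP; rewrite -sub_kermx.
by rewrite (eqmx_cast (row_base (kermx Pi)) (e, erefl)) eq_row_base.
Qed.

(** From the transversal x0 + z K through x0, flowing for unit time along sum_a w_a Xf_a gives a
    local diffeomorphism (z, w) -> x. Moving w stays in the leaf, so the z-block of its inverse has
    the vertical vectors as kernel. *)
Theorem foliation_chart : exists (V : set 'rV[R]_(d + k)) (F : 'rV[R]_(d + k) -> 'rV[R]_d),
  [/\ open V, V x0, V `<=` A, smooth_map_on V F &
      forall x, V x -> forall v, 'D_v F x = 0 <-> horizontal x v = 0].
Proof.
have A'x0 : A' x0 by split => //; rewrite P0 unitmx1.
have [r [E [r0 sE E0 EA dE]]] := commuting_flow oA' A'x0 sXf Xf_commute.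
have [K [fK KPi]] := kernel_Pi.
(* Sends (z, w) to (w, z K): the flow parameters come first in the argument of E, the displacement
   of the initial point second. *)
pose L : 'M[R]_(d + k, k + (d + k)) := col_mx (row_mx 0 K) (row_mx 1%:M 0).
have mulL z w : row_mx z w *m L = row_mx w (z *m K).
  rewrite /L mul_row_col !mul_mx_row !mulmx0 mulmx1 add_row_mx add0r addr0 //.
pose I (y : 'rV[R]_(d + k)) := row_mx 0 x0 + y *m L.
have sI : smooth_map_on setT I.
  apply: smooth_mapD; [exact: openT|exact: smooth_map_cst|].
  apply: smooth_map_mulmx; [exact: openT|exact: smooth_map_id|].
  by move=> i j; exact: smooth_cst.
have dI y v : 'D_v I y = v *m L.
  have did : derivable (id : 'rV[R]_(d + k) -> 'rV[R]_(d + k)) y v by exact: derivable_id.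
  have dL : derivable (fun y : 'rV[R]_(d + k) => y *m L) y v.
    apply: diff_derivable; apply: (smooth_map_differentiable openT _ Logic.I).
    apply: smooth_map_mulmx; [exact: openT|exact: smooth_map_id|].
    by move=> i j; exact: smooth_cst.
  have h := deriveD (derivable_cst (row_mx 0 x0 : 'rV[R]_(k + (d + k))) y v) dL.
  rewrite [LHS]h (derive_cst (row_mx 0 x0 : 'rV[R]_(k + (d + k)))) add0r.
  by rewrite (derive_mulmx L did) derive_id.
pose A2 : set 'rV[R]_(d + k) := I @^-1` [set z | `|z - row_mx 0 x0| < r].
have oA2 : open A2.
  have /continuousP : continuous I by move=> y; exact: smooth_map_continuous sI Logic.I.
  by apply; exact: open_ball_norm.
pose G := E \o I.
have sG : smooth_map_on setT G by apply: (smooth_map_comp openT openT _ sI sE).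
have dIy y : differentiable I y by exact: smooth_map_differentiable openT sI Logic.I.
have dEz z : differentiable E z by exact: smooth_map_differentiable openT sE Logic.I.
have dG y v : 'D_v G y = 'D_(v *m L) E (I y).
  by rewrite (derive_comp v (dIy y) (dEz _)) dI.
have dGw y w : A2 y -> 'D_(row_mx 0 w) G y = \sum_a w 0 a *: Xf a (G y).
  by move=> A2y; rewrite dG mulL mul0mx (dE _ _ A2y).
have A20 : A2 0 by rewrite /A2 /= /I mul0mx addr0 subrr normr0.
have G0 : G 0 = x0 by rewrite /G /= /I mul0mx addr0 E0.
have XfPi_sum (w : 'rV[R]_k) x : A' x -> (\sum_a w 0 a *: Xf a x) *m Pi = w.
  move=> A'x; rewrite mulmx_suml [RHS]row_sum_delta; apply: eq_bigr => a _.
  by rewrite -scalemxAl Xf_Pi.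
have dE0 u : 'D_(row_mx 0 u) E (row_mx 0 x0) = u.
  pose N : 'M[R]_(d + k, k + (d + k)) := row_mx 0 1%:M.
  have mulN x : x *m N = row_mx 0 x by rewrite mul_mx_row mulmx0 mulmx1.
  have did : derivable (id : 'rV[R]_(d + k) -> 'rV[R]_(d + k)) x0 u by exact: derivable_id.
  have dN := derive_mulmx N did.
  have diffN : differentiable (fun y : 'rV[R]_(d + k) => y *m N) x0.
    apply: (smooth_map_differentiable openT _ Logic.I).
    apply: smooth_map_mulmx; [exact: openT|exact: smooth_map_id|].
    by move=> i j; exact: smooth_cst.
  have h := derive_comp u diffN (dEz (x0 *m N)).
  rewrite dN derive_id !mulN in h.
  rewrite -h; apply: (derive_idE _ openT) => // y _.
  by rewrite /= mulN E0.
(* [Pi] kills the transversal directions and returns w from the flow directions, so w = 0; then z =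
   0 since K is free. *)
have inj v : 'D_v G 0 = 0 -> v = 0.
  rewrite -(hsubmxK v); set z := lsubmx v; set w := rsubmx v => h.
  have I0 : I 0 = row_mx 0 x0 by rewrite /I mul0mx addr0.
  have e1 : row_mx z w *m L = (row_mx 0 w : 'rV[R]_(d + k)) *m L + row_mx 0 (z *m K).
    by rewrite !mulL mul0mx add_row_mx addr0 add0r.
  have e2 : \sum_a w 0 a *: Xf a x0 + z *m K = 0.
    apply: etrans h; rewrite dG e1 (deriveDv _ _ (dEz _)) -dG (dGw _ _ A20) G0 I0.
    by rewrite dE0.
  have w0 : w = 0.
    have := congr1 (mulmx^~ Pi) e2; rewrite mulmxDl (XfPi_sum _ _ A'x0) -mulmxA KPi mulmx0.
    by rewrite addr0 mul0mx.
  move: e2; rewrite w0 big1 ?add0r; last by move=> a _; rewrite mxE scale0r.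
  by move=> /eqP; rewrite mulmx_free_eq0 // => /eqP ->; rewrite row_mx0.
have [U [V [H [[oU U0 UA2 oV] [GU HV sH]]]]] :=
  inverse_function oA2 A20 (smooth_map_sub (@subsetT _ A2) sG) inj.
have A'V x : V x -> A' x.
  by move=> /HV [Ux <-]; apply: EA; exact: UA2.
have dH x : V x -> differentiable H x by exact: smooth_map_differentiable.
have dGy y : differentiable G y by exact: smooth_map_differentiable openT sG Logic.I.
have GH x v : V x -> 'D_('D_v H x) G (H x) = v.
  move=> Vx; rewrite -(derive_comp v (dH x Vx) (dGy _)).
  by apply: (derive_idE _ oV) => // y /HV [].
have HG y u : U y -> 'D_('D_u G y) H (G y) = u.
  move=> Uy; have [VG _] := GU y Uy; rewrite -(derive_comp u (dGy y) (dH _ VG)).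
  by apply: (derive_idE _ oU) => // z /GU [].
have dF x v : V x -> 'D_v (fun x => lsubmx (H x)) x = lsubmx ('D_v H x).
  by move=> Vx; apply: derive_lsubmx; apply: diff_derivable; exact: dH.
exists V, (fun x => lsubmx (H x)); split => //.
- by have [] := GU 0 U0; rewrite G0.
- by move=> x /A'V [].
- exact: smooth_map_lsubmx.
move=> x Vx v; rewrite (dF x v Vx); have [Ux Gx] := HV x Vx; have [Ax uP] := A'V x Vx.
split=> h.
  rewrite -(GH x v Vx) -(hsubmxK ('D_v H x)) h (dGw _ _ (UA2 _ Ux)) Gx.
  rewrite horizontal_sum big1 // => a _; rewrite horizontalZ.
  by rewrite /Xf horizontal_mul_Xm // scaler0.
pose c := (\row_i eta i x v) *m P x.
have vE : v = \sum_a c 0 a *: Xf a x.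
  have -> : \sum_a c 0 a *: Xf a x = c *m (C x *m Xm x).
    by rewrite mulmx_sum_row; apply: eq_bigr => a _; rewrite row_mul.
  by rewrite /c mulmxA -(mulmxA _ (P x)) mulmxV // mulmx1 -horizontal_eq0.
have := HG (H x) (row_mx 0 c) Ux.
by rewrite (dGw _ _ (UA2 _ Ux)) Gx -vE => ->; rewrite row_mxKl.
Qed.

End frobenius.

(** * The map to the sphere *)

Lemma line_constant (R : realType) m (f : 'rV[R]_m -> R) (x v : 'rV[R]_m) :
  (forall t : R, 0 <= t <= 1 -> differentiable f (x + t *: v) /\ 'D_v f (x + t *: v) = 0) ->
  f (x + v) = f x.
Proof.
move=> df; have [t t01|t t01 fE] := @mvt_line R _ f x v.
  by apply: diff_derivable; have [] := df t t01.
by apply/eqP; rewrite -subr_eq0 fE; have [_ ->] := df t t01.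
Qed.

Lemma ball_line (R : realType) m (x0 x : 'rV[R]_m) (r t : R) :
  `|x - x0| < r -> 0 <= t <= 1 -> `|x0 + t *: (x - x0) - x0| < r.
Proof.
move=> xr /andP[t0 t1]; rewrite addrC addKr normrZ (ger0_norm t0).
by apply: le_lt_trans xr; rewrite ler_piMl.
Qed.

Lemma ball_constant (R : realType) m (f : 'rV[R]_m -> R) (x0 x : 'rV[R]_m) (r : R) :
  (forall y : 'rV[R]_m, `|y - x0| < r -> differentiable f y /\ forall v, 'D_v f y = 0) ->
  `|x - x0| < r -> f x = f x0.
Proof.
move=> df xr; have -> : x = x0 + (x - x0) by rewrite addrC subrK.
apply: line_constant => t t01.
by have [d1 d2] := df _ (ball_line xr t01); split.
Qed.

Lemma sum3E (V : nmodType) (F : 'I_3 -> V) : \sum_a F a = F 0 + F 1 + F 2.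
Proof.
rewrite !big_ord_recl big_ord0 addr0 -addrA.
by congr (_ + (_ + _)); congr (F _); apply: val_inj.
Qed.

Lemma sum4E (V : nmodType) (F : 'I_(3 + 1) -> V) :
  \sum_a F a = F (inord 0) + F (inord 1) + F (inord 2) + F (inord 3).
Proof.
rewrite !big_ord_recl big_ord0 addr0 -!addrA.
by congr (_ + (_ + (_ + _))); congr (F _); apply: val_inj; rewrite /= inordK.
Qed.

Section quaternions.
Variable R : realType.

(* Right multiplication by the quaternion units, acting on row vectors. *)
Definition quat_table (c : 'I_3) : seq (seq R) :=
  nth [::]
   [:: [:: [:: 0; 1; 0; 0]; [:: -1; 0; 0; 0]; [:: 0; 0; 0; -1]; [:: 0; 0; 1; 0]];
       [:: [:: 0; 0; 1; 0]; [:: 0; 0; 0; 1]; [:: -1; 0; 0; 0]; [:: 0; -1; 0; 0]];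
       [:: [:: 0; 0; 0; 1]; [:: 0; 0; -1; 0]; [:: 0; 1; 0; 0]; [:: -1; 0; 0; 0]]] c.

Definition quat (c : 'I_3) : 'M[R]_(3 + 1) :=
  \matrix_(a, b) nth 0 (nth [::] (quat_table c) a) b.

Lemma quat_skew c : (quat c)^T = - quat c.
Proof.
apply/matrixP => -[[|[|[|[|//]]]] pa] [[|[|[|[|//]]]] pb]; rewrite !mxE /=;
by case: c => [[|[|[|//]]] pc] /=; rewrite ?oppr0 ?opprK.
Qed.

Lemma quat_sqr c : quat c *m quat c = - 1%:M.
Proof.
apply/matrixP => -[[|[|[|[|//]]]] pa] [[|[|[|[|//]]]] pb]; rewrite !mxE sum4E !mxE !inordK //;
by case: c => [[|[|[|//]]] pc] /=; ring.
Qed.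

Lemma quat_mul i j k : even_triple i j k -> quat i *m quat j = quat k.
Proof.
move=> /even_tripleP [-> ->].
apply/matrixP => -[[|[|[|[|//]]]] pa] [[|[|[|[|//]]]] pb]; rewrite !mxE sum4E !mxE !inordK //;
by case: i => [[|[|[|//]]] pc] /=; ring.
Qed.

Lemma quat_mulC i j k : even_triple i j k -> quat j *m quat i = - quat k.
Proof.
move=> e; rewrite -[LHS]trmxK trmx_mul !quat_skew mulNmx mulmxN opprK (quat_mul e).
by rewrite quat_skew.
Qed.

(** With [quat_dot_self]: the products of q with the three units form an orthogonal frame, of length
    |q|, of the tangent space at q to the sphere through q. *)
Lemma quat_dot (q : 'rV[R]_(3 + 1)) c c' :
  \sum_j (q *m quat c) 0 j * (q *m quat c') 0 j = (c == c')%:R * sqnorm q.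
Proof.
rewrite /sqnorm !sum4E !mxE !sum4E !mxE !inordK //.
by case: c c' => [[|[|[|//]]] pc] [[|[|[|//]]] pc'] /=; ring.
Qed.

Lemma quat_dot_self (q : 'rV[R]_(3 + 1)) c : \sum_j q 0 j * (q *m quat c) 0 j = 0.
Proof.
rewrite !sum4E !mxE !sum4E !mxE !inordK //.
by case: c => [[|[|[|//]]] pc] /=; ring.
Qed.

End quaternions.

Section sphere_map.
Variables (R : realType) (m : nat) (delta : R) (A : set 'rV[R]_m) (x0 : 'rV[R]_m).
Variable eta : 'I_3 -> 'rV[R]_m -> 'rV[R]_m -> R.
Hypotheses (oA : open A) (Ax0 : A x0).
Hypothesis eta_lin : forall a x, scalar (eta a x).
Hypothesis seta : forall a v, smooth_on A (fun x => eta a x v).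
Hypothesis deta : forall i j k, even_triple i j k -> forall x, A x -> forall u v,
  'D_u (fun y => eta i y v) x - 'D_v (fun y => eta i y u) x =
  - 2 * delta * (eta j x u * eta k x v - eta j x v * eta k x u).

(** The connection form applied to v, acting on the fibre coordinate; [Y a] is the horizontal lift
    of e_a to the trivial bundle with fibre R^4. *)
Let S (v : 'rV[R]_m) (z : 'rV[R]_(m + (3 + 1))) : 'rV[R]_(3 + 1) :=
  \sum_c (delta * eta c (lsubmx z) v) *: (rsubmx z *m quat R c).
Let Y (a : 'I_m) (z : 'rV[R]_(m + (3 + 1))) := row_mx ('e_a : 'rV[R]_m) (S 'e_a z).
Let A4 : set 'rV[R]_(m + (3 + 1)) := lsubmx @^-1` A.

Let oA4 : open A4.
Proof. by have /continuousP := @continuous_lsubmx R 1 m (3 + 1); apply. Qed.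

Let seta4 a v : smooth_on A4 (fun z => eta a (lsubmx z) v).
Proof.
apply: (smooth_comp oA4 oA _ _ (seta a v)) => //.
by apply: smooth_map_lsubmx; exact: smooth_map_id.
Qed.

Let srq c : smooth_map_on A4 (fun z => rsubmx z *m quat R c).
Proof.
apply: smooth_map_mulmx => //; last by move=> i j; exact: smooth_cst.
by apply: smooth_map_rsubmx; exact: smooth_map_id.
Qed.

Let sS v : smooth_map_on A4 (S v).
Proof.
apply: smooth_map_sum => // c; apply: smooth_mapZ => //.
by apply: smoothM => //; exact: smooth_cst.
Qed.

Let sY a : smooth_map_on A4 (Y a).
Proof. by apply: smooth_map_row_mx; [exact: smooth_map_cst|exact: sS]. Qed.

Let dS u v z j : A4 z -> ('D_u (S v) z) 0 j =
  \sum_c (delta * eta c (lsubmx z) v * (rsubmx u *m quat R c) 0 j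
    + (rsubmx z *m quat R c) 0 j * (delta * 'D_(lsubmx u) (fun x => eta c x v) (lsubmx z))).
Proof.
move=> Az; rewrite (derive_map_rowE u j oA4 (sS v) Az).
have E : (fun z => S v z 0 j) =
    \sum_c ((fun z => delta * eta c (lsubmx z) v) * (fun z => (rsubmx z *m quat R c) 0 j)).
  by apply/funext => y; rewrite fct_sumE summxE; apply: eq_bigr => c _; rewrite mxE.
have d1 c : is_derive z u (fun z => delta * eta c (lsubmx z) v)
    (delta * 'D_(lsubmx u) (fun x => eta c x v) (lsubmx z)).
  have de : derivable (fun z => eta c (lsubmx z) v) z u.
    by apply: diff_derivable; exact: smooth_differentiable oA4 (seta4 c v) Az.
  apply: (@is_derive_eq _ _ _ _ _ _ _ _ (is_deriveZ delta (derivableP de))).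
  congr (_ * _).
  exact: (@derive_lin_comp R (m + (3 + 1)) m lsubmx (fun x => eta c x v) z u).
have d2 c : is_derive z u (fun z => (rsubmx z *m quat R c) 0 j) ((rsubmx u *m quat R c) 0 j).
  have did : derivable (id : 'rV[R]_(m + (3 + 1)) -> 'rV[R]_(m + (3 + 1))) z u.
    exact: derivable_id.
  have dr : derivable (fun z : 'rV[R]_(m + (3 + 1)) => rsubmx z) z u.
    apply: diff_derivable; apply: (smooth_map_differentiable openT _ Logic.I).
    by apply: smooth_map_rsubmx; exact: smooth_map_id.
  have dm := smooth_map_differentiable oA4 (srq c) Az.
  have dm' := diff_derivable (v := u) dm.
  split; first by move/derivable_rowP: dm'; exact.
  rewrite -(derive_rowE j dm') (derive_mulmx _ dr).
  by rewrite (derive_rsubmx did) derive_id.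
have h c := is_deriveM (d1 c) (d2 c).
rewrite E (is_derive_val (is_derive_sum h)); apply: eq_bigr => c _.
by rewrite /GRing.scale.
Qed.

(** The bracket of horizontal lifts is the curvature. The structure equations contribute -2 delta
    eta_j ^ eta_k, and the commutator of two units is twice the third, which compensates it. *)
Let Y_commute a b z : A4 z -> 'D_(Y a z) (Y b) z = 'D_(Y b z) (Y a) z.
Proof.
move=> Az; have Axz : A (lsubmx z) by [].
have dY u c : 'D_u (Y c) z = row_mx 0 ('D_u (S 'e_c) z).
  have dYc := diff_derivable (v := u) (smooth_map_differentiable oA4 (sY c) Az).
  rewrite -[LHS]hsubmxK -(derive_lsubmx dYc) -(derive_rsubmx dYc); congr row_mx.
    under eq_fun do rewrite row_mxKl.
    exact: derive_cst.
  by under eq_fun do rewrite row_mxKr.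
rewrite !dY; congr row_mx; apply/rowP => j; rewrite !(dS _ _ _ Az).
rewrite !row_mxKl !row_mxKr /S.
have e0 := even_triple_rot 0; have e1 := even_rot e0; have e2 := even_rot e1.
have t12 : (0 + 1 : 'I_3) = 1 by apply: val_inj.
have t02 : (0 + 2 : 'I_3) = 2 by apply: val_inj.
rewrite t12 t02 in e0 e1 e2.
have m0 := deta e0 Axz 'e_a 'e_b; have m1 := deta e1 Axz 'e_a 'e_b.
have m2 := deta e2 Axz 'e_a 'e_b.
have QE c (s t r : R) : ((s *: (rsubmx z *m quat R 0) + t *: (rsubmx z *m quat R 1)
    + r *: (rsubmx z *m quat R 2)) *m quat R c) 0 j =
    s * (rsubmx z *m (quat R 0 *m quat R c)) 0 j + t * (rsubmx z *m (quat R 1 *m quat R c)) 0 j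
    + r * (rsubmx z *m (quat R 2 *m quat R c)) 0 j.
  by rewrite !mulmxDl -!scalemxAl -!mulmxA !mxE.
rewrite !sum3E !QE !quat_sqr (quat_mul R e0) (quat_mul R e1) (quat_mul R e2).
rewrite (quat_mulC R e0) (quat_mulC R e1) (quat_mulC R e2) !mulmxN mulmx1.
have NE (B : 'M[R]_(1, 3 + 1)) : (- B) 0 j = - B 0 j by rewrite mxE.
rewrite !NE.
move: m0 m1 m2.
move: ('D_'e_a _ _) ('D_'e_b _ _) ('D_'e_a _ _) ('D_'e_b _ _) ('D_'e_a _ _) ('D_'e_b _ _).
move=> p2 q2 p1 q1 p0 q0 m0 m1 m2.
set w0 := (rsubmx z *m quat R 0) 0 j; set w1 := (rsubmx z *m quat R 1) 0 j.
set w2 := (rsubmx z *m quat R 2) 0 j; set w3 := rsubmx z 0 j.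
have -> : p0 = q0 + - 2 * delta * (eta 1 (lsubmx z) 'e_a * eta 2 (lsubmx z) 'e_b
  - eta 1 (lsubmx z) 'e_b * eta 2 (lsubmx z) 'e_a) by rewrite -m0; ring.
have -> : p1 = q1 + - 2 * delta * (eta 2 (lsubmx z) 'e_a * eta 0 (lsubmx z) 'e_b
  - eta 2 (lsubmx z) 'e_b * eta 0 (lsubmx z) 'e_a) by rewrite -m1; ring.
have -> : p2 = q2 + - 2 * delta * (eta 0 (lsubmx z) 'e_a * eta 1 (lsubmx z) 'e_b
  - eta 0 (lsubmx z) 'e_b * eta 1 (lsubmx z) 'e_a) by rewrite -m2; ring.
ring.
Qed.

Let S_sum (u : 'rV[R]_m) z : \sum_a u 0 a *: Y a z = row_mx u (S u z).
Proof.
have E : S u z = \sum_a u 0 a *: S 'e_a z.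
  under eq_bigr => a _ do rewrite scaler_sumr.
  rewrite exchange_big /=; apply: eq_bigr => c _.
  rewrite (scalar_rowE u (eta_lin c (lsubmx z))) mulr_sumr scaler_suml.
  by apply: eq_bigr => a _; rewrite scalerA mulrCA.
rewrite E [X in row_mx X _](row_sum_delta u).
have sumE (s : seq 'I_m) : \sum_(a <- s) u 0 a *: Y a z =
    row_mx (\sum_(a <- s) u 0 a *: 'e_a) (\sum_(a <- s) u 0 a *: S 'e_a z).
  elim: s => [|a s IH]; first by rewrite !big_nil row_mx0.
  by rewrite !big_cons IH /Y scale_row_mx add_row_mx.
exact: sumE.
Qed.

(* The parallel sections of the flat connection with form delta (eta_1 i + eta_2 j + eta_3 k)
   on the trivial bundle of quaternions; the structure equations are the flatness. *)
Theorem sphere_map : exists (W : set 'rV[R]_m) (Q : 'rV[R]_m -> 'rV[R]_(3 + 1)),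
  [/\ open W, W x0, W `<=` A, smooth_map_on W Q & forall x, W x ->
    [/\ sqnorm (Q x) = 1, Q x 0 (rshift 3 0) < 0 &
      forall v w, \sum_j ('D_v Q x) 0 j * ('D_w Q x) 0 j =
        delta ^+ 2 * \sum_a eta a x v * eta a x w]].
Proof.
(* The south pole: at points of negative height the sphere uses the projection from the north pole,
   and the height stays negative near x0. *)
pose q0 : 'rV[R]_(3 + 1) := row_mx 0 (const_mx (-1)).
pose p := row_mx x0 q0.
have A4p : A4 p by rewrite /A4 /= row_mxKl.
have [r [E [r0 sE E0 EA dE]]] := commuting_flow oA4 A4p sY Y_commute.
pose L : 'M[R]_(m, m + (m + (3 + 1))) := row_mx 1%:M 0.
have mulL z : z *m L = row_mx z 0 by rewrite mul_mx_row mulmx1 mulmx0.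
(* With parameter x - x0 and initial point (x0, q0), unit time under E is parallel transport of q0
   along the segment from x0 to x. *)
pose I (x : 'rV[R]_m) := row_mx (- x0) p + x *m L.
have IE x : I x = row_mx (x - x0) p by rewrite /I mulL add_row_mx addr0 addrC.
have sL : smooth_map_on setT (fun x : 'rV[R]_m => x *m L).
  apply: smooth_map_mulmx; [exact: openT|exact: smooth_map_id|].
  by move=> i j; exact: smooth_cst.
have sI : smooth_map_on setT I.
  by apply: smooth_mapD; [exact: openT|exact: smooth_map_cst|exact: sL].
have dI x v : 'D_v I x = row_mx v 0.
  have did : derivable (id : 'rV[R]_m -> 'rV[R]_m) x v by exact: derivable_id.
  have dL := diff_derivable (v := v) (smooth_map_differentiable openT sL (Logic.I : setT x)).
  have h := deriveD (derivable_cst (row_mx (- x0) p : 'rV[R]_(m + (m + (3 + 1)))) x v) dL.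
  rewrite [LHS]h (derive_cst (row_mx (- x0) p : 'rV[R]_(m + (m + (3 + 1))))) add0r.
  by rewrite (derive_mulmx L did) derive_id mulL.
pose e x := E (I x).
have se : smooth_map_on setT e by apply: (smooth_map_comp openT openT _ sI sE).
pose B : set 'rV[R]_m := [set x | `|x - x0| < r].
have BE x : B x -> `|I x - row_mx 0 p| < r.
  move=> Bx; rewrite IE opp_row_mx add_row_mx subr0 subrr.
  by apply: le_lt_trans Bx; apply: normr_row_mx; rewrite ?row_mxKl ?row_mxKr ?normr0.
have dIx x : differentiable I x by exact: smooth_map_differentiable openT sI Logic.I.
have dex x : differentiable e x by exact: smooth_map_differentiable openT se Logic.I.
have dEz z : differentiable E z by exact: smooth_map_differentiable openT sE Logic.I.
have de x u : B x -> 'D_u e x = row_mx u (S u (e x)).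
  move=> Bx; rewrite (derive_comp u (dIx x) (dEz _)) dI (dE _ _ (BE x Bx)).
  exact: S_sum.
have e0 : e x0 = p by rewrite /e IE subrr E0.
have B0 : B x0 by rewrite /B /= subrr normr0.
have lsub_e x : B x -> lsubmx (e x) = x.
  move=> Bx; apply/rowP => j; apply/eqP; rewrite -subr_eq0; apply/eqP.
  have h := @ball_constant R m (fun y => (lsubmx (e y) - y) 0 j) x0 x r _ Bx.
  rewrite -subrowE h; first by rewrite e0 row_mxKl subrr mxE.
  move=> y By.
  have sl : smooth_map_on setT (fun y => lsubmx (e y) - y).
    apply: smooth_map_ext (smooth_mapD openT (smooth_map_lsubmx se)
      (smooth_mapZ openT (smooth_cst setT (-1)) (smooth_map_id setT))); first exact: openT.
    by move=> z _; rewrite scaleN1r.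
  split; first exact: smooth_differentiable openT (sl j) Logic.I.
  move=> v; rewrite -(derive_map_rowE v j openT sl Logic.I).
  have did : derivable (id : 'rV[R]_m -> 'rV[R]_m) y v by exact: derivable_id.
  have dl : derivable (fun y => lsubmx (e y)) y v.
    by apply: diff_derivable; exact: smooth_map_differentiable openT (smooth_map_lsubmx se) Logic.I.
  have h1 := deriveB dl did.
  have -> : 'D_v (fun y => lsubmx (e y) - y) y = 0; last by rewrite mxE.
  apply: (etrans h1); rewrite derive_id (derive_lsubmx (diff_derivable (dex y))) (de y v By).
  by rewrite row_mxKl subrr.
pose Q x := rsubmx (e x).
have scaleE (a : R) (M : 'rV[R]_(3 + 1)) j : (a *: M) 0 j = a * M 0 j by rewrite mxE.
have sQ : smooth_map_on setT Q by exact: smooth_map_rsubmx.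
have dQ x u : B x -> 'D_u Q x = \sum_c (delta * eta c x u) *: (Q x *m quat R c).
  move=> Bx; rewrite (derive_rsubmx (diff_derivable (dex x))) (de x u Bx) row_mxKr.
  by rewrite /S lsub_e.
have Q0 : Q x0 = q0 by rewrite /Q e0 row_mxKr.
have Q1 x : B x -> sqnorm (Q x) = 1.
  move=> Bx; have h := @ball_constant R m (fun y => sqnorm (Q y)) x0 x r _ Bx.
  rewrite h.
    rewrite Q0 sqnorm_row mxE /sqnorm big1 ?add0r ?sqrrN ?expr1n // => i _.
    by rewrite mxE expr0n.
  move=> y By.
  have ss : smooth_on setT (fun y => sqnorm (Q y)).
    apply: smooth_sum; first exact: openT.
    move=> j; apply: smooth_ext (smoothM openT (sQ j) (sQ j)); first exact: openT.
    by move=> z _; rewrite expr2.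
  split; first exact: smooth_differentiable openT ss Logic.I.
  move=> v.
  have dQj j : is_derive y v (fun y => Q y 0 j) (('D_v Q y) 0 j).
    have dd := diff_derivable (v := v) (smooth_differentiable openT (sQ j) (Logic.I : setT y)).
    by split => //; rewrite (derive_map_rowE v j openT sQ Logic.I).
  have E1 : (fun y => sqnorm (Q y)) = \sum_j ((fun y => Q y 0 j) * (fun y => Q y 0 j)).
    by apply/funext => z; rewrite fct_sumE; apply: eq_bigr => j _; rewrite expr2.
  have h1 j := is_deriveM (dQj j) (dQj j).
  rewrite E1 (is_derive_val (is_derive_sum h1)) /GRing.scale /=.
  under eq_bigr => j _ do rewrite (dQ y v By) summxE mulr_sumr.
  rewrite big_split /= exchange_big /= big1 ?addr0 // => c _.
  rewrite -[RHS](mulr0 (delta * eta c y v)) -[in RHS](quat_dot_self (Q y) c) mulr_sumr.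
  by apply: eq_bigr => j _; rewrite scaleE mulrCA.
have oB : open B by exact: open_ball_norm.
pose W : set 'rV[R]_m := [set x | B x /\ Q x 0 (rshift 3 0) < 0].
exists W, Q; split.
- rewrite openE => x [Bx hx].
  have n1 : nbhs x B by apply: open_nbhs_nbhs.
  have n2 : nbhs x [set y | Q y 0 (rshift 3 0) < 0].
    have cQ := smooth_continuous (sQ (rshift 3 0)) (Logic.I : setT x).
    have n3 : nbhs (Q x 0 (rshift 3 0)) [set t : R | t < 0].
      by apply: open_nbhs_nbhs; split => //; exact: open_lt.
    exact: (cQ _ n3).
  by apply: filterS (filterI n1 n2) => y [].
- by split => //; rewrite Q0 row_mxEr mxE ltrN10.
- move=> x [Bx _]; have := EA _ (BE x Bx).
  by rewrite /A4 /= -/(e x) lsub_e.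
- exact: smooth_map_sub (@subsetT _ _) sQ.
- move=> x [Bx hx]; split => //; first exact: Q1.
  move=> v w; rewrite (dQ x v Bx) (dQ x w Bx).
  under eq_bigr => j _ do rewrite !summxE mulr_suml.
  rewrite exchange_big /= mulr_sumr; apply: eq_bigr => c _.
  under eq_bigr => j _ do rewrite mulr_sumr.
  rewrite exchange_big /= (bigD1 c) //= [X in _ + X]big1 ?addr0; last first.
    move=> c' /negbTE cc'; transitivity (delta * eta c x v * (delta * eta c' x w) *
      \sum_j (Q x *m quat R c) 0 j * (Q x *m quat R c') 0 j).
      by rewrite mulr_sumr; apply: eq_bigr => j _; rewrite [RHS]mulrACA !scaleE.
    by rewrite quat_dot eq_sym cc' mul0r mulr0.
  transitivity (delta * eta c x v * (delta * eta c x w) *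
      \sum_j (Q x *m quat R c) 0 j * (Q x *m quat R c) 0 j).
    by rewrite mulr_sumr; apply: eq_bigr => j _; rewrite [RHS]mulrACA !scaleE.
  by rewrite quat_dot eqxx (Q1 x Bx) mul1r mulr1; ring.
Qed.

End sphere_map.

(** * Local splitting *)

(** The structure of M in one chart, with [P i] and [gam] the transverse complex structures and
    metric, degenerate along the leaves. Endomorphisms act on row vectors from the right, which
    reverses the order of the product in [ls_P_mul]. The forms in [ls_closed] are the Phi_i + eta_j
    ^ eta_k of M. *)
Record local_structure (R : realType) d (delta : R) (A : set 'rV[R]_(d + 3))
    (Xi : 'I_3 -> 'rV[R]_(d + 3) -> 'rV[R]_(d + 3))
    (eta : 'I_3 -> 'rV[R]_(d + 3) -> 'rV[R]_(d + 3) -> R)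
    (P : 'I_3 -> 'rV[R]_(d + 3) -> 'M[R]_(d + 3))
    (gam : 'rV[R]_(d + 3) -> 'rV[R]_(d + 3) -> 'rV[R]_(d + 3) -> R) : Prop := {
  ls_open : open A;
  ls_smooth_Xi : forall a, smooth_map_on A (Xi a);
  ls_smooth_eta : forall a v, smooth_on A (fun x => eta a x v);
  ls_smooth_P : forall i a b, smooth_on A (fun x => P i x a b);
  ls_smooth_gam : forall v w, smooth_on A (fun x => gam x v w);
  ls_eta_lin : forall a x, scalar (eta a x);
  ls_gam_bilin : bilinear_map gam;
  ls_eta_Xi : forall x, A x -> forall a b, eta a x (Xi b x) = (a == b)%:R;
  ls_Xi_P : forall x, A x -> forall i a, Xi a x *m P i x = 0;
  ls_P_sqr : forall x, A x -> forall i v, v *m P i x *m P i x = - horizontal Xi eta x v;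
  ls_P_mul : forall x, A x -> forall i j k, even_triple i j k -> P j x *m P i x = P k x;
  ls_gam_sym : forall x, A x -> forall v w, gam x v w = gam x w v;
  ls_gam_Xi : forall x, A x -> forall v a, gam x v (Xi a x) = 0;
  ls_gam_pos : forall x, A x -> forall v, horizontal Xi eta x v != 0 -> 0 < gam x v v;
  ls_gam_P : forall x, A x -> forall i v w, gam x (v *m P i x) (w *m P i x) = gam x v w;
  ls_closed : forall i, closed_on A (fun x v w => gam x v (w *m P i x));
  ls_structure : forall i j k, even_triple i j k -> forall x, A x -> forall u v,
    'D_u (fun y => eta i y v) x - 'D_v (fun y => eta i y u) x =
    - 2 * delta * (eta j x u * eta k x v - eta j x v * eta k x u);
  ls_lie : forall a b x, A x ->
    horizontal Xi eta x ('D_(Xi a x) (Xi b) x - 'D_(Xi b x) (Xi a) x) = 0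
}.

(* The complex structures act on row vectors by right multiplication; their parallelism is
   replaced by the closedness of the Kaehler forms. *)
Record hk_box (R : realType) d (A : set 'rV[R]_d) (h : 'rV[R]_d -> 'rV[R]_d -> 'rV[R]_d -> R)
    (J : 'I_3 -> 'rV[R]_d -> 'M[R]_d) : Prop := {
  hb_open : open A;
  hb_smooth_h : forall b c, smooth_on A (fun z => h z b c);
  hb_smooth_J : forall i a b, smooth_on A (fun z => J i z a b);
  hb_bilin : bilinear_map h;
  hb_sym : forall z, A z -> forall b c, h z b c = h z c b;
  hb_pos : forall z, A z -> forall b : 'rV[R]_d, b != 0 -> 0 < h z b b;
  hb_sqr : forall z, A z -> forall i (b : 'rV[R]_d), b *m J i z *m J i z = - b;
  hb_mul : forall z, A z -> forall i j k, even_triple i j k -> J j z *m J i z = J k z;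
  hb_isometry : forall z, A z -> forall i (b c : 'rV[R]_d), h z (b *m J i z) (c *m J i z) = h z b c;
  hb_closed : forall i, closed_on A (fun z b c => h z b (c *m J i z))
}.

(** Fills the indices of the countable union to which no piece is attached. *)
Lemma hk_box0 (R : realType) d :
  hk_box (set0 : set 'rV[R]_d) (fun _ _ _ => 0) (fun _ _ => 0).
Proof.
split => //.
- by move=> *; exact: smooth_cst.
- by move=> *; under eq_fun do rewrite mxE; exact: smooth_cst.
- by split => y v a u w; rewrite mulr0 addr0.
- by move=> i x.
Qed.

Section bilinear.
Variables (R : realType) (m n k : nat).
Variable W : 'rV[R]_m -> 'rV[R]_n -> 'rV[R]_k -> R.
Hypothesis bW : bilinear_map W.

Lemma bilin0l x w : W x 0 w = 0.
Proof. by have := bW.2 x w (-1) 0 0; rewrite scaler0 addr0 /=; lra. Qed.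

Lemma bilinZl x a v w : W x (a *: v) w = a * W x v w.
Proof. by have := bW.2 x w a v 0; rewrite /= bilin0l !addr0. Qed.

Lemma bilinNl x v w : W x (- v) w = - W x v w.
Proof. by rewrite -scaleN1r bilinZl mulN1r. Qed.

Lemma bilinDl x u v w : W x (u + v) w = W x u w + W x v w.
Proof. by have := bW.2 x w 1 u v; rewrite /= scale1r mul1r. Qed.

Lemma bilin0r x w : W x w 0 = 0.
Proof. by have := bW.1 x w (-1) 0 0; rewrite scaler0 addr0 /=; lra. Qed.

Lemma bilinZr x a v w : W x w (a *: v) = a * W x w v.
Proof. by have := bW.1 x w a v 0; rewrite /= bilin0r !addr0. Qed.

Lemma bilinNr x v w : W x w (- v) = - W x w v.
Proof. by rewrite -scaleN1r bilinZr mulN1r. Qed.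

Lemma bilinDr x u v w : W x w (u + v) = W x w u + W x w v.
Proof. by have := bW.1 x w 1 u v; rewrite /= scale1r mul1r. Qed.

Lemma smooth_bilin l (A : set 'rV[R]_l) (B : set 'rV[R]_m) (G : 'rV[R]_l -> 'rV[R]_m)
    (Y : 'rV[R]_l -> 'rV[R]_n) (Z : 'rV[R]_l -> 'rV[R]_k) :
  open A -> open B -> (forall x, A x -> B (G x)) -> smooth_map_on A G ->
  (forall v w, smooth_on B (fun x => W x v w)) ->
  smooth_map_on A Y -> smooth_map_on A Z -> smooth_on A (fun x => W (G x) (Y x) (Z x)).
Proof.
move=> oA oB AB sG sW sY sZ.
have E x : W (G x) (Y x) (Z x) =
    \sum_a \sum_b Y x 0 a * (Z x 0 b * W (G x) 'e_a 'e_b).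
  rewrite (scalar_rowE (Y x) (bW.2 (G x) (Z x))); apply: eq_bigr => a _.
  by rewrite (scalar_rowE (Z x) (bW.1 (G x) 'e_a)) mulr_sumr.
apply: (smooth_ext (f := fun x => \sum_a \sum_b Y x 0 a * (Z x 0 b * W (G x) 'e_a 'e_b))) => //.
apply: smooth_sum => // a; apply: smooth_sum => // b; apply: smoothM => //; apply: smoothM => //.
exact: (smooth_comp oA oB AB sG (sW _ _)).
Qed.

End bilinear.

Section local_structure_theory.
Variables (R : realType) (d : nat) (delta : R) (A : set 'rV[R]_(d + 3)).
Variables (Xi : 'I_3 -> 'rV[R]_(d + 3) -> 'rV[R]_(d + 3))
    (eta : 'I_3 -> 'rV[R]_(d + 3) -> 'rV[R]_(d + 3) -> R)
    (P : 'I_3 -> 'rV[R]_(d + 3) -> 'M[R]_(d + 3))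
    (gam : 'rV[R]_(d + 3) -> 'rV[R]_(d + 3) -> 'rV[R]_(d + 3) -> R).
Hypothesis ls : local_structure delta A Xi eta P gam.
Notation hor := (horizontal Xi eta).

Lemma vertical_mul_P x v i : A x -> hor x v = 0 -> v *m P i x = 0.
Proof.
move=> Ax /eqP; rewrite subr_eq0 => /eqP ->; rewrite mulmx_suml big1 // => a _.
by rewrite -scalemxAl (ls_Xi_P ls Ax) scaler0.
Qed.

Lemma vertical_gam x v w : A x -> hor x v = 0 -> gam x w v = 0.
Proof.
move=> Ax /eqP; rewrite subr_eq0 => /eqP ->; rewrite sum3E !(bilinDr (ls_gam_bilin ls)).
by rewrite !(bilinZr (ls_gam_bilin ls)) !(ls_gam_Xi ls Ax) !mulr0 !addr0.
Qed.

Lemma kahler_bilin i : bilinear_map (fun x v w => gam x v (w *m P i x)).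
Proof.
have [lr ll] := ls_gam_bilin ls.
by split => [x v a u w|x w]; [rewrite mulmxDl -scalemxAl lr|exact: ll].
Qed.

Lemma kahler_skew i x : A x -> forall v w, gam x v (w *m P i x) = - gam x w (v *m P i x).
Proof.
move=> Ax v w; rewrite -(ls_gam_P ls Ax i) (ls_P_sqr ls Ax).
rewrite (bilinNr (ls_gam_bilin ls)) (ls_gam_sym ls Ax); congr (- _).
have h : hor x (w - hor x w) = 0.
  rewrite /horizontal opprD addNKr opprK -/(hor x _) horizontal_sum ?sum3E; last exact: (ls_eta_lin ls).
  by rewrite !horizontalZ ?(horizontal_Xi (ls_eta_Xi ls)) ?scaler0 ?addr0 //; exact: (ls_eta_lin ls).
have e : gam x (w - hor x w) (v *m P i x) = 0.
  by rewrite (ls_gam_sym ls Ax) (vertical_gam _ Ax h).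
rewrite (bilinDl (ls_gam_bilin ls)) (bilinNl (ls_gam_bilin ls)) in e.
by apply/esym/eqP; rewrite -subr_eq0 e.
Qed.

Lemma smooth_kahler i v w : smooth_on A (fun x => gam x v (w *m P i x)).
Proof.
have oA := ls_open ls.
apply: (smooth_bilin (ls_gam_bilin ls) (G := id) oA oA) => //.
- exact: smooth_map_id.
- exact: ls_smooth_gam ls.
- exact: smooth_map_cst.
- by apply: smooth_map_mulmx => //; [exact: smooth_map_cst|exact: (ls_smooth_P ls i)].
Qed.

End local_structure_theory.

(** * Stereographic coordinates *)

Section stereographic.
Variables (R : realType) (m : nat) (r : R) (r0 : 0 < r).

Lemma smooth_stereo_inv b : smooth_map_on setT (@stereo_inv_row R m r b).
Proof.
have oT := @openT 'rV[R]_m.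
have dgt (u : 'rV[R]_m) : sqnorm u + r ^+ 2 != 0.
  by rewrite lt0r_neq0 // ltr_wpDl ?sqnorm_ge0 // exprn_gt0.
have sq : smooth_on setT (@sqnorm R m) by move=> k; exact: Ck_sqnorm.
have sd : smooth_on setT (fun u : 'rV[R]_m => (sqnorm u + r ^+ 2)^-1).
  by apply: smoothV => // ; apply: smoothD => //; exact: smooth_cst.
apply: smooth_map_row_mx.
  apply: smooth_mapZ => //; last exact: smooth_map_id.
  by apply: smoothM => //; exact: smooth_cst.
move=> j; under eq_fun do rewrite mxE.
apply: smoothM => //; first exact: smooth_cst.
by apply: smoothM => //; apply: smoothB => //; exact: smooth_cst.
Qed.

(** The projection from the north pole, extended off the sphere so that its smoothness can be stated
    on an open subset of R^(m+1). *)
Definition stereo_row (q : 'rV[R]_(m + 1)) : 'rV[R]_m :=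
  (r / (r - q 0 (rshift m 0))) *: lsubmx q.

Lemma stereo_rowK (q : 'rV[R]_(m + 1)) : sqnorm q = r ^+ 2 -> q 0 (rshift m 0) < 0 ->
  stereo_inv_row r false (stereo_row q) = q.
Proof.
move=> q1 q0; pose p : sphere_set m r := SigSub (mem_set (q1 : sphere_set m r q)).
have dp : chart_dom (stereo_chart m r0 false) p.
  by rewrite /= /stereo_dom /= expr0 mul1r lt0r_neq0 // subr_gt0 (lt_trans q0).
have := congr1 set_val (chart_mapK dp).
by rewrite /= /stereo /= expr0 mul1r => h; exact: h.
Qed.

Lemma smooth_stereo_row : smooth_map_on [set q : 'rV[R]_(m + 1) | q 0 (rshift m 0) < 0] stereo_row.
Proof.
set A := [set q : 'rV[R]_(m + 1) | q 0 (rshift m 0) < 0].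
have oA : open A.
  have /continuousP h : continuous (fun q : 'rV[R]_(m + 1) => q 0 (rshift m 0)).
    exact: coord_continuous.
  by apply: (h [set t : R | t < 0]); exact: open_lt.
apply: smooth_mapZ => //; last by apply: smooth_map_lsubmx; exact: smooth_map_id.
apply: smoothM => //; first exact: smooth_cst.
apply: smoothV => //; last by apply: smoothB => //; [exact: smooth_cst|exact: smooth_coord].
by move=> q q0; rewrite lt0r_neq0 // subr_gt0 (lt_trans q0).
Qed.

End stereographic.

Section splitting.
Variables (R : realType) (d : nat) (delta : R) (A : set 'rV[R]_(d + 3)).
Variables (Xi : 'I_3 -> 'rV[R]_(d + 3) -> 'rV[R]_(d + 3))
    (eta : 'I_3 -> 'rV[R]_(d + 3) -> 'rV[R]_(d + 3) -> R)
    (P : 'I_3 -> 'rV[R]_(d + 3) -> 'M[R]_(d + 3))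
    (gam : 'rV[R]_(d + 3) -> 'rV[R]_(d + 3) -> 'rV[R]_(d + 3) -> R).
Hypothesis ls : local_structure delta A Xi eta P gam.
Hypothesis delta0 : delta != 0.
Notation hor := (horizontal Xi eta).
Variable x0 : 'rV[R]_(d + 3).
Hypothesis Ax0 : A x0.

Lemma hor_sub_hor x v : A x -> hor x (v - hor x v) = 0.
Proof.
move=> Ax; rewrite /horizontal opprD addNKr opprK -/(hor x _).
rewrite horizontal_sum ?sum3E; last exact: (ls_eta_lin ls).
rewrite !horizontalZ; try exact: (ls_eta_lin ls).
by rewrite !(horizontal_Xi (ls_eta_Xi ls)) // !scaler0 !addr0.
Qed.

(* Coordinates (z, w) in which the leaves of the vertical foliation are {z = cst}, and w is the
   stereographic image of a map to the sphere. *)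
Lemma splitting_chart : exists (U B : set 'rV[R]_(d + 3)) (Psi G : 'rV[R]_(d + 3) -> 'rV[R]_(d + 3))
    (r1 : R), [/\ open U, U x0, U `<=` A & 0 < r1] /\
  [/\ B = [set y | `|y - Psi x0| < r1], forall x, U x -> B (Psi x) /\ G (Psi x) = x,
      forall y, B y -> U (G y) /\ Psi (G y) = y, smooth_map_on U Psi & smooth_map_on B G] /\
  forall x, U x -> [/\ forall v, lsubmx ('D_v Psi x) = 0 <-> hor x v = 0,
    (stereo_inv_row `|delta|^-1 false (rsubmx (Psi x))) 0 (rshift 3 0) < 0 &
    forall v w,
      \sum_j ('D_v (fun y => stereo_inv_row `|delta|^-1 false (rsubmx (Psi y))) x) 0 j *
             ('D_w (fun y => stereo_inv_row `|delta|^-1 false (rsubmx (Psi y))) x) 0 j =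
      \sum_a eta a x v * eta a x w].
Proof.
have oA := ls_open ls; pose r := `|delta|^-1; have r0 : 0 < r := radius_gt0 delta0.
have [V [F [oV Vx0 VA sF dF]]] := foliation_chart oA (ls_smooth_Xi ls) (ls_eta_lin ls)
  (ls_eta_Xi ls) (ls_lie ls) Ax0.
have [W [Q [oW Wx0 WA sQ QP]]] := sphere_map oA Ax0 (ls_eta_lin ls) (ls_smooth_eta ls)
  (ls_structure ls).
pose O := V `&` W; have oO : open O by exact: openI.
have OV : O `<=` V by move=> x []. have OW : O `<=` W by move=> x [].
pose H := [set q : 'rV[R]_(3 + 1) | q 0 (rshift 3 0) < 0].
have srQ : smooth_map_on O (fun x => r *: Q x).
  by apply: smooth_mapZ => //; [exact: smooth_cst|exact: smooth_map_sub sQ].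
have HQ x : O x -> H (r *: Q x).
  by move=> [_ /QP [_ h _]]; rewrite /H /= mxE pmulr_rlt0.
have oH : open H.
  have /continuousP h : continuous (fun q : 'rV[R]_(3 + 1) => q 0 (rshift 3 0)).
    exact: coord_continuous.
  by apply: (h [set t : R | t < 0]); exact: open_lt.
pose s x := stereo_row r (r *: Q x).
have ss : smooth_map_on O s by exact: (smooth_map_comp oO oH HQ srQ (smooth_stereo_row r0)).
have sK x : O x -> stereo_inv_row r false (s x) = r *: Q x.
  move=> Ox; apply: stereo_rowK => //; last exact: HQ.
  by rewrite sqnormZ; have [_ /QP [-> _ _]] := Ox; rewrite mulr1.
pose Psi x := row_mx (F x) (s x).
have sPsi : smooth_map_on O Psi by apply: smooth_map_row_mx => //; exact: smooth_map_sub sF.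
have dPsi x v : O x -> derivable Psi x v.
  by move=> Ox; apply: diff_derivable; exact: smooth_map_differentiable sPsi Ox.
have dPl x v : O x -> lsubmx ('D_v Psi x) = 'D_v F x.
  by move=> Ox; rewrite -(derive_lsubmx (dPsi x v Ox)); under eq_fun do rewrite row_mxKl.
have dPr x v : O x -> rsubmx ('D_v Psi x) = 'D_v s x.
  by move=> Ox; rewrite -(derive_rsubmx (dPsi x v Ox)); under eq_fun do rewrite row_mxKr.
have dsK x v : O x -> 'D_v (fun y => stereo_inv_row r false (rsubmx (Psi y))) x = r *: 'D_v Q x.
  move=> Ox; have dQ : derivable Q x v.
    by apply: diff_derivable; exact: smooth_map_differentiable oW sQ (OW x Ox).
  rewrite -[RHS](deriveZ r dQ); apply: near_eq_derive; apply: (near_open_map oO Ox) => y Oy.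
  by rewrite row_mxKr sK.
have met x v w : O x ->
    \sum_j ('D_v (fun y => stereo_inv_row r false (rsubmx (Psi y))) x) 0 j *
           ('D_w (fun y => stereo_inv_row r false (rsubmx (Psi y))) x) 0 j =
    \sum_a eta a x v * eta a x w.
  move=> Ox; rewrite !dsK //; have [_ /QP [_ _ h]] := Ox.
  under eq_bigr => j _ do rewrite [X in X * _]mxE [X in _ * X]mxE mulrACA.
  rewrite -mulr_sumr h mulrA -expr2 exprVn real_normK ?num_real // mulVf ?mul1r //.
  by rewrite expf_neq0.
have Ox0 : O x0 by [].
have inj v : 'D_v Psi x0 = 0 -> v = 0.
  move=> h; have h1 : hor x0 v = 0 by rewrite -(dF x0 Vx0 v) -dPl // h linear0.
  have h2 : 'D_v s x0 = 0 by rewrite -dPr // h linear0.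
  have h3 : 'D_v (fun y => stereo_inv_row r false (rsubmx (Psi y))) x0 = 0.
    have E : \forall y \near x0, stereo_inv_row r false (rsubmx (Psi y)) = (stereo_inv_row r false \o s) y.
      by apply: filterE => y; rewrite /= row_mxKr.
    rewrite (near_eq_derive v E).
    have ds := smooth_map_differentiable oO ss Ox0.
    have di := smooth_map_differentiable openT (smooth_stereo_inv (m := 3) r0 false) (Logic.I : setT (s x0)).
    by rewrite (derive_comp v ds di) h2 derive0.
  (* At (v, v) the metric identity is a sum of squares: a vector killed by the projection to the
     sphere has all its eta_a zero, so it is horizontal; being vertical as well, it vanishes. *)
  have h4 := met x0 v v Ox0; rewrite h3 in h4.
  have h5 a : eta a x0 v = 0.
    have hs : \sum_a eta a x0 v * eta a x0 v = 0.
      by rewrite -h4 big1 // => j _; rewrite mxE mul0r.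
    have hp b : true -> 0 <= eta b x0 v * eta b x0 v by rewrite -expr2 sqr_ge0.
    move: hs => /eqP; rewrite psumr_eq0 // => /allP /(_ a (mem_index_enum a)) /=.
    by rewrite mulf_eq0 orbb => /eqP.
  by rewrite -h1 /horizontal big1 ?subr0 // => a _; rewrite h5 scale0r.
have [U0 [V0 [G [[oU0 U0x0 U0O oV0] [GU HV sG]]]]] := inverse_function oO Ox0 sPsi inj.
have [V0x0 _] := GU x0 U0x0.
have [r1 r10 r1V] := ball_in_open oV0 V0x0.
(* A ball for the maximum norm is a product of a z-ball and a w-ball: points with the same z are
   joined inside it by a segment along the leaf, and its z-projection is again a ball. *)
pose B := [set y | `|y - Psi x0| < r1].
have oB : open B by exact: open_ball_norm.
have BV : B `<=` V0.
  by move=> y By; apply: r1V => /=; apply: ltW; apply: lt_le_trans By _; rewrite ler_peMl ?ltW // ltr1n.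
pose U := [set x | U0 x /\ B (Psi x)].
exists U, B, Psi, G, r1; split; [|split].
- split => //.
  + rewrite openE => x [Ux Bx].
    have n1 : nbhs x U0 by apply: open_nbhs_nbhs.
    have n3 : nbhs (Psi x) B by apply: open_nbhs_nbhs.
    have n2 : nbhs x (Psi @^-1` B) := smooth_map_continuous sPsi (U0O x Ux) n3.
    by apply: filterS (filterI n1 n2) => y [].
  + by split => //; rewrite /B /= subrr normr0.
  + by move=> x [/U0O [/VA]].
- split => //.
  + by move=> x [Ux Bx]; split => //; have [] := GU x Ux.
  + by move=> y By; have [h1 h2] := HV y (BV y By); rewrite /U /= h2.
  + by apply: smooth_map_sub sPsi => x [/U0O].
  + exact: smooth_map_sub sG.
- move=> x [/U0O Ox _]; split; last by move=> v w; exact: met.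
  + by move=> v; rewrite dPl //; apply: dF; case: Ox.
  + by rewrite row_mxKr sK //; exact: HQ.
Qed.

End splitting.

Lemma mulmx_ext (R : realType) m n (A B : 'M[R]_(m, n)) :
  (forall b : 'rV[R]_m, b *m A = b *m B) -> A = B.
Proof. by move=> AB; apply/row_matrixP => i; rewrite !rowE. Qed.

(* Two of the Kaehler forms determine the third complex structure, hence the metric. *)
Lemma kahler_determined (R : realType) d (h h' : 'rV[R]_d -> 'rV[R]_d -> R)
    (J J' : 'I_3 -> 'M[R]_d) :
  (forall b, scalar (h b)) -> (forall b, scalar (h' b)) ->
  (forall b : 'rV[R]_d, b != 0 -> 0 < h b b) ->
  (forall i (b : 'rV[R]_d), b *m J i *m J i = - b) ->
  (forall i (b : 'rV[R]_d), b *m J' i *m J' i = - b) ->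
  (forall i j k, even_triple i j k -> J j *m J i = J k) ->
  (forall i j k, even_triple i j k -> J' j *m J' i = J' k) ->
  (forall i (b c : 'rV[R]_d), h b (c *m J i) = h' b (c *m J' i)) ->
  forall b c, h b c = h' b c.
Proof.
move=> lh lh' hpos sq sq' mul mul' same b c.
have scalarN (f : 'rV[R]_d -> R) v : scalar f -> f (- v) = - f v.
  move=> lf; have f0 : f 0 = 0 by have := lf (-1) 0 0; rewrite scaler0 addr0 /=; lra.
  by have := lf (-1) v 0; rewrite addr0 scaleN1r mulN1r f0 addr0.
have e := even_triple_rot 0; move: e.
set i : 'I_3 := 0; set j : 'I_3 := 0 + 1; set k : 'I_3 := 0 + 2 => e.
have Jki (v : 'rV[R]_d) : v *m J k *m J i = - (v *m J j).
  by rewrite -(mul _ _ _ e) mulmxA sq.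
have Jki' (v : 'rV[R]_d) : v *m J' k *m J' i = - (v *m J' j).
  by rewrite -(mul' _ _ _ e) mulmxA sq'.
have nondeg (v : 'rV[R]_d) : (forall b', h b' (v *m J i) = 0) -> v = 0.
  move=> hv; have Ji0 : v *m J i = 0.
    by apply/eqP; apply: contraT => n0; have := hpos _ n0; rewrite hv ltxx.
  by apply/eqP; rewrite -oppr_eq0 -(sq i v) Ji0 mul0mx.
have Jk (v : 'rV[R]_d) : v *m J k = v *m J' k.
  apply/eqP; rewrite -subr_eq0; apply/eqP; apply: nondeg => b'.
  have a1 := same i b' (v *m J k); have a2 := same j b' v.
  have a3 := same i b' (v *m J' k); have a4 := lh b' (-1) (v *m J' k *m J i) (v *m J k *m J i).
  rewrite Jki (scalarN _ _ (lh b')) in a1; rewrite Jki' (scalarN _ _ (lh' b')) in a3.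
  rewrite scaleN1r Jki (scalarN _ _ (lh b')) in a4.
  by rewrite mulmxBl addrC Jki a4; lra.
have := same k b (c *m J k); rewrite sq Jk sq' (scalarN _ _ (lh b)) (scalarN _ _ (lh' b)).
by move/oppr_inj.
Qed.

(** * The transverse structure in splitting coordinates *)

Section splitting_kahler.
Variables (R : realType) (d : nat) (delta : R) (A : set 'rV[R]_(d + 3)).
Variables (Xi : 'I_3 -> 'rV[R]_(d + 3) -> 'rV[R]_(d + 3))
    (eta : 'I_3 -> 'rV[R]_(d + 3) -> 'rV[R]_(d + 3) -> R)
    (P : 'I_3 -> 'rV[R]_(d + 3) -> 'M[R]_(d + 3))
    (gam : 'rV[R]_(d + 3) -> 'rV[R]_(d + 3) -> 'rV[R]_(d + 3) -> R).
Hypothesis ls : local_structure delta A Xi eta P gam.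
Notation hor := (horizontal Xi eta).
Variables (U B : set 'rV[R]_(d + 3)) (Psi G : 'rV[R]_(d + 3) -> 'rV[R]_(d + 3))
  (y0 : 'rV[R]_(d + 3)) (r : R).
Hypotheses (oU : open U) (UA : U `<=` A) (BE : B = [set y | `|y - y0| < r]).
Hypotheses (UB : forall x, U x -> B (Psi x) /\ G (Psi x) = x)
  (BU : forall y, B y -> U (G y) /\ Psi (G y) = y)
  (sPsi : smooth_map_on U Psi) (sG : smooth_map_on B G).
Hypothesis leaves : forall x, U x -> forall v, lsubmx ('D_v Psi x) = 0 <-> hor x v = 0.

Let oB : open B. Proof. by rewrite BE; exact: open_ball_norm. Qed.
Let bg := ls_gam_bilin ls.
Let GA y : B y -> A (G y). Proof. by move=> /BU [/UA]. Qed.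
Let dPsi x : U x -> differentiable Psi x. Proof. exact: smooth_map_differentiable. Qed.
Let dG y : B y -> differentiable G y. Proof. exact: smooth_map_differentiable. Qed.

(* [p x v] is the differential of the projection along the leaves, [T y b] its lift. *)
Let p x v : 'rV[R]_d := v *m lsubmx (jac Psi x : 'M[R]_(d + 3, d + 3)).
Let T y (b : 'rV[R]_d) : 'rV[R]_(d + 3) := row_mx b 0 *m jac G y.

Let pE x v : U x -> p x v = lsubmx ('D_v Psi x).
Proof.
move=> Ux; rewrite (jacP v (dPsi Ux)) /p.
by rewrite -[in RHS](hsubmxK (jac Psi x)) mul_mx_row row_mxKl.
Qed.

Let TE y b : B y -> T y b = 'D_(row_mx b 0) G y.
Proof. by move=> By; rewrite (jacP _ (dG By)). Qed.

Let dPsiG y u : B y -> 'D_('D_u G y) Psi (G y) = u.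
Proof.
move=> By; have [Ux _] := BU By.
rewrite -(derive_comp u (dG By) (dPsi Ux)).
by apply: (derive_idE _ oB) => // z /BU [].
Qed.

Let pT y b : B y -> p (G y) (T y b) = b.
Proof.
by move=> By; have [Ux _] := BU By; rewrite (pE _ Ux) (TE _ By) dPsiG // row_mxKl.
Qed.

Let pB x (u v : 'rV[R]_(d + 3)) : p x (u - v) = p x u - p x v. Proof. by rewrite /p mulmxBl. Qed.

Let p_vertical x v : U x -> p x v = 0 <-> hor x v = 0.
Proof. by move=> Ux; rewrite pE //; exact: leaves. Qed.

Let vertical_Tp y v : B y -> hor (G y) (T y (p (G y) v) - v) = 0.
Proof.
move=> By; have [Ux _] := BU By; apply/(p_vertical _ Ux).
by rewrite pB pT // subrr.
Qed.

Let TpP y v i : B y -> T y (p (G y) v) *m P i (G y) = v *m P i (G y).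
Proof.
move=> By; apply/eqP; rewrite -subr_eq0 -mulmxBl.
by rewrite (vertical_mul_P ls _ (GA By) (vertical_Tp v By)).
Qed.

Let gTp y v w : B y -> gam (G y) w (T y (p (G y) v)) = gam (G y) w v.
Proof.
move=> By; have := vertical_gam ls w (GA By) (vertical_Tp v By).
by rewrite (bilinDr bg) (bilinNr bg) => /eqP; rewrite subr_eq0 => /eqP.
Qed.

Let J i y : 'M[R]_d :=
  usubmx (jac G y : 'M[R]_(d + 3, d + 3)) *m P i (G y) *m lsubmx (jac Psi (G y) : 'M[R]_(d + 3, d + 3)).
Let h y b c := gam (G y) (T y b) (T y c).

Let JE i y (b : 'rV[R]_d) : b *m J i y = p (G y) (T y b *m P i (G y)).
Proof.
rewrite /J /p /T !mulmxA; congr (_ *m _ *m _).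
by rewrite -[in RHS](vsubmxK (jac G y)) mul_row_col mul0mx addr0.
Qed.

Let J_sqr y i (b : 'rV[R]_d) : B y -> b *m J i y *m J i y = - b.
Proof.
move=> By; have [Ux _] := BU By; have Ax := GA By.
rewrite !JE TpP // (ls_P_sqr ls Ax) /p mulNmx -/(p _ _).
have := (p_vertical (T y b - hor (G y) (T y b)) Ux).2 (hor_sub_hor ls (T y b) Ax).
by rewrite pB pT // => /eqP; rewrite subr_eq0 => /eqP <-.
Qed.

Let J_mul y i j k : B y -> even_triple i j k -> J j y *m J i y = J k y.
Proof.
move=> By e; apply: mulmx_ext => b; rewrite mulmxA !JE TpP // -mulmxA.
by rewrite (ls_P_mul ls (GA By) e).
Qed.

Let hJ y i (b c : 'rV[R]_d) : B y -> h y b (c *m J i y) = gam (G y) (T y b) (T y c *m P i (G y)).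
Proof. by move=> By; rewrite /h JE gTp. Qed.

Let h_sym y b c : B y -> h y b c = h y c b.
Proof. by move=> By; exact: (ls_gam_sym ls (GA By)). Qed.

Let h_isometry y i (b c : 'rV[R]_d) : B y -> h y (b *m J i y) (c *m J i y) = h y b c.
Proof.
move=> By; rewrite hJ // (ls_gam_sym ls (GA By)) JE gTp // (ls_gam_P ls (GA By)).
exact: h_sym.
Qed.

Let h_pos y (b : 'rV[R]_d) : B y -> b != 0 -> 0 < h y b b.
Proof.
move=> By b0; apply: (ls_gam_pos ls (GA By)); apply: contra_neq b0 => hb.
by rewrite -(pT b By); apply/(p_vertical _ (BU By).1).
Qed.

Let slice (z : 'rV[R]_d) := row_mx z (rsubmx y0).
Let box : set 'rV[R]_d := [set z | `|z - lsubmx y0| < r].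

Let slice_line y (t : R) : B y -> 0 <= t <= 1 ->
  B (slice (lsubmx y) + t *: (row_mx 0 (rsubmx y - rsubmx y0) : 'rV[R]_(d + 3))).
Proof.
rewrite BE /= => By /andP[t0 t1].
have -> : slice (lsubmx y) + t *: (row_mx 0 (rsubmx y - rsubmx y0) : 'rV[R]_(d + 3)) - y0 =
    row_mx (lsubmx (y - y0)) (t *: rsubmx (y - y0)).
  apply/eqP; rewrite subr_eq; apply/eqP; rewrite -[X in _ = _ + X](hsubmxK y0).
  by rewrite /slice scale_row_mx !add_row_mx scaler0 addr0 !linearB /= subrK addrC.
apply: le_lt_trans By; apply: normr_row_mx.
  by rewrite row_mxKl; apply: normr_row_le => // j; rewrite [X in `|X|]mxE normr_row.
rewrite row_mxKr normrZ (ger0_norm t0).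
apply: (@le_trans _ _ `|rsubmx (y - y0)|); first by rewrite ler_piMl.
by apply: normr_row_le => // j; rewrite [X in `|X|]mxE normr_row.
Qed.

Let slice_in y : B y -> B (slice (lsubmx y)).
Proof.
move=> By; have := @slice_line y 0 By; rewrite scale0r addr0; apply.
by rewrite lexx ler01.
Qed.

Let box_slice z : box z -> B (slice z).
Proof.
rewrite BE /box /= => zr.
have -> : slice z - y0 = row_mx (z - lsubmx y0) 0.
  apply/eqP; rewrite subr_eq; apply/eqP; rewrite -[X in _ = _ + X](hsubmxK y0).
  by rewrite add_row_mx subrK add0r.
by apply: le_lt_trans zr; apply: normr_row_mx; rewrite ?row_mxKl ?row_mxKr ?normr0.
Qed.

(* Closed and annihilated by the directions of the leaves, the Kaehler forms do not depend on
   the position in the leaf. *)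
Let kahler_slice i y (b c : 'rV[R]_d) : B y ->
  h y b (c *m J i y) = h (slice (lsubmx y)) b (c *m J i (slice (lsubmx y))).
Proof.
move=> By; set v : 'rV[R]_(d + 3) := row_mx 0 (rsubmx y - rsubmx y0).
pose W := pullback G (fun x v w => gam x v (w *m P i x)).
have WE y' : B y' -> h y' b (c *m J i y') = W y' (row_mx b 0) (row_mx c 0).
  by move=> By'; rewrite hJ // /W /pullback !TE.
have yE : y = slice (lsubmx y) + v.
  by rewrite /slice /v add_row_mx addr0 addrC subrK hsubmxK.
rewrite (WE y By) (WE _ (slice_in By)) {1}yE.
apply: (@line_constant R _ (fun y' => W y' (row_mx b 0) (row_mx c 0))) => t t01.
set y' := _ + t *: v; have By' : B y' by exact: slice_line.
have sD a : smooth_map_on B (fun y => 'D_a G y) by exact: smooth_map_derive.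
have sW a e : smooth_on B (fun y => W y a e).
  apply: (smooth_bilin (kahler_bilin ls i) oB (ls_open ls) GA sG (smooth_kahler ls i)).
    exact: sD.
  exact: sD.
split; first exact: smooth_differentiable oB (sW _ _) By'.
have cW : closed_on B W.
  apply: (closed_pullback oB (ls_open ls) sG GA (kahler_bilin ls i) _ _ (ls_closed ls i)).
    by move=> x Ax; exact: (kahler_skew ls i Ax).
  exact: (smooth_kahler ls i).
have vert y1 : B y1 -> hor (G y1) ('D_v G y1) = 0.
  move=> By1; apply: (leaves (BU By1).1 ('D_v G y1)).1.
  by rewrite dPsiG // /v row_mxKl.
have Wl y1 a : B y1 -> W y1 v a = 0.
  move=> By1; rewrite /W /pullback (ls_gam_sym ls (GA By1)).
  exact: (vertical_gam ls _ (GA By1) (vert y1 By1)).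
have Wr y1 a : B y1 -> W y1 a v = 0.
  move=> By1; rewrite /W /pullback (vertical_mul_P ls i (GA By1) (vert y1 By1)).
  exact: bilin0r.
have dl a e : 'D_e (fun y => W y v a) y' = 0.
  rewrite -(derive_cst (0 : R) y' e); apply: near_eq_derive.
  by apply: (near_open oB By') => y1 By1; exact: Wl.
have dr a e : 'D_e (fun y => W y a v) y' = 0.
  rewrite -(derive_cst (0 : R) y' e); apply: near_eq_derive.
  by apply: (near_open oB By') => y1 By1; exact: Wr.
(* Of the three terms of dW on (v, b, c), two have v inside the form and vanish identically on B;
   closedness therefore kills the derivative along v. *)
have cv := cW y' By' v (row_mx b 0) (row_mx c 0).
have := etrans (esym (congr2 +%R (congr2 +%R
  (erefl ('D_v (fun y => W y (row_mx b 0) (row_mx c 0)) y'))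
  (dr (row_mx c 0) (row_mx b 0))) (dl (row_mx b 0) (row_mx c 0)))) cv.
by rewrite !addr0.
Qed.

(** Closedness constrains only the Kaehler forms. That the metric too is independent of the position
    in the leaf follows from its being determined by them, through [kahler_determined]. *)
Let h_slice y b c : B y -> h y b c = h (slice (lsubmx y)) b c.
Proof.
move=> By; have Bs := slice_in By.
have hlin y' b' : scalar (h y' b').
  move=> a u w; rewrite /h /T -(bilinZr bg) -(bilinDr bg) scalemxAl -mulmxDl.
  by rewrite scale_row_mx add_row_mx scaler0 addr0.
apply: (@kahler_determined R d (h y) (h (slice (lsubmx y))) (J^~ y) (J^~ (slice (lsubmx y)))).
- exact: hlin.
- exact: hlin.
- by move=> b'; exact: h_pos.
- by move=> i' b'; exact: J_sqr.
- by move=> i' b'; exact: J_sqr.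
- by move=> i' j' k'; exact: J_mul.
- by move=> i' j' k'; exact: J_mul.
- by move=> i' b' c'; exact: kahler_slice.
Qed.

(** The structure is restricted to the slice through y0 at constant w; [h_slice] carries its metric
    back to the other points of the leaves. *)
Theorem splitting_kahler : exists (h' : 'rV[R]_d -> 'rV[R]_d -> 'rV[R]_d -> R)
    (J' : 'I_3 -> 'rV[R]_d -> 'M[R]_d),
  hk_box [set z | `|z - lsubmx y0| < r] h' J' /\
  forall x, U x -> forall v w,
    h' (lsubmx (Psi x)) (lsubmx ('D_v Psi x)) (lsubmx ('D_w Psi x)) = gam x v w.
Proof.
exists (fun z => h (slice z)), (fun i z => J i (slice z)); split; last first.
  move=> x Ux v w; have [Bx Gx] := UB Ux.
  rewrite -h_slice // -!pE // /h.
  have g1 := gTp v (T (Psi x) (p x v)) Bx; have g2 := gTp w (T (Psi x) (p x v)) Bx.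
  have g3 := gTp v w Bx; rewrite Gx in g1 g2 g3.
  have Ax := UA Ux.
  by rewrite Gx g2 (ls_gam_sym ls Ax) g3 (ls_gam_sym ls Ax).
have ob : open box by exact: open_ball_norm.
have ssl : smooth_map_on box slice.
  by apply: smooth_map_row_mx; [exact: smooth_map_id|exact: smooth_map_cst].
have sGs : smooth_map_on box (G \o slice) by exact: (smooth_map_comp ob oB box_slice ssl sG).
have sjG a b : smooth_on box (fun z => jac G (slice z) a b).
  exact: (smooth_comp ob oB box_slice ssl (smooth_jac a b oB sG)).
have sT b : smooth_map_on box (fun z => T (slice z) b).
  by apply: smooth_map_mulmx => //; exact: smooth_map_cst.
split.
- exact: ob.
- move=> b c; apply: (smooth_bilin bg ob (ls_open ls) (G := G \o slice) _ sGs (ls_smooth_gam ls)) => //.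
  by move=> z /box_slice; exact: GA.
- move=> i a b.
  have sJ : smooth_map_on box (fun z => ('e_a : 'rV[R]_d) *m J i (slice z)).
    apply: (@smooth_map_ext _ _ _ _ (fun z => T (slice z) 'e_a *m P i (G (slice z)) *m
        lsubmx (jac Psi (G (slice z)) : 'M[R]_(d + 3, d + 3))));
      [exact: ob|by move=> z _; rewrite JE|].
    have bU z : box z -> U ((G \o slice) z) by move=> /box_slice /BU [].
    apply: smooth_map_mulmx => //.
      apply: smooth_map_mulmx => // a' b'.
      apply: (smooth_comp ob (ls_open ls) _ sGs (ls_smooth_P ls i a' b')).
      by move=> z /bU /UA.
    move=> a' b'; under eq_fun do rewrite mxE.
    exact: (smooth_comp ob oU bU sGs (smooth_jac _ _ oU sPsi)).
  apply: smooth_ext (sJ b) => // z _.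
  by rewrite -rowE mxE.
- split => z b a u w; rewrite /h /T.
    rewrite -(bilinZr bg) -(bilinDr bg) scalemxAl -mulmxDl scale_row_mx add_row_mx.
    by rewrite scaler0 addr0.
  rewrite -(bilinZl bg) -(bilinDl bg) scalemxAl -mulmxDl scale_row_mx add_row_mx.
  by rewrite scaler0 addr0.
- by move=> z /box_slice Bz b c; exact: h_sym.
- by move=> z /box_slice Bz b; exact: h_pos.
- by move=> z /box_slice Bz i b; exact: J_sqr.
- by move=> z /box_slice Bz i j k; exact: J_mul.
- by move=> z /box_slice Bz i b c; exact: h_isometry.
move=> i z bz u v w.
have dsl z' (b : 'rV[R]_d) : box z' -> 'D_b slice z' = row_mx b 0.
  move=> bz'; have dz := diff_derivable (v := b) (smooth_map_differentiable ob ssl bz').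
  rewrite -[LHS]hsubmxK -(derive_lsubmx dz) -(derive_rsubmx dz); congr row_mx.
    under eq_fun do rewrite row_mxKl.
    exact: derive_id.
  under eq_fun do rewrite row_mxKr.
  exact: derive_cst.
have E b c : \forall z' \near z, h (slice z') b (c *m J i (slice z')) =
    pullback (G \o slice) (fun x v w => gam x v (w *m P i x)) z' b c.
  apply: (near_open ob bz) => z' bz'; have Bz' := box_slice bz'.
  have ds := smooth_map_differentiable ob ssl bz'.
  rewrite hJ // /pullback (derive_comp b ds (dG Bz')) (derive_comp c ds (dG Bz')).
  by rewrite !dsl // !TE.
rewrite (near_eq_derive u (E v w)) (near_eq_derive v (E w u)) (near_eq_derive w (E u v)).
apply: (closed_pullback ob (ls_open ls) sGs _ (kahler_bilin ls i) _ _ (ls_closed ls i)) => //.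
- by move=> z' /box_slice; exact: GA.
- by move=> x Ax; exact: (kahler_skew ls i Ax).
- exact: (smooth_kahler ls i).
Qed.

End splitting_kahler.

(** * Consequences of rigidity on M *)

Section three_delta_cosymplectic.
Variables (R : realType) (m : nat) (M : manifold R m) (delta : R) (phi : 'I_3 -> endofield M)
  (xi : 'I_3 -> vfield M) (eta : 'I_3 -> oneform M) (g : bilinfield M).
Hypothesis hM : three_delta_cosymplectic delta phi xi eta g.
Let h3 := tdc_a3cm hM.
Let hg := acm_metric (a3cm_acm h3 0).
Let rules := dirder_lie_rules M.
Let hK := koszul_formP hg rules.

Let rigid i j k (e : even_triple i j k) X Y Z p :=
  @rigidity _ _ _ delta _ _ _ _ h3 _ _ rules _ hK (tdc_deta hM) (tdc_dPhi hM) i j k e X Y Z p.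

Let dphiE i X Y Z p : smooth_vfield X -> smooth_vfield Y -> smooth_vfield Z ->
  dphi phi (koszul g (@dirder _ _ M) (@lie _ _ M)) i X Y Z p =
  model_dphi delta eta p i (X p) (Y p) (Z p).
Proof. by move=> sX sY sZ; have [] := rigid (even_triple_rot i) p sX sY sZ. Qed.

Let dxiE i X Z p : smooth_vfield X -> smooth_vfield Z ->
  dxi xi (koszul g (@dirder _ _ M) (@lie _ _ M)) i X Z p =
  model_dxi delta eta p i (X p) (Z p).
Proof. by move=> sX sZ; have [] := rigid (even_triple_rot i) p sX sZ sZ. Qed.

Lemma tdc_hypernormal : hypernormal phi xi eta.
Proof.
move=> i X Y sX sY p; have e := even_triple_rot i.
exact: (nijenhuis_eq0 h3 hK dphiE e sX sY (tdc_deta hM e sX sY p)).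
Qed.

Lemma tdc_killing i : killing g (xi i).
Proof. by move=> X Y sX sY p; exact: (xi_killing h3 hK dxiE i sX sY p). Qed.

Lemma tdc_lie_xi i j k : even_triple i j k -> forall p,
  lie (xi i) (xi j) p = (2 * delta) *: xi k p.
Proof. by move=> e p; exact: (lie_xi h3 hK dxiE e p). Qed.

Lemma levi_civita_metric_torsion nabla : levi_civita g nabla ->
  has_metric_torsion g (@dirder _ _ M) (@lie _ _ M) nabla.
Proof. by move=> lc; split; [exact: lc_torsion_free lc|exact: lc_metric lc]. Qed.

Lemma tdc_nabla_phi nabla i j k : levi_civita g nabla -> even_triple i j k ->
  forall X Y, smooth_vfield X -> smooth_vfield Y -> forall p,
  nabla_endo nabla X (phi i) Y p =
    (delta * (eta j p (X p) * eta j p (Y p) + eta k p (X p) * eta k p (Y p))) *: xi i p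
    - (delta * eta i p (Y p)) *: (eta j p (X p) *: xi j p + eta k p (X p) *: xi k p).
Proof.
move=> lc e X Y sX sY p.
exact: (nabla_phi_formula h3 hK dphiE e (levi_civita_metric_torsion lc) sX sY p).
Qed.

Lemma tdc_nabla_xi nabla i j k : levi_civita g nabla -> even_triple i j k ->
  forall X, smooth_vfield X -> forall p,
  nabla X (xi i) p = delta *: (eta k p (X p) *: xi j p - eta j p (X p) *: xi k p).
Proof.
move=> lc e X sX p.
exact: (nabla_xi_formula h3 hK dxiE e (levi_civita_metric_torsion lc) sX p).
Qed.

End three_delta_cosymplectic.

(** * The transverse structure *)

Section transverse.
Variables (R : realType) (m : nat) (M : manifold R m) (phi : 'I_3 -> endofield M)
  (xi : 'I_3 -> vfield M) (eta : 'I_3 -> oneform M) (g : bilinfield M).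
Hypothesis h3 : almost_3_contact_metric phi xi eta g.
Let hc i := a3cm_acm h3 i.
Let hg := acm_metric (hc 0).
Variable q : M.
Implicit Types u v w : 'rV[R]_m.

(* The structure transverse to the foliation spanned by the Reeb fields, extended by zero. *)
Definition tphi (i : 'I_3) u : 'rV[R]_m :=
  phi i q u + eta (i + 2) q u *: xi (i + 1) q - eta (i + 1) q u *: xi (i + 2) q.

Definition tmetric u v : R := g q u v - \sum_a eta a q u * eta a q v.

Lemma tphiE i j k u : even_triple i j k ->
  tphi i u = phi i q u + eta k q u *: xi j q - eta j q u *: xi k q.
Proof. by move=> /even_tripleP [-> ->]. Qed.

Lemma tphi_linear i : linear (tphi i).
Proof.
move=> a u v; rewrite /tphi !linearP /=; apply/rowP => l.
rewrite !mxE /GRing.scale /=; ring.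
Qed.

Lemma tmetric_sym u v : tmetric u v = tmetric v u.
Proof.
by rewrite /tmetric (metricC hg); congr (_ - _); apply: eq_bigr => a _; rewrite mulrC.
Qed.

Lemma tmetric_scalar u : scalar (tmetric u).
Proof.
move=> a v w; rewrite /tmetric (metricDr hg) (metricZr hg) !sum3E !linearP /= /GRing.scale /=.
ring.
Qed.

Section triple.
Variables (i j k : 'I_3).
Hypothesis e : even_triple i j k.
Let e1 := even_rot e.
Let e2 := even_rot e1.

Lemma sum_triple (V : nmodType) (F : 'I_3 -> V) : \sum_a F a = F i + F j + F k.
Proof.
have [-> ->] := (even_tripleP i j k).1 e; rewrite sum3E.
case: i => [[|[|[|//]]] pi].
- by congr (F _ + F _ + F _); apply: val_inj.
- by rewrite [RHS]addrC addrA; congr (F _ + F _ + F _); apply: val_inj.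
- by rewrite -[RHS]addrA [RHS]addrC; congr (F _ + F _ + F _); apply: val_inj.
Qed.

Lemma eta_xi_triple a : eta i q (xi a q) = (i == a)%:R.
Proof.
have [E1 E2] := (even_tripleP i j k).1 e.
have : [\/ a = i, a = j | a = k].
  rewrite E1 E2; case: i a => [[|[|[|//]]] pi] [[|[|[|//]]] pa];
  (by constructor 1; apply: val_inj) || (by constructor 2; apply: val_inj)
  || (by constructor 3; apply: val_inj).
case=> ->; first by rewrite (eta_xi_self h3) eqxx.
- rewrite (eta_xi_next h3 e) E1; case: i => [[|[|[|//]]] pi] //.
- rewrite (eta_xi_prev h3 e2) E2; case: i => [[|[|[|//]]] pi] //.
Qed.

Lemma tphi_xi a : tphi i (xi a q) = 0.
Proof.
have [E1 E2] := (even_tripleP i j k).1 e.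
have : [\/ a = i, a = j | a = k].
  rewrite E1 E2; case: i a => [[|[|[|//]]] pi] [[|[|[|//]]] pa];
  (by constructor 1; apply: val_inj) || (by constructor 2; apply: val_inj)
  || (by constructor 3; apply: val_inj).
case=> ->; rewrite (tphiE _ e).
- by rewrite (phi_xi (hc i)) (eta_xi_next h3 e2) (eta_xi_prev h3 e) !scale0r subr0 addr0.
- by rewrite (phi_xi_next h3 e) (eta_xi_prev h3 e1) (eta_xi_self h3) scale0r scale1r addr0 subrr.
- rewrite (phi_xi_prev h3 e2) (eta_xi_next h3 e1) (eta_xi_self h3) scale0r scale1r subr0.
  by rewrite addNr.
Qed.

Lemma eta_tphi u : [/\ eta i q (tphi i u) = 0, eta j q (tphi i u) = 0 & eta k q (tphi i u) = 0].
Proof.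
rewrite !(tphiE _ e) !linearB !linearD !linearZ /= /GRing.scale /=.
rewrite !(eta_xi_self h3) (eta_phi (hc i)) (eta_phi_prev h3 e) (eta_phi_next h3 e2).
rewrite (eta_xi_next h3 e) (eta_xi_prev h3 e2) (eta_xi_next h3 e1) (eta_xi_prev h3 e1).
by split; ring.
Qed.

Lemma tphi_phi l u : tphi l (tphi i u) = tphi l (phi i q u) + eta k q u *: tphi l (xi j q)
  - eta j q u *: tphi l (xi k q).
Proof.
have lZ c v : tphi l (c *: v) = c *: tphi l v.
  have h0 : tphi l 0 = 0.
    have := tphi_linear l 1 0 0; rewrite !scale1r addr0 => /eqP.
    by rewrite -subr_eq0 opprD addNKr oppr_eq0 => /eqP.
  by have := tphi_linear l c v 0; rewrite !addr0 h0 addr0.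
have lD v w : tphi l (v + w) = tphi l v + tphi l w.
  by have := tphi_linear l 1 v w; rewrite !scale1r.
by rewrite [tphi i u](tphiE _ e) !lD lZ -scaleN1r lZ lZ scaleN1r.
Qed.

End triple.

Lemma eta_tphi0 i a u : eta a q (tphi i u) = 0.
Proof.
have e := even_triple_rot i; have [h1 h2 h4] := eta_tphi e u.
have : [\/ a = i, a = i + 1 | a = i + 2].
  case: i a {e h1 h2 h4} => [[|[|[|//]]] pi] [[|[|[|//]]] pa];
  (by constructor 1; apply: val_inj) || (by constructor 2; apply: val_inj)
  || (by constructor 3; apply: val_inj).
by case=> ->.
Qed.

Lemma eta_xi a b : eta a q (xi b q) = (a == b)%:R.
Proof. exact: eta_xi_triple (even_triple_rot a) b. Qed.

Lemma tphi_xi0 i a : tphi i (xi a q) = 0.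
Proof. exact: tphi_xi (even_triple_rot i) a. Qed.

Lemma tphi_sqr i u : tphi i (tphi i u) = - (u - \sum_a eta a q u *: xi a q).
Proof.
have e := even_triple_rot i; have e2 := even_rot (even_rot e).
rewrite (tphi_phi e) !tphi_xi0 !scaler0 subr0 addr0 (tphiE _ e) (acm_phi2 (hc i)).
rewrite (eta_phi_next h3 e2) (eta_phi_prev h3 e) (sum_triple e).
by apply/rowP => l; rewrite !mxE; ring.
Qed.

Lemma tphi_mul i j k u : even_triple i j k -> tphi i (tphi j u) = tphi k u.
Proof.
move=> e; have e1 := even_rot e; have e2 := even_rot e1.
rewrite (tphi_phi e1) !tphi_xi0 !scaler0 subr0 addr0 (tphiE _ e) (tphiE _ e2) (phi_mul h3 e).
rewrite (eta_phi (hc j)) scale0r subr0 (eta_phi_prev h3 e1) scaleNr.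
by [].
Qed.

Lemma tmetric_xi u a : tmetric u (xi a q) = 0.
Proof.
rewrite /tmetric (metric_xi (hc a)) (bigD1 a) //= eta_xi eqxx mulr1 big1 ?addr0 ?subrr //.
by move=> b /negbTE ba; rewrite eta_xi ba mulr0.
Qed.

Lemma tmetric_tphi i u v : tmetric (tphi i u) (tphi i v) = tmetric u v.
Proof.
have e := even_triple_rot i; have e2 := even_rot (even_rot e).
have sE w v' : tmetric w (tphi i v') = tmetric w (phi i q v').
  rewrite (tphiE v' e) -[_ - _]addrC -scaleNr tmetric_scalar tmetric_xi mulr0 add0r.
  by rewrite addrC tmetric_scalar tmetric_xi mulr0 add0r.
rewrite sE tmetric_sym sE tmetric_sym /tmetric (acm_compat (hc i)) !(sum_triple e).
rewrite !(eta_phi (hc i)) !(eta_phi_prev h3 e) !(eta_phi_next h3 e2); ring.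
Qed.

Lemma tmetric_pos u : u - \sum_a eta a q u *: xi a q != 0 -> 0 < tmetric u u.
Proof.
set v := u - _ => v0.
have ev a : eta a q v = 0.
  rewrite /v linearB linear_sum (bigD1 a) //= linearZ /= eta_xi eqxx /GRing.scale /= mulr1.
  rewrite big1 ?addr0 ?subrr // => b /negbTE ba; rewrite linearZ /= eta_xi eq_sym ba.
  by rewrite /GRing.scale /= mulr0.
have E w : tmetric w u = tmetric w v.
  have -> : u = eta 0 q u *: xi 0 q + (eta 1 q u *: xi 1 q + (eta 2 q u *: xi 2 q + v)).
    by rewrite /v sum3E; apply/rowP => l; rewrite !mxE; ring.
  by rewrite !tmetric_scalar !tmetric_xi; ring.
rewrite E tmetric_sym E /tmetric big1 ?subr0; first exact: metric_pos hg q v v0.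
by move=> a _; rewrite ev mul0r.
Qed.

(** The origin of the forms Phi_i + eta_j ^ eta_k: they are the Kaehler forms of the transverse
    structure. *)
Lemma tmetric_kahler i j k u v : even_triple i j k -> tmetric u (tphi i v) =
  fundamental_form (phi i) g q u v + (eta j q u * eta k q v - eta j q v * eta k q u).
Proof.
move=> e; rewrite /tmetric [X in _ - X]big1 ?subr0; last by move=> a _; rewrite eta_tphi0 mulr0.
rewrite (tphiE _ e) !(metricDr hg) (metricNr hg) !(metricZr hg) !(metric_xi (hc _)).
rewrite /fundamental_form; ring.
Qed.

End transverse.

(** * Exterior derivatives in a chart *)

Section chart_forms.
Variables (R : realType) (m : nat) (M : manifold R m) (p : M).
Implicit Types (x u v w : 'rV[R]_m) (X Y : vfield M).

(** Global fields that agree near the point with coordinate fields. Their brackets vanish there, so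
    the invariant formulas [d1] and [d2] reduce to partial derivatives in the chart. *)
Lemma chart_constant_field x v : coords_cod p x -> exists X : vfield M,
  smooth_vfield X /\ \forall y \near x, local_rep X p y = v /\
    X (param p y) = coord_field p v (param p y).
Proof.
move=> cx; have px := paramP cx.
have [X [sX nX]] := vfield_germ px (smooth_map_cst (coords_cod p) v).
exists X; split => //; rewrite (paramK cx) in nX.
have nc : nbhs x (coords_cod p) by apply: open_nbhs_nbhs; split => //; exact: open_cod.
apply: filterS (filterI nX nc) => y [Xy cy]; split => //.
by rewrite (vfieldE X (paramP cy)) (paramK cy) Xy.
Qed.

Lemma lie_constant_fields X Y x u v : smooth_vfield X -> smooth_vfield Y -> coords_cod p x ->
  (\forall y \near x, local_rep X p y = u) -> (\forall y \near x, local_rep Y p y = v) ->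
  lie X Y (param p x) = 0.
Proof.
move=> sX sY cx nX nY; have px := paramP cx.
have h := lie_chart sX sY px; rewrite (paramK cx) in h.
have d0 Z w c : (\forall y \near x, local_rep Z p y = w) -> 'D_c (local_rep Z p) x = 0.
  by move=> nZ; rewrite (near_eq_derive c nZ) derive_cst.
rewrite (d0 Y v _ nY) (d0 X u _ nX) subrr in h.
rewrite -(coord_field_repK (lie X Y (param p x)) px) h.
by rewrite -(scale0r 0) coord_fieldZ // !scale0r.
Qed.

Lemma dirder_constant_field X x u (f : M -> R) (F : 'rV[R]_m -> R) :
  smooth_fun f -> coords_cod p x -> local_rep X p x = u ->
  (\forall y \near x, f (param p y) = F y) -> dirder X f (param p x) = 'D_u F x.
Proof.
move=> sf cx Xx fF; rewrite (dirder_chart X sf (paramP cx)) (paramK cx) -[rep _ _ _]/(local_rep X p x) Xx.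
exact: near_eq_derive.
Qed.

Lemma chart_d1 (eta : oneform M) (E : 'rV[R]_m -> 'rV[R]_m -> R) (w2 : M -> 'rV[R]_m -> 'rV[R]_m -> R) :
  smooth_oneform eta ->
  (forall X Y, smooth_vfield X -> smooth_vfield Y -> forall q, d1 eta X Y q = w2 q (X q) (Y q)) ->
  (forall y v, coords_cod p y -> E y v = eta (param p y) (coord_field p v (param p y))) ->
  forall x u v, coords_cod p x ->
  'D_u (fun y => E y v) x - 'D_v (fun y => E y u) x =
  w2 (param p x) (coord_field p u (param p x)) (coord_field p v (param p x)).
Proof.
move=> se dE EE x u v cx.
have [X [sX nX]] := chart_constant_field u cx; have [Y [sY nY]] := chart_constant_field v cx.
have nc : nbhs x (coords_cod p) by apply: open_nbhs_nbhs; split => //; exact: open_cod.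
have nf Z w : (\forall y \near x, local_rep Z p y = w /\
    Z (param p y) = coord_field p w (param p y)) ->
    \forall y \near x, eta (param p y) (Z (param p y)) = E y w.
  by move=> nZ; apply: filterS (filterI nZ nc) => y [[_ ->] cy]; rewrite EE.
have fst Z w : (\forall y \near x, local_rep Z p y = w /\
    Z (param p y) = coord_field p w (param p y)) -> \forall y \near x, local_rep Z p y = w.
  by apply: filterS => y [].
have [X1 X2] := nbhs_singleton nX; have [Y1 Y2] := nbhs_singleton nY.
have h := dE X Y sX sY (param p x).
rewrite /d1 (lie_constant_fields sX sY cx (fst _ _ nX) (fst _ _ nY)) linear0 subr0 in h.
rewrite (dirder_constant_field (smooth_oneform_app se sY) cx X1 (nf _ _ nY)) in h.
rewrite (dirder_constant_field (smooth_oneform_app se sX) cx Y1 (nf _ _ nX)) in h.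
by rewrite h X2 Y2.
Qed.

Lemma chart_d2 (Phi : bilinfield M) (W : 'rV[R]_m -> 'rV[R]_m -> 'rV[R]_m -> R) :
  (forall q v, Phi q 0 v = 0) ->
  (forall X Y, smooth_vfield X -> smooth_vfield Y -> smooth_fun (fun q => Phi q (X q) (Y q))) ->
  (forall X Y Z, smooth_vfield X -> smooth_vfield Y -> smooth_vfield Z ->
    forall q, d2 Phi X Y Z q = 0) ->
  (forall y v w, coords_cod p y -> W y v w =
    Phi (param p y) (coord_field p v (param p y)) (coord_field p w (param p y))) ->
  closed_on (coords_cod p) W.
Proof.
move=> P0 sP dP WE x cx u v w.
have [X [sX nX]] := chart_constant_field u cx; have [Y [sY nY]] := chart_constant_field v cx.
have [Z [sZ nZ]] := chart_constant_field w cx.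
have nc : nbhs x (coords_cod p) by apply: open_nbhs_nbhs; split => //; exact: open_cod.
have nf A a B b : (\forall y \near x, local_rep A p y = a /\
    A (param p y) = coord_field p a (param p y)) ->
  (\forall y \near x, local_rep B p y = b /\
    B (param p y) = coord_field p b (param p y)) ->
    \forall y \near x, Phi (param p y) (A (param p y)) (B (param p y)) = W y a b.
  move=> nA nB; apply: filterS (filterI (filterI nA nB) nc) => y [[[_ ->] [_ ->]] cy].
  by rewrite WE.
have fst A a : (\forall y \near x, local_rep A p y = a /\
    A (param p y) = coord_field p a (param p y)) -> \forall y \near x, local_rep A p y = a.
  by apply: filterS => y [].
have [X1 X2] := nbhs_singleton nX; have [Y1 Y2] := nbhs_singleton nY.
have [Z1 Z2] := nbhs_singleton nZ.
have h := dP X Y Z sX sY sZ (param p x); rewrite /d2 in h.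
rewrite (lie_constant_fields sX sY cx (fst _ _ nX) (fst _ _ nY)) in h.
rewrite (lie_constant_fields sY sZ cx (fst _ _ nY) (fst _ _ nZ)) in h.
rewrite (lie_constant_fields sZ sX cx (fst _ _ nZ) (fst _ _ nX)) !P0 !subr0 in h.
rewrite (dirder_constant_field (sP _ _ sY sZ) cx X1 (nf _ _ _ _ nY nZ)) in h.
rewrite (dirder_constant_field (sP _ _ sZ sX) cx Y1 (nf _ _ _ _ nZ nX)) in h.
by rewrite (dirder_constant_field (sP _ _ sX sY) cx Z1 (nf _ _ _ _ nX nY)) in h.
Qed.

Lemma chart_form_derivable (Phi : bilinfield M) (W : 'rV[R]_m -> 'rV[R]_m -> 'rV[R]_m -> R) :
  (forall X Y, smooth_vfield X -> smooth_vfield Y -> smooth_fun (fun q => Phi q (X q) (Y q))) ->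
  (forall y v w, coords_cod p y -> W y v w =
    Phi (param p y) (coord_field p v (param p y)) (coord_field p w (param p y))) ->
  forall x u v w, coords_cod p x -> derivable (fun y => W y v w) x u.
Proof.
move=> sP WE x u v w cx.
have [X [sX nX]] := chart_constant_field v cx; have [Y [sY nY]] := chart_constant_field w cx.
have nc : nbhs x (coords_cod p) by apply: open_nbhs_nbhs; split => //; exact: open_cod.
have nf : \forall y \near x, ((fun q => Phi q (X q) (Y q)) \o param p) y = W y v w.
  apply: filterS (filterI (filterI nX nY) nc) => y [[[_ Xy] [_ Yy]] cy].
  by rewrite WE //= Xy Yy.
apply: near_eq_derivable nf _; apply: diff_derivable.
exact: smooth_differentiable (open_cod p) (sP X Y sX sY p) cx.
Qed.

End chart_forms.

Lemma closed_onD (R : realType) m (A : set 'rV[R]_m) (W1 W2 W : 'rV[R]_m -> 'rV[R]_m -> 'rV[R]_m -> R) :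
  open A ->
  (forall x u v w, A x -> derivable (fun y => W1 y v w) x u) ->
  (forall x u v w, A x -> derivable (fun y => W2 y v w) x u) ->
  closed_on A W1 -> closed_on A W2 ->
  (forall x v w, A x -> W x v w = W1 x v w + W2 x v w) -> closed_on A W.
Proof.
move=> oA d1 d2 c1 c2 WE x Ax u v w.
have E a b e : 'D_e (fun y => W y a b) x = 'D_e (fun y => W1 y a b) x + 'D_e (fun y => W2 y a b) x.
  have h := deriveD (d1 x e a b Ax) (d2 x e a b Ax).
  apply: (etrans _ h); apply: near_eq_derive; apply: (near_open oA Ax) => y Ay.
  exact: WE.
apply: (etrans (congr2 +%R (congr2 +%R (E v w u) (E w u v)) (E u v w))).
have := c1 x Ax u v w; have := c2 x Ax u v w.
move: ('D_u _ _) ('D_v _ _) ('D_w _ _) ('D_u _ _) ('D_v _ _) ('D_w _ _) => r1 r2 r3 r4 r5 r6.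
lra.
Qed.

(* d(eta ^ zeta) = d eta ^ zeta - eta ^ d zeta *)
Lemma closed_wedge (R : realType) m (A : set 'rV[R]_m) (E1 E2 E3 : 'rV[R]_m -> 'rV[R]_m -> R) (c : R) :
  (forall v x, A x -> differentiable (fun y => E2 y v) x) ->
  (forall v x, A x -> differentiable (fun y => E3 y v) x) ->
  (forall x u v, A x -> 'D_u (fun y => E2 y v) x - 'D_v (fun y => E2 y u) x =
    c * (E3 x u * E1 x v - E3 x v * E1 x u)) ->
  (forall x u v, A x -> 'D_u (fun y => E3 y v) x - 'D_v (fun y => E3 y u) x =
    c * (E1 x u * E2 x v - E1 x v * E2 x u)) ->
  closed_on A (fun x u v => E2 x u * E3 x v - E2 x v * E3 x u).
Proof.
move=> d2 d3 s2 s3 x Ax u v w.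
have der2 a b : is_derive x a (fun y => E2 y b) ('D_a (fun y => E2 y b) x).
  by apply: derivableP; apply: diff_derivable; exact: d2.
have der3 a b : is_derive x a (fun y => E3 y b) ('D_a (fun y => E3 y b) x).
  by apply: derivableP; apply: diff_derivable; exact: d3.
pose D2 a b := 'D_a (fun y => E2 y b) x; pose D3 a b := 'D_a (fun y => E3 y b) x.
have E a b e : 'D_e (fun y => E2 y a * E3 y b - E2 y b * E3 y a) x =
    E2 x a * D3 e b + E3 x b * D2 e a - (E2 x b * D3 e a + E3 x a * D2 e b).
  exact: (is_derive_val (is_deriveB (is_deriveM (der2 e a) (der3 e b))
    (is_deriveM (der2 e b) (der3 e a)))).
apply: (etrans (congr2 +%R (congr2 +%R (E v w u) (E w u v)) (E u v w))).
have t2 a b : D2 a b = D2 b a + c * (E3 x a * E1 x b - E3 x b * E1 x a).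
  by rewrite -(s2 x a b Ax) /D2; ring.
have t3 a b : D3 a b = D3 b a + c * (E1 x a * E2 x b - E1 x b * E2 x a).
  by rewrite -(s3 x a b Ax) /D3; ring.
move: D2 D3 t2 t3 {E s2 s3 d2 d3 der2 der3} => D2 D3 t2 t3.
rewrite (t2 u v) (t2 u w) (t2 v w) (t3 u v) (t3 u w) (t3 v w); ring.
Qed.

Section linear_combinations.
Variables (R : realType) (V W : lmodType R) (f : V -> W).
Hypothesis lf : forall a u v, f (a *: u + v) = a *: f u + f v.

Lemma lin0 : f 0 = 0.
Proof.
have := lf (-1) 0 0; rewrite scaler0 addr0 => ->.
by rewrite scaleN1r addNr.
Qed.

Lemma linZ a u : f (a *: u) = a *: f u.
Proof. by have := lf a u 0; rewrite !addr0 lin0 addr0. Qed.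

Lemma linD u v : f (u + v) = f u + f v.
Proof. by have := lf 1 u v; rewrite !scale1r. Qed.

Lemma linN u : f (- u) = - f u.
Proof. by rewrite -scaleN1r linZ scaleN1r. Qed.

Lemma lin_sub_sum (c : 'I_3 -> R) (u : 'I_3 -> V) v :
  f (v - \sum_a c a *: u a) = f v - \sum_a c a *: f (u a).
Proof. by rewrite linD linN !sum3E !linD !linZ. Qed.

Lemma lin_add_sub a b u v w : f (u + a *: v - b *: w) = f u + a *: f v - b *: f w.
Proof. by rewrite !linD linN !linZ. Qed.

End linear_combinations.

Lemma row_add_subE (R : realType) n (a b : R) (u v w : 'rV[R]_n) c :
  (u + a *: v - b *: w) 0 c = u 0 c + a * v 0 c - b * w 0 c.
Proof. by rewrite !mxE. Qed.

(** * The local structure of M in a chart *)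

Section chart_structure.
Variables (R : realType) (d : nat) (M : manifold R (d + 3)) (delta : R)
  (phi : 'I_3 -> endofield M) (xi : 'I_3 -> vfield M) (eta : 'I_3 -> oneform M)
  (g : bilinfield M).
Hypothesis hM : three_delta_cosymplectic delta phi xi eta g.
Let h3 := tdc_a3cm hM.
Let hc i := a3cm_acm h3 i.
Let hg := acm_metric (hc 0).
Variable p : M.
Let A : set 'rV[R]_(d + 3) := coords_cod p.
Let oA : open A. Proof. exact: open_cod. Qed.
Let cf (x v : 'rV[R]_(d + 3)) := coord_field p v (param p x).

(* Components in the chart at [p], extended so as to be linear everywhere. *)
Definition chart_eta (a : 'I_3) (x v : 'rV[R]_(d + 3)) : R :=
  \sum_l v 0 l * ((fun q => eta a q (coord_field p 'e_l q)) \o param p) x.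
Definition chart_tphi (i : 'I_3) (x : 'rV[R]_(d + 3)) : 'M[R]_(d + 3) :=
  \matrix_(l, c) (rep p (param p x) (tphi phi xi eta (param p x) i (cf x 'e_l))) 0 c.
Definition chart_tmetric (x v w : 'rV[R]_(d + 3)) : R :=
  \sum_l \sum_c v 0 l * w 0 c *
    (((fun q => g q (coord_field p 'e_l q) (coord_field p 'e_c q)) \o param p) x
     - \sum_a chart_eta a x 'e_l * chart_eta a x 'e_c).

Let chart_eta_lin a (x : 'rV[R]_(d + 3)) : scalar (chart_eta a x).
Proof.
move=> c u v; rewrite /chart_eta mulr_sumr -big_split /=; apply: eq_bigr => l _.
by rewrite !mxE mulrDl mulrA.
Qed.

Let etaE a x v : A x -> chart_eta a x v = eta a (param p x) (cf x v).
Proof.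
move=> Ax; rewrite /cf (coord_field_basis v (paramP Ax)) linear_sum; apply: eq_bigr => l _.
by rewrite linearZ.
Qed.

Let cfZD x a u v : A x -> cf x (a *: u + v) = a *: cf x u + cf x v.
Proof. by move=> /paramP px; rewrite /cf coord_fieldD // coord_fieldZ. Qed.

Let repL x a u v : A x -> rep p (param p x) (a *: u + v) =
  a *: rep p (param p x) u + rep p (param p x) v.
Proof. by move=> /paramP px; rewrite repD // repZ. Qed.

Let repK x v : A x -> rep p (param p x) (cf x v) = v.
Proof. by move=> /paramP px; exact: rep_coord_fieldK. Qed.

Let cfK x u : A x -> cf x (rep p (param p x) u) = u.
Proof. by move=> /paramP px; exact: coord_field_repK. Qed.

Let tphiP i x v : A x -> v *m chart_tphi i x = rep p (param p x) (tphi phi xi eta (param p x) i (cf x v)).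
Proof.
move=> Ax; apply/rowP => c; rewrite mxE.
have lT : scalar (fun v => (rep p (param p x) (tphi phi xi eta (param p x) i (cf x v))) 0 c).
  by move=> a u w; rewrite cfZD // tphi_linear repL // !mxE.
by rewrite (scalar_rowE v lT); apply: eq_bigr => l _; rewrite !mxE.
Qed.

Let cf_tphi i x v : A x -> cf x (v *m chart_tphi i x) = tphi phi xi eta (param p x) i (cf x v).
Proof. by move=> Ax; rewrite (tphiP i v Ax) (cfK _ Ax). Qed.

Let tmetricE x v w : A x -> chart_tmetric x v w = tmetric eta g (param p x) (cf x v) (cf x w).
Proof.
move=> Ax.
have lr u : scalar (fun w => tmetric eta g (param p x) u (cf x w)).
  by move=> a b c; rewrite cfZD // (tmetric_scalar h3).
have ll u : scalar (fun w => tmetric eta g (param p x) (cf x w) u).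
  by move=> a b c; rewrite cfZD // !(tmetric_sym h3 _ _ u) (tmetric_scalar h3).
rewrite [RHS](scalar_rowE v (ll (cf x w))); apply: eq_bigr => l _.
rewrite (scalar_rowE w (lr (cf x 'e_l))) mulr_sumr; apply: eq_bigr => c _.
rewrite mulrA; congr (_ * (_ - _)); apply: eq_bigr => a _.
by rewrite !etaE.
Qed.

Let Xi a x := local_rep (xi a) p x.

Let cfXi a x : A x -> cf x (Xi a x) = xi a (param p x).
Proof. exact: cfK. Qed.

Let horE x v : A x -> cf x (horizontal Xi chart_eta x v) =
  cf x v - \sum_a eta a (param p x) (cf x v) *: xi a (param p x).
Proof.
move=> Ax; apply: (etrans (lin_sub_sum (fun a u v => cfZD a u v Ax) _ _ _)).
congr (_ - _); apply: eq_bigr => a _.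
by rewrite (etaE a v Ax) (cfXi a Ax).
Qed.

Let cf_inj x u v : A x -> cf x u = cf x v -> u = v.
Proof. by move=> Ax /(congr1 (rep p (param p x))); rewrite !repK. Qed.

Let smooth_chart_eta a v : smooth_on A (fun x => chart_eta a x v).
Proof.
by apply: smooth_sum => // l; apply: smoothM => //; [exact: smooth_cst|exact: acm_eta_smooth].
Qed.

Let deta i j k (e : even_triple i j k) x : A x -> forall u v,
  'D_u (fun y => chart_eta i y v) x - 'D_v (fun y => chart_eta i y u) x =
  - 2 * delta * (chart_eta j x u * chart_eta k x v - chart_eta j x v * chart_eta k x u).
Proof.
move=> Ax u v.
have h := @chart_d1 R _ M p (eta i) (chart_eta i)
  (fun q a b => - 2 * delta * wedge1 (eta j) (eta k) q a b) (acm_eta_smooth (hc i))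
  (tdc_deta hM e) (fun y w => @etaE i y w) x u v Ax.
by rewrite h /wedge1 !etaE.
Qed.

(** Phi_i is closed by hypothesis. By the structure equations each term of d(eta_j ^ eta_k) contains
    eta_j or eta_k twice, so the wedge is closed as well. *)
Let kahler_closed i : closed_on A (fun x v w => chart_tmetric x v (w *m chart_tphi i x)).
Proof.
have e := even_triple_rot i; move: e; set j := i + 1; set k := i + 2 => e.
have e1 := even_rot e; have e2 := even_rot e1.
pose Phi := fundamental_form (phi i) g.
pose W1 x v w := Phi (param p x) (cf x v) (cf x w).
have c1 : closed_on A W1.
  apply: (@chart_d2 _ _ _ p Phi) => //.
  - by move=> q v; rewrite /Phi /fundamental_form (metric0l hg).
  - by move=> X Y sX sY; exact: (smooth_metric hg sX (smooth_phi h3 i sY)).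
  - by move=> X Y Z sX sY sZ q; exact: (tdc_dPhi hM i sX sY sZ q).
pose W2 x v w := chart_eta j x v * chart_eta k x w - chart_eta j x w * chart_eta k x v.
have de a v x : A x -> differentiable (fun y => chart_eta a y v) x.
  by move=> Ax; exact: smooth_differentiable oA (smooth_chart_eta a v) Ax.
have c2 : closed_on A W2.
  apply: (@closed_wedge _ _ _ (chart_eta i) _ _ (- 2 * delta)).
  - by move=> v x Ax; exact: de.
  - by move=> v x Ax; exact: de.
  - by move=> x u v Ax; exact: (deta e1 Ax).
  - by move=> x u v Ax; exact: (deta e2 Ax).
have WE x v w : A x -> chart_tmetric x v (w *m chart_tphi i x) = W1 x v w + W2 x v w.
  move=> Ax; rewrite tphiP // tmetricE // cfK // (tmetric_kahler h3 _ _ _ e) /W2 !etaE //.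
apply: (closed_onD oA _ _ c1 c2 WE).
  move=> x u v w Ax; apply: (@chart_form_derivable _ _ _ p Phi) => //.
  by move=> X Y sX sY; exact: (smooth_metric hg sX (smooth_phi h3 i sY)).
move=> x u v w Ax; apply: diff_derivable.
have sW2 : smooth_on A (fun y => W2 y v w).
  by apply: smoothB => //; apply: smoothM => //; exact: smooth_chart_eta.
exact: smooth_differentiable oA sW2 Ax.
Qed.

Let smooth_chart_tphi i l c : smooth_on A (fun x => chart_tphi i x l c).
Proof.
apply: (@smooth_ext _ _ _ (fun x =>
   local_rep (fun q => phi i q (coord_field p 'e_l q)) p x 0 c
    + chart_eta (i + 2) x 'e_l * Xi (i + 1) x 0 c
    - chart_eta (i + 1) x 'e_l * Xi (i + 2) x 0 c)) => //.
  move=> x Ax; rewrite [RHS]mxE /tphi.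
  have h := lin_add_sub (fun a u v => repL a u v Ax) (eta (i + 2) (param p x) (cf x 'e_l))
    (eta (i + 1) (param p x) (cf x 'e_l)) (phi i (param p x) (cf x 'e_l))
    (xi (i + 1) (param p x)) (xi (i + 2) (param p x)).
  rewrite (etaE _ _ Ax) (etaE _ _ Ax).
  exact: (esym (etrans (congr1 (fun u : 'rV[R]_(d + 3) => u 0 c) h) (row_add_subE _ _ _ _ _ _))).
have sX a : smooth_on A (fun x => Xi a x 0 c) by exact: (acm_xi_smooth (hc a) p c).
apply: smoothB => //; last by apply: smoothM => //; exact: smooth_chart_eta.
apply: smoothD => //; first exact: (acm_phi_smooth (hc i) p l c).
by apply: smoothM => //; exact: smooth_chart_eta.
Qed.

Let smooth_chart_tmetric v w : smooth_on A (fun x => chart_tmetric x v w).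
Proof.
apply: smooth_sum => // l; apply: smooth_sum => // c; apply: smoothM => //.
  exact: smooth_cst.
apply: smoothB => //; first exact: (metric_smooth hg p l c).
by apply: smooth_sum => // a; apply: smoothM => //; exact: smooth_chart_eta.
Qed.

Let chart_tmetric_bilin : bilinear_map chart_tmetric.
Proof.
split=> [x v a u w|x w a u v]; rewrite /chart_tmetric mulr_sumr -big_split /=;
    apply: eq_bigr => l _; rewrite mulr_sumr -big_split /=; apply: eq_bigr => c _;
    by rewrite !mxE; ring.
Qed.

Lemma chart_metric_split x v w : coords_cod p x ->
  chart_tmetric x v w + \sum_a chart_eta a x v * chart_eta a x w =
  g (param p x) (coord_field p v (param p x)) (coord_field p w (param p x)).
Proof.
move=> Ax; rewrite (tmetricE v w Ax) /tmetric.
have E : \sum_a chart_eta a x v * chart_eta a x w =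
    \sum_a eta a (param p x) (cf x v) * eta a (param p x) (cf x w).
  by apply: eq_bigr => a _; rewrite (etaE a v Ax) (etaE a w Ax).
by rewrite E subrK.
Qed.

Local Opaque chart_eta chart_tphi chart_tmetric coord_field rep local_rep horizontal.

Lemma chart_local_structure :
  local_structure delta A (fun a => local_rep (xi a) p) chart_eta chart_tphi chart_tmetric.
Proof.
split.
- exact: oA.
- by move=> a; exact: (acm_xi_smooth (hc a) p).
- exact: smooth_chart_eta.
- exact: smooth_chart_tphi.
- exact: smooth_chart_tmetric.
- exact: chart_eta_lin.
- exact: chart_tmetric_bilin.
- by move=> x Ax a b; rewrite etaE // cfXi // (eta_xi h3).
- move=> x Ax i a; apply: (cf_inj Ax); rewrite (tphiP i _ Ax) (cfK _ Ax) (cfXi a Ax).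
  by rewrite (tphi_xi0 h3) (lin0 (fun a u v => cfZD a u v Ax)).
- move=> x Ax i v; apply: (cf_inj Ax).
  rewrite (tphiP i (v *m chart_tphi i x) Ax) (tphiP i v Ax) (cfK _ Ax) (cfK _ Ax) (tphi_sqr h3).
  by rewrite (linN (fun a u v => cfZD a u v Ax)) (horE v Ax).
- move=> x Ax i j k e; apply: mulmx_ext => b.
  apply: (etrans (mulmxA _ _ _)); apply: (etrans (tphiP i _ Ax)).
  apply: (etrans (congr1 (fun u => rep p (param p x) (tphi phi xi eta (param p x) i u)) (cf_tphi j b Ax))).
  apply: (etrans (congr1 (rep p (param p x)) (tphi_mul h3 _ _ e))).
  exact: (esym (tphiP k b Ax)).
- by move=> x Ax v w; rewrite (tmetricE v w Ax) (tmetricE w v Ax); exact: (tmetric_sym h3).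
- by move=> x Ax v a; rewrite (tmetricE _ _ Ax) (cfXi a Ax); exact: (tmetric_xi h3).
- move=> x Ax v v0; rewrite (tmetricE v v Ax); apply: (tmetric_pos h3); rewrite -(horE v Ax).
  apply: contra_neq v0 => hv; apply: (cf_inj Ax); rewrite hv.
  by rewrite (lin0 (fun a u v => cfZD a u v Ax)).
- move=> x Ax i v w; apply: (etrans (tmetricE _ _ Ax)).
  apply: (etrans (congr2 (tmetric eta g (param p x)) (cf_tphi i v Ax) (cf_tphi i w Ax))).
  apply: (etrans (tmetric_tphi h3 _ i _ _)).
  exact: (esym (tmetricE v w Ax)).
- exact: kahler_closed.
- by move=> i j k e x Ax u v; exact: deta.
- move=> a b x Ax.
  have px := paramP Ax.
  have E a' b' : 'D_(Xi a' x) (Xi b') x - 'D_(Xi b' x) (Xi a') x =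
      rep p (param p x) (lie (xi a') (xi b') (param p x)).
    have h := lie_chart (acm_xi_smooth (hc a')) (acm_xi_smooth (hc b')) px.
    by rewrite (paramK Ax) in h.
  (* The bracket of two Reeb fields is 2 delta times the third one, hence vertical. *)
  have H0 a' b' k : even_triple a' b' k -> horizontal Xi chart_eta x
      ('D_(Xi a' x) (Xi b') x - 'D_(Xi b' x) (Xi a') x) = 0.
    move=> e; rewrite E (tdc_lie_xi hM e) repZ // (horizontalZ Xi chart_eta_lin).
    have eX y : A y -> forall a1 b1, chart_eta a1 y (Xi b1 y) = (a1 == b1)%:R.
      by move=> Ay a1 b1; rewrite (etaE _ _ Ay) (cfXi _ Ay) (eta_xi h3).
    by rewrite (horizontal_Xi eX k Ax) scaler0.
  have : [\/ b = a, b = a + 1 | b = a + 2].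
    case: a b => [[|[|[|//]]] pi] [[|[|[|//]]] pa];
    (by constructor 1; apply: val_inj) || (by constructor 2; apply: val_inj)
    || (by constructor 3; apply: val_inj).
  case=> ->.
  + by rewrite subrr (lin0 (horizontal_linear Xi chart_eta_lin x)).
  + exact: H0 (even_triple_rot a).
  + have h := H0 _ _ _ (even_rot (even_rot (even_triple_rot a))).
    apply: (etrans (congr1 (horizontal Xi chart_eta x) (esym (opprB _ _)))).
    apply: (etrans (linN (horizontal_linear Xi chart_eta_lin x) _)).
    by apply: (etrans (congr1 -%R h)); rewrite oppr0.
Qed.

End chart_structure.

(** * The hyperkaehler factor *)

Section hyperkahler_parallel.
Variables (R : realType) (m : nat) (M : manifold R m) (J : 'I_3 -> endofield M) (g : bilinfield M).
Hypotheses (hg : riemannian_metric g) (sJ : forall i, smooth_endofield (J i)).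
Hypotheses (Jsqr : forall i p v, J i p (J i p v) = - v)
  (Jmul : forall i j k, even_triple i j k -> forall p v, J i p (J j p v) = J k p v)
  (Jisom : forall i p v w, g p (J i p v) (J i p w) = g p v w).
Hypothesis dJ : forall i X Y Z, smooth_vfield X -> smooth_vfield Y -> smooth_vfield Z ->
  forall p, d2 (fundamental_form (J i) g) X Y Z p = 0.
Variables (D : vfield M -> (M -> R) -> M -> R) (L : vfield M -> vfield M -> vfield M).
Hypothesis rules : derivation_rules D L.
Variable K : vfield M -> vfield M -> vfield M -> M -> R.
Hypothesis hK : koszul_form g D L K.
(** D and L are used as opaque variables; these equations reveal them only where [d2] or the given
    connection mentions [dirder] and [lie]. *)
Hypothesis DE : D = @dirder _ _ M.
Hypothesis LE : L = @lie _ _ M.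

Let Jskew i p v w : g p (J i p v) w = - g p v (J i p w).
Proof. by rewrite -(Jisom i) Jsqr (metricNl hg). Qed.

Let JmulC i j k : even_triple i j k -> forall p v, J j p (J i p v) = - J k p v.
Proof.
move=> e p v; have e1 := even_rot e.
by rewrite -(Jmul e1) Jsqr.
Qed.

Let field := {X : vfield M | smooth_vfield X}.

Let field_eq (X Y : field) : (forall q, sval X q = sval Y q) -> X = Y.
Proof.
case: X Y => [X sX] [Y sY] /= /funext E; subst; congr exist; exact: Prop_irrelevance.
Qed.

Let fneg (X : field) : field := exist _ _ (smooth_vfieldN (svalP X)).
Let fJ i (X : field) : field := exist _ _ (smooth_appv (sJ i) (svalP X)).

Let a i p (X Y Z : field) : R :=
  K (sval X) (appv (J i) (sval Z)) (sval Y) p + K (sval X) (sval Z) (appv (J i) (sval Y)) p.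

Let sA i X : smooth_vfield X -> smooth_vfield (appv (J i) X).
Proof. exact: smooth_appv. Qed.

Let a_skew i p X Y Z : a i p X Y Z = - a i p X Z Y.
Proof.
case: X Y Z => [X sX] [Y sY] [Z sZ]; rewrite /a /=.
have h1 := K_metric hK X (appv (J i) Z) Y p; have h2 := K_metric hK X (appv (J i) Y) Z p.
have E : (fun q => g q (appv (J i) Y q) (Z q)) = (fun q => -1 * g q (appv (J i) Z q) (Y q)).
  by apply/funext => q; rewrite /appv Jskew (metricC hg) mulN1r.
rewrite E (D_mul rules X p (@smooth_fun_cst R m M (-1)) (smooth_metric hg (sA i sZ) sY)) in h2.
rewrite (D_cst rules) in h2; lra.
Qed.

Let a_mul p i j k : even_triple i j k -> forall X Y Z,
  a k p X Y Z = a i p X Y (fJ j Z) - a j p X (fJ i Y) Z.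
Proof.
move=> e [X sX] [Y sY] [Z sZ]; rewrite /a /=.
have E1 : appv (J i) (appv (J j) Z) = appv (J k) Z.
  by apply/funext => q; rewrite /appv (Jmul e).
have E2 : appv (J j) (appv (J i) Y) = (fun q => - appv (J k) Y q).
  by apply/funext => q; rewrite /appv (JmulC e).
by rewrite E1 E2 (K_Nr hK p sX sZ (sA k sY)); ring.
Qed.

Let a_eq0 p i j k : even_triple i j k -> forall X Y Z, a i p X Y Z = 0.
Proof.
move=> e X Y Z; have e1 := even_rot e; have e2 := even_rot e1.
have sqr l x : fJ l (fJ l x) = fneg x.
  by apply: field_eq => q; rewrite /= /appv Jsqr.
have mul i' j' k' (e' : even_triple i' j' k') x : fJ i' (fJ j' x) = fJ k' x.
  by apply: field_eq => q; rewrite /= /appv (Jmul e').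
have mulC i' j' k' (e' : even_triple i' j' k') x : fJ j' (fJ i' x) = fneg (fJ k' x).
  by apply: field_eq => q; rewrite /= /appv (JmulC e').
have aNl l x y z : a l p (fneg x) y z = - a l p x y z.
  case: x y z => [x sx] [y sy] [z sz]; rewrite /a /=.
  rewrite (K_Nl hg rules hK p sx (sA l sz) sy) (K_Nl hg rules hK p sx sz (sA l sy)); ring.
have aNr l x y z : a l p x (fneg y) z = - a l p x y z.
  case: x y z => [x sx] [y sy] [z sz]; rewrite /a /=.
  have E : appv (J l) (fun q => - y q) = (fun q => - appv (J l) y q).
    by apply/funext => q; rewrite /appv linearN.
  rewrite E (K_Nr hK p sx (sA l sz) sy) (K_Nr hK p sx sz (sA l sy)); ring.
have asym l x y z : a l p x (fJ l y) z = a l p x y (fJ l z).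
  case: x y z => [x sx] [y sy] [z sz]; rewrite /a /=.
  have E w : appv (J l) (appv (J l) w) = (fun q => - w q).
    by apply/funext => q; rewrite /appv Jsqr.
  rewrite (E y) (E z) (K_Nr hK p sx sz sy) (K_Nm rules hK p sx sz sy); ring.
have acyc l x y z : a l p x y z + a l p y z x + a l p z x y = 0.
  case: x y z => [x sx] [y sy] [z sz]; rewrite /a /=.
  have h := d2_K hK p (sJ l) (Jskew l) sx sy sz.
  have h' := dJ l sx sy sz p; rewrite /d2 /fundamental_form in h'.
  by rewrite DE LE in h; rewrite -h'; exact: (esym h).
have mulA' i' j' k' (e' : even_triple i' j' k') x y z :
    a k' p x y z = a i' p x (fJ j' y) z - a j' p x y (fJ i' z).
  rewrite a_skew (a_mul p e') (a_skew i' p x z) (a_skew j' p x _ y).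
  by rewrite opprB opprK addrC.
apply: (@hitchin R field fneg (fJ i) (fJ j) (fJ k) (a i p) (a j p) (a k p)).
- exact: sqr.
- exact: sqr.
- exact: sqr.
- exact: (mul _ _ _ e).
- exact: (mulC _ _ _ e).
- exact: (mul _ _ _ e1).
- exact: (mulC _ _ _ e1).
- exact: (mul _ _ _ e2).
- exact: (mulC _ _ _ e2).
- by move=> u v w; split; exact: aNl.
- by move=> u v w; split; exact: aNr.
- by move=> u v w; split; exact: a_skew.
- by move=> u v w; split; exact: asym.
- by move=> u v w; split; exact: acyc.
- by move=> u v w; split; [exact: (a_mul p e)|exact: (a_mul p e1)|exact: (a_mul p e2)].
- by move=> u v w; split; [exact: (mulA' _ _ _ e)|exact: (mulA' _ _ _ e1)|exact: (mulA' _ _ _ e2)].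
Qed.

(** [hitchin] applied to fields on the manifold itself makes the Koszul expression of nabla J
    vanish; [K_nabla] carries this over to the given connection. *)
Lemma closed_kahler_parallel nabla : levi_civita g nabla ->
  forall i X Y, smooth_vfield X -> smooth_vfield Y -> forall p,
  nabla_endo nabla X (J i) Y p = 0.
Proof.
move=> lc i X Y sX sY p; apply: (@metric_eq_fields _ _ _ _ hg p) => Z sZ.
have hn : has_metric_torsion g D L nabla.
  by rewrite DE LE; split; [exact: lc_torsion_free lc|exact: lc_metric lc].
have h := a_eq0 p (even_triple_rot i) (exist _ X sX) (exist _ Z sZ) (exist _ Y sY).
have h1 := K_nabla hg hK p hn sX (sA i sY) sZ.
have h2 := K_nabla hg hK p hn sX sY (sA i sZ).
have E : nabla_endo nabla X (J i) Y p = nabla X (appv (J i) Y) p - J i p (nabla X Y p) by [].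
rewrite E (metricDl hg p (nabla X (appv (J i) Y) p)) (metricNl hg p (J i p _)).
by rewrite Jskew h1 [X in _ - - X]h2 opprK (metric0l hg).
Qed.

End hyperkahler_parallel.

Lemma second_countable_nat : @second_countable nat.
Proof.
exists (range (fun n : nat => [set n])); first by apply: countable_im; exact: countableP.
split=> [_ [n _ <-]|n U nU]; first exact: discrete_open.
by exists [set n]; [split => //; exists n|move=> x ->; exact: nbhs_singleton].
Qed.

Lemma hausdorff_nat : hausdorff_space nat.
Proof.
move=> p q pq.
by have [x [-> ->]] := pq [set p] [set q] (discrete_set1 p) (discrete_set1 q).
Qed.

(** * Countable disjoint unions of open sets *)

Section box_union.
Variables (R : realType) (d : nat) (box : nat -> set 'rV[R]_d).
Hypothesis obox : forall k, open (box k).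

(** Tagging points with the index of their box makes overlapping boxes disjoint; the discrete
    topology of the first factor makes each box open. *)
Definition box_union_set : set (nat * 'rV[R]_d) := [set x | box x.1 x.2].
Let S := box_union_set.
Let comp (q : S) : nat := (set_val q).1.
Let pos (q : S) : 'rV[R]_d := (set_val q).2.
Let dom (p : S) : set S := [set q | comp q = comp p].

Let pos_in (q : S) : box (comp q) (pos q).
Proof. exact: (set_mem (valP q)). Qed.

(* Outside of the box the value of the inverse of a chart is irrelevant. *)
Let inv (p : S) (z : 'rV[R]_d) : S :=
  match pselect (box (comp p) z) with
  | left bz => SigSub (mem_set (bz : S (comp p, z)))
  | right _ => p
  end.

Let invE p z : box (comp p) z -> set_val (inv p z) = (comp p, z).
Proof. by move=> bz; rewrite /inv; case: pselect. Qed.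

Let dom_open p : open (dom p).
Proof.
have cf : continuous comp.
  move=> q; apply: (@continuous_comp _ _ _ set_val fst); first exact: initial_continuous.
  exact: cvg_fst.
have /continuousP h := cf; exact: (h [set comp p] (discrete_open _)).
Qed.

Let mapP p q : dom p q -> box (comp p) (pos q).
Proof. by move=> <-; exact: pos_in. Qed.

Let invP p z : box (comp p) z -> dom p (inv p z).
Proof. by move=> bz; rewrite /dom /= /comp invE. Qed.

Let mapK p q : dom p q -> inv p (pos q) = q.
Proof.
move=> pq; apply: val_inj; rewrite -[LHS]/(set_val (inv p (pos q))) (invE (mapP pq)).
by rewrite -(pq : comp q = comp p); exact: (esym (surjective_pairing _)).
Qed.

Let invK p z : box (comp p) z -> pos (inv p z) = z.
Proof. by move=> bz; rewrite /pos invE. Qed.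

Let map_continuous p q : dom p q -> {for q, continuous pos}.
Proof.
move=> _; apply: (@continuous_comp _ _ _ set_val snd); first exact: initial_continuous.
exact: cvg_snd.
Qed.

Let inv_continuous p z : box (comp p) z -> {for z, continuous (inv p)}.
Proof.
move=> bz; apply: continuous_set_type.
have c1 : {for z, continuous (fun z : 'rV[R]_d => (comp p, z))}.
  have a1 : {for z, continuous (fun _ : 'rV[R]_d => comp p)} by exact: cst_continuous.
  have a2 : {for z, continuous (fun z : 'rV[R]_d => z)} by exact: cvg_id.
  exact: (cvg_pair a1 a2).
have E : \forall y \near z, (comp p, y) = (set_val \o inv p) y.
  have nb : nbhs z (box (comp p)) by apply: open_nbhs_nbhs; split => //; exact: obox.
  by apply: filterS nb => y by_; rewrite /= invE.
have E2 : (set_val \o inv p) z = (comp p, z) by rewrite /= invE.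
rewrite /prop_for /continuous_at E2.
by apply: cvg_trans c1; exact: (@near_eq_cvg _ _ (nbhs z)).
Qed.

Definition box_chart (p : S) : chart R S d :=
  Chart (@dom_open p) (@obox (comp p)) (@mapP p) (@invP p) (@mapK p) (@invK p)
    (@map_continuous p) (@inv_continuous p).

Let box_chart_dom p : chart_dom (box_chart p) p. Proof. by []. Qed.

Let box_chart_compat p q :
  smooth_map_on (chart_cod (box_chart p) `&` chart_inv (box_chart p) @^-1` chart_dom (box_chart q))
    (chart_map (box_chart q) \o chart_inv (box_chart p)).
Proof.
have h : smooth_map_on (box (comp p)) (pos \o inv p).
  apply: smooth_map_ext (smooth_map_id (box (comp p))) => // z bz.
  by rewrite /= invK.
by apply: smooth_map_sub h => z [].
Qed.

Definition box_union : manifold R d :=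
  @Manifold R d S box_chart box_chart_dom box_chart_compat
    (@hausdorff_set_type (nat * 'rV[R]_d)%type S (hausdorff_prod hausdorff_nat (@norm_hausdorff _ _)))
    (@second_countable_set_type (nat * 'rV[R]_d)%type S (second_countable_prod second_countable_nat
       (@second_countable_rV R d))).

Definition box_index (q : box_union) : nat := comp q.
Definition box_pos (q : box_union) : 'rV[R]_d := pos q.

Lemma box_posP (q : box_union) : box (box_index q) (box_pos q).
Proof. exact: pos_in. Qed.

Lemma box_index_param (p : box_union) z : box (box_index p) z ->
  box_index (param p z) = box_index p.
Proof. by move=> bz; rewrite /box_index /comp invE. Qed.

Lemma box_pos_param (p : box_union) z : box (box_index p) z -> box_pos (param p z) = z.
Proof. by move=> bz; exact: invK. Qed.

Lemma box_point k z : box k z -> exists q : box_union, box_index q = k /\ box_pos q = z.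
Proof. by move=> bz; exists (SigSub (mem_set (bz : S (k, z)))). Qed.

(** The coordinate map of every chart is the same globally defined projection, so p and q may lie in
    different boxes. The inverse of a chart does depend on the box, whence the hypothesis of
    [box_coord_field]. *)
Lemma box_rep (p q : box_union) v : rep p q v = v.
Proof.
apply: (derive_idE _ (@obox (box_index q))); first exact: box_posP.
by move=> z bz; rewrite /= -[LHS]/(box_pos (param q z)) box_pos_param.
Qed.

Lemma box_coord_field (p q : box_union) v : box_index q = box_index p -> coord_field p v q = v.
Proof.
move=> qp; apply: (derive_idE _ (@obox (box_index p))); first by rewrite -qp; exact: box_posP.
by move=> z bz; rewrite /= -[LHS]/(box_pos (param p z)) box_pos_param.
Qed.

Variables (h : nat -> 'rV[R]_d -> 'rV[R]_d -> 'rV[R]_d -> R)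
  (J : nat -> 'I_3 -> 'rV[R]_d -> 'M[R]_d).
Hypothesis hb : forall k, hk_box (box k) (h k) (J k).

Definition box_metric : bilinfield box_union := fun q => h (box_index q) (box_pos q).
Definition box_J (i : 'I_3) : endofield box_union :=
  fun q => mulmxr (J (box_index q) i (box_pos q)).

Let box_JE i q v : box_J i q v = v *m J (box_index q) i (box_pos q). Proof. by []. Qed.

Let box_metric_riemannian : riemannian_metric box_metric.
Proof.
split.
- move=> p i j; apply: smooth_ext (hb_smooth_h (hb (box_index p)) 'e_i 'e_j).
    exact: obox.
  move=> z bz; rewrite /= /box_metric.
  by rewrite !box_coord_field ?box_index_param // box_pos_param.
- by move=> p w; exact: (hb_bilin (hb _)).2.
- by move=> p v w; exact: (hb_sym (hb _) (box_posP p)).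
- by move=> p v; exact: (hb_pos (hb _) (box_posP p)).
Qed.

Let box_J_smooth i : smooth_endofield (box_J i).
Proof.
move=> p l.
have E : forall z, box (box_index p) z -> 'e_l *m J (box_index p) i z =
    local_rep (fun q => box_J i q (coord_field p 'e_l q)) p z.
  move=> z bz; rewrite /local_rep box_rep box_JE.
  by rewrite box_coord_field ?box_index_param // box_pos_param.
apply: smooth_map_ext E _; first exact: obox.
apply: smooth_map_mulmx; [exact: obox|exact: smooth_map_cst|exact: (hb_smooth_J (hb _))].
Qed.

(** Around p the fundamental form is the given closed form evaluated on the components of the
    fields, and [closed_fields] passes from constant fields to these. *)
Let box_d2 i X Y Z : smooth_vfield X -> smooth_vfield Y -> smooth_vfield Z ->
  forall p, d2 (fundamental_form (box_J i) box_metric) X Y Z p = 0.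
Proof.
move=> sX sY sZ p; set k := box_index p; set x := coords p p.
pose W z b c := h k z b (c *m J k i z).
have [lr ll] := hb_bilin (hb k).
have bW : bilinear_map W.
  by split => [z b a u w|z c]; [rewrite /W mulmxDl -scalemxAl lr|exact: ll].
have bx : box k x by exact: box_posP.
have dW b c : differentiable (fun z => W z b c) x.
  apply: (smooth_differentiable (@obox k) _ bx).
  apply: (smooth_bilin (hb_bilin (hb k)) (G := id) (@obox k) (@obox k)) => //.
  - exact: smooth_map_id.
  - exact: (hb_smooth_h (hb k)).
  - exact: smooth_map_cst.
  - by apply: smooth_map_mulmx; [exact: obox|exact: smooth_map_cst|exact: (hb_smooth_J (hb k))].
have skew b c : W x b c = - W x c b.
  rewrite /W -(hb_isometry (hb k) bx i) (hb_sqr (hb k) bx) (hb_sym (hb k) bx).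
  exact: (bilinNl (hb_bilin (hb k))).
have dl (V : vfield box_union) : smooth_vfield V -> differentiable (local_rep V p) x.
  by move=> sV; exact: local_rep_differentiable.
have := closed_fields bW skew dW (hb_closed (hb k) i) bx (dl X sX) (dl Y sY) (dl Z sZ).
have repx V : local_rep V p x = V p by exact: local_rep_self.
have E (V1 V2 : vfield box_union) c :
    'D_c ((fun q => fundamental_form (box_J i) box_metric q (V1 q) (V2 q)) \o param p) x =
    'D_c (fun z => W z (local_rep V1 p z) (local_rep V2 p z)) x.
  apply: near_eq_derive; apply: (near_open (@obox k) bx) => z bz.
  rewrite /= /fundamental_form /box_metric box_JE /local_rep !box_rep /W.
  by rewrite box_index_param // box_pos_param.
rewrite !repx => cl.
apply: etrans cl; rewrite /d2 /dirder /lie -/x.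
rewrite (E Y Z (X p)) (E Z X (Y p)) (E X Y (Z p)).
by [].
Qed.

Theorem box_hyperkahler : hyperkahler box_J box_metric.
Proof.
have sqr i p v : box_J i p (box_J i p v) = - v by exact: (hb_sqr (hb _) (box_posP p)).
have mul i j k : even_triple i j k -> forall p v, box_J i p (box_J j p v) = box_J k p v.
  by move=> e p v; rewrite !box_JE -mulmxA (hb_mul (hb _) (box_posP p) e).
have isom i p v w : box_metric p (box_J i p v) (box_J i p w) = box_metric p v w.
  exact: (hb_isometry (hb _) (box_posP p)).
split => //.
move=> nabla lc i X Y sX sY p.
exact: (closed_kahler_parallel box_metric_riemannian box_J_smooth sqr mul isom box_d2
  (dirder_lie_rules box_union) (koszul_formP box_metric_riemannian (dirder_lie_rules box_union))
  erefl erefl lc i sX sY p).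
Qed.

End box_union.

(** * Local isometry *)

Section maps_in_charts.
Variables (R : realType) (m n : nat) (M : manifold R m) (N : manifold R n).
Variables (p : M) (q : N) (U : set M) (F : M -> N) (O : set 'rV[R]_m) (Psi : 'rV[R]_m -> 'rV[R]_n).
Hypotheses (oU : open U) (oO : open O) (Up : U `<=` dom p) (sPsi : smooth_map_on O Psi).
Hypothesis UO : forall y, U y -> O (coords p y).
Hypothesis FE : forall y, U y -> dom q (F y) /\ coords q (F y) = Psi (coords p y).

Let F_continuous y : U y -> {for y, continuous F}.
Proof.
move=> Uy; have [qF cF] := FE Uy.
have c1 : {for y, continuous (coords p)} by apply: chart_map_continuous; exact: Up.
have c2 : {for coords p y, continuous Psi} by exact: smooth_map_continuous sPsi (UO Uy).
have c3 : {for Psi (coords p y), continuous (param q)}.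
  by apply: chart_inv_continuous; rewrite -cF; exact: coordsP.
have c4 : {for y, continuous (param q \o (Psi \o coords p))}.
  by apply: continuous_comp; [exact: continuous_comp c1 c2|exact: c3].
have nU : nbhs y U by apply: open_nbhs_nbhs.
have E : \forall z \near y, (param q \o (Psi \o coords p)) z = F z.
  by apply: filterS nU => z Uz; have [qz cz] := FE Uz; rewrite /= -cz coordsK.
have E2 : F y = (param q \o (Psi \o coords p)) y by rewrite /= -cF coordsK.
rewrite /prop_for /continuous_at E2.
by apply: cvg_trans c4; exact: (@near_eq_cvg _ _ (nbhs y)).
Qed.

Let open_image (V : set N) : open V -> open (U `&` F @^-1` V).
Proof.
move=> oV; rewrite openE => y [Uy Vy].
have nU : nbhs y U by apply: open_nbhs_nbhs.
have nV : nbhs (F y) V by apply: open_nbhs_nbhs.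
have nF : nbhs y (F @^-1` V) := F_continuous Uy nV.
by apply: filterS (filterI nU nF) => z [].
Qed.

Let domain p' (q' : N) : set 'rV[R]_m := coords_cod p' `&` param p' @^-1` (U `&` F @^-1` dom q').

Let open_domain p' q' : open (domain p' q').
Proof. by apply: open_param_preimage; apply: open_image; exact: open_dom. Qed.

Let domain_tdom p' q' x : domain p' q' x ->
  [/\ tdom p' p x, O (trans p' p x) & tdom q q' (Psi (trans p' p x))].
Proof.
move=> [cx [Ux qx]]; have [h1 h2] := FE Ux; split.
- by split => //; exact: Up.
- exact: UO.
- by rewrite /trans /= -h2; exact: tdomP.
Qed.

Let local_expr p' q' x : domain p' q' x ->
  (coords q' \o F \o param p') x = trans q q' (Psi (trans p' p x)).
Proof. by move=> [cx [Ux qx]]; have [h1 h2] := FE Ux; rewrite /trans /= -h2 coordsK. Qed.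

(** One pair of charts suffices: in any other pair F differs from Psi by transition maps, which are
    smooth. *)
Lemma smooth_between_chart : smooth_between U F.
Proof.
split=> [y|p' q']; first exact: F_continuous.
have -> : [set x | [/\ coords_cod p' x, U (param p' x) & chart_dom (chart_at q') (F (param p' x))]]
    = domain p' q'.
  by apply/seteqP; split => x [] // a [].
apply: (@smooth_map_ext _ _ _ _ (trans q q' \o (Psi \o trans p' p))).
- exact: open_domain.
- by move=> x dx; rewrite local_expr.
have s1 : smooth_map_on (domain p' q') (trans p' p).
  by apply: smooth_map_sub (smooth_trans p' p) => x /domain_tdom [].
have s2 : smooth_map_on (domain p' q') (Psi \o trans p' p).
  apply: (smooth_map_comp (@open_domain p' q') oO _ s1 sPsi).
  by move=> x /domain_tdom [].
apply: (smooth_map_comp (@open_domain p' q') (open_tdom q q') _ s2 (smooth_trans q q')).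
by move=> x /domain_tdom [].
Qed.

Lemma differential_chart y v : U y ->
  differential F y v = coord_field q ('D_(rep p y v) Psi (coords p y)) (F y).
Proof.
move=> Uy; have [qF cF] := FE Uy; have px := Up Uy.
have dx : domain y (F y) (coords y y).
  split; first exact: coordsP (dom_self y).
  by rewrite /= (coordsK (dom_self y)); split => //=; exact: dom_self.
have [t1 t2 t3] := domain_tdom dx.
have E : \forall x \near coords y y, (coords (F y) \o F \o param y) x =
    (trans q (F y) \o (Psi \o trans y p)) x.
  by apply: (near_open_map (@open_domain y (F y)) dx) => x; exact: local_expr.
have tE : trans y p (coords y y) = coords p y by exact: transE (dom_self y).
have d1 : differentiable (trans y p) (coords y y) by exact: differentiable_trans.
have d2 : differentiable Psi (trans y p (coords y y)).
  by exact: smooth_map_differentiable oO sPsi t2.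
have d3 : differentiable (trans q (F y)) (Psi (trans y p (coords y y))).
  exact: differentiable_trans.
have d12 : differentiable (Psi \o trans y p) (coords y y) by exact: differentiable_comp d1 d2.
rewrite /differential (near_eq_derive v E) (derive_comp v d12 d3) (derive_comp v d1 d2).
by rewrite /= tE -cF.
Qed.

End maps_in_charts.

Section local_splitting.
Variables (R : realType) (d : nat) (M : manifold R (d + 3)) (delta : R)
  (phi : 'I_3 -> endofield M) (xi : 'I_3 -> vfield M) (eta : 'I_3 -> oneform M)
  (g : bilinfield M).
Hypothesis delta0 : delta != 0.

(* Coordinates [sp_chart] on the chart at [p] in which [g] is the product of [sp_metric] and of
   the round metric in stereographic coordinates. *)
Record splitting (p : M) := Splitting {
  sp_dom : set 'rV[R]_(d + 3);
  sp_cod : set 'rV[R]_(d + 3);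
  sp_chart : 'rV[R]_(d + 3) -> 'rV[R]_(d + 3);
  sp_inv : 'rV[R]_(d + 3) -> 'rV[R]_(d + 3);
  sp_box : set 'rV[R]_d;
  sp_metric : 'rV[R]_d -> 'rV[R]_d -> 'rV[R]_d -> R;
  sp_J : 'I_3 -> 'rV[R]_d -> 'M[R]_d;
  sp_dom_open : open sp_dom;
  sp_dom_base : sp_dom (coords p p);
  sp_dom_cod : sp_dom `<=` coords_cod p;
  sp_cod_open : open sp_cod;
  sp_chartK : forall x, sp_dom x -> sp_cod (sp_chart x) /\ sp_inv (sp_chart x) = x;
  sp_invK : forall y, sp_cod y -> sp_dom (sp_inv y) /\ sp_chart (sp_inv y) = y;
  sp_smooth : smooth_map_on sp_dom sp_chart;
  sp_inv_smooth : smooth_map_on sp_cod sp_inv;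
  sp_cod_box : forall y, sp_cod y -> sp_box (lsubmx y);
  sp_hk : hk_box sp_box sp_metric sp_J;
  sp_height : forall x, sp_dom x ->
    (stereo_inv_row `|delta|^-1 false (rsubmx (sp_chart x))) 0 (rshift 3 0) < 0;
  sp_isometry : forall x, sp_dom x -> forall v w,
    sp_metric (lsubmx (sp_chart x)) (lsubmx ('D_v sp_chart x)) (lsubmx ('D_w sp_chart x)) +
    \sum_j ('D_v (fun y => stereo_inv_row `|delta|^-1 false (rsubmx (sp_chart y))) x) 0 j *
           ('D_w (fun y => stereo_inv_row `|delta|^-1 false (rsubmx (sp_chart y))) x) 0 j =
    g (param p x) (coord_field p v (param p x)) (coord_field p w (param p x))
}.

(** A [splitting] holds sets and maps, so it lives in Type; its existence is proved as a
    proposition, and a choice is made for every p when the pieces are assembled. *)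
Lemma splitting_exists (hM : three_delta_cosymplectic delta phi xi eta g) p :
  exists s : splitting p, True.
Proof.
have ls := chart_local_structure hM p.
have cx0 : coords_cod p (coords p p) by exact: coordsP (dom_self p).
have [U [B [Psi [G [r [[oU Ux0 UA r0] [[BE UB BU sPsi sG] UP]]]]]]] :=
  splitting_chart ls delta0 cx0.
have leaves x : U x -> forall v, lsubmx ('D_v Psi x) = 0 <->
    horizontal (fun a => local_rep (xi a) p) (chart_eta eta p) x v = 0.
  by move=> /UP [].
have [h [J [hk met]]] := splitting_kahler ls oU UA BE UB BU sPsi sG leaves.
have oB : open B by rewrite BE; exact: open_ball_norm.
have Bbox y : B y -> [set z | `|z - lsubmx (Psi (coords p p))| < r] (lsubmx y).
  rewrite BE /=; apply: le_lt_trans; rewrite -linearB; apply: normr_row_le => // j.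
  by rewrite [X in `|X|]mxE normr_row.
have height x : U x -> (stereo_inv_row `|delta|^-1 false (rsubmx (Psi x))) 0 (rshift 3 0) < 0.
  by move=> /UP [].
have iso x : U x -> forall v w,
    h (lsubmx (Psi x)) (lsubmx ('D_v Psi x)) (lsubmx ('D_w Psi x)) +
    \sum_j ('D_v (fun y => stereo_inv_row `|delta|^-1 false (rsubmx (Psi y))) x) 0 j *
           ('D_w (fun y => stereo_inv_row `|delta|^-1 false (rsubmx (Psi y))) x) 0 j =
    g (param p x) (coord_field p v (param p x)) (coord_field p w (param p x)).
  move=> Ux v w; have [_ _ sph] := UP x Ux.
  apply: (etrans (congr2 +%R (met x Ux v w) (sph v w))).
  exact: (chart_metric_split hM v w (UA x Ux)).
by exists (Splitting oU Ux0 UA oB UB BU sPsi sG Bbox hk height iso).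
Qed.

End local_splitting.

(** * Assembling the local splittings *)

Section gluing.
Variables (R : realType) (d : nat) (M : manifold R (d + 3)) (delta : R) (g : bilinfield M).
Hypothesis delta0 : delta != 0.
Variable sp : forall p : M, splitting delta g p.
Let r0 := radius_gt0 delta0.

Let W (p : M) : set M := [set q | dom p q /\ sp_dom (sp p) (coords p q)].

Let oW p : open (W p).
Proof.
rewrite openE => q [pq sq].
have n1 : nbhs q (dom p) by apply: open_nbhs_nbhs; split => //; exact: open_dom.
have n2 : nbhs (coords p q) (sp_dom (sp p)).
  by apply: open_nbhs_nbhs; split => //; exact: sp_dom_open.
have cp : {for q, continuous (coords p)} by exact: chart_map_continuous.
have n3 : nbhs q (coords p @^-1` sp_dom (sp p)) := cp _ n2.
by apply: filterS (filterI n1 n3) => z [].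
Qed.

Let Wp p : W p p. Proof. by split; [exact: dom_self|exact: sp_dom_base]. Qed.

(** Lindelöf: whenever the k-th element of a countable base lies in some [W p'], one such p' is
    attached to k. Every point has a basic neighbourhood inside its own [W], so it is covered by the
    point chosen for that index. *)
Let cover : exists c : nat -> option M, forall p, exists k p', c k = Some p' /\ W p' p.
Proof.
have [Bs /countable_injP [f fI] [oB bB]] := @manifold_second_countable _ _ M.
pose P k (p' : M) := exists X, [/\ Bs X, f X = k & X `<=` W p'].
pose c k := match pselect (exists p', P k p') with
  | left e => Some (projT1 (cid e)) | right _ => None end.
exists c => p; have nW : nbhs p (W p) by apply: open_nbhs_nbhs.
have [X [BX Xp] XW] := bB p (W p) nW.
have e : exists p', P (f X) p' by exists p, X.
exists (f X); rewrite /c; case: pselect => // e'; exists (projT1 (cid e')); split => //.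
have [Y [BY YX YW]] := projT2 (cid e').
apply: YW; have -> : Y = X by apply: fI => //; exact: mem_set.
exact: Xp.
Qed.

(** Near p0 the isometry is the splitting coordinate map of a chosen centre p, followed by the
    parametrisation of the product at q0, whose first component lies in the box of index k and whose
    second is a point of negative height. *)
Lemma glued_splitting : exists (N : manifold R d) (J : 'I_3 -> endofield N) (h : bilinfield N),
  hyperkahler J h /\ locally_isometric g (prod_metric h (sphere_metric 3 r0)).
Proof.
have [c cP] := cover.
pose box k := oapp (fun p => sp_box (sp p)) set0 (c k).
pose h k := oapp (fun p => sp_metric (sp p)) (fun _ _ _ => 0) (c k).
pose J k := oapp (fun p => sp_J (sp p)) (fun _ _ => 0) (c k).
have hb k : hk_box (box k) (h k) (J k).
  rewrite /box /h /J; case: (c k) => [p|] /=; first exact: sp_hk.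
  exact: hk_box0.
have obox k : open (box k) by exact: hb_open (hb k).
exists (box_union obox), (box_J J), (box_metric h).
split; first exact: box_hyperkahler.
move=> p0; have [k [p [ck Wp0]]] := cP p0.
have [boxE hE] : box k = sp_box (sp p) /\ h k = sp_metric (sp p).
  by rewrite /box /h ck.
set Psi := sp_chart (sp p); set G := sp_inv (sp p); set B := sp_cod (sp p).
set y0 := Psi (coords p p0).
have By0 : B y0 by have [] := sp_chartK Wp0.2.
have bk : box k (lsubmx y0) by rewrite boxE; exact: sp_cod_box By0.
have [nq [nqk nqz]] := box_point obox bk.
pose sq : sphere 3 r0 := stereo_inv r0 false (rsubmx y0).
(* On the sphere the chart depends on the sign of the height, so it is the same one at all points of
   negative height. *)
have chart_low (s : sphere 3 r0) : (set_val s) 0 (rshift 3 0) < 0 ->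
    chart_at s = stereo_chart 3 r0 false.
  by move=> s0; rewrite /= (lt_gtF s0).
have sqE : chart_at sq = stereo_chart 3 r0 false.
  by apply: chart_low; exact: (sp_height Wp0.2).
pose N := prod_manifold (box_union obox) (sphere 3 r0).
pose q0 : N := (nq, sq).
have codE y : coords_cod q0 y <-> box k (lsubmx y).
  rewrite /coords_cod /=; split=> [[]|by_]; first by rewrite /= -nqk.
  by split; [rewrite /= -[X in X _]/(box (box_index nq)) nqk|exact: Logic.I].
have paramE y : (param q0 y).2 = stereo_inv r0 false (rsubmx y).
  by rewrite -[LHS]/(chart_inv (chart_at sq) (rsubmx y)) sqE.
have Bcod y : B y -> coords_cod q0 y.
  by move=> By; apply/codE; rewrite boxE; exact: sp_cod_box By.
pose F (q : M) : N := param q0 (Psi (coords p q)).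
pose V : set N := [set z | dom q0 z /\ B (coords q0 z)].
pose G' (z : N) : M := param p (G (coords q0 z)).
have FE q : W p q -> dom q0 (F q) /\ coords q0 (F q) = Psi (coords p q).
  move=> [pq sq']; have [BP _] := sp_chartK sq'; have cB := Bcod _ BP.
  by split; [exact: paramP|exact: paramK].
have GE z : V z -> dom p (G' z) /\ coords p (G' z) = G (coords q0 z).
  move=> [_ Bz]; have [sG _] := sp_invK Bz; have cG := sp_dom_cod sG.
  by split; [exact: paramP|exact: paramK].
have oV : open V.
  rewrite openE => z [qz Bz].
  have n1 : nbhs z (dom q0) by apply: open_nbhs_nbhs; split => //; exact: open_dom.
  have n2 : nbhs (coords q0 z) B by apply: open_nbhs_nbhs; split => //; exact: sp_cod_open.
  have cq : {for z, continuous (coords q0)} by exact: chart_map_continuous.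
  have n3 : nbhs z (coords q0 @^-1` B) := cq _ n2.
  by apply: filterS (filterI n1 n3) => z' [].
have WO q : W p q -> sp_dom (sp p) (coords p q) by case.
have VB z : V z -> B (coords q0 z) by case.
have Wdom : W p `<=` dom p by move=> q [].
have Vdom : V `<=` dom q0 by move=> z [].
exists (W p), V, F, G'; split; first by split => //; exact: oW.
split.
- move=> q Wq; have [qF cF] := FE q Wq; have [BP GP0] := sp_chartK (WO q Wq).
  have GP : G (Psi (coords p q)) = coords p q := GP0.
  split; first by split => //; rewrite cF.
  by rewrite /G' cF GP coordsK //; exact: Wdom.
- move=> z Vz; have [pG cG] := GE z Vz; have [sG PG0] := sp_invK (VB z Vz).
  have PG : Psi (G (coords q0 z)) = coords q0 z := PG0.
  split; first by split => //; rewrite cG.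
  by rewrite /F cG PG coordsK //; exact: Vdom.
- exact: (smooth_between_chart (oW p) (@sp_dom_open _ _ _ _ _ _ (sp p)) Wdom (@sp_smooth _ _ _ _ _ _ (sp p)) WO FE).
- exact: (smooth_between_chart oV (@sp_cod_open _ _ _ _ _ _ (sp p)) Vdom (@sp_inv_smooth _ _ _ _ _ _ (sp p)) VB GE).
move=> q Wq v w; have [qF cF] := FE q Wq; have [BP _] := sp_chartK (WO q Wq).
have pq := Wdom q Wq.
set x := coords p q in cF BP *.
have sF : set_val (F q).2 = stereo_inv_row `|delta|^-1 false (rsubmx (Psi x)).
  by rewrite /F paramE.
have chartF : chart_at (F q).2 = stereo_chart 3 r0 false.
  by apply: chart_low; rewrite sF; exact: (sp_height (WO q Wq)).
(* [differential] and [sphere_metric] use the chart at the image point; on the image of F it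
   coincides with the chart at q0, so everything is computed in a single chart. *)
have coordsF : coords (F q) = coords q0.
  apply/funext => z.
  rewrite -[LHS]/(row_mx (coords (F q).1 z.1) (chart_map (chart_at (F q).2) z.2)) chartF.
  by rewrite -[RHS]/(row_mx (coords nq z.1) (chart_map (chart_at sq) z.2)) sqE.
have cfF u : coord_field q0 u (F q) = u.
  by rewrite /coord_field coordsF cF; exact: (trans_self u (Bcod _ BP)).
have dF u : differential F q u = 'D_(rep p q u) Psi x.
  rewrite (differential_chart (oW p) (@sp_dom_open _ _ _ _ _ _ (sp p)) Wdom (@sp_smooth _ _ _ _ _ _ (sp p)) WO FE u Wq).
  exact: cfF.
have sx := WO q Wq.
have dPsi : differentiable Psi x.
  exact: smooth_map_differentiable (@sp_dom_open _ _ _ _ _ _ (sp p)) (@sp_smooth _ _ _ _ _ _ (sp p)) sx.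
pose st u := stereo_inv_row `|delta|^-1 false u : 'rV[R]_(3 + 1).
have emb u : 'D_(rsubmx ('D_u Psi x)) (set_val \o param (F q).2) (coords (F q).2 (F q).2) =
    'D_u (fun y => st (rsubmx (Psi y))) x.
  have cs : coords (F q).2 (F q).2 = rsubmx (Psi x).
    have h1 := congr1 (fun f : N -> _ => rsubmx (f (F q))) coordsF.
    rewrite /= cF in h1; rewrite -h1.
    by rewrite [X in _ = rsubmx X]/coords /= row_mxKr.
  have ps : set_val \o param (F q).2 = st.
    by apply/funext => u'; rewrite /param chartF.
  rewrite cs ps.
  have ds : differentiable (fun y => rsubmx (Psi y)) x.
    apply: (smooth_map_differentiable (@sp_dom_open _ _ _ _ _ _ (sp p)) _ sx).
    by apply: smooth_map_rsubmx; exact: sp_smooth.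
  have dst : differentiable st (rsubmx (Psi x)).
    exact: (smooth_map_differentiable openT (smooth_stereo_inv (m := 3) r0 false)
      (Logic.I : setT (rsubmx (Psi x)))).
  rewrite (derive_comp u ds dst) (derive_rsubmx (diff_derivable dPsi)).
  by [].
have iF : box_index (F q).1 = k.
  rewrite /F /= box_index_param //; rewrite nqk; exact/codE/Bcod.
have posF : box_pos (F q).1 = lsubmx (Psi x).
  by rewrite /F /= box_pos_param // nqk; exact/codE/Bcod.
apply: (etrans (congr2 (prod_metric (box_metric h) (sphere_metric 3 r0) (F q)) (dF v) (dF w))).
have m1 a b : box_metric h (F q).1 a b = sp_metric (sp p) (lsubmx (Psi x)) a b.
  by rewrite /box_metric iF posF hE.
have m2 a b : sphere_metric 3 r0 (F q).2 (rsubmx ('D_a Psi x)) (rsubmx ('D_b Psi x)) =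
    \sum_j ('D_a (fun y => st (rsubmx (Psi y))) x) 0 j *
           ('D_b (fun y => st (rsubmx (Psi y))) x) 0 j.
  apply: eq_bigr => j _.
  exact: (congr2 (fun s t : 'rV[R]_(3 + 1) => s 0 j * t 0 j) (emb a) (emb b)).
apply: (etrans (congr2 +%R (m1 _ _) (m2 _ _))).
apply: (etrans (sp_isometry sx (rep p q v) (rep p q w))).
have E : param p x = q by exact: coordsK pq.
rewrite E; exact: (congr2 (g q) (coord_field_repK v pq) (coord_field_repK w pq)).
Qed.

End gluing.

Theorem proposition2p1p1 (R : realType) (n : nat) (M : manifold R (4 * n + 3))
    (phi : 'I_3 -> endofield M) (xi : 'I_3 -> vfield M)
    (eta : 'I_3 -> oneform M) (g : bilinfield M) (delta : R)
    (hdelta : delta != 0)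
    (hM : three_delta_cosymplectic delta phi xi eta g) :
  [/\ hypernormal phi xi eta,
      (forall nabla, levi_civita g nabla ->
        (forall i j k, even_triple i j k ->
          forall X Y, smooth_vfield X -> smooth_vfield Y -> forall p,
          nabla_endo nabla X (phi i) Y p =
            (delta * (eta j p (X p) * eta j p (Y p) +
                      eta k p (X p) * eta k p (Y p))) *: xi i p
            - (delta * eta i p (Y p)) *:
                (eta j p (X p) *: xi j p + eta k p (X p) *: xi k p)) /\
        (forall i j k, even_triple i j k ->
          forall X, smooth_vfield X -> forall p,
          nabla X (xi i) p =
            delta *: (eta k p (X p) *: xi j p - eta j p (X p) *: xi k p))),
      (forall i, killing g (xi i)) &
      exists (N : manifold R (4 * n)) (J : 'I_3 -> endofield N)
             (h : bilinfield N),
        hyperkahler J h /\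
        locally_isometric g
          (prod_metric h (sphere_metric 3 (radius_gt0 hdelta)))].
Proof.
split.
- exact: tdc_hypernormal hM.
- move=> nabla lc; split=> [i j k e X Y sX sY p|i j k e X sX p].
    exact: (tdc_nabla_phi hM lc e sX sY).
  exact: (tdc_nabla_xi hM lc e sX).
- by move=> i; exact: (tdc_killing hM).
- apply: glued_splitting => p.
  exact: (projT1 (cid (splitting_exists hdelta hM p))).
Qed.
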